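(* Let $T>0$. Let $M^0:\mathbb{R}\to[-\frac12,\frac12]$ be a nondecreasing function for which there exists $R^0>0$ such that $M^0(\pm x)=\pm\frac12$ for all $x\ge R^0$. Let $\mathsf{A}:[-\frac12,\frac12]\times[0,T]\to\mathbb{R}$ satisfy $$\|\mathsf{A}\|_{\mathrm{Lip}(T)}<\infty\quad\text{and}\quad \|\partial_\tau \mathsf{A}\|_{\mathrm{Lip}(T)}<\infty .$$ Then the Cauchy problem $$\partial_t M+\partial_x\big(\mathsf{A}(M,t)\big)=(\phi*M)\,\partial_xM,\qquad M(x,0)=M^0(x),$$ admits a unique entropy solution $M\in BV(\mathbb{R}\times[0,T])$ associated to the initial data $M^0$. Suppose moreover that $\widetilde M$ is an entropy solution of $$\partial_t \widetilde M+\partial_x\big(\widetilde{\mathsf{A}}(\widetilde M,t)\big)=(\phi*\widetilde M)\,\partial_x\widetilde M,\qquad \widetilde M(x,0)=\widetilde M^0(x),$$ where $\widetilde M^0$ and $\widetilde{\mathsf{A}}$ satisfy the same assumptions as those listed above for $M^0$ and $\mathsf{A}$, respectively (possibly with a different constant in place of $R^0$). Then for every $t\in[0,T]$, $$\|M(\cdot,t)-\widetilde M(\cdot,t)\|_{L^1(\mathbb{R})}\le \|M^0-\widetilde M^0\|_{L^1(\mathbb{R})}+t\,\|\mathsf{A}-\widetilde{\mathsf{A}}\|_{\mathrm{Lip}(T)} .$$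
   Context: Communication protocol: $\phi:\mathbb{R}\to[0,\infty]$ is nonnegative, even, nonincreasing in $|x|$ and locally integrable (bounded or weakly singular), and $\Phi(x)=\int_0^x\phi(y)\,dy$, an odd nondecreasing continuous function. For a nondecreasing $M$ with $M=\pm\frac12$ near $\pm\infty$, $\phi*M$ denotes the continuous function $(\phi*M)(x)=\int_{\mathbb{R}}\Phi(x-y)\,d(\partial_xM)(y)$ (on an interval $[-R,R]$ containing the support of $\partial_x M$ this is the convolution of $\phi$ with $M$ after an integration by parts; only its values there matter). Seminorms: for $f:[-\frac12,\frac12]\to\mathbb{R}$, $|f|_{\mathrm{Lip}}=\sup_{m\ne m'}|f(m)-f(m')|/|m-m'|$. For $f=f(m,\tau)$, $\|f\|_{\mathrm{Lip}(T)}=\sup_{0\le\tau\le T}|f(\cdot,\tau)|_{\mathrm{Lip}}$. Here $\partial_\tau\mathsf{A}$ is the derivative in the time variable. Entropy pairs: an entropy is a convex Lipschitz function $\eta:[-\frac12,\frac12]\to\mathbb{R}$; the corresponding entropy flux $q(m,t)$ is given by $\partial_m q(m,t)=\eta'(m)\,\partial_m\mathsf{A}(m,t)$, e.g. $q(m,t)=\int_{-1/2}^m\eta'(m')\,\partial_m\mathsf{A}(m',t)\,dm'$ (additive functions of $t$ are irrelevant). Entropy solution: $M:\mathbb{R}\times[0,T]\to[-\frac12,\frac12]$ is an entropy solution of $\partial_tM+\partial_x(\mathsf{A}(M,t))=(\phi*M)\partial_xM$ if (1) for every entropy pair $(\eta,q)$ and every nonnegative $\zeta\in C_c^\infty(\mathbb{R}\times(0,T))$,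 $$\int_0^T\!\!\int_{\mathbb{R}}\Big[\eta(M)\,\partial_t\zeta+q(M,t)\,\partial_x\zeta+(\phi*M)\,\partial_x(\eta(M))\,\zeta\Big]dx\,dt\ge0,$$ where for each $t$ the distributional derivative $\partial_x(\eta(M(\cdot,t)))$ is a finite Radon measure against which the continuous function $(\phi*M)\zeta$ is integrated; (2) $M(\cdot,t)$ is nondecreasing for every $t\in[0,T]$; (3) there exists $R(T)>0$ such that $M(\pm x,t)=\pm\frac12$ for all $x\ge R(T)$ and $t\in[0,T]$. The solution is associated to the initial data $M^0$ if $t\mapsto M(\cdot,t)$ is continuous from $[0,T]$ into $L^1_{\mathrm{loc}}(\mathbb{R})$ with $M(\cdot,0)=M^0$ a.e. Functions are identified when they agree a.e. in $x$ for every $t$. Since $M=\pm\frac12$ for large $|x|$, ''$M\in BV(\mathbb{R}\times[0,T])$'' means that $M$ is bounded and its distributional derivatives $\partial_xM$, $\partial_tM$ are finite Radon measures on $\mathbb{R}\times(0,T)$. *)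

(* Defs.v *)
From HB Require Import structures.
From mathcomp Require Import all_boot all_order all_algebra.
From mathcomp Require Import all_classical all_reals all_analysis.
Set Implicit Arguments.
Unset Strict Implicit.
Unset Printing Implicit Defensive.
Import Order.TTheory GRing.Theory Num.Theory.
Import numFieldNormedType.Exports.
Local Open Scope classical_set_scope.
Local Open Scope ring_scope.

(* Functions on [-1/2, 1/2] x [0, T] or R x [0, T] are encoded as total        *)
(* functions R -> R -> R, space variable first; only their values on the       *)
(* relevant domain are constrained and used.                                   *)

Section TestFunctions.
Context {R : realType} {V : normedModType R}.

(* For finite-dimensional V this is the usual class C^n: all iterated          *)
(* directional derivatives up to order n exist and are continuous.             *)
Fixpoint Cn (n : nat) (f : V -> R) : Prop :=
  continuous f /\
  if n is n'.+1 then
    forall v : V, (forall p, derivable f p v) /\ Cn n' (fun p => 'D_v f p)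
  else True.

Definition smooth (f : V -> R) : Prop := forall n, Cn n f.

Definition test_function (U : set V) (f : V -> R) : Prop :=
  [/\ smooth f,
      compact (closure [set p | f p != 0]) &
      closure [set p | f p != 0] `<=` U].

End TestFunctions.

Section ChargeIntegral.
Context d (X : measurableType d) (R : realType).
Implicit Type nu : {charge set X -> \bar R}.

Definition hahn_pos nu : set X := sval (cid (Hahn_decomposition nu)).

Definition hahn_neg nu : set X := sval (cid (svalP (cid (Hahn_decomposition nu)))).

Definition hahn_posnegP nu : hahn_decomposition nu (hahn_pos nu) (hahn_neg nu) :=
  svalP (cid (svalP (cid (Hahn_decomposition nu)))).

(* By Hahn_decomposition_uniq the Jordan parts do not depend on the choice of  *)
(* the Hahn decomposition.                                                     *)
Definition charge_integral nu (f : X -> R) : R :=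
  (\int[jordan_pos (hahn_posnegP nu)]_x f x
   - \int[jordan_neg (hahn_posnegP nu)]_x f x)%R.

End ChargeIntegral.

Section Lipschitz.
Context {R : realType}.
Implicit Types (f : R -> R) (F : R -> R -> R) (T : R).

Definition half_itv : set R := `[- 2^-1, 2^-1]%classic.

Definition lip_seminorm f : \bar R :=
  ereal_sup [set r | exists m m', [/\ half_itv m, half_itv m', m != m' &
    r = (`|f m - f m'| / `|m - m'|)%:E]].

Definition lipT_seminorm T F : \bar R :=
  ereal_sup [set lip_seminorm (F^~ tau) | tau in `[0, T]%classic].

(* One-sided at the end points of [0, T].                                      *)
Definition time_quotient F (m tau s : R) : R := (F m s - F m tau) / (s - tau).

Definition time_derivable T F (m tau : R) : Prop :=
  cvg (time_quotient F m tau s @[s --> within `[0, T]%classic tau^']).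

Definition time_derive T F (m tau : R) : R :=
  lim (time_quotient F m tau s @[s --> within `[0, T]%classic tau^']).

Definition admissible_flux T (A : R -> R -> R) : Prop :=
  [/\ (lipT_seminorm T A < +oo)%E,
      (forall m tau, half_itv m -> `[0, T]%classic tau ->
         time_derivable T A m tau) &
      (lipT_seminorm T (time_derive T A) < +oo)%E].

End Lipschitz.

Section CauchyProblem.
Context {R : realType}.
Local Notation mu := (@lebesgue_measure R).
Implicit Types (phi : R -> \bar R) (M A : R -> R -> R) (T : R).

Definition communication_protocol phi : Prop :=
  [/\ (forall x, 0 <= phi x)%E,
      (forall x, phi (- x) = phi x),
      (forall x y, `|x| <= `|y| -> (phi y <= phi x)%E) &
      (forall K : set R, compact K -> mu.-integrable K phi)].

Definition Phi phi (x : R) : R :=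
  if 0 <= x then fine (\int[mu]_(y in `[0%R, x]) phi y)%E
  else - fine (\int[mu]_(y in `[x, 0%R]) phi y)%E.

Definition is_distr_derive (f : R -> R)
    (nu : {charge set (measurableTypeR R) -> \bar R}) : Prop :=
  forall psi : R -> R, test_function [set: R] psi ->
    \int[mu]_x (f x * derive1 psi x) = - charge_integral nu psi.

(* The distributional derivative of f as a finite signed Radon measure. It is  *)
(* only used for f of bounded variation, for which it exists and is unique;    *)
(* the value 0 is a default.                                                   *)
Definition distr_derive (f : R -> R) :
    {charge set (measurableTypeR R) -> \bar R} :=
  if pselect (exists nu, is_distr_derive f nu) is left h then sval (cid h)
  else czero.

(* This is (phi * M)(x), with M a function of x only.                          *)
Definition conv_protocol phi (f : R -> R) (x : R) : R :=
  charge_integral (distr_derive f) (fun y => Phi phi (x - y)).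

Definition entropy (eta : R -> R) : Prop :=
  @convex_function R R^o half_itv eta /\ (lip_seminorm eta < +oo)%E.

(* eta and A(., t) are Lipschitz, so both derivatives exist almost everywhere. *)
Definition entropy_flux A (eta : R -> R) (m t : R) : R :=
  \int[mu]_(m' in `[- 2^-1, m]) (derive1 eta m' * derive1 (A^~ t) m').

Definition strip T : set (R * R) := [set: R] `*` `]0, T[%classic.

Definition entropy_inequality phi T A M (eta : R -> R) (zeta : R * R -> R) : Prop :=
  0 <= \int[mu]_(t in `[0, T])
    (\int[mu]_x (eta (M x t) * 'D_(0, 1) zeta (x, t)
                 + entropy_flux A eta (M x t) t * 'D_(1, 0) zeta (x, t))
     + charge_integral (distr_derive (fun x => eta (M x t)))
         (fun x => conv_protocol phi (M^~ t) x * zeta (x, t))).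

Definition entropy_solution phi T A M : Prop :=
  [/\ (forall x t : R, `[0, T]%classic t -> half_itv (M x t)),
      (forall (eta : R -> R) (zeta : R * R -> R), entropy eta ->
         test_function (strip T) zeta -> (forall p, 0 <= zeta p) ->
         entropy_inequality phi T A M eta zeta),
      (forall t : R, `[0, T]%classic t -> {homo M^~ t : x y / x <= y}) &
      (exists2 r, 0 < r & forall x t, r <= x -> `[0, T]%classic t ->
         M x t = 2^-1 /\ M (- x) t = - 2^-1)].

Definition initial_datum (M0 : R -> R) : Prop :=
  [/\ (forall x, half_itv (M0 x)),
      {homo M0 : x y / x <= y} &
      (exists2 r, 0 < r & forall x, r <= x -> M0 x = 2^-1 /\ M0 (- x) = - 2^-1)].

Definition continuous_L1loc T M : Prop :=
  forall K : set R, compact K -> forall t : R, `[0, T]%classic t ->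
    (\int[mu]_(x in K) `|M x s - M x t|%:E)%E
      @[s --> within `[0, T]%classic (nbhs t)] --> 0%E.

Definition associated_to T (M0 : R -> R) M : Prop :=
  continuous_L1loc T M /\ {ae mu, forall x, M x 0 = M0 x}.

(* Bounded variation in the sense relevant for functions equal to +-1/2 for    *)
(* large |x|: M is bounded, but not integrable. A finite signed measure on the *)
(* strip is encoded as a charge on the whole plane, which is only tested       *)
(* against functions supported in the strip.                                   *)
Definition BV_strip T M : Prop :=
  (exists B : R, forall x t : R, `[0, T]%classic t -> `|M x t| <= B) /\
  exists nux nut :
      {charge set (measurableTypeR R * measurableTypeR R)%type -> \bar R},
    forall zeta : R * R -> R, test_function (strip T) zeta ->
      \int[mu]_(t in `[0, T]) (\int[mu]_x (M x t * 'D_(1, 0) zeta (x, t)))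
        = - charge_integral nux zeta /\
      \int[mu]_(t in `[0, T]) (\int[mu]_x (M x t * 'D_(0, 1) zeta (x, t)))
        = - charge_integral nut zeta.

Definition same_solution T M1 M2 : Prop :=
  forall t : R, `[0, T]%classic t -> {ae mu, forall x, M1 x t = M2 x t}.

Definition L1norm (f : R -> R) : \bar R := ('N[mu]_1 [EFin \o f])%E.

End CauchyProblem.

(* Main.v *)
(* Let X(., t) be the quantile function (generalized inverse) of M(., t). By   *)
(* the layer-cake formula, with g = eta' nondecreasing, W = Phi, a = d_m A and *)
(* v(m, t) = a(m, t) - int W(X(m, t) - X(n, t)) dn, the entropy inequality for *)
(* eta says that d/dt int g P(X) dm >= int g P'(X) v dm in the sense of        *)
(* distributions, for every nondecreasing P. In other words X solves           *)
(* d_t X = v, corrected only by the constraint that X be nondecreasing in m.   *)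
(*                                                                             *)
(* Stability: the L1 distance of two solutions is the L1 distance of their     *)
(* quantiles. Choosing for g the indicators of superlevel sets of a            *)
(* nondecreasing Z and summing over the levels yields an evolution variational *)
(* inequality for int |X - Z| dm. Freezing each of two solutions in turn as Z, *)
(* the nonlocal terms cancel because W is odd and nondecreasing, and the       *)
(* fluxes contribute at most t sup |a - a'|.                                   *)
(*                                                                             *)
(* Existence: alternate Euler steps X + h v with the increasing rearrangement  *)
(* in m. The Hardy-Littlewood inequality is the discrete entropy inequality,   *)
(* and as rearrangement is a sup-norm contraction the iterates are uniformly   *)
(* Lipschitz in time, so they converge along an ultrafilter. The limit is BV   *)
(* because d_x M and d_t M are the images of dm dt and - v dm dt under         *)
(* (m, t) |-> (X(m, t), t).                                                    *)
From HB Require Import structures.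
Require Import Defs.
From mathcomp Require Import all_boot all_order all_algebra.
From mathcomp Require Import all_classical all_reals all_analysis.
From mathcomp Require Import measurable_realfun.
From mathcomp Require Import ring lra.
Set Implicit Arguments.
Unset Strict Implicit.
Unset Printing Implicit Defensive.
Import Order.TTheory GRing.Theory Num.Theory.
Import numFieldNormedType.Exports.
Local Open Scope classical_set_scope.
Local Open Scope ring_scope.

(** * Integrals of bounded functions *)

(** Let X(., t) be the quantile function of M(., t). In the variable m the nonlocal conservation law
    becomes d_t X = v with v(m) = a(m, t) - int W(X m - X n) dn, where W = [Phi phi] and a = d_m A,
    subject to the constraint that X stays nondecreasing in m. The L1 distance of two profiles is
    that of their quantiles ([quantile_L1]). The map X |-> int W(X m - X n) dn is accretive in L1
    because W is odd and nondecreasing: symmetrizing the double integral of sgn(X m - Y m) against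
    the difference of the kernels yields a nonnegative integrand ([accretive]). So the distance
    grows at most at the rate sup |a - b|, where a and b are the densities of the two fluxes, and
    this is at most the Lipschitz seminorm of A - A' ([flux_density_sub]).

    The rigorous form rests on an exact translation. The derivative of F(M) is the image of F'(m) dm
    under X ([distr_derive_slice]), so at each time the entropy integrand is an integral over m
    ([slice_formula]), and an entropy inequality is one integral inequality for X, with a
    nondecreasing g = eta' and a test function zeta >= 0 ([entropy_inequalityE]). Product test
    functions lead to [weak_solution] ([entropy_weak]). A smoothed |x - Z(m)| is, up to a small
    error, minus a sum of products of a nondecreasing function of m and a nondecreasing function of
    x; hence these inequalities control the growth of int |X - Z| dm for each fixed nondecreasing Z
    ([evi]). For two solutions on a short time interval, first one moves while the other is frozen,
    then conversely; both rates are close to their values at one common time, where [accretive]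
    bounds their sum. This is [stability], which contains uniqueness.

    For existence, an Euler step followed by the increasing rearrangement satisfies the entropy
    inequality up to O(h^2) ([rearr_entropy], [scheme_dissipation]), moves points with bounded speed
    ([rearr_le], [scheme_step]) and keeps them in a fixed interval ([euler_bound]). Limits along an
    ultrafilter exist pointwise, and monotonicity in m turns them into L1 limits ([mono_grid],
    [limit_exists]). The telescoped inequalities pass to the limit ([limit_entropy]), and inverting
    X gives M ([existence]). With g constant the rearrangement loses nothing, so the inequality is
    an equality; this identifies d_t M as a finite measure ([profile_BV]). *)

Section BoundedMeasurable.
Context {d} {Y : measurableType d} {R : realType}.
Implicit Types f g : Y -> R.

(** Most integrands below are of this kind and are integrated against finite measures, so this one
    predicate discharges the integrability and Fubini side conditions. *)
Definition bm f := measurable_fun [set: Y] f /\ exists C, forall y, `|f y| <= C.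

Lemma bm_cst c : bm (fun _ => c).
Proof. by split; [exact: measurable_cst|exists `|c|]. Qed.

Lemma bmD f g : bm f -> bm g -> bm (fun y => f y + g y).
Proof.
move=> [mf [C hC]] [mg [C' hC']]; split; first exact: measurable_funD.
by exists (C + C') => y; rewrite (le_trans (ler_normD _ _))// lerD.
Qed.

Lemma bmN f : bm f -> bm (fun y => - f y).
Proof.
move=> [mf [C hC]]; split; first exact: measurableT_comp.
by exists C => y; rewrite normrN.
Qed.

Lemma bmB f g : bm f -> bm g -> bm (fun y => f y - g y).
Proof. by move=> bf bg; apply: bmD => //; exact: bmN. Qed.

Lemma bmM f g : bm f -> bm g -> bm (fun y => f y * g y).
Proof.
move=> [mf [C hC]] [mg [C' hC']]; split; first exact: measurable_funM.
by exists (C * C') => y; rewrite normrM ler_pM.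
Qed.

Lemma bm_norm f : bm f -> bm (fun y => `|f y|).
Proof.
move=> [mf [C hC]]; split; first exact: measurableT_comp.
by exists C => y; rewrite normr_id.
Qed.

Lemma bm_ind (A : set Y) : measurable A -> bm (\1_A : Y -> R).
Proof.
move=> mA; split; first exact: measurable_indic.
by exists 1 => y; rewrite indicE; case: (y \in A); rewrite ?normr0 ?normr1.
Qed.

Lemma bm_sum (I : Type) (s : seq I) (F : I -> Y -> R) :
  (forall i, bm (F i)) -> bm (fun y => \sum_(i <- s) F i y).
Proof.
move=> bF; elim: s => [|i s IH].
  by under eq_fun do rewrite big_nil; exact: bm_cst.
by under eq_fun do rewrite big_cons; exact: bmD.
Qed.

Lemma bm_eq f g : f =1 g -> bm f -> bm g.
Proof. by move=> /funext ->. Qed.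

End BoundedMeasurable.

Lemma bm_comp d d' (Y : measurableType d) (Z : measurableType d') (R : realType)
  (f : Y -> R) (h : Z -> Y) :
  bm f -> measurable_fun setT h -> bm (fun z => f (h z)).
Proof.
move=> [mf [C hC]] mh; split; first exact: (measurableT_comp mf mh).
by exists C => z; exact: hC.
Qed.

Section FiniteIntegral.
Context {d} {Y : measurableType d} {R : realType}.
Variable la : {finite_measure set Y -> \bar R}.
Implicit Types f g : Y -> R.

Lemma bm_integrable f (D : set Y) : measurable D -> bm f ->
  la.-integrable D (EFin \o f).
Proof.
move=> mD [mf [C hC]].
apply: (@measurable_bounded_integrable _ _ _ la f D mD).
- by rewrite -ge0_fin_numE//; exact: fin_num_measure.
- exact: measurable_funTS.
- exists C; split; first by rewrite num_real.
  by move=> x Cx y _; exact: le_trans (hC y) (ltW Cx).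
Qed.

Let I f := @bm_integrable f setT measurableT.

Lemma intD f g : bm f -> bm g ->
  \int[la]_y (f y + g y) = \int[la]_y f y + \int[la]_y g y.
Proof. by move=> bf bg; apply: RintegralD => //; exact: I. Qed.

Lemma intB f g : bm f -> bm g ->
  \int[la]_y (f y - g y) = \int[la]_y f y - \int[la]_y g y.
Proof. by move=> bf bg; apply: RintegralB => //; exact: I. Qed.

Lemma intZ c f : bm f -> \int[la]_y (c * f y) = c * \int[la]_y f y.
Proof. by move=> bf; apply: RintegralZl => //; exact: I. Qed.

Lemma intN f : bm f -> \int[la]_y (- f y) = - \int[la]_y f y.
Proof.
move=> bf; rewrite -mulN1r -intZ//; apply: eq_Rintegral => y _.
by rewrite mulN1r.
Qed.

Lemma int_le f g : bm f -> bm g -> (forall y, f y <= g y) ->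
  \int[la]_y f y <= \int[la]_y g y.
Proof. by move=> bf bg fg; apply: le_Rintegral => //; exact: I. Qed.

Lemma int_norm f : bm f -> `|\int[la]_y f y| <= \int[la]_y `|f y|.
Proof. by move=> bf; apply: le_normr_Rintegral => //; exact: I. Qed.

Lemma int_cst c : \int[la]_y (fun _ => c) y = c * fine (la setT).
Proof. by rewrite Rintegral_cst. Qed.

Lemma int_sum (J : Type) (s : seq J) (F : J -> Y -> R) :
  (forall i, bm (F i)) ->
  \int[la]_y (\sum_(i <- s) F i y) = \sum_(i <- s) \int[la]_y F i y.
Proof.
move=> bF; elim: s => [|i s IH].
  rewrite big_nil; under eq_Rintegral do rewrite big_nil.
  by rewrite int_cst mul0r.
rewrite big_cons -IH -intD//; last exact: bm_sum.
by apply: eq_Rintegral => y _; rewrite big_cons.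
Qed.

Lemma int_ind (A : set Y) : measurable A ->
  \int[la]_y (\1_A y) = fine (la A).
Proof. by move=> mA; rewrite /Rintegral integral_indic// setIT. Qed.

Lemma int_restrict f (D : set Y) : measurable D ->
  \int[la]_(y in D) f y = \int[la]_y (f y * \1_D y).
Proof.
move=> mD; rewrite Rintegral_mkcond; apply: eq_Rintegral => y _.
by rewrite /patch indicE; case: ifP => _; rewrite ?mulr1 ?mulr0.
Qed.

End FiniteIntegral.

(** * Fubini for bounded functions and finite measures *)

Section FiniteFubini.
Context {d1 d2} {Y1 : measurableType d1} {Y2 : measurableType d2} {R : realType}.
Variables (la1 : {finite_measure set Y1 -> \bar R})
  (la2 : {finite_measure set Y2 -> \bar R}).

Let prod_fin (D : set (Y1 * Y2)) : measurable D -> ((la1 \x la2) D < +oo)%E.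
Proof.
move=> mD; apply: (@le_lt_trans _ _ ((la1 \x la2) (setT `*` setT))%E).
  by apply: le_measure; rewrite ?inE//= ?setXTT//.
rewrite product_measure1E//.
by rewrite -ge0_fin_numE ?mule_ge0// fin_numM// fin_num_measure.
Qed.

Lemma bm_integrable_prod (F : Y1 * Y2 -> R) : bm F ->
  (la1 \x la2)%E.-integrable setT (EFin \o F).
Proof.
move=> [mf [C hC]].
apply: (@measurable_bounded_integrable _ _ _ (la1 \x la2)%E F setT) => //.
- exact: prod_fin.
- exists C; split; first by rewrite num_real.
  by move=> x Cx y _; exact: le_trans (hC y) (ltW Cx).
Qed.

Lemma bm_sec1 (F : Y1 * Y2 -> R) x : bm F -> bm (fun y => F (x, y)).
Proof. by move=> bF; apply: bm_comp => //; exact: pair1_measurable. Qed.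

Lemma bm_sec2 (F : Y1 * Y2 -> R) y : bm F -> bm (fun x => F (x, y)).
Proof. by move=> bF; apply: bm_comp => //; exact: pair2_measurable. Qed.

Lemma bm_int1 (F : Y1 * Y2 -> R) : bm F -> bm (fun x => \int[la2]_y F (x, y)).
Proof.
move=> bF; split.
  apply/measurable_EFinP => /=.
  apply: (eq_measurable_fun (fubini_F la2 (EFin \o F))); last first.
    by apply: (@measurable_fubini_F _ _ _ _ _ la1); exact: bm_integrable_prod.
  move=> x _ /=; rewrite /fubini_F /Rintegral fineK//.
  by apply: integrable_fin_num => //; apply: bm_integrable => //; exact: bm_sec1.
have [_ [C hC]] := bF; exists (C * fine (la2 setT)) => x.
apply: le_trans (int_norm la2 (bm_sec1 x bF)) _.
rewrite -int_cst; apply: int_le => //; first exact/bm_norm/bm_sec1.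
exact: bm_cst.
Qed.

Lemma bm_int2 (F : Y1 * Y2 -> R) : bm F -> bm (fun y => \int[la1]_x F (x, y)).
Proof.
move=> bF; split.
  apply/measurable_EFinP => /=.
  apply: (eq_measurable_fun (fubini_G la1 (EFin \o F))); last first.
    by apply: (@measurable_fubini_G _ _ _ _ _ _ la2); exact: bm_integrable_prod.
  move=> x _ /=; rewrite /fubini_G /Rintegral fineK//.
  by apply: integrable_fin_num => //; apply: bm_integrable => //; exact: bm_sec2.
have [_ [C hC]] := bF; exists (C * fine (la1 setT)) => x.
apply: le_trans (int_norm la1 (bm_sec2 x bF)) _.
rewrite -int_cst; apply: int_le => //; first exact/bm_norm/bm_sec2.
exact: bm_cst.
Qed.

Let FE (F : Y1 * Y2 -> R) : bm F ->
  (\int[la1]_x (\int[la2]_y F (x, y)) = \int[(la1 \x la2)%E]_z F z) /\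
  (\int[la2]_y (\int[la1]_x F (x, y)) = \int[(la1 \x la2)%E]_z F z).
Proof.
move=> bF; split; rewrite {1}/Rintegral [RHS]/Rintegral.
- rewrite -(integral12_prod_meas1 (bm_integrable_prod bF)); congr fine.
  apply: eq_integral => x _; rewrite /fubini_F /Rintegral fineK//.
  by apply: integrable_fin_num => //; apply: bm_integrable => //; exact: bm_sec1.
- rewrite -(integral21_prod_meas1 (bm_integrable_prod bF)); congr fine.
  apply: eq_integral => x _; rewrite /fubini_G /Rintegral fineK//.
  by apply: integrable_fin_num => //; apply: bm_integrable => //; exact: bm_sec2.
Qed.

Lemma int_prod12 (F : Y1 * Y2 -> R) : bm F ->
  \int[(la1 \x la2)%E]_z F z = \int[la1]_x (\int[la2]_y F (x, y)).
Proof. by move=> /FE[]. Qed.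

Lemma int_swap (F : Y1 * Y2 -> R) : bm F ->
  \int[la1]_x (\int[la2]_y F (x, y)) = \int[la2]_y (\int[la1]_x F (x, y)).
Proof. by move=> /FE[-> ->]. Qed.

End FiniteFubini.

(** * Lebesgue measure on an interval as a finite measure *)

Section IntervalMeasure.
Context {R : realType}.
Local Notation mu := (@lebesgue_measure R).

(** A finite measure on the whole line rather than an integral over a set, so that the lemmas on
    bounded functions apply without domain conditions. It is zero for b <= a. *)
Definition lam (a b : R) : set (measurableTypeR R) -> \bar R :=
  mrestr mu (measurable_itv `[a, b]).

HB.instance Definition _ a b := Measure.on (lam a b).

Let lam_fin a b : fin_num_fun (lam a b).
Proof.
move=> U mU; rewrite /lam /mrestr ge0_fin_numE ?measure_ge0//.
apply: (@le_lt_trans _ _ (mu `[a, b])).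
  by apply: le_measure; rewrite ?inE//=; exact: measurableI.
by rewrite lebesgue_measure_itv/=; case: ifP => _; rewrite ?ltry.
Qed.

HB.instance Definition _ a b := @Measure_isFinite.Build _ _ _ (lam a b) (@lam_fin a b).

Lemma lam_mass a b : a <= b -> fine (lam a b setT) = b - a.
Proof.
move=> ab; rewrite /lam /mrestr setTI lebesgue_measure_itv/= lte_fin.
by case: ltP => //= ba; apply/eqP; rewrite eq_sym subr_eq0 eq_le ab ba.
Qed.

Lemma Rint_lam_gen a b (f : R -> R) :
  \int[mu]_(x in `[a, b]) f x = \int[lam a b]_(x in `[a, b]) f x.
Proof.
rewrite /Rintegral; congr fine; apply: eq_measure_integral => A mA AE.
by change (mu A = mu (A `&` `[a, b])); rewrite setIidl.
Qed.

Lemma eq_lam a b (f g : R -> R) : bm f -> bm g ->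
  (forall x, a <= x <= b -> f x = g x) ->
  \int[lam a b]_x f x = \int[lam a b]_x g x.
Proof.
move=> bf bg fg; rewrite /Rintegral; congr fine.
apply: ae_eq_integral => //.
- by apply/measurable_EFinP; case: bf.
- by apply/measurable_EFinP; case: bg.
exists (~` `[a, b]%classic); split.
- by apply: measurableC; exact: measurable_itv.
- by change (mu (~` `[a, b]%classic `&` `[a, b]) = 0%E); rewrite setICl measure0.
- move=> x /=; apply: contra_not; rewrite in_itv/= => axb _.
  by rewrite fg.
Qed.

Lemma Rint_lam a b (f : R -> R) : bm f ->
  \int[mu]_(x in `[a, b]) f x = \int[lam a b]_x f x.
Proof.
move=> bf; rewrite Rint_lam_gen int_restrict; last exact: measurable_itv.
apply: eq_lam => //.
  by apply: bmM => //; apply: bm_ind; exact: measurable_itv.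
by move=> x axb; rewrite indicE mem_set ?mulr1//= in_itv.
Qed.

Lemma Rint_lam_eq a b (f g : R -> R) : bm g ->
  (forall x, a <= x <= b -> f x = g x) ->
  \int[mu]_(x in `[a, b]) f x = \int[lam a b]_x g x.
Proof.
move=> bg fg; rewrite -Rint_lam//; apply: eq_Rintegral => x.
by rewrite inE/= in_itv/=; exact: fg.
Qed.

Lemma lam_le a b (f g : R -> R) : bm f -> bm g ->
  (forall x, a <= x <= b -> f x <= g x) ->
  \int[lam a b]_x f x <= \int[lam a b]_x g x.
Proof.
move=> bf bg fg; have bi := bm_ind (measurable_itv `[a, b]).
rewrite -Rint_lam// -[leRHS]Rint_lam// !Rint_lam_gen.
apply: le_Rintegral; try exact: measurable_itv.
- exact: bm_integrable.
- exact: bm_integrable.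
- by move=> x /=; rewrite in_itv/=; exact: fg.
Qed.

Lemma lam_cst a b c : a <= b -> \int[lam a b]_x (fun _ => c) x = c * (b - a).
Proof. by move=> ab; rewrite int_cst lam_mass. Qed.

Lemma lam_split a c b (f : R -> R) : bm f -> a <= c -> c <= b ->
  \int[lam a b]_x f x = \int[lam a c]_x f x + \int[lam c b]_x f x.
Proof.
move=> bf ac cb; rewrite -!Rint_lam//.
have itf u v : mu.-integrable `[u, v] (EFin \o f).
  have /integrableP[mf If] := bm_integrable (lam u v) (measurable_itv `[u, v]) bf.
  apply/integrableP; split => //.
  rewrite (@eq_measure_integral _ _ _ _ (lam u v))// => A mA AE.
  by change (mu A = mu (A `&` `[u, v])); rewrite setIidl.
have := @Rintegral_itvB R f (BLeft a) (BRight b) c (itf _ _).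
rewrite !bnd_simp => /(_ ac cb) H.
apply/eqP; rewrite addrC -subr_eq H Rintegral_itv_obnd_cbnd//.
by apply: integrableS (itf c b) => //; apply: subset_itvr; rewrite bnd_simp.
Qed.

End IntervalMeasure.

(** * Smooth functions *)

Section SmoothAlgebra.
Context {R : realType} {V : normedModType R}.
Implicit Types (f g : V -> R) (n : nat).

Lemma CnW n f : Cn n.+1 f -> Cn n f.
Proof.
elim: n f => [|n IH] f [cf df]; first by split.
by split=> // v; have [dv /IH] := df v.
Qed.

Lemma Cn_continuous n f : Cn n f -> continuous f.
Proof. by case: n => [|n] []. Qed.

Lemma Cn_ext n f g : f =1 g -> Cn n g -> Cn n f.
Proof. by move=> /funext ->. Qed.

Lemma Cn_cst n (c : R) : Cn n (fun _ : V => c).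
Proof.
elim: n c => [|n IH] c; split=> //; try exact: cst_continuous.
move=> v; split; first by move=> p; exact: derivable_cst.
by apply: (Cn_ext _ (IH 0)) => p; rewrite derive_cst.
Qed.

Lemma CnD n f g : Cn n f -> Cn n g -> Cn n (fun p => f p + g p).
Proof.
elim: n f g => [|n IH] f g [cf df] [cg dg]; split=> //.
- by move=> p; apply: cvgD; [exact: cf|exact: cg].
- by move=> p; apply: cvgD; [exact: cf|exact: cg].
move=> v; have [f1 f2] := df v; have [g1 g2] := dg v; split.
  by move=> p; apply: derivableD.
by apply: (Cn_ext _ (IH _ _ f2 g2)) => p; rewrite -deriveD.
Qed.

Lemma CnM n f g : Cn n f -> Cn n g -> Cn n (fun p => f p * g p).
Proof.
elim: n f g => [|n IH] f g Hf Hg.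
  by split=> // p; apply: cvgM; [exact: (Cn_continuous Hf)|exact: (Cn_continuous Hg)].
split; first by move=> p; apply: cvgM; [exact: (Cn_continuous Hf)|exact: (Cn_continuous Hg)].
move=> v; have [_ /(_ v)[f1 f2]] := Hf; have [_ /(_ v)[g1 g2]] := Hg; split.
  by move=> p; apply: derivableM.
apply: (@Cn_ext _ _ (fun p => f p * 'D_v g p + g p * 'D_v f p)).
  by move=> p; rewrite [LHS]deriveM.
by apply: CnD; apply: IH => //; exact: CnW.
Qed.

Lemma CnV n f : (forall p, f p != 0) -> Cn n f -> Cn n (fun p => (f p)^-1).
Proof.
move=> f0; elim: n => [|n IH] Hf.
  by split=> // p; apply: cvgV => //; exact: (Cn_continuous Hf).
split; first by move=> p; apply: cvgV => //; exact: (Cn_continuous Hf).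
move=> v; have [_ /(_ v)[f1 f2]] := Hf; split.
  by move=> p; apply: derivableV.
have HV := IH (CnW Hf).
apply: (@Cn_ext _ _ (fun p => (-1) * ((f p)^-1 * (f p)^-1) * 'D_v f p)).
  by move=> p; rewrite deriveV// /GRing.scale/= mulN1r expr2 invfM.
by apply: CnM => //; apply: CnM; [exact: Cn_cst|exact: CnM].
Qed.

Lemma smooth_cst (c : R) : smooth (fun _ : V => c).
Proof. by move=> n; exact: Cn_cst. Qed.

Lemma smoothD f g : smooth f -> smooth g -> smooth (fun p => f p + g p).
Proof. by move=> Hf Hg n; exact: CnD. Qed.

Lemma smoothM f g : smooth f -> smooth g -> smooth (fun p => f p * g p).
Proof. by move=> Hf Hg n; exact: CnM. Qed.

Lemma smoothB f g : smooth f -> smooth g -> smooth (fun p => f p - g p).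
Proof.
move=> Hf Hg n; apply: (@Cn_ext _ _ (fun p => f p + (-1) * g p)).
  by move=> p; rewrite mulN1r.
by apply: smoothD => //; apply: smoothM => //; exact: smooth_cst.
Qed.

Lemma smoothV f : (forall p, f p != 0) -> smooth f -> smooth (fun p => (f p)^-1).
Proof. by move=> f0 Hf n; exact: CnV. Qed.

Lemma smooth_derive f v : smooth f -> smooth ('D_v f).
Proof. by move=> Hf n; have [_ /(_ v)[]] := Hf n.+1. Qed.

Lemma smooth_derivable f v p : smooth f -> derivable f p v.
Proof. by move=> Hf; have [_ /(_ v)[]] := Hf 1. Qed.

Lemma smooth_continuous f : smooth f -> continuous f.
Proof. by move=> Hf; exact: (Cn_continuous (Hf 0)). Qed.

(** Near a point outside the closed support f is constantly zero, hence so is its derivative. *)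
Lemma test_derive U f v : test_function U f -> test_function U ('D_v f).
Proof.
move=> [sf Kf Uf]; have sub : closure [set p | 'D_v f p != 0] `<=`
    closure [set p | f p != 0].
  rewrite [X in _ `<=` X]closureE => p Hp C /= [cC fC].
  rewrite ((closure_id C).1 cC).
  move: Hp; apply: closureS => q /=; apply: contra_neqP => Cq.
  have : \forall q' \near q, f q' = cst 0 q'.
    have : open (~` C) by exact: closed_openC.
    rewrite openE => /(_ _ Cq); apply: filterS => q' /= nC.
    by apply: contrapT => fq; apply: nC; apply: fC; apply/eqP.
  by move=> /near_eq_derive ->; rewrite derive_cst.
split; first exact: smooth_derive.
  by apply: subclosed_compact Kf sub; exact: closed_closure.
exact: subset_trans Uf.
Qed.

Lemma test_bounded U f : test_function U f -> exists C, forall p, `|f p| <= C.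
Proof.
move=> [sf Kf _].
have cf : {within closure [set p | f p != 0], continuous f}.
  by apply: continuous_subspaceT; exact: smooth_continuous.
have [M [_ HM]] := compact_bounded (continuous_compact cf Kf).
exists (Num.max 0 (M + 1)) => p; have [->|fp] := eqVneq (f p) 0.
  by rewrite normr0 le_max lexx.
rewrite le_max; apply/orP; right; apply: HM; first by rewrite ltrDl.
by exists p => //; exact: subset_closure.
Qed.

Lemma is_derive_line f p v (s : R) : derivable f (p + s *: v) v ->
  is_derive s (1 : R) (fun s : R => f (p + s *: v)) ('D_v f (p + s *: v)).
Proof.
move=> Hd.
have E : (fun h : R => h^-1 *: (((fun s => f (p + s *: v)) \o shift s) (h *: (1 : R))
      - f (p + s *: v))) =
    (fun h : R => h^-1 *: ((f \o shift (p + s *: v)) (h *: v) - f (p + s *: v))).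
  apply/funext => k /=; congr (_ *: (f _ - _)).
  by rewrite (_ : k *: (1 : R) = k) ?scalerDl 1?addrCA//; exact: mulr1.
split; first by rewrite /derivable E.
by rewrite /derive E.
Qed.

Lemma continuous_line f p v : (forall q, derivable f q v) ->
  continuous (fun s : R => f (p + s *: v)).
Proof.
move=> df s; apply: differentiable_continuous; apply/derivable1_diffP.
by have [] := is_derive_line (df (p + s *: v)).
Qed.

Lemma MVT_line f p v (h : R) : (forall q, derivable f q v) -> 0 <= h ->
  exists2 c, 0 <= c <= h & f (p + h *: v) - f p = 'D_v f (p + c *: v) * h.
Proof.
move=> df h0.
have [c] := MVT_segment h0 (fun s _ => is_derive_line (df (p + s *: v)))
  (continuous_subspaceT (continuous_line df)).
by rewrite in_itv/= scale0r addr0 subr0 => ch E; exists c.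
Qed.

Lemma test_lip U f v : test_function U f ->
  exists2 C, 0 <= C & forall p h, `|f (p + h *: v) - f p| <= C * `|h|.
Proof.
move=> tf; have [C hC] := test_bounded (test_derive v tf).
exists C; first by apply: le_trans (hC 0).
have [sf _ _] := tf.
have df q : derivable f q v by exact: smooth_derivable.
have H p h : 0 <= h -> `|f (p + h *: v) - f p| <= C * `|h|.
  by move=> h0; have [c _ ->] := MVT_line p df h0; rewrite normrM ler_wpM2r.
move=> p h; have [|h0] := leP 0 h; first exact: H.
have := H (p + h *: v) (- h); rewrite -addrA -scalerDl addrN scale0r addr0 normrN.
by rewrite distrC; apply; rewrite oppr_ge0 ltW.
Qed.

End SmoothAlgebra.

(** * Smooth functions of one variable and separated products *)

Section SmoothProduct.
Context {R : realType}.
Implicit Types f g : R -> R.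

Lemma Cn_fst n f : Cn n f -> Cn n (fun p : R * R => f p.1).
Proof.
elim: n f => [|n IH] f [cf df]; split=> //.
- by move=> p; apply: continuous_comp; [exact: cvg_fst|exact: cf].
- by move=> p; apply: continuous_comp; [exact: cvg_fst|exact: cf].
move=> v; have [f1 f2] := df v.1; split; first by move=> p; exact: (f1 p.1).
exact: (IH _ f2).
Qed.

Lemma Cn_snd n f : Cn n f -> Cn n (fun p : R * R => f p.2).
Proof.
elim: n f => [|n IH] f [cf df]; split=> //.
- by move=> p; apply: continuous_comp; [exact: cvg_snd|exact: cf].
- by move=> p; apply: continuous_comp; [exact: cvg_snd|exact: cf].
move=> v; have [f1 f2] := df v.2; split; first by move=> p; exact: (f1 p.2).
exact: (IH _ f2).
Qed.

Lemma derive1_scale f x v : derivable f x 1 -> 'D_v f x = v * 'D_1 f x.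
Proof.
move=> /derivable1_diffP df; rewrite !deriveE//.
by rewrite -[in LHS](mulr1 v) -[in LHS]/(v *: (1 : R)) linearZ.
Qed.

Lemma derivable_scale f x v : derivable f x 1 -> derivable f x v.
Proof. by move=> /derivable1_diffP df; exact: diff_derivable. Qed.

Lemma CnS_derive n f f' : (forall x : R, is_derive x (1 : R) f (f' x)) -> Cn n f' -> Cn n.+1 f.
Proof.
move=> df Hf'; split.
  move=> x; apply: differentiable_continuous; apply/derivable1_diffP.
  by have [] := df x.
move=> v; split.
  by move=> x; apply: derivable_scale; have [] := df x.
apply: (@Cn_ext _ _ _ _ (fun x => v * f' x)).
  by move=> x; have [d1 d2] := df x; rewrite derive1_scale// d2.
by apply: CnM => //; exact: Cn_cst.
Qed.

Lemma smooth_is_derive f (x : R) : smooth f -> is_derive x (1 : R) f (derive1 f x).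
Proof. by move=> sf; rewrite derive1E; split=> //; exact: smooth_derivable. Qed.

Lemma smooth_derive1 f : smooth f -> smooth (derive1 f).
Proof.
by move=> sf; rewrite (_ : derive1 f = 'D_1 f); [exact: smooth_derive|apply/funext => x; rewrite derive1E].
Qed.

Lemma is_derive_affine f (a b x df : R) : is_derive (a * x + b) (1 : R) f df ->
  is_derive x (1 : R) (fun x => f (a * x + b)) (df * a).
Proof.
move=> H; apply: (@is_derive1_comp _ f (fun x => a * x + b)) => //.
have -> : (fun x0 => a * x0 + b) = (a \*: id) + cst b by apply/funext.
by apply: is_derive_eq; rewrite /GRing.scale/= mulr1 addr0.
Qed.

Lemma smooth_affine f (a b : R) : smooth f -> smooth (fun x => f (a * x + b)).
Proof.
move=> sf n; elim: n f sf => [|n IH] f sf.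
  split=> // x; apply: (@continuous_comp _ _ _ (fun x => a * x + b) f).
    by apply: cvgD; [apply: cvgM; [exact: cvg_cst|exact: cvg_id]|exact: cvg_cst].
  exact: smooth_continuous.
apply: (@CnS_derive _ _ (fun x => derive1 f (a * x + b) * a)).
  by move=> x; apply: is_derive_affine; exact: smooth_is_derive.
apply: CnM; last exact: Cn_cst.
by apply: IH; exact: smooth_derive1.
Qed.

Lemma smooth_sep f g : smooth f -> smooth g -> smooth (fun p : R * R => f p.1 * g p.2).
Proof. by move=> sf sg n; apply: CnM; [exact: Cn_fst|exact: Cn_snd]. Qed.

Lemma derive_sep01 f g x t : smooth f -> smooth g ->
  'D_(0, 1) (fun p : R * R => f p.1 * g p.2) (x, t) = f x * derive1 g t.
Proof.
move=> sf sg; rewrite deriveM.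
- have -> : 'D_(0, 1) (fun p : R * R => f p.1) (x, t) = 'D_0 f x by [].
  have -> : 'D_(0, 1) (fun p : R * R => g p.2) (x, t) = 'D_1 g t by [].
  rewrite [X in _ + _ *: X]derive1_scale ?mul0r; last exact: smooth_derivable.
  by rewrite scaler0 addr0 derive1E.
- by rewrite -[derivable _ _ _]/(derivable f x 0); exact: smooth_derivable.
- by rewrite -[derivable _ _ _]/(derivable g t 1); exact: smooth_derivable.
Qed.

End SmoothProduct.

(** * A smooth step function *)

Section SmoothStep.
Context {R : realType}.

Lemma is_derive_ext (f g : R -> R) (x df dg : R) : is_derive x (1 : R) f df ->
  f =1 g -> df = dg -> is_derive x (1 : R) g dg.
Proof. by move=> D /funext <- <-. Qed.

(** The functions x^(-k) exp(-1/x) on x > 0, extended by 0. The span of the family is closed under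
    differentiation, so smoothness follows by induction on the order for all k at once. *)
Definition expinv (k : nat) (x : R) : R :=
  if 0 < x then (x^-1) ^+ k * expR (- x^-1) else 0.

Lemma expinv_ge0 k x : 0 <= expinv k x.
Proof.
rewrite /expinv; case: ifPn => // x0.
by rewrite mulr_ge0 ?expR_ge0// exprn_ge0// invr_ge0 ltW.
Qed.

(** One term of the exponential series, exp(y) >= y^(k+2) / (k+2)! with y = 1/x. The quadratic bound
    makes the derivative at 0 vanish. *)
Lemma expinv_le k x : expinv k x <= k.+2`!%:R * x ^+ 2.
Proof.
rewrite /expinv; case: ifPn => x0; last by rewrite mulr_ge0// sqr_ge0.
have y0 : 0 < x^-1 by rewrite invr_gt0.
rewrite expRN ler_pdivrMr ?expR_gt0//.
have /(le_trans _) := expR_ge1Dxn k.+1 (ltW y0).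
move=> /(_ (x^-1 ^+ k.+2 / k.+2`!%:R)) H.
have {H} H := H _; have {}H : x^-1 ^+ k.+2 / k.+2`!%:R <= expR x^-1.
  by apply: H; rewrite lerDr.
apply: (@le_trans _ _ (k.+2`!%:R * x ^+ 2 * (x^-1 ^+ k.+2 / k.+2`!%:R))).
  have f0 : (k.+2`!%:R : R) != 0 by rewrite pnatr_eq0 -lt0n fact_gt0.
  have xn : x != 0 by rewrite gt_eqF.
  rewrite le_eqVlt; apply/orP; left; apply/eqP.
  rewrite -addn2 exprD; field; apply/andP; split=> //; exact/mulf_neq0.
by rewrite ler_wpM2l// mulr_ge0// sqr_ge0.
Qed.

Lemma is_derive_expinv k x :
  is_derive (x : R) (1 : R) (expinv k) (expinv k.+2 x - k%:R * expinv k.+1 x).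
Proof.
have [x0|x0|->] := ltgtP x 0.
- apply: (@near_eq_is_derive _ _ _ (cst 0)).
    near=> y; rewrite /expinv ltNge (_ : y <= 0)//.
    by near: y; exact: lt_le_nbhsl.
  rewrite /expinv ltNge (ltW x0)/= mulr0 subr0; exact: is_derive_cst.
- apply: (@near_eq_is_derive _ _ _ (fun y : R => (y^-1) ^+ k * expR (- y^-1) : R)).
    near=> y; rewrite /expinv (_ : 0 < y)//.
    by near: y; exact: lt_nbhsr.
  rewrite /expinv x0.
  have xn : x != 0 by rewrite gt_eqF.
  have dV : is_derive x (1 : R) (fun y : R => y^-1) (- x ^- 2).
    have := @is_deriveV _ id x 1 1 xn (is_derive_id _ _).
    by rewrite /GRing.scale/= mulr1.
  have dX : is_derive x (1 : R) (fun y : R => (y^-1) ^+ k) (k%:R * x^-1 ^+ k.-1 * (- x ^- 2)).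
    apply: (is_derive_ext (@is_deriveX _ _ (fun y : R => y^-1) k x 1 _ dV)) => //.
    by move=> y; rewrite exprfctE.
  have dE : is_derive x (1 : R) (fun y : R => expR (- y^-1)) (expR (- x^-1) * (x ^- 2)).
    apply: (@is_derive1_comp _ expR (fun y => - y^-1)).
    by have := is_deriveN dV; rewrite opprK.
  apply: (is_derive_ext (is_deriveM dX dE)) => //.
  rewrite /GRing.scale/= !exprS; case: k {dX} => [|k]; first by rewrite !mul0r/=; field.
  by rewrite -pred_Sn exprS; field.
- have z k' : expinv k' 0 = 0 by rewrite /expinv ltxx.
  rewrite !z mulr0 subr0.
  suff H : (h^-1 *: ((expinv k \o shift 0) (h *: 1) - expinv k 0)) @[h --> 0^'] --> (0 : R).
    by split; [apply/cvg_ex; exists 0|apply/cvg_lim => //; exact: Rhausdorff].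
  apply/cvgr0Pnorm_le => e e0.
  have f0 : 0 < (k.+2`!%:R : R) by rewrite ltr0n fact_gt0.
  near=> h; rewrite /= addr0 z subr0 /GRing.scale/= mulr1 normrM.
  have hn : h != 0 by near: h; exact: nbhs_dnbhs_neq.
  rewrite normfV mulrC ler_pdivrMr ?normr_gt0// ger0_norm ?expinv_ge0//.
  apply: le_trans (expinv_le _ _) _.
  rewrite -real_normK ?num_real// expr2 mulrA ler_wpM2r// -ler_pdivlMl// mulrC.
  near: h; apply: dnbhs0_le; exact: divr_gt0.
Unshelve. all: by end_near.
Qed.

Lemma smooth_expinv k : smooth (expinv k).
Proof.
move=> n; elim: n k => [|n IH] k.
  split=> // x; apply: differentiable_continuous; apply/derivable1_diffP.
  by have [] := is_derive_expinv k x.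
apply: (CnS_derive (is_derive_expinv k)).
apply: (@Cn_ext _ _ _ _ (fun x => expinv k.+2 x + (- k%:R) * expinv k.+1 x)).
  by move=> x; rewrite mulNr.
by apply: CnD => //; apply: CnM => //; exact: Cn_cst.
Qed.

Lemma expinv_homo x y : x <= y -> expinv 0 x <= expinv 0 y.
Proof.
move=> xy; rewrite /expinv !expr0 !mul1r; case: ifPn => x0; last first.
  by case: ifPn => // _; exact: expR_ge0.
by rewrite (lt_le_trans x0 xy) ler_expR lerN2 lef_pV2// posrE (lt_le_trans x0 xy).
Qed.

Definition sstep (x : R) := expinv 0 x / (expinv 0 x + expinv 0 (1 - x)).

Let den_gt0 x : 0 < expinv 0 x + expinv 0 (1 - x).
Proof.
have p (y : R) : 0 < y -> 0 < expinv 0 y.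
  by move=> y0; rewrite /expinv y0 expr0 mul1r expR_gt0.
have [x0|x0] := ltP 0 x; first by rewrite ltr_wpDr ?p// expinv_ge0.
by rewrite ltr_wpDl ?p ?expinv_ge0//; lra.
Qed.

Lemma smooth_sstep : smooth sstep.
Proof.
have s1 : smooth (fun x : R => expinv 0 (1 - x)).
  move=> n; apply: (@Cn_ext _ _ _ _ (fun x : R => expinv 0 ((-1) * x + 1))).
    by move=> x; congr expinv; rewrite mulN1r addrC.
  by apply: smooth_affine; exact: smooth_expinv.
apply: smoothM; first exact: smooth_expinv.
apply: smoothV; first by move=> x; rewrite gt_eqF.
by apply: smoothD => //; exact: smooth_expinv.
Qed.

Lemma sstep0 x : x <= 0 -> sstep x = 0.
Proof. by move=> x0; rewrite /sstep {1}/expinv ltNge x0 mul0r. Qed.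

Lemma sstep_sym x : sstep (1 - x) = 1 - sstep x.
Proof.
have := den_gt0 x; rewrite /sstep (_ : 1 - (1 - x) = x); last by lra.
by move=> d0; rewrite [X in _ / X]addrC; field; rewrite gt_eqF.
Qed.

Lemma sstep1 x : 1 <= x -> sstep x = 1.
Proof.
move=> x1; have := sstep_sym (1 - x); rewrite (_ : 1 - (1 - x) = x); last by lra.
by have -> : sstep (1 - x) = 0 by [apply: sstep0; lra]; rewrite subr0.
Qed.

Lemma sstep_ge0 x : 0 <= sstep x.
Proof. by rewrite divr_ge0 ?expinv_ge0// ltW. Qed.

Lemma sstep_le1 x : sstep x <= 1.
Proof. by have := sstep_ge0 (1 - x); rewrite sstep_sym; lra. Qed.

Lemma sstep_homo x y : x <= y -> sstep x <= sstep y.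
Proof.
move=> xy; rewrite /sstep ler_pdivrMr// mulrAC ler_pdivlMr//.
rewrite !mulrDr mulrC lerD2l; apply: ler_pM; rewrite ?expinv_ge0 ?expinv_homo//.
by lra.
Qed.

Lemma sstep_derive_ge0 x : 0 <= derive1 sstep x.
Proof.
rewrite derive1E; apply: limr_ge; first exact: smooth_derivable smooth_sstep.
near=> h; rewrite /GRing.scale/= mulr1.
have [h0|h0] := leP 0 h.
  by rewrite mulr_ge0 ?invr_ge0// subr_ge0 sstep_homo// lerDr.
by rewrite mulr_le0 ?invr_le0 ?(ltW h0)// subr_le0 sstep_homo// gerDr ltW.
Unshelve. all: by end_near.
Qed.

Lemma derive1_locally_cst (f : R -> R) (c x : R) :
  (\forall y \near x, f y = c) -> derive1 f x = 0.
Proof.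
move=> H; rewrite derive1E (near_eq_derive (g := cst c)) ?derive_cst//.
Qed.

Lemma sstep_derive0 x : x < 0 \/ 1 < x -> derive1 sstep x = 0.
Proof.
move=> [x0|x1].
  apply: (@derive1_locally_cst _ 0); near=> y; apply: sstep0.
  by near: y; exact: lt_le_nbhsl.
apply: (@derive1_locally_cst _ 1); near=> y; apply: sstep1.
by near: y; exact: lt_le_nbhsr.
Unshelve. all: by end_near.
Qed.

End SmoothStep.

Section TestFunctionSupport.
Context {R : realType}.

Lemma test_itv (U : set R) (f : R -> R) a b : smooth f ->
  (forall x, f x != 0 -> a <= x <= b) -> `[a, b] `<=` U -> test_function U f.
Proof.
move=> sf f0 abU.
have sub : closure [set p | f p != 0] `<=` `[a, b]%classic.
  rewrite [X in _ `<=` X](closure_id _).1; last exact: itv_closed.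
  by apply: closureS => x /= /f0; rewrite in_itv.
split=> //; last exact: subset_trans abU.
by apply: subclosed_compact sub; [exact: closed_closure|exact: segment_compact].
Qed.

Lemma test_sep T (f g : R -> R) a b c d : smooth f -> smooth g ->
  (forall x, f x != 0 -> a <= x <= b) -> (forall t, g t != 0 -> c <= t <= d) ->
  0 < c -> d < T -> test_function (strip T) (fun p : R * R => f p.1 * g p.2).
Proof.
move=> sf sg f0 g0 c0 dT.
have sub : closure [set p | f p.1 * g p.2 != 0] `<=` `[a, b]%classic `*` `[c, d]%classic.
  rewrite [X in _ `<=` X](closure_id _).1; last first.
    have -> : `[a, b]%classic `*` `[c, d]%classic =
      (@fst R R @^-1` `[a, b]%classic) `&` (@snd R R @^-1` `[c, d]%classic) by [].
    by apply: closedI; apply: closed_comp => //; try exact: itv_closed; move=> x _;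
      [exact: cvg_fst|exact: cvg_snd].
  apply: closureS => -[x t] /=; rewrite mulf_eq0 negb_or => /andP[/f0 h1 /g0 h2].
  by split; rewrite in_itv.
split; first exact: smooth_sep.
  apply: subclosed_compact sub; first exact: closed_closure.
  by apply: compact_setX; exact: segment_compact.
move=> p /sub [_ /=]; rewrite in_itv/= => /andP[cp pd]; split=> //=.
by rewrite in_itv/= (lt_le_trans c0 cp) (le_lt_trans pd dT).
Qed.

End TestFunctionSupport.

(** * Smooth approximations of the sign and of the absolute value *)

Section SmoothAbs.
Context {R : realType}.

(** [sgk k u] is tanh(k u), and its primitive [absk k u] is ln(2 cosh(k u)) / k, which lies between
    |u| and |u| + 1/k. *)
Definition sgk (k u : R) : R := 1 - 2 / (expR (2 * k * u) + 1).
Definition absk (k u : R) : R := k^-1 * ln (expR (k * u) + expR (- (k * u))).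

Let den (k u : R) : 0 < expR (2 * k * u) + 1.
Proof. by rewrite ltr_wpDl// expR_ge0. Qed.

Lemma sgkN k u : sgk k (- u) = - sgk k u.
Proof.
rewrite /sgk mulrN expRN; have := den k u; have := expR_gt0 (2 * k * u).
set e := expR _ => e0 d0; field; apply/andP; split; rewrite gt_eqF//.
Qed.

Lemma sgk_homo k u v : 0 <= k -> u <= v -> sgk k u <= sgk k v.
Proof.
move=> k0 uv; rewrite /sgk lerD2l lerN2 ler_wpM2l// lef_pV2 ?posrE//.
by rewrite lerD2r ler_expR ler_wpM2l// mulr_ge0.
Qed.

Lemma sgk_le1 k u : `|sgk k u| <= 1.
Proof.
have h v : sgk k v <= 1 by rewrite /sgk gerBl divr_ge0// ltW.
by rewrite ler_norml h andbT lerNl -sgkN.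
Qed.

Lemma smooth_expR : smooth (@expR R).
Proof.
elim=> [|n IH]; first by split=> //; exact: continuous_expR.
apply: (@CnS_derive _ _ _ expR) => //; exact: is_derive_expR.
Qed.

Lemma smooth_sgk k : smooth (sgk k).
Proof.
apply: smoothB; first exact: smooth_cst.
apply: smoothM; first exact: smooth_cst.
apply: smoothV; first by move=> x; rewrite gt_eqF.
apply: smoothD; last exact: smooth_cst.
move=> n; apply: (@Cn_ext _ _ _ _ (fun x => expR (2 * k * x + 0))).
  by move=> x; rewrite addr0.
by apply: smooth_affine; exact: smooth_expR.
Qed.

Lemma is_derive_sgk k (u : R) : is_derive u (1 : R) (sgk k) (k * (1 - sgk k u ^+ 2)).
Proof.
have d1 : is_derive u (1 : R) (fun u => expR (2 * k * u) + 1) (expR (2 * k * u) * (2 * k)).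
  have -> : (fun u => expR (2 * k * u) + 1) = (fun u => expR (2 * k * u + 0)) \+ cst 1.
    by apply/funext => x /=; rewrite addr0.
  rewrite -[_ * (2 * k)]addr0; apply: is_deriveD.
  have := @is_derive_affine _ expR (2 * k) 0 u _ (is_derive_expR _).
  by rewrite addr0.
have dn : expR (2 * k * u) + 1 != 0 by rewrite gt_eqF.
have -> : sgk k = cst 1 \- (2 \*: (fun u => (expR (2 * k * u) + 1)^-1)) by [].
apply: (is_derive_ext (is_deriveB (is_derive_cst (1 : R) u 1) (is_deriveZ 2
  (@is_deriveV _ (fun u => expR (2 * k * u) + 1) u _ 1 dn d1)))) => //.
rewrite /GRing.scale/= /sgk; move: dn; set e := expR _ => dn.
by rewrite sub0r (_ : 2 *: (e + 1)^-1 = 2 * (e + 1)^-1)//; field.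
Qed.

Lemma sgk_lip k u v : 0 <= k -> `|sgk k u - sgk k v| <= k * `|u - v|.
Proof.
move=> k0; wlog vu : u v / v <= u => [H|].
  have [|/ltW] := leP v u; first exact: H.
  by move=> /H; rewrite distrC [`|v - u|]distrC.
have cs : continuous (sgk k) by exact: smooth_continuous (smooth_sgk k).
have [c _ ->] := MVT_segment vu (fun x _ => is_derive_sgk k x) (continuous_subspaceT cs).
rewrite normrM ler_wpM2r// normrM ger0_norm// ler_piMr//.
have s1 : sgk k c ^+ 2 <= 1 by rewrite -real_normK ?num_real// exprn_ile1// sgk_le1.
by rewrite ler_norml; have := sqr_ge0 (sgk k c); lra.
Qed.

Lemma abskN k u : absk k (- u) = absk k u.
Proof. by rewrite /absk mulrN opprK addrC. Qed.

Lemma is_derive_absk k (u : R) : 0 < k -> is_derive u (1 : R) (absk k) (sgk k u).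
Proof.
move=> k0; have E a : is_derive u (1 : R) (fun u => expR (a * u)) (expR (a * u) * a).
  have := @is_derive_affine _ expR a 0 u _ (is_derive_expR _).
  by rewrite addr0; under eq_fun do rewrite addr0.
have d1 : is_derive u (1 : R) (fun u => expR (k * u) + expR (- (k * u)))
    (expR (k * u) * k + expR (- k * u) * (- k)).
  rewrite (_ : (fun u => _) = (fun u => expR (k * u)) \+ (fun u => expR (- k * u))).
    by apply: is_deriveD; exact: E.
  by apply/funext => x /=; rewrite mulNr.
have dp : 0 < expR (k * u) + expR (- (k * u)) by rewrite addr_gt0 ?expR_gt0.
apply: (is_derive_ext (is_deriveZ k^-1
  (@is_derive1_comp _ (@ln R) _ u _ _ (is_derive1_ln dp) d1))) => //.
rewrite /GRing.scale/= /sgk mulNr expRN -mulrA [2 * _]mulr_natl expRM_natl expr2.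
move: dp; rewrite expRN; have := expR_gt0 (k * u); set e := expR _ => e0 dp.
by field; rewrite !gt_eqF//= addr_gt0// mulr_gt0.
Qed.

Lemma absk_ge k u : 0 < k -> `|u| <= absk k u.
Proof.
move=> k0; rewrite /absk mulrC ler_pdivlMr//.
rewrite -[X in X <= _]expRK ler_ln ?posrE ?expR_gt0 ?addr_gt0 ?expR_gt0//.
case: (ger0P u) => u0; first by rewrite mulrC lerDl expR_ge0.
by rewrite mulNr mulrC lerDr expR_ge0.
Qed.

Lemma absk_le k u : 0 < k -> absk k u <= `|u| + k^-1.
Proof.
move=> k0; wlog u0 : u / 0 <= u => [H|].
  have [|/ltW u0] := leP 0 u; first exact: H.
  by rewrite -abskN -normrN; apply: H; rewrite oppr_ge0.
rewrite ger0_norm// /absk mulrC ler_pdivrMr// mulrDl mulVf ?gt_eqF//.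
rewrite -[leRHS]expRK ler_ln ?posrE ?expR_gt0 ?addr_gt0 ?expR_gt0//.
rewrite expRD mulrC; have h : 2 <= expR 1 :> R by have := expR_ge1Dx (1 : R); lra.
have e1 : expR (- (u * k)) <= expR (u * k).
  by rewrite ler_expR; have := mulr_ge0 u0 (ltW k0); lra.
by have := expR_gt0 (u * k); nra.
Qed.

Lemma absk_lip k u v : 0 < k -> `|absk k u - absk k v| <= `|u - v|.
Proof.
move=> k0; wlog vu : u v / v <= u => [H|].
  have [|/ltW] := leP v u; first exact: H.
  by move=> /H; rewrite distrC [`|v - u|]distrC.
have cs : continuous (absk k).
  move=> x; apply: differentiable_continuous; apply/derivable1_diffP.
  by have [] := is_derive_absk x k0.
have [c _ ->] := MVT_segment vu (fun x _ => is_derive_absk x k0) (continuous_subspaceT cs).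
by rewrite normrM ler_piMl// sgk_le1.
Qed.

End SmoothAbs.

(** * Charges and distributional derivatives *)

Section BoundedConvergence.
Context {d} {Y : measurableType d} {R : realType}.
Variable la : {finite_measure set Y -> \bar R}.

Lemma bounded_cvg (F : nat -> Y -> R) (f : Y -> R) (C : R) :
  (forall n, bm (F n)) -> bm f -> (forall n y, `|F n y| <= C) ->
  (forall y, F n y @[n --> \oo] --> f y) ->
  (\int[la]_y F n y) @[n --> \oo] --> \int[la]_y f y.
Proof.
move=> bF bf FC Ff.
have mE g : bm g -> measurable_fun setT (EFin \o g : Y -> \bar R).
  by move=> [mg _]; exact/measurable_EFinP.
have H : ((\int[la]_y (F n y)%:E) @[n --> \oo] --> \int[la]_y (f y)%:E)%E.
  have [|||_ _] := @dominated_convergence _ Y R la setT measurableT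
    (fun n => EFin \o F n) (EFin \o f) (cst C%:E) (fun n => mE _ (bF n)) (mE _ bf).
  - apply/aeW => y _ /=; apply: cvg_EFin; first by apply: nearW.
    exact: Ff.
  - exact: (bm_integrable la measurableT (bm_cst C)).
  - by apply/aeW => y n _ /=; rewrite lee_fin.
  - by [].
have fin g : bm g -> (\int[la]_y (g y)%:E)%E \is a fin_num.
  by move=> bg; apply: integrable_fin_num => //; exact: (bm_integrable la).
by apply: fine_cvg; rewrite /Rintegral fineK ?fin.
Qed.

End BoundedConvergence.

Lemma integral_mrestr d (Y : measurableType d) (R : realType)
  (m : {measure set Y -> \bar R}) (S : set Y) (mS : measurable S) (f : Y -> \bar R) :
  measurable_fun setT f ->
  (\int[mrestr m mS]_y f y = \int[m]_(y in S) f y)%E.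
Proof.
move=> mf; rewrite (@ae_eq_integral _ _ _ (mrestr m mS) setT (f \_ S))//.
- rewrite -integral_mkcond; apply: eq_measure_integral => A mA AS.
  by rewrite /= /mrestr setIidl.
- by apply/(measurable_restrictT _ mS); exact: measurable_funTS.
exists (~` S); split.
- exact: measurableC.
- by rewrite /= /mrestr setICl measure0.
- by move=> y /=; apply: contra_not => yS _; rewrite patchE mem_set.
Qed.

(** An alias indexed by the proof of finiteness, on which the structure of finite measure can be
    declared. *)
Definition fin_measure d (Y : measurableType d) (R : realType)
  (m : {measure set Y -> \bar R}) & fin_num_fun m : set Y -> \bar R := m.

Section FinMeasure.
Context d (Y : measurableType d) (R : realType).
Variables (m : {measure set Y -> \bar R}) (finm : fin_num_fun m).
HB.instance Definition _ := Measure.on (fin_measure finm).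
HB.instance Definition _ := @Measure_isFinite.Build _ _ _ (fin_measure finm) finm.
End FinMeasure.

(** * Images of measures with a density *)

Section DensityPush.
Context {d d'} {Y : measurableType d} {X : measurableType d'} {R : realType}.
Variable la : {finite_measure set Y -> \bar R}.

(* The density is realized by the region under its graph, which reduces        *)
(* integration against it to Fubini.                                           *)
Lemma density_push (w : Y -> R) (Z : Y -> X) : bm w -> (forall y, 0 <= w y) ->
  measurable_fun setT Z ->
  exists m : {finite_measure set X -> \bar R},
    forall h : X -> R, bm h -> \int[m]_x h x = \int[la]_y (w y * h (Z y)).
Proof.
move=> bw w0 mZ; have [mw [C hC]] := bw.
pose S := [set p : Y * measurableTypeR R | 0 <= p.2 <= w p.1].
have mS : measurable S.
  rewrite (_ : S = [set p | 0 <= p.2] `&` [set p | p.2 <= w p.1]).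
    by apply: measurableI; rewrite -[X in measurable X]setTI;
      [apply: measurable_fun_ler => //; exact: measurable_cst
      |apply: measurable_fun_ler => //; exact: measurableT_comp].
  by apply/seteqP; split=> [p /= /andP[]//|p [/= h1 h2]]; rewrite /S /= h1.
have bS : bm (\1_S : _ -> R) := bm_ind mS.
pose m0 := mrestr (la \x lam 0 C)%E mS.
have mphi : measurable_fun setT (Z \o @fst Y (measurableTypeR R)).
  exact: measurableT_comp.
pose phi := Z \o @fst Y (measurableTypeR R).
pose m1 : {measure set X -> \bar R} :=
  measure_function_pushforward__canonical__measure_function_Measure m0 mphi.
have fin : fin_num_fun (m1 : set X -> \bar R).
  move=> U mU; rewrite ge0_fin_numE ?measure_ge0//.
  have := @bm_integrable_prod _ _ _ _ _ la (lam 0 C) _ bS.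
  move/integrableP => [_]; apply: le_lt_trans.
  under eq_integral do rewrite /= ger0_norm ?indicE ?ler0n//.
  rewrite [leRHS](_ : _ = (la \x lam 0 C)%E S); last first.
    by under eq_integral do rewrite -indicE; rewrite integral_indic// setIT.
  change ((la \x lam 0 C)%E ((phi @^-1` U) `&` S) <= (la \x lam 0 C)%E S)%E.
  have mU' : measurable ((phi @^-1` U) `&` S).
    by apply: measurableI => //; have := mphi measurableT _ mU; rewrite setTI.
  by apply: le_measure; [rewrite inE|rewrite inE|exact: subIsetr].
pose m : {finite_measure set X -> \bar R} := fin_measure fin.
exists m => h bh.
have bhZ : bm (fun p : Y * measurableTypeR R => h (Z p.1)).
  exact: bm_comp bh mphi.
have mh : measurable_fun setT (EFin \o (h \o phi)).
  by apply/measurable_EFinP; case: bhZ.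
have E : \int[m]_x h x = \int[(la \x lam 0 C)%E]_p (h (Z p.1) * \1_S p).
  rewrite /Rintegral; congr fine.
  have -> : (\int[m]_x (h x)%:E = \int[pushforward m0 phi]_x (h x)%:E)%E by [].
  have RE : (\int[(la \x lam 0 C)]_p (h (Z p.1) * \1_S p)%:E =
      \int[(la \x lam 0 C)]_(p in S) (h (Z p.1))%:E)%E.
    rewrite [RHS]integral_mkcond; apply: eq_integral => p _.
    by rewrite patchE indicE; case: ifP; rewrite ?mulr1 ?mulr0.
  have mEh : measurable_fun setT (EFin \o h : X -> \bar R).
    by apply/measurable_EFinP; case: bh.
  have ih : m0.-integrable (phi @^-1` setT) ((EFin \o h) \o phi).
    rewrite preimage_setT; apply/integrableP; split; first exact: mh.
    rewrite integral_mrestr; last by apply: measurableT_comp.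
    have /integrableP[_] := @bm_integrable_prod _ _ _ _ _ la (lam 0 C) _ (bmM bhZ bS).
    apply: le_lt_trans; rewrite [leLHS]integral_mkcond.
    rewrite le_eqVlt; apply/orP; left; apply/eqP; apply: eq_integral => p _.
    by rewrite patchE /= indicE; case: ifP; rewrite ?mulr1// mulr0 normr0.
  have P := integral_pushforward mphi mEh ih measurableT.
  rewrite RE; apply: (etrans P); rewrite preimage_setT.
  exact: integral_mrestr.
have bF : bm (fun p : Y * measurableTypeR R => h (Z p.1) * \1_S p) by exact: bmM.
rewrite E int_prod12//; apply: eq_Rintegral => y _ /=.
have bS1 : bm (fun s : measurableTypeR R => \1_S (y, s) : R) by exact: (bm_sec1 y bS).
rewrite intZ// mulrC; congr (_ * _).
have wC : w y <= C by rewrite (le_trans (ler_norm _)).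
(* The section of S at y is [0, w y]; above w y it leaves only the end point, which is null. *)
rewrite (lam_split (c := w y))//.
rewrite (@eq_lam _ _ _ _ (fun _ => 1))//; last 2 first.
  exact: bm_cst.
  by move=> x xw; rewrite indicE mem_set.
rewrite lam_cst// subr0 mul1r -[RHS]addr0; congr (_ + _).
have bi : bm (\1_`[w y, C] : R -> R) by apply: bm_ind; exact: measurable_itv.
have bw1 : bm (\1_[set w y] : R -> R) by apply: bm_ind.
rewrite (@eq_lam _ _ _ _ (\1_[set w y]))//.
  rewrite int_ind// /lam /= /mrestr.
  rewrite (_ : fine _ = 0)//; apply/eqP; rewrite fine_eq0.
    rewrite eq_le measure_ge0 andbT -(lebesgue_measure_set1 (w y)).
    by apply: le_measure; rewrite ?inE//; apply: measurableI => //; exact: measurable_itv.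
  rewrite ge0_fin_numE//; apply: (@le_lt_trans _ _ (lebesgue_measure [set w y])).
    by apply: le_measure; rewrite ?inE//; apply: measurableI => //; exact: measurable_itv.
  by rewrite lebesgue_measure_set1.
move=> x /andP[wx xC]; rewrite !indicE; congr (nat_of_bool _)%:R.
apply/idP/idP; rewrite !inE /S /=.
  by move=> /andP[_ xw]; apply/eqP; rewrite eq_le xw wx.
by move=> ->; rewrite w0 lexx.
Qed.

(** A signed density is the difference of the nonnegative densities w + C and C. The last clause
    says that sets missed by Z are null for both parts, so integrands may be changed off the range
    of Z. *)
Lemma push_charge (w : Y -> R) (Z : Y -> X) : bm w -> measurable_fun setT Z ->
  exists nu : {charge set X -> \bar R},
  exists m1 m2 : {finite_measure set X -> \bar R},
    [/\ (forall A, measurable A -> nu A = m1 A - m2 A)%E,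
        (forall h : X -> R, bm h ->
          \int[m1]_x h x - \int[m2]_x h x = \int[la]_y (w y * h (Z y))) &
        (forall A, measurable A -> (forall y, ~ A (Z y)) -> m1 A = 0 /\ m2 A = 0)%E].
Proof.
move=> bw mZ; have [_ [C hC]] := bw.
have C0 y : 0 <= w y + C by have := hC y; rewrite ler_norml => /andP[]; lra.
have [m1 H1] := density_push (bmD bw (bm_cst C)) C0 mZ.
have C0' (y : Y) : 0 <= C by apply: le_trans (hC y).
have [m2 H2] := density_push (bm_cst C) C0' mZ.
exists (cadd (charge_of_finite_measure m1) (cscale (-1) (charge_of_finite_measure m2))).
exists m1, m2; split.
- move=> A mA; rewrite -[RHS]/(m1 A - m2 A)%E.
  rewrite -[LHS]/(m1 A + (-1)%:E * m2 A)%E.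
  by rewrite EFinN mulN1e.
- move=> h bh; rewrite H1// H2//.
  have bhZ : bm (fun y => h (Z y)) by exact: bm_comp bh mZ.
  rewrite -intB; [|by apply: bmM => //; apply: bmD => //; exact: bm_cst|
    by apply: bmM => //; exact: bm_cst].
  by apply: eq_Rintegral => y _; rewrite -mulrBl addrK.
- move=> A mA nA.
  have z (u : Y -> R) : \int[la]_y (u y * \1_A (Z y)) = 0.
    rewrite (eq_Rintegral _ _ (g := fun=> 0)) ?int_cst ?mul0r// => y _.
    by rewrite indicE memNset ?mulr0.
  have bA := bm_ind mA.
  split; apply/eqP; rewrite -fine_eq0 ?fin_num_measure//.
    by rewrite -int_ind// H1// z.
  by rewrite -int_ind// H2// z.
Qed.

End DensityPush.

(** * Integration against a difference of finite measures *)

Section ChargeIntegralTheory.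
Context {d} {X : measurableType d} {R : realType}.
Variable nu : {charge set X -> \bar R}.

Lemma jordan_fine (A : set X) : measurable A ->
  nu A = (jordan_pos (hahn_posnegP nu) A - jordan_neg (hahn_posnegP nu) A)%E.
Proof.
by move=> mA; rewrite (jordan_decomp (hahn_posnegP nu) mA) /cadd/= /cscale/= EFinN mulN1e.
Qed.

Lemma int_measure_add (m1 m2 : {finite_measure set X -> \bar R}) (f : X -> R) : bm f ->
  (\int[measure_add m1 m2]_x (f x)%:E)%E = (\int[m1]_x f x + \int[m2]_x f x)%:E.
Proof.
move=> bf; have i1 := bm_integrable m1 measurableT bf.
have i2 := bm_integrable m2 measurableT bf.
rewrite (integral_measure_add measurableT i1 i2).
by rewrite EFinD /Rintegral !fineK//; apply: integrable_fin_num.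
Qed.

(* Allowing f and g to differ on a null set of both measures handles the       *)
(* unbounded kernel in conv_protocol.                                          *)
Lemma charge_integral_sub (m1 m2 : {finite_measure set X -> \bar R}) (N : set X)
    (f g : X -> R) :
  (forall A, measurable A -> nu A = m1 A - m2 A)%E ->
  measurable N -> m1 N = 0%E -> m2 N = 0%E ->
  measurable_fun setT f -> bm g -> (forall x, ~ N x -> f x = g x) ->
  charge_integral nu f = \int[m1]_x g x - \int[m2]_x g x.
Proof.
move=> nuE mN m1N m2N mf bg fg.
pose p := jordan_pos (hahn_posnegP nu); pose n := jordan_neg (hahn_posnegP nu).
(* The two decompositions of [nu] are compared through sums, as an identity between positive
   measures. *)
have E A : measurable A -> measure_add p m2 A = measure_add n m1 A.
  move=> mA; rewrite !measure_addE; change (p A + m2 A = n A + m1 A)%E.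
  have := jordan_fine mA; rewrite nuE// -/p -/n.
  have [? ? ? ?] : [/\ m1 A \is a fin_num, m2 A \is a fin_num, p A \is a fin_num &
    n A \is a fin_num] by split; apply: fin_num_measure.
  rewrite -(fineK (_ : m1 A \is a fin_num))// -(fineK (_ : m2 A \is a fin_num))//
    -(fineK (_ : p A \is a fin_num))// -(fineK (_ : n A \is a fin_num))//.
  by rewrite -!EFinB -!EFinD => -[H]; congr EFin; lra.
(* As [nu] vanishes on all measurable subsets of N, its Jordan parts vanish on N too. *)
have z A : measurable A -> A `<=` N -> nu A = 0%E.
  move=> mA AN; rewrite nuE//.
  have le0 (m : {finite_measure set X -> \bar R}) : m N = 0%E -> m A = 0%E.
    move=> mN0; apply/eqP; rewrite eq_le measure_ge0 andbT -mN0.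
    by apply: le_measure; rewrite ?inE.
  by rewrite !le0// sube0.
have [[mP _] [mQ _] _ _] := hahn_posnegP nu.
have pN : p N = 0%E.
  rewrite /p jordan_posE cjordan_posE /crestr0 mem_set// /crestr z//.
  exact: measurableI.
have nN : n N = 0%E.
  rewrite /n jordan_negE cjordan_negE /crestr0 mem_set// /crestr z ?oppe0//.
  exact: measurableI.
have ext (m : {finite_measure set X -> \bar R}) : m N = 0%E ->
    \int[m]_x f x = \int[m]_x g x.
  move=> mN0; rewrite /Rintegral; congr fine; apply: ae_eq_integral => //.
  - exact/measurable_EFinP.
  - by apply/measurable_EFinP; case: bg.
  exists N; split=> // x /=; apply: contra_notP => Nx _.
  by rewrite fg.
rewrite /charge_integral -/p -/n.
rewrite (ext p)// (ext n)//.
have : (\int[measure_add p m2]_x (g x)%:E = \int[measure_add n m1]_x (g x)%:E)%E.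
  by apply: eq_measure_integral => A mA _; exact: E.
by rewrite (int_measure_add p m2)// (int_measure_add n m1)// => -[]; lra.
Qed.

Lemma charge_integral_bm (m1 m2 : {finite_measure set X -> \bar R}) (f : X -> R) :
  (forall A, measurable A -> nu A = m1 A - m2 A)%E -> bm f ->
  charge_integral nu f = \int[m1]_x f x - \int[m2]_x f x.
Proof.
move=> nuE bf; apply: (@charge_integral_sub _ _ set0) => //.
by case: bf.
Qed.

End ChargeIntegralTheory.

(** * Uniqueness and representation of distributional derivatives *)

Section DistributionalDerivative.
Context {R : realType}.
Local Notation mu := (@lebesgue_measure R).

Lemma continuous_bm (f : R -> R) C : continuous f -> (forall x, `|f x| <= C) ->
  bm (f : measurableTypeR R -> R).
Proof.
by move=> cf hC; split; [exact: continuous_measurable_fun|exists C].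
Qed.

Lemma test_bm U (psi : R -> R) : test_function U psi ->
  bm (psi : measurableTypeR R -> R).
Proof.
move=> tp; have [C hC] := test_bounded tp; have [sp _ _] := tp.
by apply: (@continuous_bm _ C) => //; exact: smooth_continuous.
Qed.

(** Test functions bounded by 1 that converge pointwise to the indicator of ]a, b]; these half-open
    intervals generate the Borel sets. *)
Definition bump (a b : R) (n : nat) (x : R) : R :=
  sstep (n.+1%:R * (x - a)) - sstep (n.+1%:R * (x - b)).

Lemma bump_test a b n : a <= b -> test_function setT (bump a b n).
Proof.
move=> ab; apply: (@test_itv _ _ _ a (b + 1)) => //.
- apply: smoothB.
    move=> k; apply: (@Cn_ext _ _ _ _ (fun x : R => sstep (n.+1%:R * x + - (n.+1%:R * a)))).
      by move=> x; rewrite mulrBr.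
    by apply: smooth_affine; exact: smooth_sstep.
  move=> k; apply: (@Cn_ext _ _ _ _ (fun x : R => sstep (n.+1%:R * x + - (n.+1%:R * b)))).
    by move=> x; rewrite mulrBr.
  by apply: smooth_affine; exact: smooth_sstep.
- move=> x; have n0 : 0 < n.+1%:R :> R by rewrite ltr0n.
  apply: contra_neqT; rewrite negb_and -!ltNge => /orP[xa|bx].
    rewrite /bump !sstep0 ?subrr//; rewrite pmulr_rle0//; lra.
  have n1 : 1 <= n.+1%:R :> R by rewrite ler1n.
  by rewrite /bump !sstep1 ?subrr//; nra.
Qed.

Lemma bump_le1 a b n x : a <= b -> `|bump a b n x| <= 1.
Proof.
move=> ab; have := sstep_ge0 (n.+1%:R * (x - b)).
have := sstep_le1 (n.+1%:R * (x - a)).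
have h : sstep (n.+1%:R * (x - b)) <= sstep (n.+1%:R * (x - a)).
  by apply: sstep_homo; rewrite ler_wpM2l// lerD2l lerN2.
by rewrite /bump ler_norml; lra.
Qed.

Let step_cvg (a x : R) :
  sstep (n.+1%:R * (x - a)) @[n --> \oo] --> (if a < x then 1 else 0 : R).
Proof.
case: ifPn => ax; last first.
  rewrite (_ : (fun n => _) = fun=> 0); first exact: cvg_cst.
  apply/funext => n; apply: sstep0; rewrite pmulr_rle0 ?ltr0n//.
  by rewrite -leNgt in ax; lra.
have xa : 0 < x - a by rewrite subr_gt0.
apply: cvg_near_cst; exists (Num.truncn (x - a)^-1) => // n /= hn.
apply: sstep1; rewrite -ler_pdivrMr// mul1r.
have /ltW/le_trans := truncnS_gt (x - a)^-1; apply.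
by rewrite ler_nat ltnS.
Qed.

Lemma bump_cvg a b x : a <= b ->
  bump a b n x @[n --> \oo] --> (\1_`]a, b]%classic x : R).
Proof.
move=> ab.
have E : (if a < x then 1 else 0) - (if b < x then 1 else 0) = \1_`]a, b]%classic x :> R.
  rewrite indicE.
  have -> : (x \in `]a, b]%classic) = (a < x <= b) by apply/idP/idP; rewrite inE/= in_itv.
  case: (ltP b x) => bx; last by rewrite subr0 andbT; case: ifP.
  by rewrite (le_lt_trans ab bx) subrr.
by rewrite -E; apply: cvgB; exact: step_cvg.
Qed.

(** Test functions determine the values on half-open intervals, as limits along [bump]. Moving
    negative parts to the other side makes both sides positive measures, which agree once they agree
    on these intervals. *)
Lemma distr_charge_unique (f : R -> R)
    (nu : {charge set (measurableTypeR R) -> \bar R})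
    (m1 m2 : {finite_measure set (measurableTypeR R) -> \bar R}) :
  is_distr_derive f nu ->
  (forall psi, test_function setT psi ->
    \int[mu]_x (f x * derive1 psi x) = - (\int[m1]_x psi x - \int[m2]_x psi x)) ->
  forall A, measurable A -> nu A = (m1 A - m2 A)%E.
Proof.
move=> Hnu Hm.
pose p := jordan_pos (hahn_posnegP nu); pose n := jordan_neg (hahn_posnegP nu).
have Hd (psi : R -> R) : test_function setT psi ->
    \int[p]_x psi x - \int[n]_x psi x = \int[m1]_x psi x - \int[m2]_x psi x.
  by move=> tpsi; apply: oppr_inj; rewrite -Hm// Hnu.
have fn (m : {finite_measure set (measurableTypeR R) -> \bar R}) A :
  measurable A -> m A \is a fin_num by move=> mA; exact: fin_num_measure.
have arith (a b c d : R) : a - b = c - d -> a + d = b + c by lra.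
have earith (a b c d : \bar R) : a \is a fin_num -> b \is a fin_num ->
    c \is a fin_num -> d \is a fin_num -> fine a + fine d = fine b + fine c ->
    (a + d = b + c)%E.
  by case: a => //a; case: b => //b; case: c => //c; case: d => //d _ _ _ _ /= H;
    rewrite -!EFinD H.
have earith' (a b c d : \bar R) : a \is a fin_num -> b \is a fin_num ->
    c \is a fin_num -> d \is a fin_num -> (a + d = b + c -> a - b = c - d)%E.
  case: a => //a; case: b => //b; case: c => //c; case: d => //d _ _ _ _.
  by rewrite -!EFinD => -[H]; congr EFin; lra.
have E A : measurable A -> measure_add p m2 A = measure_add n m1 A.
  apply: (@measure_unique _ R (measurableTypeR R) (@ocitv R)
    (fun k : nat => `](- k%:R : R), k%:R]%classic)) => //.
  - exact: ocitvI.
  - by move=> k; exact: is_ocitv.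
  - apply/seteqP; split=> // x _; exists (Num.truncn `|x|).+1 => //=.
    rewrite in_itv/=; have := truncnS_gt `|x|; rewrite ltr_norml => /andP[-> h].
    exact: ltW.
  - move=> _ [[a b] _ <-] /=.
    have [ab|ba] := leP a b; last first.
      by rewrite set_itv_ge ?bnd_simp -?leNgt ?ltW// !measure0.
    have mI : measurable (`]a, b]%classic : set (measurableTypeR R)).
      exact: measurable_itv.
    have L (m : {finite_measure set (measurableTypeR R) -> \bar R}) :
        (\int[m]_x bump a b k x) @[k --> \oo] --> fine (m `]a, b]%classic).
      rewrite -int_ind//; apply: (@bounded_cvg _ _ _ _ _ _ 1).
      - by move=> k; apply: test_bm (bump_test k ab).
      - exact: bm_ind.
      - by move=> k x; exact: bump_le1.
      - by move=> x; exact: bump_cvg.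
    have L1 : (\int[m1]_x bump a b k x - \int[m2]_x bump a b k x) @[k --> \oo] -->
        fine (p `]a, b]%classic) - fine (n `]a, b]%classic).
      under eq_fun do rewrite -(Hd _ (bump_test _ ab)).
      by apply: cvgB; exact: L.
    have L2 : (\int[m1]_x bump a b k x - \int[m2]_x bump a b k x) @[k --> \oo] -->
        fine (m1 `]a, b]%classic) - fine (m2 `]a, b]%classic).
      by apply: cvgB; exact: L.
    have /arith H : fine (p `]a, b]%classic) - fine (n `]a, b]%classic) =
      fine (m1 `]a, b]%classic) - fine (m2 `]a, b]%classic).
      exact: (@cvg_unique _ (@Rhausdorff R) _ _ _ _ L1 L2).
    apply: (etrans (measure_addE p m2 _)); apply: (etrans _ (esym (measure_addE n m1 _))).
    change (p `]a, b]%classic + m2 `]a, b]%classic =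
      n `]a, b]%classic + m1 `]a, b]%classic)%E.
    exact: (earith _ _ _ _ (fn p _ mI) (fn n _ mI) (fn m1 _ mI) (fn m2 _ mI) H).
  - move=> k; pose I : set (measurableTypeR R) := `](- k%:R : R), k%:R]%classic.
    have mI : measurable I by exact: measurable_itv.
    apply: (@le_lt_trans _ _ (p I + m2 I)%E); first by rewrite -(measure_addE p m2).
    by apply: lte_add_pinfty; rewrite ltey_eq fn.
move=> A mA; have := E A mA; rewrite !measure_addE.
change ((p A + m2 A = n A + m1 A)%E -> nu A = (m1 A - m2 A)%E).
rewrite (jordan_fine nu mA) -/p -/n.
change ((p A + m2 A = n A + m1 A)%E -> (p A - n A = m1 A - m2 A)%E).
exact: (earith' _ _ _ _ (fn p _ mA) (fn n _ mA) (fn m1 _ mA) (fn m2 _ mA)).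
Qed.

(** [push_charge] supplies a charge that represents the derivative, so the default value in
    [distr_derive] is not taken; uniqueness then identifies the chosen charge with the image of w
    under Z. The integrand h may be irregular on a set N that Z avoids. *)
Lemma distr_derive_push d (Y : measurableType d)
    (la : {finite_measure set Y -> \bar R}) (w : Y -> R) (Z : Y -> measurableTypeR R)
    (f : R -> R) (N : set (measurableTypeR R)) (h g : R -> R) :
  bm w -> measurable_fun setT Z ->
  (forall psi, test_function setT psi ->
    \int[mu]_x (f x * derive1 psi x) = - \int[la]_y (w y * psi (Z y))) ->
  measurable N -> (forall y, ~ N (Z y)) ->
  measurable_fun setT (h : measurableTypeR R -> R) ->
  bm (g : measurableTypeR R -> R) -> (forall x, ~ N x -> h x = g x) ->
  charge_integral (distr_derive f) h = \int[la]_y (w y * g (Z y)).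
Proof.
move=> bw mZ Hf mN NZ mh bg hg.
have [nu0 [m1 [m2 [nuE mE m0]]]] := push_charge la bw mZ.
have Hf' psi : test_function setT psi ->
    \int[mu]_x (f x * derive1 psi x) = - (\int[m1]_x psi x - \int[m2]_x psi x).
  by move=> tpsi; rewrite mE ?Hf//; exact: test_bm tpsi.
have [z1 z2] := m0 _ mN NZ.
have H : is_distr_derive f (distr_derive f).
  rewrite /distr_derive; case: pselect => [e|ne]; first exact: (svalP (cid e)).
  case: ne; exists nu0 => psi tpsi; rewrite Hf' //.
  by rewrite (charge_integral_bm nuE)//; exact: test_bm tpsi.
by rewrite (charge_integral_sub (distr_charge_unique H Hf') mN z1 z2 mh bg hg) mE.
Qed.

End DistributionalDerivative.

Lemma int_ext d (Y : measurableType d) (R : realType)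
  (la : {measure set Y -> \bar R}) (f g : Y -> R) : f =1 g ->
  \int[la]_y f y = \int[la]_y g y.
Proof. by move=> /funext ->. Qed.

(** * Quantile functions *)

Section IndicatorIntegrals.
Context {R : realType}.

Lemma measurable_homo (f : R -> R) : {homo f : x y / x <= y} ->
  measurable_fun setT (f : measurableTypeR R -> measurableTypeR R).
Proof. by move=> hf; exact: nondecreasing_measurable. Qed.

Lemma bm_homo (f : R -> R) C : {homo f : x y / x <= y} -> (forall x, `|f x| <= C) ->
  bm (f : measurableTypeR R -> R).
Proof. by move=> hf hC; split; [exact: measurable_homo|exists C]. Qed.

Lemma bm_lt d (Y : measurableType d) (f g : Y -> R) :
  measurable_fun setT f -> measurable_fun setT g -> bm (fun y => (f y < g y)%R%:R : R).
Proof.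
move=> mf mg; have mS : measurable [set y | f y < g y].
  by rewrite -[X in measurable X]setTI; exact: measurable_fun_ltr.
by apply: (bm_eq _ (bm_ind mS)) => y; rewrite indicE mem_setE.
Qed.

Lemma bm_le d (Y : measurableType d) (f g : Y -> R) :
  measurable_fun setT f -> measurable_fun setT g -> bm (fun y => (f y <= g y)%R%:R : R).
Proof.
move=> mf mg; apply: (bm_eq _ (bmB (bm_cst 1) (bm_lt mg mf))) => y.
by rewrite ltNge; case: (f y <= g y); rewrite ?subrr ?subr0.
Qed.

Lemma bm_eqr d (Y : measurableType d) (f g : Y -> R) :
  measurable_fun setT f -> measurable_fun setT g -> bm (fun y => (f y == g y)%R%:R : R).
Proof.
move=> mf mg; apply: (bm_eq _ (bmM (bm_le mf mg) (bm_le mg mf))) => y.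
by rewrite eq_le; case: (f y <= g y); case: (g y <= f y); rewrite ?mulr1 ?mulr0.
Qed.

Lemma lam_pt (a b c : R) : \int[lam a b]_x (c == x)%R%:R = 0.
Proof.
rewrite (int_ext (lam a b) (g := \1_[set c])); last first.
  move=> x; rewrite indicE eq_sym; congr (nat_of_bool _)%:R.
  by apply/idP/idP; rewrite inE/=; move=> /eqP.
rewrite int_ind//; apply/eqP; rewrite fine_eq0 ?fin_num_measure//.
rewrite eq_le measure_ge0 andbT -(lebesgue_measure_set1 c).
by apply: le_measure; rewrite ?inE//; apply: measurableI => //; exact: measurable_itv.
Qed.

Lemma lam_empty (a b : R) (f : R -> R) : bm (f : measurableTypeR R -> R) -> b <= a ->
  \int[lam a b]_x f x = 0.
Proof.
move=> bf ba; apply/eqP; rewrite -normr_le0.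
have [C0 [C hC]] := bf; apply: le_trans (int_norm _ bf) _.
apply: le_trans (int_le _ (bm_norm bf) (bm_cst C) _) _; first exact: hC.
rewrite int_cst; have -> : fine (lam a b setT) = 0; last by rewrite mulr0.
rewrite /lam /= /mrestr setTI lebesgue_measure_itv/= lte_fin ltNge ba//.
Qed.

Lemma lam_below (a b c : R) (f : R -> R) : bm (f : measurableTypeR R -> R) ->
  a <= c -> c <= b -> \int[lam a b]_x (f x * (x < c)%R%:R) = \int[lam a c]_x f x.
Proof.
move=> bf ac cb.
have bl : bm (fun x : measurableTypeR R => (x < c)%R%:R : R) by exact: bm_lt.
have bfl := bmM bf bl.
have be : bm (fun x : measurableTypeR R => (c == x)%R%:R : R) by exact: bm_eqr.
rewrite (lam_split bfl ac cb) [X in _ + X](_ : _ = 0) ?addr0; last first.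
  rewrite (@eq_lam _ _ _ _ (fun _ => 0)) ?int_cst ?mul0r//; first exact: bm_cst.
  by move=> x /andP[cx _]; rewrite ltNge cx mulr0.
have bfe := bmM bf be.
rewrite (@eq_lam _ _ _ _ (fun x => f x - f x * (c == x)%R%:R))//; last 2 first.
  exact: bmB.
  move=> x /andP[ax xc]; rewrite lt_neqAle xc andbT eq_sym.
  by case: eqP => _; rewrite ?mulr1 ?mulr0 ?subrr ?subr0.
rewrite intB// [X in _ - X](_ : _ = 0) ?subr0//.
rewrite (int_ext (lam a c) (g := fun x => f c * (c == x)%R%:R)); last first.
  by move=> x; case: eqP => [->|]; rewrite ?mulr0.
by rewrite intZ// lam_pt mulr0.
Qed.

Lemma lam_above (a b c : R) (f : R -> R) : bm (f : measurableTypeR R -> R) ->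
  a <= c -> c <= b -> \int[lam a b]_x (f x * (c <= x)%R%:R) = \int[lam c b]_x f x.
Proof.
move=> bf ac cb.
have bl : bm (fun x : measurableTypeR R => (x < c)%R%:R : R) by exact: bm_lt.
have bfl := bmM bf bl.
rewrite (int_ext (lam a b) (g := fun x => f x - f x * (x < c)%R%:R)); last first.
  by move=> x; rewrite leNgt; case: (x < c); rewrite ?mulr1 ?mulr0 ?subrr ?subr0.
by rewrite intB// lam_below// (lam_split bf ac cb) addrC addKr.
Qed.

End IndicatorIntegrals.

Section Quantile.
Context {R : realType}.
Local Notation lI := (lam (- 2^-1 : R) 2^-1).

(* X is a quantile function (generalized inverse) of M. The relation is        *)
(* symmetric up to graphs, which are null sets.                                *)
Definition qrel (M X : R -> R) := forall x m, - 2^-1 <= m <= 2^-1 ->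
  (x < X m -> M x <= m) /\ (X m < x -> m <= M x).

(** The generalized inverse, truncated to [-B, B]. The added point -B keeps the set nonempty, so for
    B >= 0 the result is nondecreasing in v and bounded by B whatever f is. It serves to pass from M
    to X, from X to M, and to define rearrangements. *)
Definition ginv (B : R) (f : R -> R) (v : R) : R :=
  sup ([set y | (- B <= y <= B) /\ f y <= v] `|` [set - B]).

Lemma ginv_sup (B : R) (f : R -> R) (v : R) : 0 <= B ->
  has_sup ([set y | (- B <= y <= B) /\ f y <= v] `|` [set - B]).
Proof.
move=> B0; split; first by exists (- B); right.
exists B => y [[/andP[]]//|->]; lra.
Qed.

Lemma ginv_bound (B : R) (f : R -> R) (v : R) : 0 <= B -> - B <= ginv B f v <= B.
Proof.
move=> B0; apply/andP; split.
  by apply: sup_upper_bound; [exact: ginv_sup|right].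
apply: ge_sup; first by exists (- B); right.
by move=> y [[/andP[]]//|->]; lra.
Qed.

Lemma ginv_norm (B : R) (f : R -> R) (v : R) : 0 <= B -> `|ginv B f v| <= B.
Proof. by move=> B0; rewrite ler_norml ginv_bound. Qed.

Lemma ginv_homo (B : R) (f : R -> R) : 0 <= B -> {homo ginv B f : u v / u <= v}.
Proof.
move=> B0 u v uv; apply: ge_sup; first by exists (- B); right.
move=> y Hy; apply: sup_upper_bound; first exact: ginv_sup.
by case: Hy => [[yB fy]|->]; [left; split=> //; exact: le_trans uv|right].
Qed.

Lemma lt_ginv (B : R) (f : R -> R) (v y : R) : 0 <= B -> {homo f : x y / x <= y} -> - B <= y ->
  y < ginv B f v -> f y <= v.
Proof.
move=> B0 hf By yg.
have [|z Hz h] := @sup_adherent _ _ (ginv B f v - y) _ (ginv_sup f v B0).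
  by rewrite subr_gt0.
have yz : y < z by move: h; rewrite -/(ginv B f v); lra.
case: Hz => [[_ fz]|zB]; first by apply: le_trans fz; exact/hf/ltW.
by move: yz; rewrite zB ltNge By.
Qed.

Lemma ginv_lt (B : R) (f : R -> R) (v y : R) : 0 <= B -> y <= B -> ginv B f v < y -> v < f y.
Proof.
move=> B0 yB gy; rewrite ltNge; apply/negP => fy.
have : y <= ginv B f v; last by rewrite leNgt gy.
apply: sup_upper_bound; first exact: ginv_sup.
left; split=> //; rewrite yB andbT.
have /andP[h _] := ginv_bound f v B0; exact: ltW (le_lt_trans h gy).
Qed.

Lemma qrel_ginv M Q : 0 <= Q -> {homo M : x y / x <= y} -> (forall x, half_itv (M x)) ->
  (forall x, Q <= x -> M x = 2^-1 /\ M (- x) = - 2^-1) -> qrel M (ginv Q M).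
Proof.
move=> Q0 hM MI MQ x m mI; have /andP[m1 m2] := mI; split=> h.
  have [Qx|xQ] := leP (- Q) x; first exact: lt_ginv h.
  have [|_] := MQ (- x); first by rewrite lerNr ltW.
  by rewrite opprK => ->.
have [xQ|Qx] := leP x Q; first by apply: ltW; apply: ginv_lt h.
by have [|-> _] := MQ x; first exact: ltW.
Qed.

Lemma ginv_qrel X : {homo X : x y / x <= y} -> qrel (ginv 2^-1 X) X.
Proof.
have h0 : 0 <= 2^-1 :> R by rewrite invr_ge0.
move=> hX x m /andP[m1 m2]; split=> h; rewrite leNgt; apply/negP => hm.
  by have := lt_ginv h0 hX m1 hm; rewrite leNgt h.
by have := ginv_lt h0 m2 hm; rewrite ltNge (ltW h).
Qed.

(** * The layer-cake formula and the L1 distance of quantiles *)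

Section LayerCake.
Variables (Q : R).
Hypothesis (Q0 : 0 <= Q).
Local Notation lQ := (lam (- Q) Q).

Let bV M : {homo M : x y / x <= y} ->
  bm (fun p : measurableTypeR R * measurableTypeR R => (M p.2 <= p.1)%R%:R : R).
Proof.
move=> hM; apply: bm_le => //.
by apply: (measurableT_comp (measurable_homo hM)); exact: measurable_snd.
Qed.

Let bU X : {homo X : x y / x <= y} ->
  bm (fun p : measurableTypeR R * measurableTypeR R => (p.2 < X p.1)%R%:R : R).
Proof.
move=> hX; apply: bm_lt => //.
by apply: (measurableT_comp (measurable_homo hX)); exact: measurable_fst.
Qed.

Let D M X (p : R * R) : R := (M p.2 <= p.1)%R%:R - (p.2 < X p.1)%R%:R.

(** The indicators of M x <= m and of x < X m can differ only on the graphs X m = x and M x = m.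
    Each of these has one point on every line parallel to one of the axes, hence is null by
    Fubini. *)
Let null M X : {homo M : x y / x <= y} -> {homo X : x y / x <= y} -> qrel M X ->
  \int[lI]_m (\int[lQ]_x `|D M X (m, x)|) <= 0.
Proof.
move=> hM hX MX.
have mM := measurable_homo hM; have mX := measurable_homo hX.
have b1 : bm (fun p : measurableTypeR R * measurableTypeR R => (X p.1 == p.2)%R%:R : R).
  by apply: bm_eqr => //; apply: (measurableT_comp mX); exact: measurable_fst.
have b2 : bm (fun p : measurableTypeR R * measurableTypeR R => (M p.2 == p.1)%R%:R : R).
  by apply: bm_eqr => //; apply: (measurableT_comp mM); exact: measurable_snd.
have bD : bm (fun p : measurableTypeR R * measurableTypeR R => `|D M X p|).
  by apply: bm_norm; apply: bmB; [exact: bV|exact: bU].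
have bs := bmD b1 b2.
have h : \int[lI]_m (\int[lQ]_x `|D M X (m, x)|) <=
    \int[lI]_m (\int[lQ]_x ((X m == x)%R%:R + (M x == m)%R%:R)).
  apply: lam_le.
  - exact: (bm_int1 lI lQ bD).
  - exact: (bm_int1 lI lQ bs).
  move=> m mI; apply: int_le.
  - exact: (bm_sec1 m bD).
  - exact: (bm_sec1 m bs).
  move=> x; rewrite /D /=; have [r1 r2] := MX x m mI.
  have [xX|Xx|_] := ltgtP x (X m).
  - by rewrite (r1 xX) subrr normr0 addr_ge0.
  - by rewrite subr0 ger0_norm// add0r eq_le (r2 Xx) andbT.
  - by rewrite subr0 ger0_norm// ler_wpDr//; case: (M x <= m).
apply: le_trans h _.
rewrite (int_ext lI (g := fun m => \int[lQ]_x (X m == x)%R%:R + \int[lQ]_x (M x == m)%R%:R)); last first.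
  by move=> m; rewrite intD//; [exact: (bm_sec1 m b1)|exact: (bm_sec1 m b2)].
rewrite intD; [|exact: (bm_int1 lI lQ b1)|exact: (bm_int1 lI lQ b2)].
rewrite (int_ext lI (g := fun=> 0)); last by move=> m; rewrite lam_pt.
rewrite int_cst mul0r add0r (int_swap lI lQ b2).
rewrite (int_ext lQ (g := fun=> 0)); last by move=> x; exact: (lam_pt (- 2^-1) 2^-1 (M x)).
by rewrite int_cst mul0r.
Qed.

(** Both sides integrate g m * psi x over the region below the graph of X, described by x < X m in
    one order of integration and by M x <= m in the other. *)
Lemma layer_cake M X psi g : {homo M : x y / x <= y} -> {homo X : x y / x <= y} ->
  qrel M X -> (forall m, `|X m| <= Q) -> (forall x, half_itv (M x)) ->
  bm (psi : measurableTypeR R -> R) -> bm (g : measurableTypeR R -> R) ->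
  \int[lI]_m (g m * \int[lam (- Q) (X m)]_x psi x) =
  \int[lQ]_x (psi x * \int[lam (M x) 2^-1]_m g m).
Proof.
move=> hM hX MX XQ MI bpsi bg.
have bF : bm (fun p : measurableTypeR R * measurableTypeR R => g p.1 * psi p.2).
  by apply: bmM; [exact: bm_comp bg measurable_fst|exact: bm_comp bpsi measurable_snd].
have bFU := bmM bF (bU hX); have bFV := bmM bF (bV hM).
have EL : \int[lI]_m (g m * \int[lam (- Q) (X m)]_x psi x) =
    \int[lI]_m (\int[lQ]_x (g m * psi x * (x < X m)%R%:R)).
  apply: eq_Rintegral => m _.
  have /andP[X1 X2] : - Q <= X m <= Q by rewrite -ler_norml.
  rewrite -(lam_below bpsi X1 X2) -intZ; last first.
    by apply: bmM => //; exact: bm_lt.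
  by apply: eq_Rintegral => x _; rewrite mulrA.
have ER : \int[lQ]_x (psi x * \int[lam (M x) 2^-1]_m g m) =
    \int[lI]_m (\int[lQ]_x (g m * psi x * (M x <= m)%R%:R)).
  rewrite (int_swap lI lQ bFV); apply: eq_Rintegral => x _ /=.
  have : half_itv (M x) by [].
  rewrite /half_itv /= in_itv/= => /andP[M1 M2].
  rewrite -(lam_above bg M1 M2) -intZ; last first.
    by apply: bmM => //; exact: bm_le.
  by apply: eq_Rintegral => m _; rewrite mulrCA mulrA.
rewrite EL ER; apply/eqP; rewrite eq_sym -subr_eq0 -normr_le0.
have bD : bm (fun p : measurableTypeR R * measurableTypeR R => `|D M X p|).
  by apply: bm_norm; apply: bmB; [exact: bV|exact: bU].
rewrite -intB; [|exact: (bm_int1 lI lQ bFV)|exact: (bm_int1 lI lQ bFU)].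
have [_ [C hC]] := bF.
have C0 : 0 <= C by exact: le_trans (hC (0, 0)).
have bI : bm (fun m : measurableTypeR R => \int[lQ]_x (g m * psi x * (M x <= m)%R%:R) -
    \int[lQ]_x (g m * psi x * (x < X m)%R%:R)).
  by apply: bmB; [exact: (bm_int1 lI lQ bFV)|exact: (bm_int1 lI lQ bFU)].
apply: le_trans (int_norm _ bI) _.
apply: (@le_trans _ _ (\int[lI]_m (C * \int[lQ]_x `|D M X (m, x)|))).
  apply: int_le; first exact: bm_norm.
    by apply: bmM; [exact: bm_cst|exact: (bm_int1 lI lQ bD)].
  move=> m; rewrite -intB; [|exact: (bm_sec1 m bFV)|exact: (bm_sec1 m bFU)].
  have bi : bm (fun x : measurableTypeR R => g m * psi x * (M x <= m)%R%:R -
      g m * psi x * (x < X m)%R%:R).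
    by apply: bmB; [exact: (bm_sec1 m bFV)|exact: (bm_sec1 m bFU)].
  apply: le_trans (int_norm _ bi) _.
  rewrite -intZ; last exact: (bm_sec1 m bD).
  apply: int_le; first exact: bm_norm.
    by apply: bmM; [exact: bm_cst|exact: (bm_sec1 m bD)].
  by move=> x; rewrite -mulrBr normrM ler_wpM2r// (hC (m, x)).
rewrite intZ; last exact: (bm_int1 lI lQ bD).
by rewrite mulr_ge0_le0// null.
Qed.

Let abs_int (a b c d : R) : c <= a -> c <= b -> a <= d -> b <= d ->
  `|a - b| = \int[lam c d]_x `|(x < a)%R%:R - (x < b)%R%:R : R|.
Proof.
move=> ca cb ad bd; wlog ab : a b ca cb ad bd / a <= b => [H|].
  have [ab|/ltW ba] := leP a b; first exact: H.
  rewrite distrC H//; apply: eq_Rintegral => x _; exact: distrC.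
have bl (e : R) : bm (fun x : measurableTypeR R => 1 * (x < e)%R%:R : R).
  by apply: bmM; [exact: bm_cst|exact: bm_lt].
rewrite (int_ext (lam c d) (g := fun x => 1 * (x < b)%R%:R - 1 * (x < a)%R%:R)); last first.
  move=> x; rewrite !mul1r; case: (ltP x a) => xa; last first.
    by rewrite sub0r normrN subr0 normr_nat.
  by rewrite (lt_le_trans xa ab) subrr normr0.
rewrite intB// !lam_below//; try exact: bm_cst.
by rewrite !lam_cst// !mul1r ler0_norm; lra.
Qed.

(** Both sides are the area between the two graphs, sliced along one axis or the other. *)
Lemma quantile_L1 M X N Y : {homo M : x y / x <= y} -> {homo X : x y / x <= y} ->
  qrel M X -> {homo N : x y / x <= y} -> {homo Y : x y / x <= y} -> qrel N Y ->
  (forall m, `|X m| <= Q) -> (forall m, `|Y m| <= Q) ->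
  (forall x, half_itv (M x)) -> (forall x, half_itv (N x)) ->
  \int[lI]_m `|X m - Y m| = \int[lQ]_x `|M x - N x|.
Proof.
move=> hM hX MX hN hY NY XQ YQ MI NI.
have bF := bm_norm (bmB (bU hX) (bU hY)); have bG := bm_norm (bmB (bV hM) (bV hN)).
have EL : \int[lI]_m `|X m - Y m| =
    \int[lI]_m (\int[lQ]_x `|(x < X m)%R%:R - (x < Y m)%R%:R : R|).
  apply: eq_Rintegral => m _.
  have /andP[X1 X2] : - Q <= X m <= Q by rewrite -ler_norml.
  have /andP[Y1 Y2] : - Q <= Y m <= Q by rewrite -ler_norml.
  exact: abs_int.
have ER : \int[lQ]_x `|M x - N x| =
    \int[lI]_m (\int[lQ]_x `|(M x <= m)%R%:R - (N x <= m)%R%:R : R|).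
  rewrite (int_swap lI lQ bG); apply: eq_Rintegral => x _ /=.
  have : half_itv (M x) by []. have : half_itv (N x) by [].
  rewrite /half_itv /= !in_itv/= => /andP[N1 N2] /andP[M1 M2].
  rewrite (abs_int M1 N1 M2 N2); apply: eq_Rintegral => m _.
  rewrite !leNgt; case: (m < M x); case: (m < N x) => /=;
    by rewrite ?subrr ?subr0 ?sub0r ?normrN.
rewrite EL ER; apply/eqP; rewrite -subr_eq0 -normr_le0.
have bD M' X' : {homo M' : x y / x <= y} -> {homo X' : x y / x <= y} ->
    bm (fun p : measurableTypeR R * measurableTypeR R => `|D M' X' p|).
  by move=> hM' hX'; apply: bm_norm; apply: bmB; [exact: bV|exact: bU].
have bD1 := bD _ _ hM hX; have bD2 := bD _ _ hN hY.
rewrite -intB; [|exact: (bm_int1 lI lQ bF)|exact: (bm_int1 lI lQ bG)].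
have bI := bmB (bm_int1 lI lQ bF) (bm_int1 lI lQ bG).
apply: le_trans (int_norm lI bI) _.
have bS := bmD bD1 bD2.
apply: (@le_trans _ _ (\int[lI]_m (\int[lQ]_x (`|D M X (m, x)| + `|D N Y (m, x)|)))).
  apply: int_le; [exact: bm_norm|exact: (bm_int1 lI lQ bS)|].
  move=> m; rewrite -intB; [|exact: (bm_sec1 m bF)|exact: (bm_sec1 m bG)].
  have bi := bmB (bm_sec1 m bF) (bm_sec1 m bG).
  apply: le_trans (int_norm _ bi) _.
  apply: int_le; [exact: bm_norm|exact: (bm_sec1 m bS)|].
  move=> x; rewrite /D /=.
  move: (x < X m)%R%:R (x < Y m)%R%:R (M x <= m)%R%:R (N x <= m)%R%:R => a b c d.
  apply: le_trans (ler_dist_dist _ _) _.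
  rewrite (_ : a - b - (c - d) = (d - b) - (c - a)); last by ring.
  by rewrite [leRHS]addrC ler_normB.
rewrite (int_ext lI (g := fun m => \int[lQ]_x `|D M X (m, x)| + \int[lQ]_x `|D N Y (m, x)|)); last first.
  by move=> m; rewrite intD//; [exact: (bm_sec1 m bD1)|exact: (bm_sec1 m bD2)].
rewrite intD; [|exact: (bm_int1 lI lQ bD1)|exact: (bm_int1 lI lQ bD2)].
by rewrite -[leRHS]addr0 lerD// null.
Qed.

End LayerCake.
End Quantile.

(** * The kernel and the flux *)

Section Reflection.
Context {R : realType}.
Local Notation mu := (@lebesgue_measure R).

Lemma lebesgue_measure_opp (A : set (measurableTypeR R)) : measurable A ->
  mu (-%R @^-1` A) = mu A.
Proof.
move=> mA; have mo : measurable_fun setT (-%R : measurableTypeR R -> measurableTypeR R).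
  exact: (@oppr_measurable R).
pose m1 : {measure set (measurableTypeR R) -> \bar R} :=
  measure_function_pushforward__canonical__measure_function_Measure mu mo.
apply/esym; apply: (@lebesgue_measure_unique R m1) => // X [[a b] _ <-] /=.
rewrite -[RHS]/(mu (-%R @^-1` `]a, b]%classic)).
rewrite (_ : -%R @^-1` `]a, b]%classic = `[(- b), (- a)[%classic); last first.
  by apply/seteqP; split=> x /=; rewrite !in_itv/= => /andP[h1 h2];
    apply/andP; split; lra.
rewrite !lebesgue_measure_itv/= !lte_fin ltrN2; case: ifP => // _.
by rewrite -!EFinB; congr EFin; lra.
Qed.

Lemma integral_opp (D : set (measurableTypeR R)) (f : R -> \bar R) : measurable D ->
  measurable_fun D (f : measurableTypeR R -> \bar R) -> (forall x, 0 <= f x)%E ->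
  (\int[mu]_(x in D) f x = \int[mu]_(x in -%R @^-1` D) f (- x)%R)%E.
Proof.
move=> mD mf f0; have mo : measurable_fun setT (-%R : measurableTypeR R -> measurableTypeR R).
  exact: (@oppr_measurable R).
pose m1 : {measure set (measurableTypeR R) -> \bar R} :=
  measure_function_pushforward__canonical__measure_function_Measure mu mo.
rewrite (@eq_measure_integral _ _ _ _ m1).
  exact: (@ge0_integral_pushforward _ _ _ _ R _ mo mu).
by move=> A mA _; exact: (esym (lebesgue_measure_opp mA)).
Qed.

End Reflection.

(* The only properties of Phi that the theory uses; the last one is the        *)
(* uniform continuity of Phi in a linear form.                                 *)
Definition good_kernel (R : realType) (W : R -> R) :=
  [/\ forall x, W (- x) = - W x, {homo W : x y / x <= y} &
      forall e, 0 < e -> exists2 C, 0 <= C & forall u v, `|W u - W v| <= e + C * `|u - v|].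

(** * Monotonicity and uniform continuity of the interaction kernel *)

Section Kernel.
Context {R : realType}.
Local Notation mu := (@lebesgue_measure R).
Variable phi : R -> \bar R.
Hypothesis hphi : communication_protocol phi.

Let itv_lty (a b : R) : (mu `[a, b] < +oo)%E.
Proof. by rewrite lebesgue_measure_itv/=; case: ifP => _; rewrite ?ltry. Qed.

Let phi_ge0 x : (0 <= phi x)%E. Proof. by have [] := hphi. Qed.

Let iphi a b : mu.-integrable `[a, b] phi.
Proof. by have [_ _ _ h] := hphi; apply: h; exact: segment_compact. Qed.

(** An infinite value at x would, by monotonicity in |x|, be taken on all of [-|x|, |x|], against
    local integrability. *)
Let phi_fin x : x != 0 -> phi x \is a fin_num.
Proof.
move=> x0; rewrite ge0_fin_numE// ltey; apply/eqP => xoo.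
have [_ _ mono _] := hphi.
have n0 : 0 < `|x| by rewrite normr_gt0.
have mI : measurable (`[- `|x|, `|x|]%classic : set (measurableTypeR R)).
  exact: measurable_itv.
have [N [mN N0 sN]] := integrable_ae mI (iphi (- `|x|) `|x|).
pose J : set (measurableTypeR R) := `[- `|x|, `|x|]%classic.
have : (mu J <= mu N)%E.
  apply: le_measure; rewrite ?inE//.
  move=> y /= yx; apply: sN => /= /(_ yx).
  have : (phi x <= phi y)%E by apply: mono; rewrite ler_norml; move: yx; rewrite /J /= in_itv.
  by rewrite xoo leye_eq => /eqP ->.
rewrite N0 /J lebesgue_measure_itv/= lte_fin ifT; last lra.
by rewrite -EFinB lee_fin; lra.
Qed.

Let f x := fine (phi x).

Let f_ge0 x : 0 <= f x. Proof. exact: fine_ge0. Qed.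

Let intE a b : (\int[mu]_(x in `[a, b]) phi x = \int[mu]_(x in `[a, b]) (f x)%:E)%E.
Proof.
apply: ae_eq_integral.
- exact: measurable_itv.
- exact: measurable_int (iphi a b).
- apply/measurable_EFinP; apply: measurableT_comp => //.
  exact: measurable_int (iphi a b).
exists [set 0]; split; [exact: measurable_set1|exact: lebesgue_measure_set1|].
move=> x /=; apply: contra_notP => /eqP x0 _.
by rewrite /f fineK// phi_fin.
Qed.

Let itf a b : mu.-integrable `[a, b] (EFin \o f).
Proof.
apply/integrableP; split.
  apply/measurable_EFinP; apply: measurableT_comp => //.
  exact: measurable_int (iphi a b).
have /integrableP[_] := iphi a b; apply: le_lt_trans.
have -> : (\int[mu]_(x in `[a, b]) `|(EFin \o f) x| = \int[mu]_(x in `[a, b]) (f x)%:E)%E.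
  by apply: eq_integral => x _; rewrite /= ger0_norm.
rewrite -intE; have mp := measurable_int _ (iphi a b).
apply: ge0_le_integral => //.
- by apply: measurableT_comp.
- by move=> x _; exact: lee_abs.
Qed.

Let I a b := \int[mu]_(x in `[a, b]) f x.

Let I_ge0 a b : 0 <= I a b. Proof. by apply: Rintegral_ge0 => x _; exact: f_ge0. Qed.

Let Isplit a b c : a <= b -> b <= c -> I a c = I a b + I b c.
Proof.
move=> ab bc; have := @Rintegral_itvB R f (BLeft a) (BRight c) b (itf _ _).
rewrite !bnd_simp => /(_ ab bc) H.
apply/eqP; rewrite addrC -subr_eq /I H Rintegral_itv_obnd_cbnd//.
by apply: integrableS (itf b c) => //; apply: subset_itvr; rewrite bnd_simp.
Qed.

Let PhiE x : Phi phi x = if 0 <= x then I 0 x else - I x 0.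
Proof. by rewrite /Phi /I /Rintegral !intE. Qed.

Let PhiB x y : x <= y -> Phi phi y - Phi phi x = I x y.
Proof.
move=> xy; rewrite !PhiE; have [x0|x0] := leP 0 x.
  by rewrite (le_trans x0 xy) (Isplit x0 xy) addrC addKr.
have [y0|y0] := leP 0 y; first by rewrite (Isplit (ltW x0) y0); lra.
by rewrite (Isplit xy (ltW y0)); lra.
Qed.

Let Phi_odd x : Phi phi (- x) = - Phi phi x.
Proof.
have sym b : I (- b) 0 = I 0 b.
  rewrite /I /Rintegral -!intE; congr fine.
  rewrite [RHS]integral_opp//; last exact: measurable_int (iphi 0 b).
  rewrite (_ : -%R @^-1` `[0, b]%classic = `[- b, 0]%classic); last first.
    by apply/seteqP; split=> x' /=; rewrite !in_itv/= => /andP[h1 h2];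
      apply/andP; split; lra.
  by apply: eq_integral => y _; have [_ -> _ _] := hphi.
rewrite !PhiE; have [x0|x0|x0] := ltrgtP 0 x.
- by rewrite oppr_ge0 leNgt x0/= sym.
- by rewrite oppr_ge0 (ltW x0) opprK -sym opprK.
by rewrite -x0 oppr0 lexx /I set_itv1 Rintegral_set1 oppr0.
Qed.

Let Phi_small e : 0 < e -> exists2 r, 0 < r & I 0 r <= e.
Proof.
move=> e0; have := @parameterized_integral_continuous R 0 1 f ler01 (itf 0 1).
move=> /continuous_within_itvP => /(_ ltr01)[_ + _].
rewrite /parameterized_integral set_itv1 Rintegral_set1 => /cvgrPdist_le /(_ _ e0) H.
have : \forall x \near (0 : R)^'+, 0 < x /\ I 0 x <= e.
  near=> x; split; first by near: x; exact: nbhs_right_gt.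
  have : `|0 - \int[mu]_(t in `[0, x]) f t| <= e by near: x; exact: H.
  by rewrite sub0r normrN ger0_norm// Rintegral_ge0.
by move=> /filter_ex[r []]; exists r.
Unshelve. all: by end_near.
Qed.

(** The singularity of phi at 0 contributes at most e over a small interval [-r, r], and outside it
    phi is bounded by phi(r), which becomes the constant C. *)
Lemma Phi_good : good_kernel (Phi phi).
Proof.
split; first exact: Phi_odd.
  by move=> x y xy; rewrite -subr_ge0 PhiB.
move=> e e0.
(* Half of e, since the integral over [-r, r] is twice that over [0, r]. *)
have [r r0 Ir] := Phi_small (divr_gt0 e0 (ltr0Sn R 1)).
exists (f r); first exact: f_ge0.
move=> u v; wlog uv : u v / u <= v => [H|].
  have [|/ltW] := leP u v; first exact: H.
  by move=> /H; rewrite distrC [`|v - u|]distrC.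
rewrite distrC PhiB// ger0_norm// distrC ger0_norm ?subr_ge0//.
have far a b : a <= b -> b <= - r \/ r <= a -> I a b <= f r * (b - a).
  move=> ab H; have c0 : mu.-integrable `[a, b] (EFin \o cst (f r)).
    apply: (@measurable_bounded_integrable _ _ _ mu (cst (f r))) => //.
      exact: itv_lty.
    by exists (f r); split; rewrite ?num_real// => y fy z _ /=; rewrite ger0_norm// ltW.
  apply: (@le_trans _ _ (\int[mu]_(x in `[a, b]) cst (f r) x)).
    apply: le_Rintegral; [exact: measurable_itv|exact: itf|exact: c0|].
    move=> y; rewrite /= in_itv/= => /andP[ay yb].
    have ry : `|r| <= `|y|.
      rewrite ger0_norm ?(ltW r0)//; case: H => H.
        by rewrite ler0_norm; lra.
      by rewrite ger0_norm; lra.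
    have [_ _ mono _] := hphi.
    have rn : r != 0 by rewrite gt_eqF.
    have yn : y != 0 by rewrite -normr_gt0 (lt_le_trans _ ry)// normr_gt0.
    by apply: fine_le; rewrite ?phi_fin ?mono.
  rewrite Rintegral_cst// -(lam_mass ab); apply: ler_wpM2l; first exact: f_ge0.
  by rewrite /lam /= /mrestr setTI.
have sym : I (- r) r = I 0 r + I 0 r.
  have := PhiB (_ : - r <= r); rewrite Phi_odd opprK.
  rewrite {1 2}PhiE (ltW r0) => -> //; lra.
have near a b : - r <= a -> a <= b -> b <= r -> I a b <= e.
  move=> ra ab br; have ar := le_trans ab br.
  have := Isplit ra ar; rewrite (Isplit ab br) sym.
  by have := I_ge0 (- r) a; have := I_ge0 b r; lra.
have [vr|rv] := leP v (- r).
  by apply: le_trans (far _ _ uv (or_introl vr)) _; rewrite lerDr ltW.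
have [ru|ur] := leP r u.
  by apply: le_trans (far _ _ uv (or_intror ru)) _; rewrite lerDr ltW.
have fr := f_ge0 r.
have I0 a : I a a = 0 by rewrite /I set_itv1 Rintegral_set1.
(* [u, v] is cut into its parts to the left of -r, within [-r, r], and to the right of r. *)
pose p := Num.max u (- r); pose q := Num.min v r.
have [up pr pm] : [/\ u <= p, - r <= p & I u p <= f r * (p - u)].
  rewrite /p; case: (leP u (- r)) => h; split=> //; try exact: ltW.
    by apply: far => //; left.
  by rewrite I0 subrr mulr0.
have [qv qr qm] : [/\ q <= v, q <= r & I q v <= f r * (v - q)].
  rewrite /q; case: (leP v r) => h; split=> //; try exact: ltW.
    by rewrite I0 subrr mulr0.
  by apply: far => //; [exact: ltW|right].
have pq : p <= q.
  rewrite /p /q; case: (leP u (- r)) => h; case: (leP v r) => h' //; try exact: ltW; lra.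
rewrite (Isplit (le_trans up pq) qv) (Isplit up pq).
have npq := near p q pr pq qr.
have := mulr_ge0 fr (_ : 0 <= q - p); rewrite subr_ge0 => /(_ pq); nra.
Qed.

End Kernel.

(** * Integrals of functions that agree off a null set *)

Section NullSets.
Context {R : realType}.
Local Notation mu := (@lebesgue_measure R).

Definition null_set (N : set (measurableTypeR R)) := measurable N /\ mu N = 0%E.

Lemma null_setU N1 N2 : null_set N1 -> null_set N2 -> null_set (N1 `|` N2).
Proof.
move=> [m1 z1] [m2 z2]; split; first exact: measurableU.
apply/eqP; rewrite eq_le measure_ge0 andbT.
apply: le_trans (measureU2 _ m1 m2) _; rewrite [leLHS](_ : _ = 0%E)//.
by rewrite -[RHS]adde0; congr (_ + _)%E.
Qed.

Lemma null_set1 (x : R) : null_set [set x].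
Proof. by split; [exact: measurable_set1|exact: lebesgue_measure_set1]. Qed.

Lemma null_set0 : null_set set0.
Proof. by split; [exact: measurable0|exact: measure0]. Qed.

Import HBNNSimple.

(** No measurability of f and g is assumed, since derivatives such as that of an entropy enter
    without it. The integral is a supremum over simple functions, and a simple function may be set
    to zero on N without changing its integral. *)
Lemma ge0_le_integral_null (f g : measurableTypeR R -> \bar R) N : null_set N ->
  (forall x, ~ N x -> (f x <= g x)%E) -> (forall x, (0 <= f x)%E) ->
  (forall x, (0 <= g x)%E) -> (\int[mu]_x f x <= \int[mu]_x g x)%E.
Proof.
move=> [mN N0] fg f0 g0; rewrite !ge0_integralTE//.
apply: ge_ereal_sup => _ [h hf <-].
pose h' := proj_nnsfun h (measurableC mN).
have -> : sintegral mu h = sintegral mu h'.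
  rewrite -!integralT_nnsfun; apply: ae_eq_integral => //.
  - exact/measurable_EFinP.
  - exact/measurable_EFinP.
  exists N; split=> // x /=; apply: contra_notP => Nx _.
  by rewrite /proj_nnsfun/= /mindic indicE mem_set// mulr1.
apply: ereal_sup_ubound; exists h' => //= x.
rewrite /h' /proj_nnsfun/= /mindic indicE.
have [Nx|Nx] := pselect (N x); first by rewrite memNset ?mulr0.
by rewrite mem_set// mulr1; apply: le_trans (hf x) (fg _ Nx).
Qed.

Lemma integral_eq_null (f g : measurableTypeR R -> \bar R) (D N : set (measurableTypeR R)) :
  null_set N -> (forall x, D x -> ~ N x -> f x = g x) ->
  (\int[mu]_(x in D) f x = \int[mu]_(x in D) g x)%E.
Proof.
move=> nN fg; have E x : ~ N x -> (f \_ D) x = (g \_ D) x.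
  by move=> Nx; rewrite !patchE; case: ifP => // /set_mem /fg ->.
rewrite integral_mkcond [RHS]integral_mkcond integralE [RHS]integralE.
congr (_ - _)%E; apply/eqP; rewrite eq_le; apply/andP; split;
  apply: (ge0_le_integral_null nN) => // x Nx; by rewrite ?funeposE ?funenegE E.
Qed.

Lemma Rint_lam_null (a b : R) (f g : R -> R) N : null_set N ->
  bm (g : measurableTypeR R -> R) -> (forall x, a <= x <= b -> ~ N x -> f x = g x) ->
  \int[mu]_(x in `[a, b]) f x = \int[lam a b]_x g x.
Proof.
move=> nN bg fg; rewrite -Rint_lam// /Rintegral; congr fine.
apply: (integral_eq_null nN) => x /=; rewrite in_itv/= => ab Nx.
by rewrite fg.
Qed.

Lemma lam_eq_null (a b : R) (f g : R -> R) N : null_set N ->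
  bm (f : measurableTypeR R -> R) -> bm (g : measurableTypeR R -> R) ->
  (forall x, a <= x <= b -> ~ N x -> f x = g x) ->
  \int[lam a b]_x f x = \int[lam a b]_x g x.
Proof. by move=> nN bf bg fg; rewrite -[LHS]Rint_lam//; exact: Rint_lam_null fg. Qed.

Lemma lam_le_null (a b : R) (f g : R -> R) N : null_set N ->
  bm (f : measurableTypeR R -> R) -> bm (g : measurableTypeR R -> R) ->
  (forall x, a <= x <= b -> ~ N x -> f x <= g x) ->
  \int[lam a b]_x f x <= \int[lam a b]_x g x.
Proof.
move=> nN bf bg fg; have [mN _] := nN; have bN := bm_ind (R := R) (measurableC mN).
rewrite (lam_eq_null nN bf (g := fun x => f x * \1_(~` N) x)); last 2 first.
  exact: bmM.
  by move=> x _ Nx; rewrite indicE mem_set// mulr1.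
rewrite [leRHS](lam_eq_null nN bg (g := fun x => g x * \1_(~` N) x)); last 2 first.
  exact: bmM.
  by move=> x _ Nx; rewrite indicE mem_set// mulr1.
apply: lam_le; [exact: bmM|exact: bmM|] => x ab.
have [Nx|Nx] := pselect (N x); first by rewrite indicE memNset ?mulr0.
by rewrite ler_wpM2r ?fg// indicE ler0n.
Qed.

End NullSets.

(** * Lebesgue differentiation of primitives *)

Section Differentiation.
Context {R : realType}.
Local Notation mu := (@lebesgue_measure R).
Local Notation h2 := (2^-1 : R).
Implicit Types f h : R -> R.

Definition prim f (x : R) := \int[mu]_(t in `[- h2, x]) f t.

Lemma ftc_null f : mu.-integrable `[- h2, h2] (EFin \o f) ->
  exists2 N, null_set N & forall x, - h2 < x < h2 -> ~ N x ->
    derivable (prim f) x 1 /\ derive1 (prim f) x = f x.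
Proof.
move=> intf; pose f1 := f \_ `[- h2, h2].
have mI := measurable_itv `[- h2, h2].
have locf : locally_integrable [set: R] f1 by exact: integrable_locally.
have int1 y : mu.-integrable [set` Interval (BLeft (- h2)) (BRight y)] (EFin \o f1).
  have : mu.-integrable setT (EFin \o f1).
    by rewrite /f1 -restrict_EFin; apply/integrable_restrict; rewrite ?setTI.
  by apply: integrableS => //; exact: measurable_itv.
have [N [mN N0 sN]] := FTC1 int1 locf.
exists N => // x /andP[x1 x2] Nx.
have Hx : derivable (fun y => \int[mu]_(t in [set` Interval (BLeft (- h2)) (BRight y)]) f1 t) x 1
   /\ derive1 (fun y => \int[mu]_(t in [set` Interval (BLeft (- h2)) (BRight y)]) f1 t) x = f1 x.
  apply: contrapT => H; apply: Nx; apply: sN => /= H'; apply: H; apply: H'.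
  by rewrite lte_fin.
have E : \forall y \near x, \int[mu]_(t in [set` Interval (BLeft (- h2)) (BRight y)]) f1 t = prim f y.
  near=> y; apply: eq_Rintegral => t; rewrite inE/= in_itv/= => /andP[t1 t2].
  rewrite /f1 patchE mem_set//= in_itv/= t1/= (le_trans t2)//.
  by near: y; exact: lt_le_nbhsl.
have [d1 d2] := Hx; split; first exact: near_eq_derivable d1.
rewrite derive1E -(near_eq_derive _ E) -derive1E d2 /f1 patchE mem_set//=.
by rewrite in_itv/= !ltW.
Unshelve. all: by end_near.
Qed.

(** Almost everywhere the density is the limit of the difference quotients of its primitive, which
    are at most c. *)
Lemma density_le f c : mu.-integrable `[- h2, h2] (EFin \o f) ->
  (forall a b, - h2 <= a -> a <= b -> b <= h2 -> prim f b - prim f a <= c * (b - a)) ->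
  exists2 N, null_set N & forall x, - h2 <= x <= h2 -> ~ N x -> f x <= c.
Proof.
move=> /ftc_null[N nN HN] fc; exists (N `|` ([set - h2] `|` [set h2])).
  by apply: null_setU => //; apply: null_setU; exact: null_set1.
move=> x /andP[x1 x2] /not_orP[Nx /not_orP[xn1 xn2]].
have x3 : - h2 < x < h2.
  by rewrite !lt_neqAle x1 x2 !andbT; apply/andP; split; apply/eqP; [move/esym|].
have [d1 <-] := HN x x3 Nx; have /andP[x4 x5] := x3.
rewrite derive1E; apply: limr_le; first exact: d1.
near=> k; rewrite /GRing.scale/= mulr1.
have k1 : `|k| < x - - h2 by near: k; apply: dnbhs0_lt; rewrite subr_gt0.
have k2 : `|k| < h2 - x by near: k; apply: dnbhs0_lt; rewrite subr_gt0.
have kn : k != 0 by near: k; exact: nbhs_dnbhs_neq.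
move: k1 k2; rewrite !ltr_norml => /andP[k1 k1'] /andP[k2 k2'].
have [k0|k0] := ltP 0 k.
  rewrite mulrC ler_pdivrMr//; have := fc x (k + x) x1.
  by rewrite addrK; apply; lra.
have {}k0 : k < 0 by rewrite lt_neqAle kn k0.
rewrite mulrC ler_ndivrMr//; have := fc (k + x) x.
rewrite (_ : x - (k + x) = - k); last by lra.
by rewrite mulrN -opprB lerN2; apply; lra.
Unshelve. all: by end_near.
Qed.

End Differentiation.

(** * Densities of Lipschitz functions *)

Section Lipschitz.
Context {R : realType}.
Local Notation mu := (@lebesgue_measure R).
Local Notation h2 := (2^-1 : R).

Lemma stieltjes_measure (f : R -> R) (L : R) : {homo f : x y / x <= y} ->
  (forall x y, `|f x - f y| <= L * `|x - y|) ->
  exists nu : {measure set (measurableTypeR R) -> \bar R},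
    forall a b, a <= b -> nu `]a, b]%classic = (f b - f a)%:E.
Proof.
move=> hf lf.
have rc : right_continuous f.
  move=> x; apply: cvg_at_right_filter; apply/cvgrPdist_le => e e0.
  have L0 : 0 < `|L| + 1 by rewrite ltr_wpDl.
  near=> y; apply: le_trans (lf _ _) _.
  apply: (@le_trans _ _ ((`|L| + 1) * `|x - y|)).
    by rewrite ler_wpM2r// (le_trans (ler_norm L))// lerDl.
  rewrite mulrC -ler_pdivlMr//; near: y.
  by apply/nbhs_ballP; exists (e / (`|L| + 1)); [exact: divr_gt0|move=> z /= /ltW].
pose cf := isCumulative.Build R _ R f hf rc.
pose F : cumulative R R := HB.pack f cf.
exists (lebesgue_stieltjes_measure F) => a b ab.
rewrite -[LHS]/(lebesgue_stieltjes_measure F `]a, b]%classic) /lebesgue_stieltjes_measure.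
rewrite /measure_extension measurable_mu_extE/=; last exact: is_ocitv.
move: ab; rewrite le_eqVlt => /predU1P[<-|ab].
  by rewrite set_itv_ge ?bnd_simp ?ltxx// wlength0 subrr.
by rewrite wlength_itv_bnd ?ltW.
Unshelve. all: by end_near.
Qed.

(** Composition with it extends a function from [-1/2, 1/2] to the line by constants and keeps its
    Lipschitz constant. *)
Definition clampI (m : R) := Num.max (- h2) (Num.min m h2).

Lemma clampI_itv m : - h2 <= clampI m <= h2.
Proof. by rewrite /clampI le_max lexx ge_max ge_min lexx orbT andbT /=; lra. Qed.

Lemma clampI_id m : - h2 <= m <= h2 -> clampI m = m.
Proof. by rewrite /clampI => /andP[a b]; rewrite min_l// max_r. Qed.

Lemma clampI_lip m n : `|clampI m - clampI n| <= `|m - n|.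
Proof.
wlog mn : m n / n <= m => [H|].
  have [|/ltW] := leP n m; first exact: H.
  by move=> /H; rewrite distrC [`|n - m|]distrC.
rewrite [leRHS]ger0_norm ?subr_ge0// /clampI ler_norml.
by case: (leP m h2); case: (leP n h2); case: (leP (- h2) m); case: (leP (- h2) n);
  case: (leP (- h2) h2); lra.
Qed.

Definition lip_on (L : R) (A : R -> R) := forall m m', - h2 <= m <= h2 ->
  - h2 <= m' <= h2 -> `|A m - A m'| <= L * `|m - m'|.

Lemma bm_prim (g : R -> R) x : bm (g : measurableTypeR R -> R) ->
  prim g x = \int[lam (- h2) x]_y g y.
Proof. by move=> bg; rewrite /prim Rint_lam. Qed.

Lemma lam_mu_integrable (a b : R) (f : R -> R) : bm (f : measurableTypeR R -> R) ->
  mu.-integrable `[a, b] (EFin \o f).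
Proof.
move=> bf.
have /integrableP[mf If] := bm_integrable (lam a b) (measurable_itv `[a, b]) bf.
apply/integrableP; split => //.
rewrite (@eq_measure_integral _ _ _ _ (lam a b))// => X mX XE.
by change (mu X = mu (X `&` `[a, b])); rewrite setIidl.
Qed.

(* F = A + L id and L id - A are both nondecreasing, so the Stieltjes measure  *)
(* of F is dominated by 2 L times the Lebesgue measure.                        *)
Lemma lip_density (A : R -> R) (L : R) : 0 <= L -> lip_on L A ->
  exists a : measurableTypeR R -> R, [/\ bm a, forall m, `|a m| <= L,
    forall m, - h2 <= m <= h2 -> A m = A (- h2) + \int[lam (- h2) m]_y a y &
    exists2 N, null_set N & forall m, - h2 <= m <= h2 -> ~ N m ->
      derivable A m 1 /\ derive1 A m = a m].
Proof.
move=> L0 lA.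
have lAc m n : `|A (clampI m) - A (clampI n)| <= L * `|m - n|.
  apply: le_trans (lA _ _ (clampI_itv m) (clampI_itv n)) _.
  by rewrite ler_wpM2l// clampI_lip.
pose F m := A (clampI m) + L * m; pose G m := L * m - A (clampI m).
have lL m n : `|L * m - L * n| <= L * `|m - n| by rewrite -mulrBr normrM ger0_norm.
have hF : {homo F : x y / x <= y}.
  move=> x y xy; rewrite /F -subr_ge0.
  have := lAc y x; rewrite [`|y - x|]ger0_norm ?subr_ge0// ler_norml => /andP[h _]; nra.
have hG : {homo G : x y / x <= y}.
  move=> x y xy; rewrite /G -subr_ge0.
  have := lAc y x; rewrite [`|y - x|]ger0_norm ?subr_ge0// ler_norml => /andP[_ h]; nra.
have lF x y : `|F x - F y| <= (2 * L) * `|x - y|.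
  rewrite /F (_ : _ - _ = (A (clampI x) - A (clampI y)) + (L * x - L * y)); last by ring.
  by apply: le_trans (ler_normD _ _) _; have := lAc x y; have := lL x y; lra.
have lG x y : `|G x - G y| <= (2 * L) * `|x - y|.
  rewrite /G (_ : _ - _ = (L * x - L * y) - (A (clampI x) - A (clampI y))); last by ring.
  by apply: le_trans (ler_normB _ _) _; have := lAc x y; have := lL x y; lra.
have [nF HF] := stieltjes_measure hF lF; have [nG HG] := stieltjes_measure hG lG.
have L20 : 0 <= 2 * L by rewrite mulr_ge0.
pose m2 : {measure set (measurableTypeR R) -> \bar R} := mscale (NngNum L20) mu.
have E X : measurable X -> (nF X + nG X = (2 * L)%:E * mu X)%E.
  move=> mX; rewrite -(measure_addE nF nG) -[RHS]/(m2 X).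
  apply: (@measure_unique _ R (measurableTypeR R) (@ocitv R)
    (fun k : nat => `](- k%:R : R), k%:R]%classic)) => //.
  - exact: ocitvI.
  - by move=> k; exact: is_ocitv.
  - apply/seteqP; split=> // x _; exists (Num.truncn `|x|).+1 => //=.
    rewrite in_itv/=; have := truncnS_gt `|x|; rewrite ltr_norml => /andP[-> h].
    exact: ltW.
  - move=> _ [[u v] _ <-] /=.
    have [uv|vu] := leP u v; last first.
      by rewrite set_itv_ge ?bnd_simp -?leNgt ?ltW// !measure0.
    apply: (etrans (measure_addE nF nG _)).
    rewrite HF// HG// /m2 /= /mscale/= lebesgue_measure_itv/= lte_fin.
    rewrite -EFinD; move: uv; rewrite le_eqVlt => /predU1P[->|uv].
      by rewrite ltxx mule0; congr EFin; ring.
    by rewrite uv -EFinB -EFinM; congr EFin; rewrite /F /G; ring.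
  - move=> k; rewrite [X in (X < _)%E](measure_addE nF nG).
    have kk : (- k%:R : R) <= k%:R by have := ler0n R k; lra.
    by rewrite HF// HG// -EFinD ltry.
pose J : set (measurableTypeR R) := `[- h2, h2]%classic.
have mI : measurable J by exact: measurable_itv.
have mu0 X : measurable X -> mu X = 0%E -> nF X = 0%E.
  move=> mX X0; apply/eqP; rewrite eq_le measure_ge0 andbT.
  by have := E _ mX; rewrite X0 mule0 => <-; rewrite leeDl.
have fin : (nF J < +oo)%E.
  have := E _ mI; rewrite /J lebesgue_measure_itv/=; case: ifP => _.
    rewrite -EFinB -EFinM => H; apply: (@le_lt_trans _ _ (((2 * L) * (h2 - - h2))%:E)).
      by rewrite -H leeDl.
    by rewrite ltry.
  by rewrite mule0 => H; apply: (@le_lt_trans _ _ 0%E) => //; rewrite -H leeDl.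
pose n1 : {finite_measure set (measurableTypeR R) -> \bar R} := mfrestr mI fin.
pose nu := charge_of_finite_measure n1.
have numu : (nu : {charge set (measurableTypeR R) -> \bar R}) `<< mu.
  apply/null_content_dominatesP => X mX X0.
  have XI : measurable (X `&` J) by exact: measurableI.
  change (nF (X `&` J) = 0)%E; apply: mu0 => //.
  apply/eqP; rewrite eq_le measure_ge0 andbT -[leRHS]X0.
  by apply: le_measure; rewrite ?inE.
pose g := Radon_Nikodym nu mu.
have ig : mu.-integrable setT g := Radon_Nikodym_integrable numu.
have gfin x : g x \is a fin_num := Radon_Nikodym_fin_num x numu.
pose f x := fine (g x).
have fE : EFin \o f = g by apply/funext => x /=; rewrite /f fineK.
have iF : mu.-integrable setT (EFin \o f) by rewrite fE.
have intf : mu.-integrable `[- h2, h2] (EFin \o f) by exact: integrableS iF.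
have h20 : 0 < h2 by rewrite invr_gt0.
have pE x : - h2 <= x <= h2 -> prim f x = F x - F (- h2).
  move=> /andP[x1 x2].
  have mx : measurable (`[- h2, x]%classic : set (measurableTypeR R)).
    exact: measurable_itv.
  rewrite /prim /Rintegral.
  have -> : (\int[mu]_(t in `[(- h2)%R, x]) (f t)%:E = \int[mu]_(t in `[(- h2)%R, x]) g t)%E.
    by apply: eq_integral => t _; rewrite -[RHS]/(g t) -fE.
  rewrite -(Radon_Nikodym_integral numu mx).
  pose J2 : set (measurableTypeR R) := `[- h2, x]%classic.
  change (fine (nF (J2 `&` J)) = F x - F (- h2)); rewrite /J2 /J.
  rewrite setIidl; last by apply: subset_itvl; rewrite bnd_simp.
  have -> : `[- h2, x]%classic = [set - h2] `|` `]- h2, x]%classic by rewrite setU1itv.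
  rewrite measureU//; last first.
    by apply/seteqP; split=> y //= [->]; rewrite in_itv/= ltxx.
  have z1 := mu0 _ (measurable_set1 (- h2)) (lebesgue_measure_set1 (- h2)).
  by rewrite [X in (X + _)%E]z1 [X in (_ + X)%E](HF _ _ x1) add0e.
have [N1 nN1 H1] : exists2 N, null_set N &
    forall x, - h2 <= x <= h2 -> ~ N x -> f x <= 2 * L.
  apply: density_le => // a b a1 ab b1.
  rewrite !pE ?a1 ?b1 ?(le_trans a1 ab) ?(le_trans ab b1)//.
  rewrite opprB addrA subrK; apply: le_trans (ler_norm _) _.
  by apply: le_trans (lF _ _) _; rewrite ger0_norm ?subr_ge0.
have intNf : mu.-integrable `[- h2, h2] (EFin \o (fun x => - f x)).
  have -> : EFin \o (fun x => - f x) = (\- (EFin \o f))%E by apply/funext.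
  exact: integrableN.
have pN x : - h2 <= x <= h2 -> prim (fun x => - f x) x = - prim f x.
  move=> /andP[x1 x2]; rewrite /prim -[RHS]mulN1r -RintegralZl//.
    by apply: eq_Rintegral => y _; rewrite mulN1r.
  by apply: integrableS intf => //; apply: subset_itvl; rewrite bnd_simp.
have [N2 nN2 H2] : exists2 N, null_set N &
    forall x, - h2 <= x <= h2 -> ~ N x -> - f x <= 0.
  apply: density_le => // a b a1 ab b1.
  rewrite !pN ?a1 ?b1 ?(le_trans a1 ab) ?(le_trans ab b1)//.
  rewrite !pE ?a1 ?b1 ?(le_trans a1 ab) ?(le_trans ab b1)// mul0r.
  by have := hF _ _ ab; lra.
(* f is the density of A + L id and lies in [0, 2 L] almost everywhere, so f - L is the density of
   A; the truncation acts on a null set and makes the bound L hold at every point. *)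
pose a (x : measurableTypeR R) : R := Num.max (- L) (Num.min (f x - L) L).
have aL x : `|a x| <= L.
  by rewrite /a ler_norml le_max lexx /= ge_max ge_min lexx orbT andbT; lra.
have mf : measurable_fun setT (f : measurableTypeR R -> R).
  by apply/measurable_EFinP; exact: measurable_int iF.
have ba : bm a.
  split; last by exists L.
  apply: measurable_maxr; first exact: measurable_cst.
  apply: measurable_minr; last exact: measurable_cst.
  by apply: measurable_funB => //; exact: measurable_cst.
have aE x : - h2 <= x <= h2 -> ~ (N1 `|` N2) x -> a x = f x - L.
  move=> xI /not_orP[/(H1 _ xI) h1 /(H2 _ xI) h2].
  by rewrite /a min_l ?max_r//; lra.
have nN := null_setU nN1 nN2.
have AE m : - h2 <= m <= h2 -> A m = A (- h2) + \int[lam (- h2) m]_y a y.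
  move=> mI'; have /andP[m1' m2'] := mI'.
  rewrite -(Rint_lam_null nN (f := fun x => f x - L))//; last first.
    move=> x /andP[x1 x2] Nx; rewrite aE// x1/=; exact: le_trans m2'.
  rewrite RintegralB//; last 2 first.
  - by apply: integrableS intf => //; apply: subset_itvl; rewrite bnd_simp.
  - exact: (lam_mu_integrable _ _ (bm_cst L)).
  rewrite [X in _ + (_ - X)]Rint_lam ?lam_cst//; last exact: bm_cst.
  have := pE m mI'; rewrite /prim => ->.
  rewrite /F !clampI_id ?lexx//=; last by lra.
  by ring.
exists a; split=> //.
have [N3 nN3 H3] := ftc_null (lam_mu_integrable (- h2) h2 ba).
exists (N3 `|` ([set - h2] `|` [set h2])).
  by apply: null_setU => //; apply: null_setU; exact: null_set1.
move=> x /andP[x1 x2] /not_orP[Nx /not_orP[xn1 xn2]].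
have x3 : - h2 < x < h2.
  by rewrite !lt_neqAle x1 x2 !andbT; apply/andP; split; apply/eqP; [move/esym|].
have [d1 d2] := H3 x x3 Nx; have /andP[x4 x5] := x3.
have E' : \forall y \near x, A y = A (- h2) + prim a y.
  near=> y; rewrite bm_prim//; apply: AE; apply/andP; split.
    by near: y; exact: lt_le_nbhsr.
  by near: y; exact: lt_le_nbhsl.
have d3 : derivable (fun y => A (- h2) + prim a y) x 1.
  exact: (derivableD (derivable_cst (A (- h2)) x 1) d1).
split; first by apply: near_eq_derivable d3; near=> y; apply/esym; near: y.
rewrite -d2 !derive1E (near_eq_derive _ E').
by have := deriveD (derivable_cst (A (- h2)) x 1) d1; rewrite derive_cst add0r => <-.
Unshelve. all: by end_near.
Qed.

End Lipschitz.

(** * Densities of admissible fluxes *)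

Section LipschitzSeminorm.
Context {R : realType}.
Local Notation mu := (@lebesgue_measure R).
Local Notation h2 := (2^-1 : R).

Lemma half_itvE (m : R) : half_itv m <-> - h2 <= m <= h2.
Proof. by rewrite /half_itv /= in_itv. Qed.

Lemma lip_seminormP (f : R -> R) L : (lip_seminorm f <= L%:E)%E -> lip_on L f.
Proof.
move=> H m m' mI mI'; have [->|mm] := eqVneq m m'; first by rewrite !subrr normr0 mulr0.
rewrite -ler_pdivrMr ?normr_gt0 ?subr_eq0// -lee_fin; apply: le_trans H.
by apply: ereal_sup_ubound; exists m, m'; split=> //; exact/half_itvE.
Qed.

Lemma lipT_seminormP T F : (lipT_seminorm T F < +oo)%E ->
  exists2 L : R, 0 <= L & (lipT_seminorm T F <= L%:E)%E /\
    forall tau, 0 <= tau <= T -> lip_on L (F^~ tau).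
Proof.
move=> H; have H' : (lipT_seminorm T F <= (Num.max 0 (fine (lipT_seminorm T F)))%:E)%E.
  by case: (lipT_seminorm T F) H => [r _|//|_]; rewrite ?lee_fin ?le_max ?lexx ?orbT ?leNye.
exists (Num.max 0 (fine (lipT_seminorm T F))); first by rewrite le_max lexx.
split=> // tau tT; apply: lip_seminormP; apply: le_trans H'.
by apply: ereal_sup_ubound; exists tau => //=; rewrite in_itv.
Qed.

Lemma lip_sub_ereal T (F : R -> R -> R) (tau : R) L : 0 <= tau <= T ->
  lipT_seminorm T F = L%:E -> lip_on L (F^~ tau).
Proof.
move=> tT E; apply: lip_seminormP; rewrite -E.
by apply: ereal_sup_ubound; exists tau => //=; rewrite in_itv.
Qed.

(* At the end points of [0, T] only one-sided difference quotients are         *)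
(* available.                                                                  *)
Lemma time_quotient_lip (T : R) (G G' : R -> R) c :
  (forall tau, 0 <= tau <= T ->
    (G s - G tau) / (s - tau) @[s --> within `[0, T]%classic tau^'] --> G' tau) ->
  (forall tau, 0 <= tau <= T -> `|G' tau| <= c) ->
  forall s t, 0 <= s <= T -> 0 <= t <= T -> `|G t - G s| <= c * `|t - s|.
Proof.
move=> HG Gc s t sT tT; wlog st : s t sT tT / s < t => [H|].
  have [st|ts|->] := ltgtP s t; first exact: H.
    by rewrite distrC [`|t - s|]distrC; exact: H.
  by rewrite !subrr normr0 mulr0.
have near_quot tau e : 0 <= tau <= T -> 0 < e -> exists2 d, 0 < d & forall u,
    `|tau - u| < d -> u != tau -> 0 <= u <= T ->
    `|G' tau - (G u - G tau) / (u - tau)| <= e.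
  move=> tauT e0; have /cvgrPdist_le /(_ _ e0) := HG _ tauT.
  case/nbhs_ballP => d d0 Hd; exists d; first exact: d0.
  by move=> u du un uT; apply: (Hd u) => //=; rewrite in_itv.
have /andP[s0 _] := sT; have /andP[_ tT'] := tT.
have dG x : x \in `]s, t[ -> is_derive x (1 : R) G (G' x).
  rewrite in_itv/= => /andP[sx xt].
  have xT : 0 <= x <= T by rewrite (le_trans s0 (ltW sx)) (le_trans (ltW xt) tT').
  suff H : (h^-1 *: ((G \o shift x) (h *: (1 : R)) - G x)) @[h --> 0^'] --> (G' x : R).
    by split; [apply/cvg_ex; exists (G' x)|apply/cvg_lim => //; exact: Rhausdorff].
  apply/cvgrPdist_le => e e0; have [d d0 Hd] := near_quot _ _ xT e0.
  near=> h.
  have hn : h != 0 by near: h; exact: nbhs_dnbhs_neq.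
  have hd : `|h| < d by near: h; exact: dnbhs0_lt.
  have h1 : `|h| < x - s by near: h; apply: dnbhs0_lt; rewrite subr_gt0.
  have h3 : `|h| < t - x by near: h; apply: dnbhs0_lt; rewrite subr_gt0.
  move: h1 h3; rewrite !ltr_norml => /andP[h1 h1'] /andP[h3 h3'].
  have := Hd (h + x); rewrite /= addrK [h^-1 *: _]mulrC (_ : h *: 1 = h); last exact: mulr1.
  apply.
  - by rewrite opprD addrCA subrr addr0 normrN.
  - by rewrite -subr_eq0 addrK.
  - by apply/andP; split; lra.
have cG : {within `[s, t], continuous G}.
  apply/subspace_continuousP => x /=; rewrite in_itv/= => /andP[sx xt].
  have xT : 0 <= x <= T by rewrite (le_trans s0 sx) (le_trans xt tT').
  apply/cvgrPdist_le => e e0; have [d d0 Hd] := near_quot _ _ xT (ltr01 : 0 < (1 : R)).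
  have c1 : 0 < `|c| + 1 by rewrite ltr_wpDl.
  apply/nbhs_ballP; exists (Num.min d (e / (`|c| + 1))).
    by rewrite /= lt_min d0 divr_gt0.
  move=> y /=; rewrite /ball/= lt_min in_itv/= => /andP[yd ye] /andP[sy yt].
  have [->|yx] := eqVneq y x; first by rewrite subrr normr0 ltW.
  have yT : 0 <= y <= T by rewrite (le_trans s0 sy) (le_trans yt tT').
  have := Hd y yd yx yT; rewrite distrC => /(le_trans (lerB_dist _ _)).
  have := Gc x xT; have := ler_norm c.
  rewrite normrM normfV => cc gc q.
  have yx0 : 0 < `|y - x| by rewrite normr_gt0 subr_eq0.
  have {}q : `|G y - G x| / `|y - x| <= `|c| + 1 by lra.
  move: q; rewrite ler_pdivrMr// => q; rewrite distrC; apply: le_trans q _.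
  by rewrite mulrC -ler_pdivlMr// distrC ltW.
have [x xst ->] := MVT st dG cG.
rewrite normrM ler_wpM2r//; apply: Gc.
by move: xst; rewrite in_itv/= => /andP[sx xt];
  rewrite (le_trans s0 (ltW sx)) (le_trans (ltW xt) tT').
Unshelve. all: by end_near.
Qed.

Lemma density_lip (D : R -> R) (a : measurableTypeR R -> R) c : bm a -> lip_on c D ->
  (forall m, - h2 <= m <= h2 -> D m = D (- h2) + \int[lam (- h2) m]_y a y) ->
  exists2 N, null_set N & forall m, - h2 <= m <= h2 -> ~ N m -> `|a m| <= c.
Proof.
move=> ba lD DE.
have pE x : - h2 <= x <= h2 -> prim a x = D x - D (- h2).
  by move=> xI; rewrite bm_prim// DE// addrC addKr.
have pN x : prim (fun y => - a y) x = - prim a x.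
  by rewrite !bm_prim//; [exact: intN|exact: bmN].
have itv u v : - h2 <= u -> u <= v -> v <= h2 -> - h2 <= u <= h2 /\ - h2 <= v <= h2.
  by move=> u1 uv v1; rewrite u1 v1 (le_trans u1 uv) (le_trans uv v1).
have [N1 n1 H1] : exists2 N, null_set N & forall x, - h2 <= x <= h2 -> ~ N x -> a x <= c.
  apply: density_le; first exact: lam_mu_integrable.
  move=> u v u1 uv v1; have [uI vI] := itv _ _ u1 uv v1.
  rewrite !pE// opprB addrA subrK; apply: le_trans (ler_norm _) _.
  by apply: le_trans (lD _ _ vI uI) _; rewrite ger0_norm ?subr_ge0.
have [N2 n2 H2] : exists2 N, null_set N & forall x, - h2 <= x <= h2 -> ~ N x -> - a x <= c.
  apply: density_le; first exact/lam_mu_integrable/bmN.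
  move=> u v u1 uv v1; have [uI vI] := itv _ _ u1 uv v1.
  rewrite !pN !pE// opprK (_ : _ + _ = - (D v - D u)); last by ring.
  apply: le_trans (ler_norm _) _; rewrite normrN.
  by apply: le_trans (lD _ _ vI uI) _; rewrite ger0_norm ?subr_ge0.
exists (N1 `|` N2); first exact: null_setU.
move=> m mI /not_orP[/(H1 _ mI) h1 /(H2 _ mI) h3].
by rewrite ler_norml; lra.
Qed.

(* a = d A / d m, and L bounds both seminorms of the admissible flux A.        *)
Definition flux_density T (A a : R -> R -> R) (L : R) :=
  [/\ 0 <= L,
      forall t, bm (a t : measurableTypeR R -> R) /\ forall m, `|a t m| <= L,
      forall t m, 0 <= t <= T -> - h2 <= m <= h2 ->
        A m t = A (- h2) t + \int[lam (- h2) m]_y a t y,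
      forall t, 0 <= t <= T -> exists2 N, null_set N & forall m, - h2 <= m <= h2 -> ~ N m ->
        derive1 (A^~ t) m = a t m &
      forall s t, 0 <= s <= T -> 0 <= t <= T -> exists2 N, null_set N &
        forall m, - h2 <= m <= h2 -> ~ N m -> `|a t m - a s m| <= L * `|t - s|].

(** The density is chosen for each t separately. For its dependence on time, A(m, .) - A(m', .) has
    a time derivative bounded by a multiple of |m - m'|; by the mean value theorem A(., t) - A(., s)
    is then Lipschitz in m with a constant proportional to |t - s|, and this bounds the difference
    of the densities off a null set depending on s and t. *)
Lemma flux_density_exists T A : admissible_flux T A -> exists a L, flux_density T A a L.
Proof.
move=> [H1 H2 H3]; have [L1 L10 [_ lip1]] := lipT_seminormP H1.
have [L2 L20 [_ lip2]] := lipT_seminormP H3.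
have /choice[a Ha] t : exists a : measurableTypeR R -> R, [/\ bm a, forall m, `|a m| <= L1,
    forall m, 0 <= t <= T -> - h2 <= m <= h2 -> A m t = A (- h2) t + \int[lam (- h2) m]_y a y &
    0 <= t <= T -> exists2 N, null_set N & forall m, - h2 <= m <= h2 -> ~ N m ->
      derive1 (A^~ t) m = a m].
  have [tT|tT] := pselect (0 <= t <= T); last first.
    exists (fun=> 0); split=> //; first exact: bm_cst.
    by move=> m; rewrite normr0.
  have [a [a1 a2 a3 [N nN a4]]] := lip_density L10 (lip1 t tT).
  exists a; split=> //; first by move=> m _; exact: a3.
  by move=> _; exists N => // m mI Nm; have [] := a4 m mI Nm.
exists a, (Num.max L1 L2); split.
- by rewrite le_max L10.
- by move=> t; have [? h _ _] := Ha t; split=> // m; rewrite le_max h.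
- by move=> t m; have [_ _ h _] := Ha t; exact: h.
- by move=> t; have [_ _ _ h] := Ha t; exact: h.
move=> s t sT tT; have [bs _ hs _] := Ha s; have [bt _ ht _] := Ha t.
have lD : lip_on (L2 * `|t - s|) (fun m => A m t - A m s).
  move=> m m' mI mI'.
  have := @time_quotient_lip T (fun tau => A m tau - A m' tau)
    (fun tau => time_derive T A m tau - time_derive T A m' tau) (L2 * `|m - m'|) _ _ s t sT tT.
  rewrite (_ : A m t - A m' t - (A m s - A m' s) = A m t - A m s - (A m' t - A m' s)); last by ring.
  rewrite mulrAC; apply.
  - move=> tau tauT; have tauI : `[0, T]%classic tau by rewrite /= in_itv.
    have c1' := H2 _ _ ((half_itvE m).2 mI) tauI.
    have c2' := H2 _ _ ((half_itvE m').2 mI') tauI.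
    rewrite (_ : (fun u => _) = (fun u => time_quotient A m tau u - time_quotient A m' tau u)).
      by apply: cvgB; [exact: c1'|exact: c2'].
    by apply/funext => u; rewrite /time_quotient; ring.
  - by move=> tau tauT; exact: lip2.
have [N nN HN] : exists2 N, null_set N & forall m, - h2 <= m <= h2 -> ~ N m ->
    `|a t m - a s m| <= L2 * `|t - s|.
  apply: (density_lip _ lD); first exact: bmB.
  by move=> m mI; rewrite intB// (ht m tT mI) (hs m sT mI); ring.
exists N => // m mI Nm; apply: le_trans (HN m mI Nm) _.
by rewrite ler_wpM2r// le_max lexx orbT.
Qed.

Lemma entropy_fluxE T A a L eta (g : measurableTypeR R -> R) N m t : flux_density T A a L ->
  bm g -> null_set N -> (forall m, - h2 <= m <= h2 -> ~ N m -> derive1 eta m = g m) ->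
  0 <= t <= T -> - h2 <= m <= h2 ->
  entropy_flux A eta m t = \int[lam (- h2) m]_y (g y * a t y).
Proof.
move=> [_ H2 _ H4 _] bg nN gE tT /andP[m1 m2]; have [N' nN' aE] := H4 t tT.
have [ba _] := H2 t.
apply: (Rint_lam_null (null_setU nN nN')); first exact: bmM.
move=> x /andP[x1 x2] /not_orP[Nx Nx'].
have xI : - h2 <= x <= h2 by rewrite x1 (le_trans x2).
by rewrite gE ?aE.
Qed.

End LipschitzSeminorm.

(** * Nondecreasing densities of convex functions *)

Section ConvexDensity.
Context {R : realType}.
Local Notation h2 := (2^-1 : R).

Lemma convex_segment (eta : R -> R) x y s : @convex_function R R^o half_itv eta ->
  - h2 <= x <= h2 -> - h2 <= y <= h2 -> 0 <= s <= 1 ->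
  eta (s * x + (1 - s) * y) <= s * eta x + (1 - s) * eta y.
Proof.
move=> ce xI yI /andP[s0 s1].
have := ce (Itv01 s0 s1) x y; rewrite !inE.
by move=> /(_ ((half_itvE x).2 xI) ((half_itvE y).2 yI)).
Qed.

Lemma convex_derive (eta : R -> R) m z : @convex_function R R^o half_itv eta ->
  - h2 <= m <= h2 -> - h2 <= z <= h2 -> derivable eta m 1 ->
  derive1 eta m * (z - m) <= eta z - eta m.
Proof.
move=> ce mI zI dm; rewrite leNgt; apply/negP => H.
have dz : derivable eta m (z - m) by exact: derivable_scale.
have /cvgr_gt : (h^-1 *: ((eta \o shift m) (h *: (z - m)) - eta m)) @[h --> 0^'] --> 'D_(z - m) eta m.
  exact: dz.
rewrite derive1_scale// -derive1E mulrC => /(_ _ H) /nbhs_ballP[d d0 Hd].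
(* A step small enough for the difference quotient to exceed eta z - eta m, and at most 1 so as to
   stay on the segment from m to z. *)
pose s := Num.min (d / 2) (2^-1).
have s0 : 0 < s by rewrite /s lt_min divr_gt0//= invr_gt0.
have s1 : s <= 1 by rewrite /s ge_min; apply/orP; right; lra.
have sd : s < d by rewrite /s gt_min; apply/orP; left; have : 0 < d by []; lra.
have := Hd s; rewrite /ball/= sub0r normrN gtr0_norm// => /(_ sd).
rewrite gt_eqF// => /(_ isT); rewrite ltNge => /negP; apply.
rewrite /GRing.scale/= mulrC ler_pdivrMr//.
have := convex_segment ce zI mI (_ : 0 <= s <= 1); rewrite (ltW s0) s1 => /(_ isT).
rewrite (_ : s * z + (1 - s) * m = s * (z - m) + m); last by ring.
move=> h; rewrite (_ : (eta z - eta m) * s = s * eta z + (1 - s) * eta m - eta m); last by ring.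
lra.
Qed.

(** By convexity the derivative is nondecreasing where it exists. Taking at m the supremum of its
    values at the good points up to m, with -L adjoined, gives a version that is nondecreasing
    everywhere. *)
Lemma entropy_density (eta : R -> R) : entropy eta ->
  exists g : measurableTypeR R -> R, exists2 L, 0 <= L &
  [/\ {homo (g : R -> R) : x y / x <= y}, forall m, `|g m| <= L,
    forall m, - h2 <= m <= h2 -> eta m = eta (- h2) + \int[lam (- h2) m]_y g y &
    exists2 N, null_set N & forall m, - h2 <= m <= h2 -> ~ N m -> derive1 eta m = g m].
Proof.
move=> [ce le].
have [L L0 lip] : exists2 L : R, 0 <= L & lip_on L eta.
  exists (Num.max 0 (fine (lip_seminorm eta))); first by rewrite le_max lexx.
  apply: lip_seminormP.
  by case: (lip_seminorm eta) le => [r _|//|_]; rewrite ?lee_fin ?le_max ?lexx ?orbT ?leNye.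
have [a [ba aL aE [N nN dE]]] := lip_density L0 lip.
have amono m m' : - h2 <= m <= h2 -> - h2 <= m' <= h2 -> ~ N m -> ~ N m' -> m <= m' -> a m <= a m'.
  move=> mI mI' Nm Nm'; rewrite le_eqVlt => /predU1P[->//|mm].
  have [d1 e1] := dE m mI Nm; have [d2 e2] := dE m' mI' Nm'.
  have := convex_derive ce mI mI' d1; have := convex_derive ce mI' mI d2.
  rewrite e1 e2 => h3 h4; have p0 : 0 < m' - m by lra.
  rewrite -(ler_pM2r p0); lra.
pose S (m : R) := [set y | exists m', [/\ - h2 <= m' <= h2, ~ N m', m' <= m & y = a m']] `|` [set - L].
have hS m : has_sup (S m).
  split; first by exists (- L); right.
  exists L => _ [[m' [_ _ _ ->]]|->]; first by rewrite (le_trans (ler_norm _)).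
  by lra.
pose g (m : measurableTypeR R) : R := sup (S m).
have gL m : `|g m| <= L.
  rewrite ler_norml; apply/andP; split.
    by apply: sup_upper_bound => //; right.
  apply: ge_sup; first by exists (- L); right.
  move=> _ [[m' [_ _ _ ->]]|->]; first by rewrite (le_trans (ler_norm _)).
  by lra.
have hg : {homo (g : R -> R) : x y / x <= y}.
  move=> x y xy; apply: ge_sup; first by exists (- L); right.
  move=> z Hz; apply: sup_upper_bound => //.
  by case: Hz => [[m' [h1 h3 h4 ->]]|->]; [left; exists m'; split=> //; exact: le_trans xy|right].
have gE m : - h2 <= m <= h2 -> ~ N m -> g m = a m.
  move=> mI Nm; apply/eqP; rewrite eq_le; apply/andP; split.
    apply: ge_sup; first by exists (- L); right.
    move=> _ [[m' [h1 h3 h4 ->]]|->]; first exact: amono.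
    by have := aL m; rewrite ler_norml => /andP[].
  by apply: sup_upper_bound => //; left; exists m.
exists g, L => //; split=> //.
  move=> m mI; rewrite aE//; congr (_ + _); apply: (lam_eq_null nN) => //.
    exact: bm_homo gL.
  move=> x /andP[x1 x2] Nx; rewrite gE// x1 (le_trans x2)//.
  by have /andP[] := mI.
exists N => // m mI Nm; have [_ ->] := dE m mI Nm; by rewrite gE.
Qed.

End ConvexDensity.

(** * The entropy inequality in quantile form *)

Section SliceSupport.
Context {R : realType}.
Local Notation mu := (@lebesgue_measure R).

Lemma Rint_supp (Q : R) (F : R -> R) : bm (F : measurableTypeR R -> R) ->
  (forall x, Q < `|x| -> F x = 0) -> \int[mu]_x F x = \int[lam (- Q) Q]_x F x.
Proof.
move=> bF F0; rewrite -Rint_lam// [RHS]Rintegral_mkcond.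
apply: eq_Rintegral => x _; rewrite patchE; case: ifPn => //.
rewrite notin_setE/= in_itv/= -ler_norml => /negP; rewrite -ltNge; exact: F0.
Qed.

Lemma lam_deriv (a b : R) (F f : R -> R) : a <= b -> continuous f ->
  bm (f : measurableTypeR R -> R) -> (forall x : R, is_derive x (1 : R) F (f x)) ->
  \int[lam a b]_x f x = F b - F a.
Proof.
rewrite le_eqVlt => /predU1P[<- _ bf _|ab cf bf dF].
  by rewrite lam_empty// subrr.
rewrite -Rint_lam// /Rintegral (@continuous_FTC2 _ f F)//.
- exact: continuous_subspaceT.
- have cF : continuous F.
    move=> x; apply: differentiable_continuous; apply/derivable1_diffP.
    by have [] := dF x.
  split.
  + by move=> x _; have [] := dF x.
  + by apply: cvg_at_right_filter; exact: cF.
  + by apply: cvg_at_left_filter; exact: cF.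
- by move=> x _; rewrite derive1E; have [_ ->] := dF x.
Qed.

End SliceSupport.

Section Slice.
Context {R : realType}.
Local Notation mu := (@lebesgue_measure R).
Local Notation h2 := (2^-1 : R).
Local Notation lI := (lam (- 2^-1 : R) 2^-1).
Local Notation mR := (measurableTypeR R).

Definition vel (W : R -> R) (a X : R -> R) (m : R) : R :=
  a m - \int[lI]_n W (X m - X n).

(* The integrand in time of the entropy inequality, in quantile form.          *)
Definition slice_rate (W a g p q X : R -> R) : R :=
  \int[lI]_m (g m * (p (X m) + q (X m) * vel W a X m)).

(** A time slice f of a solution together with its quantile X. The bound is put on X; that f is 1/2
    or -1/2 outside [-Q, Q] follows ([profile_out]). *)
Definition profile (f X : R -> R) (Q : R) :=
  [/\ {homo f : x y / x <= y}, forall x, half_itv (f x), {homo X : x y / x <= y},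
      forall m, `|X m| <= Q & qrel f X].

Definition has_density (F : R -> R) (g : R -> R) :=
  bm (g : mR -> R) /\
  forall m, - h2 <= m <= h2 -> F m = F (- h2) + \int[lam (- h2) m]_y g y.

Lemma h2itv : - h2 <= - h2 <= h2 /\ - h2 <= h2 <= h2.
Proof. by split; apply/andP; split; lra. Qed.

(** Anchored at 1/2, since tail integrals are what [layer_cake] produces. *)
Lemma density_tail F g m : has_density F g -> - h2 <= m <= h2 ->
  F m = F h2 - \int[lam m h2]_y g y.
Proof.
move=> [bg FE] mI; have /andP[m1 m2] := mI.
by rewrite (FE m)// (FE h2) ?(lam_split bg m1 m2)//; [ring|have [] := h2itv].
Qed.

Lemma has_density_id : has_density id (fun=> 1).
Proof.
split; first exact: bm_cst.
by move=> m /andP[m1 m2]; rewrite lam_cst// mul1r addrC subrK.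
Qed.

Variable W : R -> R.
Hypothesis hW : good_kernel W.

Lemma kernel_measurable : measurable_fun setT (W : mR -> mR).
Proof. by have [_ h _] := hW; exact: measurable_homo. Qed.

Lemma kernel_bound (B u : R) : `|u| <= B -> `|W u| <= W B.
Proof.
have [odd mono _] := hW; rewrite ler_norml => /andP[u1 u2].
by rewrite ler_norml -odd !mono.
Qed.

Lemma bm_kernel X Y Q : {homo X : x y / x <= y} -> {homo Y : x y / x <= y} ->
  (forall m, `|X m| <= Q) -> (forall m, `|Y m| <= Q) ->
  bm (fun p : mR * mR => W (X p.1 - Y p.2)).
Proof.
move=> hX hY XQ YQ; split.
  apply: (measurableT_comp kernel_measurable); apply: measurable_funB.
    by apply: (measurableT_comp (measurable_homo hX)); exact: measurable_fst.
  by apply: (measurableT_comp (measurable_homo hY)); exact: measurable_snd.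
exists (W (Q + Q)) => p; apply: kernel_bound.
by apply: le_trans (ler_normB _ _) _; rewrite lerD.
Qed.

Lemma bm_vel a X Q : bm (a : mR -> R) -> {homo X : x y / x <= y} ->
  (forall m, `|X m| <= Q) -> bm (vel W a X : mR -> R).
Proof.
move=> ba hX XQ; apply: bmB => //.
exact: (bm_int1 lI lI (bm_kernel hX hX XQ XQ)).
Qed.

Lemma int_conv_bound (X : R -> R) Q m : {homo X : x y / x <= y} -> (forall m, `|X m| <= Q) ->
  `|\int[lI]_n W (X m - X n)| <= W (Q + Q).
Proof.
move=> hX XQ; have bk := bm_sec1 m (bm_kernel hX hX XQ XQ).
apply: le_trans (int_norm lI bk) _.
apply: le_trans (int_le lI (bm_norm bk) (bm_cst (W (Q + Q))) _) _.
  move=> n; apply: kernel_bound.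
  by apply: le_trans (ler_normB _ _) _; rewrite lerD.
by rewrite lam_cst ?mulr1 ?lexx//; lra.
Qed.

Lemma vel_bound (a X : R -> R) Q L m : {homo X : x y / x <= y} -> (forall m, `|X m| <= Q) ->
  (forall m, `|a m| <= L) -> `|vel W a X m| <= L + W (Q + Q).
Proof.
move=> hX XQ aL; apply: le_trans (ler_normB _ _) _; rewrite lerD//.
exact: int_conv_bound.
Qed.

Variables (f X : R -> R) (Q : R).
Hypothesis prof : profile f X Q.

Let Q0 : 0 <= Q. Proof. by have [_ _ _ h _] := prof; apply: le_trans (h 0). Qed.

Lemma bm_tail (g : R -> R) : bm (g : mR -> R) ->
  bm (fun x : mR => \int[lam (f x) h2]_y g y).
Proof.
move=> bg; have [hf fI _ _ _] := prof.
have bF : bm (fun p : mR * mR => g p.1 * (f p.2 <= p.1)%R%:R).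
  apply: bmM; first exact: bm_comp bg measurable_fst.
  apply: bm_le => //.
  by apply: (measurableT_comp (measurable_homo hf)); exact: measurable_snd.
(* The measure [lam 0 0] is a placeholder: only measurability and boundedness in x are wanted. *)
apply: (bm_eq _ (bm_int2 lI (lam 0 0) bF)) => x /=.
have /half_itvE/andP[f1 f2] := fI x.
by rewrite -(lam_above bg f1 f2).
Qed.

Lemma bm_density F g : has_density F g -> bm (fun x : mR => F (f x)).
Proof.
move=> dF; have [bg _] := dF; have [_ fI _ _ _] := prof.
apply: (bm_eq _ (bmB (bm_cst (F h2)) (bm_tail bg))) => x /=.
by rewrite [RHS](density_tail dF)//; apply/half_itvE; exact: fI.
Qed.

Lemma slice_density F g psi : has_density F g -> bm (psi : mR -> R) ->
  \int[lam (- Q) Q]_x (F (f x) * psi x) =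
  F h2 * \int[lam (- Q) Q]_x psi x - \int[lI]_m (g m * \int[lam (- Q) (X m)]_x psi x).
Proof.
move=> dF bpsi; have [hf fI hX XQ fX] := prof; have [bg _] := dF.
rewrite (layer_cake hf hX fX XQ fI bpsi bg).
rewrite -intZ// -intB; [|by apply: bmM => //; exact: bm_cst|by apply: bmM => //; exact: bm_tail].
apply: int_ext => x.
apply: (etrans (congr1 (fun u => u * psi x)
  (density_tail dF ((half_itvE (f x)).1 (fI x))))).
by apply: (etrans (mulrBl _ _ _)); congr (_ - _); exact: mulrC.
Qed.

End Slice.

(** * The entropy integrand at a fixed time *)

Section SliceFormula.
Context {R : realType}.
Local Notation mu := (@lebesgue_measure R).
Local Notation h2 := (2^-1 : R).
Local Notation lI := (lam (- 2^-1 : R) 2^-1).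
Local Notation mR := (measurableTypeR R).
Variables (phi : R -> \bar R) (f X : R -> R) (Q : R).
Hypothesis hphi : communication_protocol phi.
Hypothesis prof : profile f X Q.
Local Notation W := (Phi phi).

Let hW : good_kernel W. Proof. exact: Phi_good. Qed.

Lemma profileW Q' : Q <= Q' -> profile f X Q'.
Proof.
by move=> QQ; have [hf fI hX XQ fX] := prof; split=> // m; exact: le_trans QQ.
Qed.

(** The derivative of F(f) is the image of g(m) dm under X. This chain rule needs no care at the
    jumps of f: a jump corresponds to an interval of m on which X is constant, and the mass of the
    atom is the integral of g over it. *)
Lemma distr_derive_slice F g psi : has_density F g -> test_function setT psi ->
  \int[mu]_x (F (f x) * derive1 psi x) = - \int[lI]_m (g m * psi (X m)).
Proof.
move=> dF tp; have [sp Kp _] := tp.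
(* [-B, B] contains the range of X and the support of psi, so no boundary terms remain. *)
have [B QB HB] : exists2 B, Q <= B & forall x, B <= `|x| -> psi x = 0.
  have [M [_ HM]] := compact_bounded Kp.
  exists (Num.max Q (`|M| + 2)); first by rewrite le_max lexx.
  move=> x; rewrite ge_max => /andP[_ Mx]; apply/eqP; apply: contraPT Mx => px.
  apply/negP; rewrite -ltNge.
  have := HM (`|M| + 1) _ x (@subset_closure _ [set p | psi p != 0] x px).
  by rewrite (le_lt_trans (ler_norm M)) ?ltrDl// => /(_ isT)/= ?; lra.
have Q0 : 0 <= Q by have [_ _ _ h _] := prof; apply: le_trans (h 0).
have B0 : 0 <= B by lra.
have tp' : test_function setT (derive1 psi).
  have := test_derive (1 : R) tp; rewrite (_ : 'D_(1 : R) psi = derive1 psi)//.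
  by apply/funext => x; rewrite derive1E.
have cd : continuous (derive1 psi) by have [s _ _] := tp'; exact: smooth_continuous.
have bd := test_bm tp'.
have pd (x : R) : is_derive x (1 : R) psi (derive1 psi x) := smooth_is_derive x sp.
have d0 x : B < `|x| -> derive1 psi x = 0.
  move=> Bx; apply: (@derive1_locally_cst _ _ 0).
  have : \forall y \near x, B < `|y|.
    have cn : `|y| @[y --> x] --> `|x| by apply: cvg_norm; exact: cvg_id.
    exact: (cvgr_gt _ cn).
  by apply: filterS => y By; apply: HB; exact: ltW.
have profB := profileW QB; have [_ _ _ XB _] := profB.
rewrite (@Rint_supp _ B); last 2 first.
- apply: (bmM _ bd); exact: (bm_density prof dF).
- by move=> x Bx; rewrite d0// mulr0.
rewrite (slice_density profB dF bd) (lam_deriv (F := psi))//; last lra.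
have pB : psi B = 0 by apply: HB; rewrite ger0_norm.
have pNB : psi (- B) = 0 by apply: HB; rewrite normrN ger0_norm.
rewrite pB pNB subrr mulr0 sub0r; congr (- _); apply: int_ext => m.
rewrite (lam_deriv (F := psi))// ?pNB ?subr0//.
by have := XB m; rewrite ler_norml => /andP[].
Qed.

(** The integrand may be unbounded on the line, as the kernel can be, but the derivative charges
    only [-Q, Q], where it agrees with a bounded function. *)
Lemma charge_slice F g h hq : has_density F g -> measurable_fun setT (h : mR -> R) ->
  bm (hq : mR -> R) -> (forall x, `|x| <= Q -> h x = hq x) ->
  charge_integral (distr_derive (fun x => F (f x))) h = \int[lI]_m (g m * hq (X m)).
Proof.
move=> dF mh bq hhq; have [_ _ hX XQ _] := prof; have [bg _] := dF.
have mN : measurable (~` `[- Q, Q]%classic : set mR).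
  by apply: measurableC; exact: measurable_itv.
apply: (distr_derive_push bg (measurable_homo hX) _ mN _ mh bq).
- by move=> psi tp; exact: distr_derive_slice.
- by move=> y /=; apply; rewrite in_itv/= -ler_norml.
- by move=> x /contrapT; rewrite /= in_itv/= -ler_norml; exact: hhq.
Qed.

Lemma conv_slice x : conv_protocol phi f x = \int[lI]_n W (x - X n).
Proof.
have [_ _ hX XQ _] := prof.
have mW : measurable_fun setT ((fun y => W (x - y)) : mR -> R).
  apply: (measurableT_comp (kernel_measurable hW)).
  by apply: measurable_funB => //; exact: measurable_cst.
have mI : measurable (`[- Q, Q]%classic : set mR) by exact: measurable_itv.
pose hq (y : mR) : R := W (x - y) * \1_`[- Q, Q]%classic y.
have bq : bm hq.
  split; first by apply: measurable_funM => //; exact: measurable_indic.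
  exists (W (`|x| + Q)) => y; rewrite /hq indicE.
  have [/set_mem|_] := boolP (y \in `[- Q, Q]%classic).
    rewrite /= in_itv/= -ler_norml mulr1 => yQ; apply: (kernel_bound hW).
    by apply: le_trans (ler_normB _ _) _; rewrite lerD2l.
  rewrite mulr0 normr0; apply: le_trans (normr_ge0 (W 0)) _; apply: (kernel_bound hW).
  by rewrite normr0 addr_ge0// (le_trans _ (XQ 0)).
rewrite /conv_protocol (charge_slice (@has_density_id R) mW bq).
  apply: int_ext => m; rewrite mul1r /hq indicE mem_set ?mulr1//=.
  by rewrite in_itv/= -ler_norml.
by move=> y yQ; rewrite /hq indicE mem_set ?mulr1//= in_itv/= -ler_norml.
Qed.

(** The flux q has density g a, so after [layer_cake] the flux term and the nonlocal term are both
    of the form int g z0(X) (...) dm and combine into the velocity [vel]. The term with p0, later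
    the time derivative of the test function, becomes its primitive evaluated at X. *)
Lemma slice_formula F q g a p0 z0 z1 :
  has_density F g -> bm (a : mR -> R) ->
  (forall m, - h2 <= m <= h2 -> q m = \int[lam (- h2) m]_y (g y * a y)) ->
  bm (p0 : mR -> R) -> bm (z0 : mR -> R) -> bm (z1 : mR -> R) -> continuous z1 ->
  (forall x : R, is_derive x (1 : R) z0 (z1 x)) ->
  (forall x, Q <= `|x| -> [/\ p0 x = 0, z0 x = 0 & z1 x = 0]) ->
  \int[mu]_x (F (f x) * p0 x + q (f x) * z1 x)
  + charge_integral (distr_derive (fun x => F (f x)))
      (fun x => conv_protocol phi f x * z0 x) =
  F h2 * \int[lam (- Q) Q]_x p0 x
  - slice_rate W a g (fun x => \int[lam (- Q) x]_y p0 y) z0 X.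
Proof.
move=> dF ba qE bp0 bz0 bz1 cz1 dz supp; have [hf fI hX XQ fX] := prof.
have [bg _] := dF; have Q0 : 0 <= Q by apply: le_trans (XQ 0).
have [n1 n2] := @h2itv R.
have bga := bmM bg ba.
have dq : has_density q (fun y => g y * a y).
  split=> // m mI; rewrite (qE m mI) (qE (- h2) n1) [X in _ = X + _]lam_empty ?add0r//.
have bFf := bm_density prof dF; have bqf := bm_density prof dq.
rewrite (@Rint_supp _ Q); last 2 first.
- by apply: bmD; apply: bmM.
- by move=> x /ltW /supp[-> _ ->]; rewrite !mulr0 addr0.
rewrite intD; [|exact: bmM|exact: bmM].
rewrite (slice_density prof dF bp0) (slice_density prof dq bz1).
have zQ : z0 Q = 0 by have [] := supp Q; rewrite ?ger0_norm.
have zNQ : z0 (- Q) = 0 by have [] := supp (- Q); rewrite ?normrN ?ger0_norm.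
rewrite (lam_deriv (F := z0))//; last lra.
rewrite zQ zNQ subrr mulr0 sub0r.
have bk : bm (fun p : mR * mR => W (p.1 - X p.2) * z0 p.1).
  have [mz [C hC]] := bz0; split.
    apply: measurable_funM.
      apply: (measurableT_comp (kernel_measurable hW)); apply: measurable_funB.
        exact: measurable_fst.
      by apply: (measurableT_comp (measurable_homo hX)); exact: measurable_snd.
    exact: measurableT_comp.
  exists (W (Q + Q) * C) => p; rewrite normrM.
  have [pQ|pQ] := leP Q `|p.1|.
    have [_ -> _] := supp _ pQ; rewrite normr0 mulr0 mulr_ge0//.
      apply: le_trans (normr_ge0 (W 0)) _; apply: (kernel_bound hW).
      by rewrite normr0 addr_ge0.
    exact: le_trans (hC 0).
  apply: ler_pM => //; apply: (kernel_bound hW).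
  by apply: le_trans (ler_normB _ _) _; rewrite lerD// ltW.
have hqE x : conv_protocol phi f x * z0 x = \int[lI]_n (W (x - X n) * z0 x).
  rewrite conv_slice mulrC; have [xQ|xQ] := leP Q `|x|.
    have [_ -> _] := supp _ xQ; rewrite mul0r (int_ext lI (g := fun=> 0)) ?int_cst ?mul0r//.
    by move=> n; rewrite mulr0.
  rewrite -intZ; first by apply: int_ext => n; rewrite mulrC.
  split.
    apply: (measurableT_comp (kernel_measurable hW)); apply: measurable_funB.
      exact: measurable_cst.
    exact: measurable_homo.
  exists (W (Q + Q)) => n; apply: (kernel_bound hW).
  by apply: le_trans (ler_normB _ _) _; rewrite lerD// ltW.
have bhq := bm_int1 lI lI bk.
rewrite (charge_slice (hq := fun x => \int[lI]_n (W (x - X n) * z0 x)) dF)//; last first.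
  have -> : (fun x => conv_protocol phi f x * z0 x) =
    (fun x => \int[lI]_n (W (x - X n) * z0 x)) by apply/funext.
  by case: bhq.
have bzX : bm (fun m : mR => z0 (X m)).
  by apply: bm_comp bz0 _; exact: measurable_homo.
have bpX : bm (fun m : mR => \int[lam (- Q) (X m)]_y p0 y).
  have [mp [C hC]] := bp0.
  have bF : bm (fun p : mR * mR => p0 p.2 * (p.2 < X p.1)%R%:R).
    apply: bmM; first exact: bm_comp bp0 measurable_snd.
    apply: bm_lt => //.
    by apply: (measurableT_comp (measurable_homo hX)); exact: measurable_fst.
  apply: (bm_eq _ (bm_int1 lI (lam (- Q) Q) bF)) => m /=.
  by apply: lam_below => //; have := XQ m; rewrite ler_norml => /andP[].
have bzdX m : \int[lam (- Q) (X m)]_x z1 x = z0 (X m).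
  rewrite (lam_deriv (F := z0))// ?zNQ ?subr0//.
  by have := XQ m; rewrite ler_norml => /andP[].
rewrite (int_ext lI (f := fun m => g m * a m * _) (g := fun m => g m * a m * z0 (X m))); last first.
  by move=> m; rewrite bzdX.
have bv := bm_vel hW ba hX XQ.
have bc := bm_int1 lI lI (bm_kernel hW hX hX XQ XQ).
rewrite (int_ext lI (f := fun m => g m * \int[lI]_n (W (X m - X n) * z0 (X m)))
  (g := fun m => g m * z0 (X m) * \int[lI]_n W (X m - X n))); last first.
  move=> m; rewrite -mulrA; congr (_ * _).
  rewrite -intZ; last exact: (bm_sec1 m (bm_kernel hW hX hX XQ XQ)).
  by apply: int_ext => n; rewrite mulrC.
have b1 := bmM bg bpX; have b2 := bmM bga bzX; have b3 := bmM (bmM bg bzX) bc.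
rewrite /slice_rate (int_ext lI
  (f := fun m => g m * (\int[lam (- Q) (X m)]_y p0 y + z0 (X m) * vel W a X m)) (g := fun m =>
  g m * \int[lam (- Q) (X m)]_y p0 y + g m * a m * z0 (X m)
  - g m * z0 (X m) * \int[lI]_n W (X m - X n))); last first.
  move=> m; rewrite /vel; move: (\int[_]_y _) (\int[_]_n _) => u v; ring.
rewrite intB//; last exact: bmD.
rewrite intD//; move: (\int[_]_m _) (\int[_]_m _) (\int[_]_m _) => u1 u2 u3.
by move: (F h2 * _) => u4; ring.
Qed.

End SliceFormula.

(** * Joint measurability through time discretization *)

Section TimeSteps.
Context {d} {Y : measurableType d} {R : realType}.
Local Notation mR := (measurableTypeR R).
Variables (T : R).
Hypothesis T0 : 0 < T.

Definition tpt (n k : nat) : R := T * (k%:R / n.+1%:R).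

Definition steps (F : Y -> R -> R) (n : nat) (p : Y * mR) : R :=
  \sum_(k <- iota 0 n.+1) F p.1 (tpt n k) * ((tpt n k <= p.2)%R%:R * (p.2 < tpt n k.+1)%R%:R).

Lemma tpt0 n : tpt n 0 = 0. Proof. by rewrite /tpt mul0r mulr0. Qed.

Lemma tptN n : tpt n n.+1 = T. Proof. by rewrite /tpt divff ?mulr1// pnatr_eq0. Qed.

Lemma tptS n k : tpt n k.+1 = tpt n k + T / n.+1%:R.
Proof. by rewrite /tpt -[in LHS]natr1 mulrDl mulrDr mul1r. Qed.

Lemma tpt_le n k l : (k <= l)%N -> tpt n k <= tpt n l.
Proof. by move=> kl; rewrite ler_wpM2l ?(ltW T0)// ler_wpM2r// ler_nat. Qed.

Lemma tpt_itv n k : (k <= n.+1)%N -> 0 <= tpt n k <= T.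
Proof.
by move=> kn; have := tpt_le n (leq0n k); have := tpt_le n kn; rewrite tpt0 tptN => -> ->.
Qed.

Lemma tpt_cell n t : 0 <= t < T -> exists2 k, (k < n.+1)%N & tpt n k <= t < tpt n k.+1.
Proof.
move=> /andP[t0 tT].
have ex : exists k, (k <= n)%N && (tpt n k <= t) by exists 0%N; rewrite tpt0.
have bd k : (k <= n)%N && (tpt n k <= t) -> (k <= n)%N by case/andP.
have [k /andP[kn kt] kmax] := ex_maxnP ex bd; exists k => //; rewrite kt/=.
rewrite ltNge; apply/negP => H; have [kn'|kn'] := ltnP k n.
  by have := kmax k.+1; rewrite kn' H => /(_ isT); rewrite ltnn.
have kE : k = n by apply/eqP; rewrite eqn_leq kn.
by move: H; rewrite kE tptN leNgt tT.
Qed.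

Lemma stepsE n t : 0 <= t < T -> exists2 k, (k < n.+1)%N &
  `|t - tpt n k| <= T / n.+1%:R /\ forall F y, steps F n (y, t) = F y (tpt n k).
Proof.
move=> /(tpt_cell n)[k kn /andP[kt tk]]; exists k => //; split.
  by rewrite ger0_norm ?subr_ge0// lerBlDl -tptS ltW.
move=> F y; have kin : k \in iota 0 n.+1 by rewrite mem_iota.
rewrite /steps (bigD1_seq k kin (iota_uniq _ _)) [fst _]/= [snd _]/=.
rewrite big1 => [|l lk]; first by rewrite kt tk !mulr1 /= addr0.
have [ll|ll|ll] := ltngtP l k; last by rewrite ll eqxx in lk.
  by rewrite [t < _]ltNge (le_trans (tpt_le n ll) kt) !mulr0.
by rewrite [_ <= t]leNgt (lt_le_trans tk (tpt_le n ll)) mul0r mulr0.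
Qed.

Lemma bm_steps F n : (forall t, bm (fun y => F y t)) -> bm (steps F n).
Proof.
move=> bF; apply: bm_sum => k; apply: bmM.
  exact: (bm_comp (bF (tpt n k)) measurable_fst).
apply: bmM; first by apply: bm_le; [exact: measurable_cst|exact: measurable_snd].
by apply: bm_lt; [exact: measurable_snd|exact: measurable_cst].
Qed.

(** Functions that are measurable in y and continuous in t are pointwise limits of their piecewise
    constant interpolations [steps]. These vanish outside [0, T[, so the time T is excluded from the
    conclusion. *)
Lemma caratheodory F C B : (forall t, bm (fun y => F y t)) ->
  (forall y t, 0 <= t <= T -> `|F y t| <= B) ->
  (forall y s t, 0 <= s <= T -> 0 <= t <= T -> `|F y t - F y s| <= C * `|t - s|) ->
  exists2 G : Y * mR -> R, bm G & forall y t, 0 <= t < T -> G (y, t) = F y t.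
Proof.
move=> bF FB FC.
pose G (p : Y * mR) : R := F p.1 p.2 * ((0 <= p.2)%R%:R * (p.2 < T)%R%:R).
exists G; last by move=> y t /andP[t0 tT]; rewrite /G/= t0 tT !mulr1.
split; last first.
  exists `|B| => -[y t]; rewrite /G/=.
  have [/andP[t0 tT]|] := boolP (0 <= t < T).
    by rewrite t0 tT !mulr1 (le_trans (FB y t _)) ?ler_norm// t0 ltW.
  by rewrite negb_and => /orP[/negbTE->|/negbTE->]; rewrite ?mul0r ?mulr0 normr0.
apply: (@measurable_fun_cvg _ _ _ setT (fun n => steps F n)).
  by move=> n; have [] := bm_steps n bF.
move=> -[y t] _.
have [tI|tI] := boolP (0 <= t < T); last first.
  have -> : G (y, t) = 0.
    by rewrite /G/=; move: tI; rewrite negb_and => /orP[/negbTE->|/negbTE->]; rewrite ?mul0r ?mulr0.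
  have -> : (fun n => steps F n (y, t)) = fun=> 0; last exact: cvg_cst.
  apply/funext => n; rewrite /steps big_seq big1// => k; rewrite mem_iota /= add0n => kn.
  move: tI; rewrite negb_and -!ltNge -leNgt => /orP[t0|tT].
    rewrite [_ <= t]leNgt (lt_le_trans t0) ?mul0r ?mulr0//.
    by have /andP[] := tpt_itv (ltnW kn).
  rewrite [t < _]ltNge (le_trans _ tT) ?mulr0//.
  by have /andP[] := tpt_itv kn.
have -> : G (y, t) = F y t by rewrite /G/=; have /andP[-> ->] := tI; rewrite !mulr1.
apply/cvgrPdist_le => e e0.
near=> n.
have [k kn [tk ->]] := stepsE n tI.
have C1 : 0 < `|C| + 1 by rewrite ltr_wpDl.
have {}tI : 0 <= t <= T by have /andP[-> /ltW ->] := tI.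
apply: le_trans (FC y _ _ (tpt_itv (ltnW kn)) tI) _.
apply: le_trans (_ : (`|C| + 1) * (T / n.+1%:R) <= _).
  apply: le_trans (ler_wpM2r (normr_ge0 _) (_ : C <= `|C| + 1)) _.
    by rewrite (le_trans (ler_norm C))// lerDl.
  by apply: ler_wpM2l => //; exact: ltW.
near: n; have [N _ HN] : \forall n \near \oo, (`|C| + 1) * T / e < n%:R :> R by exact: nbhs_infty_gtr.
exists N => // n /HN; rewrite /= mulrA ler_pdivrMr ?ltr0n// ltr_pdivrMr// => h.
rewrite mulrC; apply: le_trans (_ : n%:R * e <= _); first by rewrite mulrC ltW.
by rewrite mulrC ler_wpM2l ?ler_nat// ltW.
Unshelve. all: by end_near.
Qed.

End TimeSteps.

(** * Entropies and their nondecreasing densities *)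

Section EntropyPairs.
Context {R : realType}.
Local Notation mu := (@lebesgue_measure R).
Local Notation h2 := (2^-1 : R).
Local Notation mR := (measurableTypeR R).

Definition entropy_pair (eta g : R -> R) := [/\ entropy eta, has_density eta g &
  exists2 N, null_set N & forall m, - h2 <= m <= h2 -> ~ N m -> derive1 eta m = g m].

Lemma entropy_has_pair eta : entropy eta -> exists2 g, entropy_pair eta g &
  {homo g : x y / x <= y} /\ exists L, forall m, `|g m| <= L.
Proof.
move=> he; have [g [L L0 [gh gL gE gN]]] := entropy_density he.
exists g; last by split=> //; exists L.
by split=> //; split=> //; exact: bm_homo gL.
Qed.

(** The converse of [entropy_has_pair]: the primitive of g lies above its tangent lines of slope g
    z, hence is convex. It allows the entropy inequality to be tested with indicators of superlevel
    sets. *)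
Lemma has_pair_entropy (g : R -> R) L : {homo g : x y / x <= y} -> (forall m, `|g m| <= L) ->
  exists eta, entropy_pair eta g.
Proof.
move=> gh gL; have bg : bm (g : mR -> R) by exact: bm_homo gL.
have L0 : 0 <= L by apply: le_trans (gL 0).
have itg := lam_mu_integrable (- h2) h2 bg.
have [N nN HN] := ftc_null itg.
have pE (m : R) : prim g m = \int[lam (- h2) m]_y g y by exact: bm_prim.
have pS (x y : R) : - h2 <= x -> x <= y -> prim g y = prim g x + \int[lam x y]_z g z.
  by move=> x1 xy; rewrite !pE (lam_split bg x1 xy).
have pub (x y z : R) : x <= y -> y <= z -> \int[lam x y]_u g u <= g z * (y - x).
  move=> xy yz; rewrite -(lam_cst (g z) xy); apply: lam_le => //; first exact: bm_cst.
  by move=> u /andP[_ uy]; apply: gh; lra.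
have plb (x y z : R) : x <= y -> z <= x -> g z * (y - x) <= \int[lam x y]_u g u.
  move=> xy yz; rewrite -(lam_cst (g z) xy); apply: lam_le => //; first exact: bm_cst.
  by move=> u /andP[ux _]; apply: gh; lra.
(* the graph of prim g lies above its chord slopes g z *)
have tang (x z : R) : - h2 <= x -> - h2 <= z -> prim g z + g z * (x - z) <= prim g x.
  move=> x1 z1; have [xz|/ltW zx] := leP x z.
    rewrite (pS x z)//; have := pub x z z xz (lexx z); lra.
  rewrite (pS z x)//; have := plb z x z zx (lexx z); lra.
exists (prim g); split.
- split.
    move=> t x y /set_mem xI /set_mem yI.
    have /half_itvE /andP[x1 x2] := xI; have /half_itvE /andP[y1 y2] := yI.
    pose u : R := t%:num.
    change (prim g (u * x + (1 - u) * y) <= u * prim g x + (1 - u) * prim g y).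
    have t0 : 0 <= u by rewrite /u.
    have t1 : 0 <= 1 - u by rewrite subr_ge0; exact: (ltac:(by []) : t%:num <= 1 :> R).
    set z := (X in prim g X <= _).
    have zI : - h2 <= z.
      rewrite /z; have : u * (- h2) <= u * x by exact: ler_wpM2l.
      have : (1 - u) * (- h2) <= (1 - u) * y by exact: ler_wpM2l.
      lra.
    have := ler_wpM2l t0 (tang x z x1 zI); have := ler_wpM2l t1 (tang y z y1 zI).
    have : (1 - u) * (prim g z + g z * (y - z)) + u * (prim g z + g z * (x - z)) = prim g z.
      by rewrite /z; ring.
    lra.
  apply: (@le_lt_trans _ _ L%:E); last exact: ltry.
  apply: ge_ereal_sup => _ [m [m' [mI m'I mm ->]]]; rewrite lee_fin.
  rewrite ler_pdivrMr ?normr_gt0 ?subr_eq0//.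
  move: mI m'I => /half_itvE /andP[m1 m2] /half_itvE /andP[m3 m4].
  have key (x y : R) : - h2 <= x -> x <= y -> `|prim g y - prim g x| <= L * (y - x).
    move=> x1 xy; rewrite (pS x y)// addrC addKr.
    apply: le_trans (int_norm (lam x y) bg) _; rewrite -(lam_cst L xy).
    by apply: lam_le => //; [exact: bm_norm|exact: bm_cst].
  have [mm'|/ltW mm'] := leP m m'.
    by rewrite distrC [X in L * X]distrC [X in L * X]ger0_norm ?subr_ge0//; exact: key.
  by rewrite [X in L * X]ger0_norm ?subr_ge0//; exact: key.
- split=> // m mI; rewrite !pE [X in _ = X + _]lam_empty ?add0r//.
- exists (N `|` ([set - h2] `|` [set h2])).
    by apply: null_setU => //; apply: null_setU; exact: null_set1.
  move=> m /andP[m1 m2] Nm; have [] := HN m => //; last by move=> Nm'; apply: Nm; left.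
  apply/andP; split; rewrite lt_neqAle ?m1 ?m2 andbT; apply/eqP => mE; apply: Nm; right.
    by left; rewrite /= mE.
  by right; rewrite /= mE.
Qed.

End EntropyPairs.

(** * Uniform continuity on the time interval *)

Section UniformContinuity.
Context {R : realType}.
Local Notation mR := (measurableTypeR R).
Variable T : R.
Hypothesis T0 : 0 < T.

Definition ucont_on (D : R -> R -> R) := forall e, 0 < e -> exists2 dl, 0 < dl &
  forall s t, 0 <= s <= T -> 0 <= t <= T -> `|t - s| <= dl -> D t s <= e.

(** The Heine-Cantor theorem for a quantity D subject to a triangle inequality, applied to the L1
    distance of quantiles at two times. *)
Lemma ucont_compact (D : R -> R -> R) :
  (forall r s t, 0 <= r <= T -> 0 <= s <= T -> 0 <= t <= T -> D t s <= D t r + D s r) ->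
  (forall t, 0 <= t <= T -> forall e, 0 < e -> exists2 dl, 0 < dl &
    forall s, 0 <= s <= T -> `|s - t| < dl -> D s t <= e) -> ucont_on D.
Proof.
move=> Dtri Dc e e0.
have /compact_near_coveringP : compact `[0, T]%classic by exact: segment_compact.
have Fd : ProperFilter (0^'+ : set_system R) by exact: at_right_proper_filter.
pose P (dl : R) (s : R) := 0 <= s <= T -> forall t, 0 <= t <= T -> `|t - s| <= dl -> D t s <= e.
move=> /(_ _ (0^'+ : set_system R) P _)[].
  move=> r; rewrite /= in_itv/= => rI.
  have [dl dl0 Hd] := Dc r rI (e / 2) (divr_gt0 e0 (ltr0Sn R 1)).
  exists (ball r (dl / 2), [set d | 0 < d < dl / 2]) => /=.
    split; first exact: nbhsx_ballx (divr_gt0 dl0 (ltr0Sn R 1)).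
    exists (dl / 2); first by rewrite /= divr_gt0.
    by move=> x /=; rewrite sub0r normrN => xd x0; rewrite x0/= (le_lt_trans (ler_norm x)).
  move=> [s d]/= [rs /andP[d0 dd]] sI t tI ts.
  move: rs; rewrite /ball/= distrC => rs.
  have := Dtri r s t rI sI tI; have := Hd s sI; have := Hd t tI.
  have h1 : `|s - r| < dl by lra.
  have h3 : `|t - r| < dl.
    have := ler_normD (t - s) (s - r); rewrite addrA subrK; lra.
  by move=> /(_ h3) h4 /(_ h1); lra.
move=> d0 /= d00 H; exists (d0 / 2); first exact: divr_gt0 d00 (ltr0Sn R 1).
move=> s t sI tI ts; have := H (d0 / 2); rewrite /= sub0r normrN gtr0_norm ?divr_gt0//.
have h : d0 / 2 < d0 by move: d00 => /=; lra.
by move=> /(_ h isT s); rewrite /= in_itv/= => /(_ sI sI t tI ts).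
Qed.

Definition ucont (S : R -> R) := ucont_on (fun t s => `|S t - S s|).

(** Functions of time are controlled on [0, T] only; composing with this projection makes them
    continuous, hence measurable and bounded, on the whole line. *)
Definition tclamp (t : R) : R := Num.max 0 (Num.min t T).

Lemma tclamp_itv t : 0 <= tclamp t <= T.
Proof. by rewrite /tclamp le_max lexx/= ge_max (ltW T0) ge_min lexx orbT. Qed.

Lemma tclamp_id t : 0 <= t <= T -> tclamp t = t.
Proof. by move=> /andP[t0 tT]; rewrite /tclamp min_l// max_r. Qed.

Lemma tclamp_lip s t : `|tclamp s - tclamp t| <= `|s - t|.
Proof.
have T1 := ltW T0; rewrite /tclamp; have hT : Num.max 0 T = T by rewrite max_r.
have := ler_norm (s - t); have := ler_norm (t - s); rewrite [`|t - s|]distrC ler_norml.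
case: (leP s T) => sT; case: (leP t T) => tT; rewrite ?hT;
  case: (leP 0 s) => h1; case: (leP 0 t) => h3;
  move=> h4 h5; apply/andP; split; lra.
Qed.

Lemma ucont_continuous S : ucont S -> continuous (fun t => S (tclamp t)).
Proof.
move=> uS t; apply/cvgrPdist_le => e e0; have [dl dl0 Hd] := uS e e0.
exists dl => // s /= ts; apply: Hd; [exact: tclamp_itv|exact: tclamp_itv|].
exact: le_trans (tclamp_lip _ _) (ltW ts).
Qed.

Lemma ucont_bounded S : ucont S -> exists B, forall t, 0 <= t <= T -> `|S t| <= B.
Proof.
move=> uS; have cS := ucont_continuous uS.
have [|c _ Hc] := @EVT_max R (fun t => `|S (tclamp t)|) 0 T (ltW T0).
  apply: continuous_subspaceT => t; apply: cvg_norm; exact: cS.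
exists (`|S (tclamp c)|) => t tI; have := Hc t; rewrite in_itv/= tclamp_id//; exact.
Qed.

Lemma ucont_bm S : ucont S -> bm ((fun t => S (tclamp t)) : mR -> R).
Proof.
move=> uS; have [B HB] := ucont_bounded uS.
apply: (@continuous_bm _ _ B); first exact: ucont_continuous.
by move=> t; apply: HB; exact: tclamp_itv.
Qed.

End UniformContinuity.

Section IntegralBounds.
Context {d} {Y : measurableType d} {R : realType}.
Variable la : {finite_measure set Y -> \bar R}.
Implicit Types u v : Y -> R.

Lemma int_ge0 u : bm u -> (forall y, 0 <= u y) -> 0 <= \int[la]_y u y.
Proof.
by move=> bu u0; have := int_le la (bm_cst 0) bu u0; rewrite int_cst mul0r.
Qed.

Lemma int_prod_dist u v u' v' V B : bm u -> bm v -> bm u' -> bm v' ->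
  (forall y, `|v y| <= V) -> (forall y, `|u' y| <= B) ->
  `|\int[la]_y (u y * v y) - \int[la]_y (u' y * v' y)| <=
  V * \int[la]_y `|u y - u' y| + B * \int[la]_y `|v y - v' y|.
Proof.
move=> bu bv bu' bv' hv hu'.
have b1 := bmM bu bv; have b2 := bmM bu' bv'.
have b3 := bm_norm (bmB bu bu'); have b4 := bm_norm (bmB bv bv').
rewrite -intB//; apply: le_trans (int_norm la (bmB b1 b2)) _.
rewrite -!intZ//.
have b5 := bmM (bm_cst V) b3; have b6 := bmM (bm_cst B) b4.
rewrite -(intD la b5 b6); apply: int_le; [exact: bm_norm (bmB b1 b2)|exact: bmD b5 b6|].
move=> y; have -> : u y * v y - u' y * v' y = v y * (u y - u' y) + u' y * (v y - v' y) by ring.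
by apply: le_trans (ler_normD _ _) _; rewrite !normrM lerD// ler_wpM2r.
Qed.

End IntegralBounds.

(** * L1 continuity of the velocity and of the entropy rate *)

Section RateContinuity.
Context {R : realType}.
Local Notation mu := (@lebesgue_measure R).
Local Notation h2 := (2^-1 : R).
Local Notation lI := (lam (- 2^-1 : R) 2^-1).
Local Notation mR := (measurableTypeR R).

Definition l1d (X Y : R -> R) := \int[lI]_m `|X m - Y m|.

Definition mono (Q : R) (X : R -> R) := {homo X : x y / x <= y} /\ forall m, `|X m| <= Q.

Lemma lI1 (c : R) : \int[lI]_m (fun=> c) m = c.
Proof. by rewrite lam_cst; lra. Qed.

Lemma bm_mono Q X : mono Q X -> bm (X : mR -> R).
Proof. by move=> [hX XQ]; exact: bm_homo XQ. Qed.

Lemma l1d_ge0 (X Y : R -> R) : bm (X : mR -> R) -> bm (Y : mR -> R) -> 0 <= l1d X Y.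
Proof. by move=> bX bY; apply: int_ge0 => //; apply: bm_norm; exact: bmB. Qed.

Lemma l1d_sym X Y : l1d X Y = l1d Y X.
Proof. by apply: int_ext => m; rewrite distrC. Qed.

Lemma l1d_tri (X Y Z : R -> R) : bm (X : mR -> R) -> bm (Y : mR -> R) -> bm (Z : mR -> R) ->
  l1d X Z <= l1d X Y + l1d Y Z.
Proof.
move=> bX bY bZ; have b1 := bm_norm (bmB bX bY); have b2 := bm_norm (bmB bY bZ).
rewrite /l1d -(intD lI b1 b2); apply: int_le; [exact: bm_norm (bmB bX bZ)|exact: bmD|].
by move=> m; rewrite (_ : X m - Z m = (X m - Y m) + (Y m - Z m)) ?ler_normD//; ring.
Qed.

Lemma l1d_le_sup (X Y : R -> R) c : bm (X : mR -> R) -> bm (Y : mR -> R) ->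
  (forall m, `|X m - Y m| <= c) -> l1d X Y <= c.
Proof.
move=> bX bY H; rewrite -(lI1 c); apply: int_le => //; last exact: bm_cst.
exact: bm_norm (bmB bX bY).
Qed.

Variables (W : R -> R) (T : R) (A a : R -> R -> R) (L Q : R).
Hypotheses (hW : good_kernel W) (fd : flux_density T A a L).

Let ba t : bm (a t : mR -> R). Proof. by have [_ h _ _ _] := fd; have [] := h t. Qed.

Lemma bm_velm t X : mono Q X -> bm (vel W (a t) X : mR -> R).
Proof. by move=> [hX XQ]; exact: (bm_vel hW (ba t) hX XQ). Qed.

Lemma velm_bound t X m : mono Q X -> `|vel W (a t) X m| <= L + W (Q + Q).
Proof. by move=> [hX XQ]; have [_ h _ _ _] := fd; apply: vel_bound => //; exact: (h t).2. Qed.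

(** Continuity in the linear form error e plus C times the distance, inherited from the kernel,
    which is uniformly continuous but perhaps not Lipschitz. *)
Lemma vel_cont e : 0 < e -> exists2 C, 0 <= C & forall X Y s t, mono Q X -> mono Q Y ->
  0 <= s <= T -> 0 <= t <= T ->
  l1d (vel W (a t) X) (vel W (a s) Y) <= e + C * (l1d X Y + `|t - s|).
Proof.
move=> e0; have [_ _ /(_ e e0)[C C0 HC]] := hW; have [L0 _ _ _ La] := fd.
(* L accounts for the flux; C occurs twice because the argument X m - X n changes through both m and
   n. *)
exists (Num.max L (C + C)); first by rewrite le_max L0.
move=> X Y s t mX mY sI tI; have [N nN HN] := La s t sI tI.
have [hX XQ] := mX; have [hY YQ] := mY.
have bX := bm_mono mX; have bY := bm_mono mY; have bXY := bm_norm (bmB bX bY).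
have key m : ~ N m -> - h2 <= m <= h2 ->
    `|vel W (a t) X m - vel W (a s) Y m| <= L * `|t - s| + (e + C * (`|X m - Y m| + l1d X Y)).
  move=> Nm mI; have k1 := bm_sec1 m (bm_kernel hW hX hX XQ XQ).
  have k2 := bm_sec1 m (bm_kernel hW hY hY YQ YQ).
  have -> : vel W (a t) X m - vel W (a s) Y m =
      (a t m - a s m) - \int[lI]_n (W (X m - X n) - W (Y m - Y n)).
    by rewrite (intB lI k1 k2) /vel /=; ring.
  apply: le_trans (ler_normB _ _) _; apply: lerD; first exact: HN.
  apply: le_trans (int_norm lI (bmB k1 k2)) _.
  have b1 := bmD (bm_cst (`|X m - Y m|)) bXY.
  have b2 := bmM (bm_cst C) b1.
  have b3 := bmD (bm_cst e) b2.
  apply: le_trans (int_le lI (bm_norm (bmB k1 k2)) b3 _) _.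
    move=> n /=; apply: le_trans (HC _ _) _; rewrite lerD2l ler_wpM2l//.
    rewrite (_ : X m - X n - (Y m - Y n) = (X m - Y m) - (X n - Y n)); last by ring.
    exact: ler_normB.
  rewrite (intD lI (bm_cst e) b2) lI1 (intZ lI C b1) (intD lI (bm_cst _) bXY).
  by rewrite lI1.
have b1 := bmD bXY (bm_cst (l1d X Y)).
have b2 := bmM (bm_cst C) b1; have b3 := bmD (bm_cst e) b2.
have b4 := bmD (bm_cst (L * `|t - s|)) b3.
have bv := bm_norm (bmB (bm_velm t mX) (bm_velm s mY)).
rewrite /l1d; apply: le_trans (lam_le_null nN bv b4 _) _.
  by move=> m mI Nm; exact: key.
rewrite (intD lI (bm_cst _) b3) lI1 (intD lI (bm_cst e) b2) lI1.
rewrite (intZ lI C b1) (intD lI bXY (bm_cst _)) lI1 -/(l1d X Y).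
have d0 : 0 <= l1d X Y by exact: l1d_ge0.
rewrite mulrDr addrCA lerD2l addrC mulrDr -mulrDl; apply: lerD; apply: ler_wpM2r => //.
  by rewrite le_max lexx orbT.
by rewrite le_max lexx.
Qed.

(* In the applications z is a test function zeta and p is a primitive in x of  *)
(* its time derivative.                                                        *)
Definition strip_pair K (p z : R -> R -> R) := [/\ forall t, continuous (p t),
  forall t, continuous (z t),
  forall t x, `|x| <= Q -> `|p t x| <= K /\ `|z t x| <= K &
  forall t s x y, `|x| <= Q -> `|y| <= Q -> `|p t x - p s y| <= K * (`|x - y| + `|t - s|) /\
    `|z t x - z s y| <= K * (`|x - y| + `|t - s|)].

Lemma bm_contX (f X : R -> R) K : continuous f -> mono Q X ->
  (forall x, `|x| <= Q -> `|f x| <= K) -> bm ((fun m => f (X m)) : mR -> R).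
Proof.
move=> cf [hX XQ] fK; split; last by exists K => m; exact: fK.
apply: (@measurableT_comp _ _ _ mR mR mR (f : mR -> mR)); last exact: measurable_homo.
exact: continuous_measurable_fun.
Qed.

Lemma slice_cont K p z (g : R -> R) : strip_pair K p z -> bm (g : mR -> R) ->
  forall e, 0 < e -> exists2 C, 0 <= C & forall X Y s t, mono Q X -> mono Q Y ->
  0 <= s <= T -> 0 <= t <= T ->
  `|slice_rate W (a t) g (p t) (z t) X - slice_rate W (a s) g (p s) (z s) Y| <=
  e + C * (l1d X Y + `|t - s|).
Proof.
move=> [cp cz pzK pzL] bg e e0.
have [_ [G0 hG]] := bg; pose G := `|G0|.
have gG m : `|g m| <= G by apply: le_trans (hG m) _; exact: ler_norm.
have GG : 0 <= G by exact: normr_ge0.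
pose V := `|L + W (Q + Q)|; have V0 : 0 <= V by exact: normr_ge0.
pose K' := `|K|; have K0 : 0 <= K' by exact: normr_ge0.
have e1 : 0 < e / (G * K' + 1) by rewrite divr_gt0// ltr_wpDl// mulr_ge0.
have [C C0 HC] := vel_cont e1.
exists (G * K' * (1 + V + C)).
  by apply: mulr_ge0; [exact: mulr_ge0|apply: addr_ge0 => //; apply: addr_ge0].
move=> X Y s t mX mY sI tI; have [hX XQ] := mX; have [hY YQ] := mY.
have bX := bm_mono mX; have bY := bm_mono mY; have bXY := bm_norm (bmB bX bY).
have d0 : 0 <= l1d X Y by exact: l1d_ge0.
have bpX r Z : mono Q Z -> bm ((fun m => p r (Z m)) : mR -> R).
  by move=> mZ; apply: (bm_contX (K := K) (cp r) mZ) => x xQ; exact: (pzK r x xQ).1.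
have bzX r Z : mono Q Z -> bm ((fun m => z r (Z m)) : mR -> R).
  by move=> mZ; apply: (bm_contX (K := K) (cz r) mZ) => x xQ; exact: (pzK r x xQ).2.
have bvX := bm_velm t mX; have bvY := bm_velm s mY.
pose uX (m : mR) : R := p t (X m) + z t (X m) * vel W (a t) X m.
pose uY (m : mR) : R := p s (Y m) + z s (Y m) * vel W (a s) Y m.
have buX : bm uX by apply: bmD; [exact: bpX|apply: bmM => //; exact: bzX].
have buY : bm uY by apply: bmD; [exact: bpX|apply: bmM => //; exact: bzX].
rewrite /slice_rate -(intB lI (bmM bg buX) (bmM bg buY)).
apply: le_trans (int_norm lI (bmB (bmM bg buX) (bmM bg buY))) _.
have bvd := bm_norm (bmB bvX bvY).
have b1 := bmD bXY (bm_cst `|t - s|); have b2 := bmM (bm_cst (K' * (1 + V))) b1.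
have b3 := bmM (bm_cst K') bvd.
have b4 := bmM (bm_cst G) (bmD b2 b3).
apply: le_trans (int_le lI (bm_norm (bmB (bmM bg buX) (bmM bg buY))) b4 _) _.
  move=> m /=; rewrite -mulrBr normrM; apply: ler_pM => //.
  have [h1 h3] := pzL t s (X m) (Y m) (XQ m) (YQ m).
  have -> : uX m - uY m = (p t (X m) - p s (Y m)) +
     ((z t (X m) - z s (Y m)) * vel W (a t) X m + z s (Y m) * (vel W (a t) X m - vel W (a s) Y m)).
    by rewrite /uX /uY; ring.
  have dd0 : 0 <= `|X m - Y m| + `|t - s| by rewrite addr_ge0.
  have KK : K * (`|X m - Y m| + `|t - s|) <= K' * (`|X m - Y m| + `|t - s|).
    by rewrite ler_wpM2r// ler_norm.
  apply: le_trans (ler_normD _ _) _.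
  set dd := `|X m - Y m| + `|t - s| in h1 h3 dd0 KK *.
  set w := `|vel W (a t) X m - vel W (a s) Y m|.
  rewrite (_ : K' * (1 + V) * dd + K' * w = K' * dd + (K' * dd * V + K' * w)); last by ring.
  apply: lerD; first exact: le_trans h1 KK.
  apply: le_trans (ler_normD _ _) _; rewrite !normrM; apply: lerD.
    apply: ler_pM => //; first exact: le_trans h3 KK.
    by apply: le_trans (velm_bound t m mX) _; exact: ler_norm.
  apply: ler_wpM2r => //; apply: le_trans (pzK s (Y m) (YQ m)).2 _; exact: ler_norm.
rewrite (intZ lI G (bmD b2 b3)) (intD lI b2 b3) (intZ lI _ b1) (intZ lI _ bvd).
rewrite (intD lI bXY (bm_cst _)) lI1 -/(l1d X Y).
have := HC X Y s t mX mY sI tI; rewrite {1}/l1d.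
set D := \int[lI]_m `|_ - _| => hD.
have GK : 0 <= G * K' by exact: mulr_ge0.
have h1 : G * K' * D <= G * K' * (e / (G * K' + 1) + C * (l1d X Y + `|t - s|)).
  exact: ler_wpM2l.
have h3 : G * K' * (e / (G * K' + 1)) <= e.
  rewrite mulrCA -[leRHS]mulr1 ler_wpM2l ?(ltW e0)//.
  by rewrite ler_pdivrMr ?mul1r ?lerDl// ltr_wpDl.
have -> : G * (K' * (1 + V) * (l1d X Y + `|t - s|) + K' * D) =
  G * K' * (1 + V) * (l1d X Y + `|t - s|) + G * K' * D by ring.
have -> : G * K' * (1 + V + C) * (l1d X Y + `|t - s|) =
  G * K' * (1 + V) * (l1d X Y + `|t - s|) + G * K' * (C * (l1d X Y + `|t - s|)) by ring.
by rewrite mulrDr in h1; lra.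
Qed.

Lemma profile_mono f Y : profile f Y Q -> mono Q Y.
Proof. by move=> [_ _ h1 h3 _]. Qed.

Lemma ucont_slice K p z (g : R -> R) X : strip_pair K p z -> bm (g : mR -> R) ->
  (forall t, 0 <= t <= T -> mono Q (X t)) -> ucont_on T (fun t s => l1d (X t) (X s)) ->
  ucont T (fun t => slice_rate W (a t) g (p t) (z t) (X t)).
Proof.
move=> sp bg hm uX e e0; have [C C0 HC] := slice_cont sp bg (divr_gt0 e0 (ltr0Sn R 1)).
have C1 : 0 < 4 * (C + 1) by lra.
have e1 : 0 < e / (4 * (C + 1)) by rewrite divr_gt0.
have [d d0 Hd] := uX _ e1.
exists (Num.min d (e / (4 * (C + 1)))); first by rewrite lt_min d0.
move=> s t sI tI; rewrite le_min => /andP[td te].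
apply: le_trans (HC (X t) (X s) s t (hm t tI) (hm s sI) sI tI) _.
have h := Hd s t sI tI td.
have h1 : C * (l1d (X t) (X s) + `|t - s|) <= (C + 1) * (e / (4 * (C + 1)) + e / (4 * (C + 1))).
  apply: ler_pM => //; [|by lra|exact: lerD].
  by apply: addr_ge0 => //; apply: l1d_ge0; apply: bm_mono; exact: hm.
have : (C + 1) * (e / (4 * (C + 1)) + e / (4 * (C + 1))) = e / 2.
  by field; rewrite gt_eqF//; lra.
by move=> h3; rewrite h3 in h1; lra.
Qed.

End RateContinuity.

(** * Sections and Lipschitz bounds of test functions on the strip *)

Section StripTestFunctions.
Context {R : realType}.
Local Notation mu := (@lebesgue_measure R).
Local Notation mR := (measurableTypeR R).
Local Notation e10 := ((1, 0) : R * R).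
Local Notation e01 := ((0, 1) : R * R).
Implicit Types f : R * R -> R.

Lemma strip_support T f : test_function (strip T) f -> exists2 Q, 0 <= Q &
  forall x t, Q <= `|x| \/ ~~ (0 < t < T) -> f (x, t) = 0.
Proof.
move=> [sf Kf fU]; have [M [_ HM]] := compact_bounded Kf.
exists (`|M| + 2); first by rewrite addr_ge0.
move=> x t H; apply: contrapT => /eqP fx.
have cl : closure [set p | f p != 0] (x, t) by exact: subset_closure.
have [_] := fU _ cl; rewrite /= in_itv/= => tT; case: H; last by rewrite tT.
apply/negP; rewrite -ltNge; have := HM (`|M| + 1) _ _ cl.
rewrite (le_lt_trans (ler_norm M)) ?ltrDl// => /(_ isT).
by rewrite /= prod_normE ge_max/= => /andP[? _]; lra.
Qed.

Lemma lam_lip (q x y C : R) (f : R -> R) : bm (f : mR -> R) -> (forall x, `|f x| <= C) ->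
  `|\int[lam q x]_u f u - \int[lam q y]_u f u| <= C * `|x - y|.
Proof.
move=> bf fC; have C0 : 0 <= C by apply: le_trans (fC 0).
wlog xy : x y / x <= y.
  move=> H; have [|/ltW] := leP x y; first exact: H.
  by rewrite distrC [`|x - y|]distrC; exact: H.
have bd u v : u <= v -> `|\int[lam u v]_z f z| <= C * (v - u).
  move=> uv; apply: le_trans (int_norm (lam u v) bf) _; rewrite -(lam_cst C uv).
  by apply: lam_le => //; [exact: bm_norm|exact: bm_cst].
rewrite [X in C * X]distrC [X in C * X]ger0_norm ?subr_ge0// distrC.
have [qx|/ltW xq] := leP q x; first by rewrite (lam_split bf qx xy) addrC addKr; exact: bd.
rewrite (lam_empty bf xq) subr0; have [yq|/ltW qy] := leP y q.
  by rewrite (lam_empty bf yq) normr0 mulr_ge0// subr_ge0.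
by apply: le_trans (bd q y qy) _; rewrite ler_wpM2l//; lra.
Qed.

Lemma pairZ10 (x t : R) : (0, t) + x *: (1, 0) = (x, t) :> R * R.
Proof. by rewrite /GRing.add/GRing.scale/= /add_pair/= /GRing.scale/= mulr1 mulr0 add0r addr0. Qed.

Lemma pairZ01 (x t : R) : (x, 0) + t *: (0, 1) = (x, t) :> R * R.
Proof. by rewrite /GRing.add/GRing.scale/= /add_pair/= /GRing.scale/= mulr1 mulr0 add0r addr0. Qed.

Lemma strip_derive10 f (x t : R) : smooth f ->
  is_derive x (1 : R) (fun x => f (x, t)) ('D_(1, 0) f (x, t)).
Proof.
move=> sf; have := is_derive_line (p := (0, t) : R * R) (v := e10) (s := x)
  (@smooth_derivable _ _ f e10 _ sf).
rewrite pairZ10 => h; apply: (is_derive_ext h) => // y; by rewrite pairZ10.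
Qed.

Lemma strip_derive01 f (x t : R) : smooth f ->
  is_derive t (1 : R) (fun t => f (x, t)) ('D_(0, 1) f (x, t)).
Proof.
move=> sf; have := is_derive_line (p := (x, 0) : R * R) (v := e01) (s := t)
  (@smooth_derivable _ _ f e01 _ sf).
rewrite pairZ01 => h; apply: (is_derive_ext h) => // y; by rewrite pairZ01.
Qed.

Lemma continuous_is_derive (f f' : R -> R) : (forall x : R, is_derive x (1 : R) f (f' x)) ->
  continuous f.
Proof.
move=> df x; apply: differentiable_continuous; apply/derivable1_diffP.
by have [] := df x.
Qed.

Lemma strip_lip U f : test_function U f -> exists2 C, 0 <= C & forall x t y s : R,
  `|f (x, t)| <= C /\ `|f (x, t) - f (y, s)| <= C * (`|x - y| + `|t - s|).
Proof.
move=> tf; have [C0 HC0] := test_bounded tf.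
have [C1 C10 HC1] := test_lip e10 tf; have [C2 C20 HC2] := test_lip e01 tf.
exists (`|C0| + C1 + C2); first by rewrite !addr_ge0.
move=> x t y s; split.
  by apply: le_trans (HC0 _) _; rewrite -addrA (le_trans (ler_norm C0))// lerDl addr_ge0.
have -> : f (x, t) - f (y, s) = (f (x, t) - f (y, t)) + (f (y, t) - f (y, s)) by ring.
apply: le_trans (ler_normD _ _) _; rewrite mulrDr; apply: lerD.
  have := HC1 (y, t) (x - y); rewrite (_ : (y, t) + (x - y) *: (1, 0) = (x, t)).
    move=> h; apply: le_trans h _; rewrite ler_wpM2r//; have := normr_ge0 C0; lra.
  by rewrite /GRing.add/GRing.scale/= /add_pair/= /GRing.scale/= mulr1 mulr0 addr0 addrC subrK.
have := HC2 (y, s) (t - s); rewrite (_ : (y, s) + (t - s) *: (0, 1) = (y, t)).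
  move=> h; apply: le_trans h _; rewrite ler_wpM2r//; have := normr_ge0 C0; lra.
by rewrite /GRing.add/GRing.scale/= /add_pair/= /GRing.scale/= mulr1 mulr0 addr0 addrC subrK.
Qed.

Lemma strip_section_bm U f t : test_function U f -> bm ((fun x => f (x, t)) : mR -> R).
Proof.
move=> tf; have [C _ HC] := strip_lip tf; have [sf _ _] := tf.
apply: (@continuous_bm _ _ C); last by move=> x; exact: (HC x t x t).1.
by apply: (continuous_is_derive (f' := fun x => 'D_(1, 0) f (x, t))) => x; exact: strip_derive10.
Qed.

End StripTestFunctions.

(** * The space-time entropy inequality for quantiles *)

Section EntropyInequality.
Context {R : realType}.
Local Notation mu := (@lebesgue_measure R).
Local Notation h2 := (2^-1 : R).
Local Notation lI := (lam (- 2^-1 : R) 2^-1).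
Local Notation mR := (measurableTypeR R).
Local Notation e10 := ((1, 0) : R * R).
Local Notation e01 := ((0, 1) : R * R).
Variables (T Q : R).
Hypotheses (T0 : 0 < T) (Q0 : 0 <= Q).

Definition tprim (zeta : R * R -> R) (t x : R) : R :=
  \int[lam (- Q) x]_y 'D_(0, 1) zeta (y, t).

Lemma strip_pair_zeta zeta : test_function (strip T) zeta ->
  exists K, strip_pair Q K (tprim zeta) (fun t x => zeta (x, t)).
Proof.
move=> tz; have [sz _ _] := tz; have tz1 := test_derive e01 tz.
have [C C0 HC] := strip_lip tz; have [C1 C10 HC1] := strip_lip tz1.
have bz1 t := strip_section_bm t tz1.
have lipx t x y : `|tprim zeta t x - tprim zeta t y| <= C1 * `|x - y|.
  by apply: lam_lip => // z; exact: (HC1 z t z t).1.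
pose K := C + C1 * (1 + Q + Q).
have K1 : C <= K by rewrite lerDl mulr_ge0// !addr_ge0.
have K2 : C1 * (1 + Q + Q) <= K by rewrite lerDr.
have K0 : 0 <= K by lra.
exists K; split.
- move=> t x; apply/cvgrPdist_le => e e0; exists (e / (C1 + 1)).
    by rewrite /= divr_gt0// ltr_wpDl.
  move=> y /= xy; apply: le_trans (lipx t x y) _.
  apply: le_trans (_ : (C1 + 1) * `|x - y| <= _); first by rewrite ler_wpM2r// lerDl.
  by rewrite mulrC -ler_pdivlMr ?ltr_wpDl// ltW.
- move=> t; apply: (continuous_is_derive (f' := fun x => 'D_(1, 0) zeta (x, t))) => x.
  exact: strip_derive10.
- move=> t x xQ; split; last exact: le_trans (HC x t x t).1 K1.
  have := lipx t x (- Q); rewrite [X in _ - X]lam_empty ?subr0// => h.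
  apply: le_trans h (le_trans _ K2); rewrite ler_wpM2l//.
  by apply: le_trans (ler_normB _ _) _; rewrite normrN (ger0_norm Q0); lra.
- move=> t s x y xQ yQ; split; last first.
    by apply: le_trans (HC x t y s).2 _; rewrite ler_wpM2r// addr_ge0.
  apply: le_trans (ler_distD (tprim zeta t y) _ _) _; rewrite mulrDr; apply: lerD.
    apply: le_trans (lipx t x y) _; rewrite ler_wpM2r// (le_trans _ K2)//.
    by apply: ler_peMr => //; rewrite -addrA lerDl addr_ge0.
  have bd := bmB (bz1 t) (bz1 s).
  have Qy : - Q <= y by move: yQ; rewrite ler_norml => /andP[].
  rewrite -(intB (lam (- Q) y) (bz1 t) (bz1 s)).
  apply: le_trans (int_norm (lam (- Q) y) bd) _.
  apply: le_trans (lam_le (g := fun=> C1 * `|t - s|) (bm_norm bd) (bm_cst _) _) _.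
    move=> u _; apply: le_trans (HC1 u t u s).2 _.
    by rewrite subrr normr0 add0r.
  rewrite lam_cst// mulrAC ler_wpM2r// (le_trans _ K2)// ler_wpM2l//.
  by move: yQ; rewrite ler_norml => /andP[]; lra.
Qed.

Lemma ucont_tprim zeta : test_function (strip T) zeta -> ucont T (fun t => tprim zeta t Q).
Proof.
move=> tz; have [K [_ _ _ hL]] := strip_pair_zeta tz.
have QQ : `|Q| <= Q by rewrite ger0_norm.
move=> e e0; exists (e / (`|K| + 1)); first by rewrite divr_gt0// ltr_wpDl.
move=> s t _ _ ts; apply: le_trans (hL t s Q Q QQ QQ).1 _.
have -> : `|Q - Q| + `|t - s| = `|t - s| by rewrite subrr normr0 add0r.
apply: le_trans (_ : (`|K| + 1) * `|t - s| <= _).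
  by rewrite ler_wpM2r// (le_trans (ler_norm K))// lerDl.
by rewrite mulrC -ler_pdivlMr// ltr_wpDl.
Qed.

(** By Fubini the time derivative is integrated in t first, and zeta vanishes at times 0 and T. This
    removes the constant term of [slice_formula]. *)
Lemma int_time_derive zeta : test_function (strip T) zeta ->
  (forall x t, Q <= `|x| \/ ~~ (0 < t < T) -> zeta (x, t) = 0) ->
  \int[lam 0 T]_t tprim zeta (tclamp T t) Q = 0.
Proof.
move=> tz zs; have [sz _ _] := tz; have tz1 := test_derive e01 tz.
have [C1 C10 HC1] := strip_lip tz1.
have bz1 t := strip_section_bm t tz1.
have [||G bG GE] := @caratheodory _ mR R T T0 (fun x t => 'D_(0, 1) zeta (x, t)) C1 C1 bz1.
- by move=> x t _; exact: (HC1 x t x t).1.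
- by move=> x s t _ _; apply: le_trans (HC1 x t x s).2 _; rewrite subrr normr0 add0r.
have nT := @null_set1 R T.
have uI := ucont_tprim tz.
have bI := ucont_bm T0 uI.
rewrite (lam_eq_null nT bI (bm_int2 (lam (- Q) Q) (lam 0 T) bG)); last first.
  move=> t /andP[t0 tT] tT'; have {}tT' : t < T.
    by rewrite lt_neqAle tT andbT; apply/eqP => h; apply: tT'.
  rewrite tclamp_id ?t0//; apply: int_ext => x /=; rewrite GE// t0//.
rewrite -(int_swap (lam (- Q) Q) (lam 0 T) bG) (int_ext (lam (- Q) Q) (g := fun=> 0)).
  by rewrite int_cst mul0r.
move=> x.
have ct : continuous (fun t => 'D_(0, 1) zeta (x, t)).
  apply: (continuous_is_derive (f' := fun t => 'D_(0, 1) ('D_(0, 1) zeta) (x, t))) => t.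
  by apply: strip_derive01; exact: smooth_derive.
have bt : bm ((fun t => 'D_(0, 1) zeta (x, t)) : mR -> R).
  by apply: (@continuous_bm _ _ C1) => // t; exact: (HC1 x t x t).1.
rewrite (lam_eq_null (g := fun t => 'D_(0, 1) zeta (x, t)) nT (bm_sec1 x bG) bt); last first.
  move=> t /andP[t0 tT] tT'; rewrite GE// t0/=.
  by rewrite lt_neqAle tT andbT; apply/eqP => h; apply: tT'.
have dz (t : R) : is_derive t (1 : R) (fun t => zeta (x, t)) ('D_(0, 1) zeta (x, t)).
  exact: strip_derive01.
rewrite (lam_deriv (ltW T0) ct bt dz).
by rewrite !zs ?subrr//; right; rewrite ltxx// andbF.
Qed.

Variables (phi : R -> \bar R) (A a M X : R -> R -> R) (L : R).
Local Notation W := (Phi phi).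
Hypothesis hphi : communication_protocol phi.
Hypothesis fd : flux_density T A a L.
Hypothesis hp : forall t, 0 <= t <= T -> profile (M^~ t) (X t) Q.
Hypothesis uX : ucont_on T (fun t s => l1d (X t) (X s)).

Let hW : good_kernel W. Proof. exact: Phi_good. Qed.

(** [slice_formula] at each time gives eta(1/2) int d_t zeta minus the rate; the first part
    integrates to zero, and the minus sign reverses the inequality. *)
Lemma entropy_inequalityE eta g zeta : entropy_pair eta g ->
  test_function (strip T) zeta ->
  (forall x t, Q <= `|x| \/ ~~ (0 < t < T) -> [/\ zeta (x, t) = 0,
     'D_(0, 1) zeta (x, t) = 0 & 'D_(1, 0) zeta (x, t) = 0]) ->
  entropy_inequality phi T A M eta zeta <->
  \int[lam 0 T]_t slice_rate W (a (tclamp T t)) g (tprim zeta (tclamp T t))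
    (fun x => zeta (x, tclamp T t)) (X (tclamp T t)) <= 0.
Proof.
move=> [_ dg [N nN HN]] tz zs; have [bg _] := dg; have [sz _ _] := tz.
have [K sp] := strip_pair_zeta tz.
have tz1 := test_derive e01 tz; have tz2 := test_derive e10 tz.
have uS := ucont_slice hW fd sp bg (fun t tI => profile_mono (hp tI)) uX.
have uI := ucont_tprim tz.
have bI := ucont_bm T0 uI; have bS := ucont_bm T0 uS.
have bI' := bmM (bm_cst (eta h2)) bI.
rewrite /entropy_inequality (Rint_lam_eq (bmB bI' bS)).
  rewrite (intB (lam 0 T) bI' bS) (intZ (lam 0 T) _ bI) int_time_derive//.
    by rewrite mulr0 sub0r oppr_ge0.
  by move=> x t /zs[].
move=> t tI; rewrite tclamp_id//.
have [_ ha _ _ _] := fd.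
have qE m : - h2 <= m <= h2 ->
    entropy_flux A eta m t = \int[lam (- h2) m]_y (g y * a t y).
  by move=> mI; exact: (entropy_fluxE fd bg nN HN tI mI).
have cz1 : continuous (fun x => 'D_(1, 0) zeta (x, t)).
  apply: (continuous_is_derive (f' := fun x => 'D_(1, 0) ('D_(1, 0) zeta) (x, t))) => x.
  by apply: strip_derive10; exact: smooth_derive.
have dz (x : R) : is_derive x (1 : R) (fun x => zeta (x, t)) ('D_(1, 0) zeta (x, t)).
  exact: strip_derive10.
have supp (x : R) : Q <= `|x| -> [/\ 'D_(0, 1) zeta (x, t) = 0, zeta (x, t) = 0 &
    'D_(1, 0) zeta (x, t) = 0].
  by move=> xQ; have [] := zs x t (or_introl xQ).
exact: (slice_formula hphi (hp tI) dg (ha t).1 qE (strip_section_bm t tz1)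
  (strip_section_bm t tz) (strip_section_bm t tz2) cz1 dz supp).
Qed.

(** On the common range [-Q, Q] the L1 distances of the profiles and of the quantiles coincide, so
    local L1 continuity of M is continuity of X, uniform by compactness of [0, T]. *)
Lemma time_continuity : continuous_L1loc T M -> ucont_on T (fun t s => l1d (X t) (X s)).
Proof.
move=> cM; apply: ucont_compact => //.
  move=> r s t rI sI tI; have bX u (uI : 0 <= u <= T) := bm_mono (profile_mono (hp uI)).
  by rewrite (l1d_sym (X s)); apply: l1d_tri; exact: bX.
move=> t tI e e0.
have cK : compact `[- Q, Q]%classic by exact: segment_compact.
have tI' : `[0, T]%classic t by rewrite /= in_itv.
have H := cM _ cK t tI'.
have dE s : 0 <= s <= T ->
    (\int[mu]_(x in `[(- Q)%R, Q]) `|M x s - M x t|%:E)%E = (l1d (X s) (X t))%:E.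
  move=> sI; have [hM MI hX XQ q] := hp sI; have [hM' MI' hX' XQ' q'] := hp tI.
  rewrite /l1d (quantile_L1 hM hX q hM' hX' q' XQ XQ' MI MI').
  have bM u : 0 <= u <= T -> bm ((fun x => M x u) : mR -> R).
    move=> uI; have [hMu MIu _ _ _] := hp uI; apply: (bm_homo (C := 2^-1)) => // x.
    by rewrite ler_norml; apply/half_itvE; exact: MIu.
  have bd := bm_norm (bmB (bM s sI) (bM t tI)).
  rewrite -(Rint_lam _ _ bd) /Rintegral fineK//.
  apply: integral_fune_fin_num => //; exact: lam_mu_integrable.
have : (fun s => (\int[mu]_(x in `[(- Q)%R, Q]) `|M x s - M x t|%:E)%E)
    @ within `[0, T]%classic (nbhs t) --> (0 : R)%:E by exact: H.
move=> /fine_cvg /cvgrPdist_lt /(_ e e0) /= [d d0 Hd]; exists d => // s sI sd.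
have := Hd s; rewrite /= distrC => /(_ sd); rewrite in_itv/= => /(_ sI).
by rewrite dE//= sub0r normrN => /ltW; apply: le_trans; exact: ler_norm.
Qed.

End EntropyInequality.

(** * Stability *)

Section WeakMonotonicity.
Context {R : realType}.
Local Notation mR := (measurableTypeR R).

Definition ramp (u v x : R) : R := sstep ((v - u)^-1 * x + - u / (v - u)).
Definition dramp (u v x : R) : R := derive1 sstep ((v - u)^-1 * x + - u / (v - u)) / (v - u).

Let rampE (u v x : R) : (v - u)^-1 * x + - u / (v - u) = (x - u) / (v - u).
Proof. by rewrite mulrC -mulrDl. Qed.

Lemma smooth_ramp u v : smooth (ramp u v).
Proof. exact/smooth_affine/smooth_sstep. Qed.

Lemma is_derive_ramp u v (x : R) : is_derive x (1 : R) (ramp u v) (dramp u v x).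
Proof. by apply: is_derive_affine; apply: smooth_is_derive; exact: smooth_sstep. Qed.

Lemma ramp0 u v x : u < v -> x <= u -> ramp u v x = 0.
Proof.
by move=> uv xu; rewrite /ramp rampE sstep0// mulr_le0_ge0 ?invr_ge0 ?subr_le0// subr_ge0 ltW.
Qed.

Lemma ramp1 u v x : u < v -> v <= x -> ramp u v x = 1.
Proof.
by move=> uv vx; rewrite /ramp rampE sstep1// ler_pdivlMr ?subr_gt0// mul1r lerD2r.
Qed.

Lemma ramp_ge0 u v x : 0 <= ramp u v x. Proof. exact: sstep_ge0. Qed.
Lemma ramp_le1 u v x : ramp u v x <= 1. Proof. exact: sstep_le1. Qed.

Lemma dramp_ge0 u v x : u < v -> 0 <= dramp u v x.
Proof. by move=> uv; rewrite divr_ge0 ?sstep_derive_ge0// subr_ge0 ltW. Qed.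

Lemma dramp_supp u v x : u < v -> dramp u v x != 0 -> u <= x <= v.
Proof.
move=> uv; apply: contraNT; rewrite negb_and -!ltNge => H; rewrite /dramp rampE.
rewrite sstep_derive0 ?mul0r//; case/orP: H => H; [left|right].
  by rewrite pmulr_llt0 ?invr_gt0 ?subr_gt0// subr_lt0.
by rewrite ltr_pdivlMr ?subr_gt0// mul1r ltrD2r.
Qed.

Lemma derive1_ramp u v : derive1 (ramp u v) = dramp u v.
Proof. by apply/funext => x; rewrite derive1E; have [_ ->] := is_derive_ramp u v x. Qed.

Lemma test_dramp u v : u < v -> test_function setT (dramp u v).
Proof.
move=> uv; apply: (@test_itv _ _ _ u v) => //; last by move=> x; exact: dramp_supp.
by rewrite -derive1_ramp; apply: smooth_derive1; exact: smooth_ramp.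
Qed.

(** [dramp u v] is a probability density on [u, v], so the integral is an average of values of H
    near K. *)
Lemma ramp_average T u v (H : R -> R) K e : u < v -> 0 <= u -> v <= T ->
  bm (H : mR -> R) -> (forall x, u <= x <= v -> `|H x - K| <= e) ->
  `|\int[lam 0 T]_x (dramp u v x * H x) - K| <= e.
Proof.
move=> uv u0 vT bH HK; have bd := test_bm (test_dramp uv).
have cd : continuous (dramp u v) by have [s _ _] := test_dramp uv; exact: smooth_continuous.
have T0 : 0 <= T by lra.
have d1 : \int[lam 0 T]_x dramp u v x = 1.
  rewrite (lam_deriv T0 cd bd (is_derive_ramp u v)) ramp1// ramp0// subr0//.
have KE c : c = \int[lam 0 T]_x (c * dramp u v x) by rewrite (intZ (lam 0 T) c bd) d1 mulr1.
have bdH := bmM bd bH; have bK c := bmM (bm_cst c) bd.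
rewrite ler_norml lerBrDr lerBlDr; apply/andP; split.
  rewrite [leLHS]KE; apply: int_le => // x.
  have [->|dx] := eqVneq (dramp u v x) 0; first by rewrite mul0r mulr0.
  rewrite mulrC ler_wpM2l ?dramp_ge0//.
  by have := HK x (dramp_supp uv dx); rewrite ler_norml => /andP[? _]; lra.
rewrite [leRHS]KE; apply: int_le => // x.
have [->|dx] := eqVneq (dramp u v x) 0; first by rewrite mul0r mulr0.
rewrite [leRHS]mulrC ler_wpM2l ?dramp_ge0//.
by have := HK x (dramp_supp uv dx); rewrite ler_norml => /andP[_ ?]; lra.
Qed.

Definition time_test (s t : R) (theta : R -> R) := [/\ smooth theta,
  forall r, 0 <= theta r & exists c d, [/\ s < c, d < t & forall r, theta r != 0 -> c <= r <= d]].

Lemma time_test_derive s t theta r : time_test s t theta -> (r <= s) || (t <= r) ->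
  derive1 theta r = 0.
Proof.
move=> [_ _ [c [d [sc dt supp]]]] H; apply: (@derive1_locally_cst _ _ 0).
case/orP: H => H.
  have : \forall y \near r, y < c by apply: lt_nbhsl; exact: le_lt_trans sc.
  apply: filterS => y yc; apply/eqP; apply: contraT => /supp /andP[]; lra.
have : \forall y \near r, d < y by apply: lt_nbhsr; exact: lt_le_trans H.
by apply: filterS => y yc; apply/eqP; apply: contraT => /supp /andP[]; lra.
Qed.

Lemma time_test_test s t theta : time_test s t theta -> test_function setT theta.
Proof. by move=> [st _ [c [d [_ _ supp]]]]; exact: (test_itv st supp). Qed.

Lemma bm_time_derive s t theta : time_test s t theta -> bm (derive1 theta : mR -> R).
Proof.
move=> tt; have := test_bm (test_derive (1 : R) (time_test_test tt)).
by apply: bm_eq => r; rewrite derive1E.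
Qed.

Variables (T : R).
Hypothesis T0 : 0 < T.

Lemma int_time_test s t theta : 0 <= s -> t <= T -> time_test s t theta ->
  \int[lam 0 T]_r (derive1 theta r * tclamp T r) = - \int[lam 0 T]_r theta r.
Proof.
move=> s0 tT tt; have [sth _ [c [d [sc dt supp]]]] := tt.
have bth := test_bm (time_test_test tt); have bd := bm_time_derive tt.
have cd : continuous (derive1 theta) by apply: smooth_continuous; exact: smooth_derive1.
have bc : bm ((fun r => tclamp T r) : mR -> R).
  by apply: (ucont_bm T0 (S := id)) => e e0; exists e.
have bdc := bmM bd bc.
pose f (r : R) := derive1 theta r * r + theta r.
have bf : bm (f : mR -> R).
  apply: (bm_eq _ (bmD (bmM bd (bmM bc (bm_cst 1))) bth)) => r; rewrite /f mulr1.
  have [/tclamp_id ->//|] := boolP (0 <= r <= T).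
  rewrite negb_and -!ltNge => rT; rewrite (time_test_derive tt) ?mul0r//.
  by case/orP: rT => h; apply/orP; [left|right]; lra.
have df (r : R) : is_derive r (1 : R) (fun r => theta r * r) (f r).
  have h1 := smooth_is_derive r sth; have h3 := is_derive_id r (1 : R).
  apply: (is_derive_ext (is_deriveM h1 h3)) => //.
  by rewrite /f /GRing.scale/= mulr1 addrC [r * _]mulrC.
have cf : continuous f.
  move=> r; apply: cvgD; last exact: smooth_continuous.
  by apply: cvgM; [exact: cd|exact: cvg_id].
have := lam_deriv (ltW T0) cf bf df.
have z (r : R) : (r <= s) || (t <= r) -> theta r = 0.
  by move=> H; apply/eqP; apply: contraT => /supp /andP[]; case/orP: H; lra.
rewrite (z T) ?(z 0) ?s0 ?tT ?orbT// !mul0r subrr => H.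
apply/eqP; rewrite -addr_eq0 -(intD (lam 0 T) bdc bth) -[X in _ == X]H; apply/eqP.
by apply: eq_lam => //; [exact: bmD|move=> r rI; rewrite tclamp_id].
Qed.

(** The test function rises from 0 to 1 just after s and falls back just before t; its derivative
    averages H near s minus H near t. *)
Lemma weak_homo (H : R -> R) s t : ucont T H -> 0 <= s -> s < t -> t <= T ->
  (forall theta, time_test s t theta ->
    \int[lam 0 T]_r (derive1 theta r * H (tclamp T r)) <= 0) -> H s <= H t.
Proof.
move=> uH s0 st tT Hw; apply/ler_addgt0Pr => e e0.
have [dl dl0 Hd] := uH (e / 2) (divr_gt0 e0 (ltr0Sn R 1)).
have bH := ucont_bm T0 uH.
(* The ramps occupy [s + h, s + 2 h] and [t - 2 h, t - h]: within dl of the end points, and in the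
   right order because 4 h <= t - s. *)
pose h := Num.min (dl / 2) ((t - s) / 4).
have h0 : 0 < h by rewrite lt_min; apply/andP; split; lra.
have h1 : h <= dl / 2 by rewrite ge_min lexx.
have h3 : h <= (t - s) / 4 by rewrite ge_min lexx orbT.
pose u1 := s + h; pose v1 := s + 2 * h; pose u2 := t - 2 * h; pose v2 := t - h.
have uv1 : u1 < v1 by rewrite /u1 /v1; lra.
have uv2 : u2 < v2 by rewrite /u2 /v2; lra.
pose theta x := ramp u1 v1 x - ramp u2 v2 x.
have dth : derive1 theta = fun x => dramp u1 v1 x - dramp u2 v2 x.
  apply/funext => x; rewrite derive1E.
  have d1 := is_derive_ramp u1 v1 x; have d2 := is_derive_ramp u2 v2 x.
  by have [_ ->] := @is_deriveB _ _ _ _ _ _ _ _ _ d1 d2.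
have tt : time_test s t theta.
  split.
  - by apply: smoothB; exact: smooth_ramp.
  - move=> r; rewrite subr_ge0; have [ru|ru] := leP r u2.
      by rewrite (ramp0 uv2 ru) ramp_ge0.
    by rewrite (ramp1 uv1) ?ramp_le1//; move: ru; rewrite /u2 /v1; lra.
  - exists u1, v2; split; [by rewrite /u1; lra|by rewrite /v2; lra|].
    move=> r; apply: contraNT; rewrite negb_and -!ltNge => /orP[ru|ru]; apply/eqP.
      by rewrite /theta !ramp0 ?subrr// ltW//; move: ru; rewrite /u1 /u2; lra.
    by rewrite /theta !ramp1 ?subrr// ltW//; move: ru; rewrite /v1 /v2; lra.
have := Hw theta tt; rewrite dth.
have b1 := test_bm (test_dramp uv1); have b2 := test_bm (test_dramp uv2).
have b1H := bmM b1 bH; have b2H := bmM b2 bH.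
rewrite (int_ext (lam 0 T) (g := fun r => dramp u1 v1 r * H (tclamp T r) - dramp u2 v2 r * H (tclamp T r))); last first.
  by move=> r; rewrite mulrBl.
rewrite (intB (lam 0 T) b1H b2H).
have A1 : `|\int[lam 0 T]_x (dramp u1 v1 x * H (tclamp T x)) - H s| <= e / 2.
  apply: ramp_average => //; [by rewrite /u1; lra|by rewrite /v1; lra|].
  move=> x /andP[x1 x2]; have xI : 0 <= x <= T by move: x1 x2; rewrite /u1 /v1; lra.
  rewrite tclamp_id//; apply: Hd => //; first by apply/andP; split; lra.
  by rewrite ger0_norm; move: x1 x2; rewrite /u1 /v1; lra.
have A2 : `|\int[lam 0 T]_x (dramp u2 v2 x * H (tclamp T x)) - H t| <= e / 2.
  apply: ramp_average => //; [by rewrite /u2; lra|by rewrite /v2; lra|].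
  move=> x /andP[x1 x2]; have xI : 0 <= x <= T by move: x1 x2; rewrite /u2 /v2; lra.
  rewrite tclamp_id//; apply: Hd => //; first by apply/andP; split; lra.
  by rewrite distrC ger0_norm; move: x1 x2; rewrite /u2 /v2; lra.
move: A1 A2; rewrite !ler_norml => /andP[? ?] /andP[? ?] ?; lra.
Qed.

(* G' >= V in the sense of distributions.                                      *)
Lemma weak_growth (G V : R -> R) s t c : ucont T G -> ucont T V -> 0 <= s -> s < t -> t <= T ->
  (forall theta, time_test 0 T theta ->
    \int[lam 0 T]_r (derive1 theta r * G (tclamp T r) + theta r * V (tclamp T r)) <= 0) ->
  (forall r, s <= r <= t -> c <= V r) -> c * (t - s) <= G t - G s.
Proof.
move=> uG uV s0 st tT Hw Vc.
suff : G s - c * s <= G t - c * t by lra.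
apply: (@weak_homo (fun r => G r - c * r)) => //.
  move=> e e0; have [dl dl0 Hd] := uG (e / 2) (divr_gt0 e0 (ltr0Sn R 1)).
  have c1 : 0 < `|c| + 1 by rewrite ltr_wpDl.
  exists (Num.min dl (e / 2 / (`|c| + 1))); first by rewrite lt_min dl0 !divr_gt0.
  move=> p q pI qI; rewrite le_min => /andP[d1 d2].
  have -> : G q - c * q - (G p - c * p) = (G q - G p) - c * (q - p) by ring.
  apply: le_trans (ler_normB _ _) _; rewrite normrM.
  have h1 := Hd p q pI qI d1.
  have h3 : `|c| * `|q - p| <= e / 2.
    move: d2; rewrite ler_pdivlMr// mulrC => h; apply: le_trans h.
    by rewrite ler_wpM2r// lerDl.
  lra.
move=> theta tt; have [sth th0 [c1 [d1 [sc1 d1t supp]]]] := tt.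
have tt' : time_test 0 T theta by split=> //; exists c1, d1; split=> //; lra.
have bG := ucont_bm T0 uG; have bV := ucont_bm T0 uV.
have bth := test_bm (time_test_test tt); have bd := bm_time_derive tt.
have bc : bm ((fun r => tclamp T r) : mR -> R).
  by apply: (ucont_bm T0 (S := id)) => e e0; exists e.
have b1 := bmM bd bG; have b2 := bmM bth bV; have b3 := bmM bd bc.
rewrite (int_ext (lam 0 T) (g := fun r => derive1 theta r * G (tclamp T r) - c * (derive1 theta r * tclamp T r))); last first.
  by move=> r; ring.
have b4 := bmM (bm_cst c) bth.
apply: le_trans (Hw theta tt').
rewrite (intB (lam 0 T) b1 (bmM (bm_cst c) b3)) (intD (lam 0 T) b1 b2) (intZ (lam 0 T) c b3).
rewrite (int_time_test s0 tT tt) mulrN opprK lerD2l -(intZ (lam 0 T) c bth); apply: int_le => // r.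
have [->|tr] := eqVneq (theta r) 0; first by rewrite mul0r mulr0.
rewrite mulrC ler_wpM2l//.
have /andP[r1 r2] := supp r tr.
by rewrite tclamp_id; [apply: Vc|]; apply/andP; split; lra.
Qed.

End WeakMonotonicity.

(** * Product test functions *)

Section WeakSolution.
Context {R : realType}.
Local Notation mu := (@lebesgue_measure R).
Local Notation h2 := (2^-1 : R).
Local Notation lI := (lam (- 2^-1 : R) 2^-1).
Local Notation mR := (measurableTypeR R).

Definition Epos (g f X : R -> R) := \int[lI]_m (g m * f (X m)).
Definition Evel (W a g f X : R -> R) := \int[lI]_m (g m * (f (X m) * vel W a X m)).

(* Testing the entropy inequality with theta(t) psi(x), in quantile form; only *)
(* the values of psi at the range of X matter.                                 *)
Definition weak_solution (T Q : R) (W : R -> R) (a X : R -> R -> R) :=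
  forall (g : R -> R) B Psi psi K theta, {homo g : x y / x <= y} -> (forall m, `|g m| <= B) ->
    smooth psi -> (forall x : R, is_derive x (1 : R) Psi (psi x)) ->
    (forall x, `|x| <= Q + 1 -> 0 <= psi x) -> bm (psi : mR -> R) ->
    strip_pair Q K (fun=> Psi) (fun=> psi) -> time_test 0 T theta ->
    \int[lam 0 T]_t (derive1 theta t * Epos g Psi (X (tclamp T t))
      + theta t * Evel W (a (tclamp T t)) g psi (X (tclamp T t))) <= 0.

Lemma slice_Epos (W a g f X : R -> R) : slice_rate W a g f (fun=> 0) X = Epos g f X.
Proof. by apply: int_ext => m; rewrite mul0r addr0. Qed.

Lemma slice_Evel (W a g f X : R -> R) : slice_rate W a g (fun=> 0) f X = Evel W a g f X.
Proof. by apply: int_ext => m; rewrite add0r. Qed.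

Lemma strip_pair0 Q K (p : R -> R -> R) z : strip_pair Q K p z ->
  strip_pair Q `|K| p (fun=> (fun=> 0) : R -> R) /\ strip_pair Q `|K| (fun=> (fun=> 0) : R -> R) z.
Proof.
move=> [cp cz b l]; have KK := ler_norm K.
have d0 x y t s : 0 <= `|x - y| + `|t - s| :> R by rewrite addr_ge0.
split; split; do ?[exact: cp|exact: cz|by move=> t x; exact: cvg_cst].
- by move=> t x xQ; rewrite normr0; split=> //; exact: le_trans (b t x xQ).1 KK.
- move=> t s x y xQ yQ; rewrite subrr normr0 mulr_ge0//; split=> //.
  by apply: le_trans (l t s x y xQ yQ).1 _; rewrite ler_wpM2r.
- by move=> t x xQ; rewrite normr0; split=> //; exact: le_trans (b t x xQ).2 KK.
- move=> t s x y xQ yQ; rewrite subrr normr0 mulr_ge0//; split=> //.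
  by apply: le_trans (l t s x y xQ yQ).2 _; rewrite ler_wpM2r.
Qed.

Section Rates.
Variables (T Q : R) (W : R -> R) (A a X : R -> R -> R) (L : R).
Hypotheses (T0 : 0 < T) (Q0 : 0 <= Q) (hW : good_kernel W) (fd : flux_density T A a L).
Hypotheses (hm : forall t, 0 <= t <= T -> mono Q (X t))
  (uX : ucont_on T (fun t s => l1d (X t) (X s))).
Variables (g : R -> R) (Psi psi : R -> R) (K : R).
Hypotheses (bg : bm (g : mR -> R)) (sp : strip_pair Q K (fun=> Psi) (fun=> psi)).

Lemma ucont_Epos : ucont T (fun t => Epos g Psi (X t)).
Proof.
have [sp1 _] := strip_pair0 sp; have := ucont_slice hW fd sp1 bg hm uX.
by rewrite (_ : (fun t => _) = fun t => Epos g Psi (X t))//; apply/funext => t; exact: slice_Epos.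
Qed.

Lemma ucont_Evel : ucont T (fun t => Evel W (a t) g psi (X t)).
Proof.
have [_ sp1] := strip_pair0 sp; have := ucont_slice hW fd sp1 bg hm uX.
by rewrite (_ : (fun t => _) = fun t => Evel W (a t) g psi (X t))//; apply/funext => t; exact: slice_Evel.
Qed.

End Rates.

Lemma cutoff (Q : R) : exists chi : R -> R, [/\ smooth chi, forall x, 0 <= chi x,
  forall x, `|x| <= Q -> chi x = 1 & forall x, chi x != 0 -> - (Q + 1) <= x <= Q + 1].
Proof.
have h1 : - (Q + 1) < - Q by lra.
have h3 : Q < Q + 1 by lra.
exists (fun x => ramp (- (Q + 1)) (- Q) x * (1 - ramp Q (Q + 1) x)); split.
- apply: smoothM; first exact: smooth_ramp.
  by apply: smoothB; [exact: smooth_cst|exact: smooth_ramp].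
- by move=> x; rewrite mulr_ge0 ?ramp_ge0// subr_ge0 ramp_le1.
- by move=> x; rewrite ler_norml => /andP[x1 x2]; rewrite ramp1// ramp0// subr0 mulr1.
- move=> x; apply: contraNT; rewrite negb_and -!ltNge => /orP[] /ltW xQ.
    by rewrite ramp0 ?mul0r.
  by rewrite [ramp Q _ _]ramp1// subrr mulr0.
Qed.

(** The test function is theta(t) chi(x) psi(x), where the cutoff chi is 1 on the range of X and
    vanishes where psi may be negative. *)
Lemma entropy_weak (T Q : R) (phi : R -> \bar R) (A a M X : R -> R -> R) (L : R) :
  0 < T -> 0 <= Q -> communication_protocol phi -> flux_density T A a L ->
  (forall eta zeta, entropy eta -> test_function (strip T) zeta -> (forall p, 0 <= zeta p) ->
    entropy_inequality phi T A M eta zeta) ->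
  (forall t, 0 <= t <= T -> profile (M^~ t) (X t) Q) ->
  ucont_on T (fun t s => l1d (X t) (X s)) -> weak_solution T Q (Phi phi) a X.
Proof.
move=> T0 Q0 hphi fd hent hp uX g B Psi psi K theta hg gB spsi dPsi psi0 bpsi sp tt.
have hW := Phi_good hphi; have hm t tI := profile_mono (hp t tI).
have bg : bm (g : mR -> R) by exact: bm_homo gB.
have [eta ep] := has_pair_entropy hg gB.
have [chi [schi chi0 chi1 chis]] := cutoff Q.
have [sth th0 [c [d [c0 dT supp]]]] := tt.
pose f x := chi x * psi x; have sf : smooth f by exact: smoothM.
have fs x : f x != 0 -> - (Q + 1) <= x <= Q + 1.
  by rewrite mulf_eq0 negb_or => /andP[/chis].
have f0 x : 0 <= f x.
  have [->//|/fs] := eqVneq (f x) 0; rewrite -ler_norml => xQ.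
  by rewrite mulr_ge0// psi0.
pose zeta (p : R * R) := f p.1 * theta p.2.
have tz : test_function (strip T) zeta := test_sep sf sth fs supp c0 dT.
have [Q1 Q10 S1] := strip_support tz.
have [Q2 Q20 S2] := strip_support (test_derive ((0, 1) : R * R) tz).
have [Q3 Q30 S3] := strip_support (test_derive ((1, 0) : R * R) tz).
pose Q' := Num.max Q (Num.max Q1 (Num.max Q2 Q3)).
have QQ' : Q <= Q' by rewrite le_max lexx.
have Q'0 : 0 <= Q' by exact: le_trans QQ'.
have zs x t : Q' <= `|x| \/ ~~ (0 < t < T) -> [/\ zeta (x, t) = 0,
     'D_(0, 1) zeta (x, t) = 0 & 'D_(1, 0) zeta (x, t) = 0].
  move=> H; split; [apply: S1|apply: S2|apply: S3]; case: H => H; [left|by right|left|by right|left|by right];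
  by apply: le_trans H; rewrite !le_max lexx ?orbT.
have hp' t tI := profileW (hp t tI) QQ'.
have z0 p : 0 <= zeta p by rewrite mulr_ge0.
have ee : entropy eta by have [] := ep.
have := (entropy_inequalityE T0 Q'0 hphi fd hp' uX ep tz zs).1 (hent eta zeta ee tz z0).
have bf : bm (f : mR -> R) := test_bm (test_itv sf fs (@subsetT _ _)).
(* On the range of X the primitive of chi psi is Psi up to the constant [kap], which contributes a
   multiple of the integral of theta', that is, zero. *)
pose kap := \int[lam (- Q') (- Q)]_x f x - Psi (- Q).
have [cPsi cpsi pzK _] := sp.
have prim x : `|x| <= Q -> \int[lam (- Q') x]_y f y = kap + Psi x.
  move=> xQ; have /andP[x1 x2] : - Q <= x <= Q by rewrite -ler_norml.
  have q1 : - Q' <= - Q by rewrite lerN2.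
  rewrite (lam_split bf q1 x1) /kap -addrA; congr (_ + _).
  rewrite (eq_lam (g := psi) bf bpsi).
    by rewrite (lam_deriv x1 (cpsi 0) bpsi dPsi) addrC.
  move=> y /andP[y1 y2]; rewrite /f chi1 ?mul1r// ler_norml y1.
  exact: le_trans x2.
have clampE t : theta (tclamp T t) = theta t /\ derive1 theta (tclamp T t) = derive1 theta t.
  have [/tclamp_id ->//|] := boolP (0 <= t <= T).
  have z r : (r <= 0) || (T <= r) -> theta r = 0 /\ derive1 theta r = 0.
    move=> H; split; last exact: (time_test_derive tt).
    by apply/eqP; apply: contraT => /supp /andP[]; case/orP: H; lra.
  rewrite negb_and -!ltNge => tT; have [|-> ->] := z t; first by case/orP: tT => /ltW ->; rewrite ?orbT.
  apply: z; rewrite /tclamp; case/orP: tT => h.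
    by rewrite min_l ?max_l ?lexx//; lra.
  by rewrite min_r ?max_r ?lexx ?orbT//; lra.
rewrite (int_ext (lam 0 T) (g := fun t => (kap * \int[lI]_m g m) * derive1 theta t +
   (derive1 theta t * Epos g Psi (X (tclamp T t))
      + theta t * Evel (Phi phi) (a (tclamp T t)) g psi (X (tclamp T t))))); last first.
  move=> t; have [e1 e2] := clampE t; have tI := tclamp_itv T0 t.
  set s := tclamp T t in e1 e2 tI *; have mX := hm s tI; have [hX XQ] := mX.
  have bP : bm ((fun m => Psi (X s m)) : mR -> R).
    by apply: (bm_contX (K := K) (cPsi 0) mX) => x xQ; exact: (pzK 0 x xQ).1.
  have bp : bm ((fun m => psi (X s m)) : mR -> R).
    by apply: (bm_contX (K := K) (cpsi 0) mX) => x xQ; exact: (pzK 0 x xQ).2.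
  have bv := bm_velm hW fd s mX.
  have b1 := bmM bg bP; have b2 := bmM bg (bmM bp bv).
  rewrite /slice_rate (int_ext lI (g := fun m => derive1 theta t * kap * g m +
    (derive1 theta t * (g m * Psi (X s m)) + theta t * (g m * (psi (X s m) * vel (Phi phi) (a s) (X s) m))))).
    have b3 := bmM (bm_cst (derive1 theta t)) b1; have b4 := bmM (bm_cst (theta t)) b2.
    rewrite (intD lI (bmM (bm_cst _) bg) (bmD b3 b4)) (intD lI b3 b4).
    rewrite (intZ lI _ bg) (intZ lI _ b1) (intZ lI _ b2) /Epos /Evel; ring.
  move=> m; have -> : tprim Q' zeta s (X s m) = derive1 theta t * (kap + Psi (X s m)).
    rewrite -prim// -e2 -(intZ (lam (- Q') (X s m)) _ bf); apply: int_ext => y.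
    by rewrite mulrC; exact: derive_sep01.
  rewrite /zeta /= /f chi1// e1 mul1r; ring.
have bth := test_bm (time_test_test tt); have bd := bm_time_derive tt.
have cd : continuous (derive1 theta) by apply: smooth_continuous; exact: smooth_derive1.
have b1 := ucont_bm T0 (ucont_Epos hW fd hm uX bg sp).
have b2 := ucont_bm T0 (ucont_Evel hW fd hm uX bg sp).
rewrite (intD (lam 0 T) (bmM (bm_cst _) bd) (bmD (bmM bd b1) (bmM bth b2))).
rewrite (intZ (lam 0 T) _ bd) (lam_deriv (ltW T0) cd bd (fun r => smooth_is_derive r sth)).
have z r : (r <= 0) || (T <= r) -> theta r = 0.
  by move=> H; apply/eqP; apply: contraT => /supp /andP[]; case/orP: H; lra.
by rewrite !z ?lexx ?orbT// subrr mulr0 add0r.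
Qed.

End WeakSolution.

(** * Decomposition along levels *)

Section LevelSums.
Context {R : realType}.

(** Abel summation: [lev] carries the dependence on Z and is nondecreasing in c, [inc] carries that
    on x. The sum of the products telescopes to minus F at the last level below c; the coefficient
    -1 takes care of the lowest level. *)
Definition lev (z : nat -> R) (c : R) (i : nat) : R :=
  if i is i'.+1 then (z i'.+1 <= c)%R%:R else - 1.

Definition inc (z : nat -> R) (F : R -> R) (i : nat) : R :=
  if i is i'.+1 then F (z i') - F (z i'.+1) else F (z 0%N).

Lemma level_sum (z : nat -> R) c N : (forall i, z i <= z i.+1) -> z 0%N <= c ->
  exists i, [/\ (i <= N)%N, z i <= c, (i < N)%N -> c < z i.+1 &
    forall F, \sum_(j < N.+1) lev z c j * inc z F j = - F (z i)].
Proof.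
move=> zS z0; elim: N => [|N [i [iN zi ic IH]]].
  by exists 0%N; split=> // F; rewrite big_ord_recr big_ord0 /= add0r mulN1r.
have zle k l : (k <= l)%N -> z k <= z l.
  elim: l => [|l IHl]; first by rewrite leqn0 => /eqP ->.
  by rewrite leq_eqVlt => /predU1P[->//|]; rewrite ltnS => /IHl /le_trans; apply.
have [zc|cz] := leP (z N.+1) c.
  exists N.+1; split=> //; first by rewrite ltnn.
  have iE : i = N.
    apply/eqP; rewrite eqn_leq iN /= leqNgt; apply/negP => lt_iN.
    by have := ic lt_iN; rewrite ltNge (le_trans (zle _ _ _) zc)// ltnS ltnW.
  by move=> F; rewrite big_ord_recr IH /= zc iE mul1r; ring.
exists i; split=> //; first exact: leqW.
  by rewrite ltnS leq_eqVlt => /predU1P[->//|/ic].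
by move=> F; rewrite big_ord_recr IH /= leNgt cz mul0r addr0.
Qed.

End LevelSums.

(** * The evolution variational inequality *)

Section Stability.
Context {R : realType}.
Local Notation mu := (@lebesgue_measure R).
Local Notation h2 := (2^-1 : R).
Local Notation lI := (lam (- 2^-1 : R) 2^-1).
Local Notation mR := (measurableTypeR R).

Lemma smooth_shift (f : R -> R) b : smooth f -> smooth (fun x => f (x - b)).
Proof.
move=> sf; rewrite (_ : (fun x => _) = fun x => f (1 * x + - b)); first exact: smooth_affine.
by apply/funext => x; rewrite mul1r.
Qed.

Lemma is_derive_shift (f : R -> R) (b x df : R) : is_derive (x - b) (1 : R) f df ->
  is_derive x (1 : R) (fun x => f (x - b)) df.
Proof.
move=> d; have := @is_derive_affine R f 1 (- b) x df; rewrite mul1r => /(_ d) h.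
by apply: (is_derive_ext h) => [y|]; rewrite ?mul1r// mulr1.
Qed.

Lemma strip_pair_lip (Q : R) (Psi psi : R -> R) C : 0 <= C -> 0 <= Q ->
  (forall x y, `|Psi x - Psi y| <= C * `|x - y|) ->
  (forall x y, `|psi x - psi y| <= C * `|x - y|) ->
  exists K, strip_pair Q K (fun=> Psi) (fun=> psi).
Proof.
move=> C0 Q0 h1 h3.
have cl (f : R -> R) : (forall x y, `|f x - f y| <= C * `|x - y|) -> continuous f.
  move=> hf x; apply/cvgrPdist_le => e e0; exists (e / (C + 1)).
    by rewrite /= divr_gt0// ltr_wpDl.
  move=> y /= xy; apply: le_trans (hf x y) _.
  apply: le_trans (_ : (C + 1) * `|x - y| <= _); first by rewrite ler_wpM2r// lerDl.
  by rewrite mulrC -ler_pdivlMr ?ltr_wpDl// ltW.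
have bd (f : R -> R) x : (forall x y, `|f x - f y| <= C * `|x - y|) -> `|x| <= Q ->
    `|f x| <= `|f 0| + C * Q.
  move=> hf xQ; have := hf x 0; rewrite subr0 => h.
  have : `|f x| <= `|f x - f 0| + `|f 0| by rewrite -{1}(subrK (f 0) (f x)) ler_normD.
  have : C * `|x| <= C * Q by exact: ler_wpM2l.
  lra.
have p0 := normr_ge0 (Psi 0); have p1 := normr_ge0 (psi 0); have cq : 0 <= C * Q by exact: mulr_ge0.
exists (`|Psi 0| + `|psi 0| + C * Q + C); split; [by move=> _; exact: cl|by move=> _; exact: cl| |].
  by move=> _ x xQ; split; apply: le_trans (bd _ _ _ xQ) _ => //; lra.
move=> t s x y _ _; have d0 := normr_ge0 (x - y); have d1 := normr_ge0 (t - s).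
have H : C * `|x - y| <= (`|Psi 0| + `|psi 0| + C * Q + C) * (`|x - y| + `|t - s|).
  by apply: ler_pM => //; lra.
by split; apply: le_trans H.
Qed.

Lemma bm_contd (f X Z : R -> R) Q B : continuous f -> mono Q X -> mono Q Z ->
  (forall u, `|u| <= Q + Q -> `|f u| <= B) -> bm ((fun m => f (X m - Z m)) : mR -> R).
Proof.
move=> cf mX mZ fB; have [hX XQ] := mX; have [hZ ZQ] := mZ; split; last first.
  by exists B => m; apply: fB; apply: le_trans (ler_normB _ _) _; exact: lerD.
apply: (@measurableT_comp _ _ _ mR mR mR (f : mR -> mR)).
  exact: continuous_measurable_fun.
by apply: measurable_funB; exact: measurable_homo.
Qed.

Lemma bm_sgk k (X Z : R -> R) Q : mono Q X -> mono Q Z ->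
  bm ((fun m => sgk k (X m - Z m)) : mR -> R).
Proof.
move=> mX mZ; apply: (bm_contd (f := sgk k) (B := 1) _ mX mZ); last by move=> u _; exact: sgk_le1.
by apply: smooth_continuous; exact: smooth_sgk.
Qed.

Lemma continuous_absk k : 0 < k -> continuous (absk k : R -> R).
Proof. by move=> k0; apply: (continuous_is_derive (f' := sgk k)) => x; exact: is_derive_absk. Qed.

Lemma bm_absk k (X Z : R -> R) Q : 0 < k -> mono Q X -> mono Q Z ->
  bm ((fun m => absk k (X m - Z m)) : mR -> R).
Proof.
move=> k0 mX mZ; apply: (bm_contd (f := absk k) (B := Q + Q + k^-1) _ mX mZ).
  exact: continuous_absk.
move=> u uQ; rewrite ger0_norm; first by apply: le_trans (absk_le _ k0) _; rewrite lerD2r.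
by apply: le_trans (absk_ge u k0).
Qed.

Lemma ucont_sum (T : R) (J : Type) (r : seq J) (F : J -> R -> R) : (forall j, ucont T (F j)) ->
  ucont T (fun t => \sum_(j <- r) F j t).
Proof.
move=> uF; elim: r => [|j r IH] e e0.
  by exists 1 => // s t _ _ _; rewrite !big_nil subrr normr0 ltW.
have [d1 d10 H1] := uF j (e / 2) (divr_gt0 e0 (ltr0Sn R 1)).
have [d2 d20 H2] := IH (e / 2) (divr_gt0 e0 (ltr0Sn R 1)).
exists (Num.min d1 d2); first by rewrite lt_min d10.
move=> s t sI tI; rewrite le_min => /andP[h1 h3]; rewrite !big_cons opprD addrACA.
have := H1 s t sI tI h1; have := H2 s t sI tI h3.
by move=> l1 l2; apply: le_trans (ler_normD _ _) _; lra.
Qed.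

(** The formal time derivative of int absk k (X - Z) dm along d_t X = [vel W a X]. *)
Definition dissipation (W a : R -> R) k (X Z : R -> R) :=
  \int[lI]_m (sgk k (X m - Z m) * vel W a X m).

Section EVI.
Variables (T Q : R) (W : R -> R) (A a X : R -> R -> R) (L : R).
Hypotheses (T0 : 0 < T) (Q0 : 0 <= Q) (hW : good_kernel W) (fd : flux_density T A a L).
Hypotheses (hm : forall t, 0 <= t <= T -> mono Q (X t))
  (uX : ucont_on T (fun t s => l1d (X t) (X s))) (wX : weak_solution T Q W a X).
Variable k : R.
Hypothesis k0 : 0 < k.

(* absk k (x - Z) is minus a sum, over the levels of Z, of the products of     *)
(* nondecreasing functions of x with the indicators of the superlevel sets of  *)
(* Z, which are entropy densities.                                             *)
Lemma evi Z s t C : mono Q Z -> 0 <= s -> s < t -> t <= T ->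
  (forall r, s <= r <= t -> dissipation W (a r) k (X r) Z <= C) ->
  \int[lI]_m absk k (X t m - Z m) <= \int[lI]_m absk k (X s m - Z m) + C * (t - s).
Proof.
move=> mZ s0 st tT HC; have [hZ ZQ] := mZ; apply/ler_addgt0Pr => e e0.
have Q0' := Q0; have k0' := k0.
pose V := `|L + W (Q + Q)|; have V0 : 0 <= V by exact: normr_ge0.
(* h * c0 collects the errors of replacing Z by its levels of mesh h: an error h in the integral of
   [absk] at each of the times s and t, and k * V * h per unit of time in the dissipation. *)
pose c0 := k * V * (t - s) + 2.
have c00 : 0 < c0.
  have : 0 <= k * V * (t - s) by rewrite !mulr_ge0// ?ltW// subr_gt0.
  by rewrite /c0; lra.
have [n _ Hn] : \forall n \near \oo, (Q + Q + 2) * c0 / e < n%:R :> R by exact: nbhs_infty_gtr.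
have {Hn} hn := Hn n (leqnn n).
pose N := n.+1; pose h := (Q + Q + 2) / N%:R.
have N0 : 0 < N%:R :> R by rewrite ltr0n.
have h0 : 0 < h by apply: divr_gt0 => //; lra.
have hc : h * c0 <= e.
  rewrite /h mulrAC ler_pdivrMr// [leRHS]mulrC -ler_pdivrMr//.
  by apply: le_trans (ltW hn) _; rewrite ler_nat.
(* The levels run from -(Q + 1) to Q + 1. The lowest is below the values of Z, and below every x
   with |x| <= Q + 1, where [p 0] has to be nonnegative. *)
pose z (i : nat) := - (Q + 1) + i%:R * h.
have zS i : z i <= z i.+1 by rewrite /z -natr1 mulrDl mul1r; lra.
have zlo i : - (Q + 1) <= z i by rewrite /z lerDl mulr_ge0// ltW.
have zN : z N = Q + 1 by rewrite /z /h mulrC divfK ?pnatr_eq0//; ring.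
have z0 m : z 0%N <= Z m by have := ZQ m; rewrite /z mul0r ler_norml => /andP[]; lra.
pose g i m := lev z (Z m) i.
pose P i x := inc z (fun w => absk k (x - w)) i.
pose p i x := inc z (fun w => sgk k (x - w)) i.
have gh i : {homo g i : x y / x <= y}.
  move=> x y xy; rewrite /g; case: i => [|i]//=.
  have := hZ _ _ xy; case: (leP (z i.+1) (Z x)) => // zx Zxy.
  by rewrite (le_trans zx Zxy).
have gB i m : `|g i m| <= 1.
  by rewrite /g; case: i => [|i] /=; [rewrite normrN1|case: (leP (z i.+1) (Z m)) => _; rewrite ?normr1 ?normr0].
have bg i : bm (g i : mR -> R) by exact: bm_homo (gB i).
have sp i : smooth (p i).
  rewrite /p; case: i => [|i] /=; first exact: smooth_shift (smooth_sgk k).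
  by apply: smoothB; exact: smooth_shift (smooth_sgk k).
have dP i (x : R) : is_derive x (1 : R) (P i) (p i x).
  rewrite /P /p; case: i => [|i] /=; first by apply: is_derive_shift; exact: is_derive_absk.
  have d1 : is_derive x (1 : R) (fun x => absk k (x - z i)) (sgk k (x - z i)).
    by apply: is_derive_shift; exact: is_derive_absk.
  have d2 : is_derive x (1 : R) (fun x => absk k (x - z i.+1)) (sgk k (x - z i.+1)).
    by apply: is_derive_shift; exact: is_derive_absk.
  exact: (is_deriveB d1 d2).
have sg0 : sgk k 0 = 0 :> R by have := sgkN k (0 : R); rewrite oppr0 => /eqP; rewrite -addr_eq0 -mulr2n mulrn_eq0 => /eqP.
have p0 i x : `|x| <= Q + 1 -> 0 <= p i x.
  rewrite ler_norml => /andP[x1 _]; rewrite /p; case: i => [|i] /=.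
    by rewrite -sg0; apply: sgk_homo; [exact: ltW|rewrite /z mul0r; lra].
  by rewrite subr_ge0; apply: sgk_homo; [exact: ltW|have := zS i; lra].
have bp i : bm (p i : mR -> R).
  apply: (@continuous_bm _ _ 2); first exact: smooth_continuous.
  move=> x; rewrite /p; case: i => [|i] /=; first by have := sgk_le1 k (x - z 0%N); lra.
  by apply: le_trans (ler_normB _ _) _; have := sgk_le1 k (x - z i); have := sgk_le1 k (x - z i.+1); lra.
have sd (u v c : R) : u - c - (v - c) = u - v by ring.
have sw (u v c d : R) : u - v - (c - d) = (u - c) - (v - d) by ring.
have lip i : exists K, strip_pair Q K (fun=> P i) (fun=> p i).
  apply: (@strip_pair_lip _ _ _ (2 + 2 * k)) => //; first by lra.
    move=> x y; have d0 := normr_ge0 (x - y); have kd : 0 <= k * `|x - y| by rewrite mulr_ge0// ltW.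
    rewrite /P; case: i => [|i] /=.
      by have := absk_lip (x - z 0%N) (y - z 0%N) k0; rewrite sd; lra.
    have := absk_lip (x - z i) (y - z i) k0; have := absk_lip (x - z i.+1) (y - z i.+1) k0.
    by rewrite !sd sw => l1 l2; apply: le_trans (ler_normB _ _) _; lra.
  move=> x y; have d0 := normr_ge0 (x - y); have kd : 0 <= k * `|x - y| by rewrite mulr_ge0// ltW.
  rewrite /p; case: i => [|i] /=.
    by have := sgk_lip (x - z 0%N) (y - z 0%N) (ltW k0); rewrite sd; lra.
  have := sgk_lip (x - z i) (y - z i) (ltW k0); have := sgk_lip (x - z i.+1) (y - z i.+1) (ltW k0).
  by rewrite !sd sw => l1 l2; apply: le_trans (ler_normB _ _) _; lra.
(* Z m is replaced by the last level w below it, at which the sums telescope. *)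
have Wk m : exists w, [/\ `|Z m - w| <= h & forall F, \sum_(j < N.+1) g j m * inc z F j = - F w].
  have [i [iN zi ic HF]] := level_sum N zS (z0 m); exists (z i); split=> //.
  rewrite ger0_norm ?subr_ge0// lerBlDl; have [ltN|geN] := ltnP i N.
    by apply: le_trans (ltW (ic ltN)) _; rewrite /z -natr1 mulrDl mul1r addrA.
  have -> : i = N by apply/eqP; rewrite eqn_leq iN.
  by rewrite zN; have := ZQ m; rewrite ler_norml => /andP[_]; lra.
pose G r := \sum_(i < N.+1) Epos (g i) (P i) (X r).
pose Vr r := \sum_(i < N.+1) Evel W (a r) (g i) (p i) (X r).
have bPX i r : 0 <= r <= T -> bm ((fun m => g i m * P i (X r m)) : mR -> R).
  move=> rI; apply: bmM => //; have [K [cP _ PK _]] := lip i.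
  by apply: (bm_contX (K := K) (cP 0) (hm rI)) => x xQ; exact: (PK 0 x xQ).1.
have bpX i r : 0 <= r <= T -> bm ((fun m => g i m * (p i (X r m) * vel W (a r) (X r) m)) : mR -> R).
  move=> rI; apply: bmM => //; apply: bmM; last exact: (bm_velm hW fd r (hm rI)).
  have [K [_ cP PK _]] := lip i.
  by apply: (bm_contX (K := K) (cP 0) (hm rI)) => x xQ; exact: (PK 0 x xQ).2.
have GE r : 0 <= r <= T -> `|G r + \int[lI]_m absk k (X r m - Z m)| <= h.
  move=> rI; have ba := bm_absk k0 (hm rI) mZ; rewrite /G /Epos.
  rewrite -[X in `|X + _|](int_sum lI (index_enum 'I_N.+1) (F := fun i m => g i m * P i (X r m))); last by move=> i; exact: bPX.
  have bs := bm_sum (index_enum 'I_N.+1) (fun i : 'I_N.+1 => bPX i r rI).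
  rewrite -(intD lI bs ba); apply: le_trans (int_norm lI (bmD bs ba)) _.
  rewrite -[leRHS]lI1; apply: int_le; [exact: bm_norm (bmD bs ba)|exact: bm_cst|].
  move=> m; have [w [wh ->]] := Wk m.
  rewrite addrC; apply: le_trans (absk_lip _ _ k0) _; apply: le_trans wh.
  by rewrite opprB addrC addrA subrK distrC.
have VE r : 0 <= r <= T -> - dissipation W (a r) k (X r) Z - k * V * h <= Vr r.
  move=> rI; have bs1 := bmM (bm_sgk k (hm rI) mZ) (bm_velm hW fd r (hm rI)).
  rewrite /Vr /Evel.
  rewrite -[leRHS](int_sum lI (index_enum 'I_N.+1) (F := fun i m => g i m * (p i (X r m) * vel W (a r) (X r) m))); last by move=> i; exact: bpX.
  have bs := bm_sum (index_enum 'I_N.+1) (fun i : 'I_N.+1 => bpX i r rI).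
  rewrite -[k * V * h]lI1 -(intN lI bs1) -(intB lI (bmN bs1) (bm_cst _)).
  apply: int_le; [exact: bmB (bmN bs1) (bm_cst _)|exact: bs|].
  move=> m; have [w [wh HF]] := Wk m.
  have -> : \sum_(i < N.+1) g i m * (p i (X r m) * vel W (a r) (X r) m) =
      - sgk k (X r m - w) * vel W (a r) (X r) m.
    rewrite -(HF (fun w => sgk k (X r m - w))) mulr_suml; apply: eq_bigr => i _.
    by rewrite mulrA.
  have : `|(sgk k (X r m - w) - sgk k (X r m - Z m)) * vel W (a r) (X r) m| <= k * h * V.
    rewrite normrM; apply: ler_pM => //.
      apply: le_trans (sgk_lip _ _ (ltW k0)) _; rewrite ler_wpM2l ?(ltW k0)//.
      by rewrite (_ : X r m - w - (X r m - Z m) = Z m - w)//; ring.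
    by apply: le_trans (velm_bound hW fd r m (hm rI)) _; exact: ler_norm.
  rewrite ler_norml => /andP[_]; rewrite mulrBl mulNr [k * V * h]mulrAC; lra.
have uG : ucont T G.
  apply: ucont_sum => i; have [K sK] := lip i.
  exact: (ucont_Epos hW fd hm uX (bg i) sK).
have uV : ucont T Vr.
  apply: ucont_sum => i; have [K sK] := lip i.
  exact: (ucont_Evel hW fd hm uX (bg i) sK).
have Hw theta : time_test 0 T theta ->
    \int[lam 0 T]_r (derive1 theta r * G (tclamp T r) + theta r * Vr (tclamp T r)) <= 0.
  move=> tt; have bth := test_bm (time_test_test tt); have bd := bm_time_derive tt.
  pose F (i : 'I_N.+1) r := derive1 theta r * Epos (g i) (P i) (X (tclamp T r)) +
    theta r * Evel W (a (tclamp T r)) (g i) (p i) (X (tclamp T r)).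
  have bF i : bm (F i : mR -> R).
    have [K sK] := lip i; apply: bmD; apply: bmM => //.
      exact: (ucont_bm T0 (ucont_Epos hW fd hm uX (bg i) sK)).
    exact: (ucont_bm T0 (ucont_Evel hW fd hm uX (bg i) sK)).
  rewrite (int_ext (lam 0 T) (g := fun r => \sum_(i < N.+1) F i r)).
    rewrite (int_sum (lam 0 T) (index_enum 'I_N.+1) bF); apply: sumr_le0 => i _.
    have [K sK] := lip i.
    exact: (wX (gh i) (gB i) (sp i) (dP i) (p0 i) (bp i) sK tt).
  by move=> r; rewrite /F big_split /= -!mulr_sumr.
have tI : 0 <= t <= T by rewrite (le_trans s0 (ltW st)).
have sI : 0 <= s <= T by rewrite s0 (le_trans (ltW st)).
have HV r : s <= r <= t -> - C - k * V * h <= Vr r.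
  move=> /andP[r1 r2]; apply: le_trans (VE r _); last by rewrite (le_trans s0 r1) (le_trans r2).
  by rewrite lerD2r lerN2; apply: HC; rewrite r1.
have E : (- C - k * V * h) * (t - s) = - (C * (t - s)) + 2 * h - h * c0 by rewrite /c0; ring.
move: hc (weak_growth T0 uG uV s0 st tT Hw HV) (GE t tI) (GE s sI); rewrite E.
move: (G t) (G s) (\int[lI]_m absk k (X t m - Z m)) (\int[lI]_m absk k (X s m - Z m)).
move: (h * c0) (C * (t - s)) (h) => E1 E2 h' G1 G2 J1 J2; clear; rewrite !ler_norml.
by move=> ? ? /andP[? ?] /andP[? ?]; lra.
Qed.

End EVI.
End Stability.

(** * L1 stability of two solutions *)

Section Contraction.
Context {R : realType}.
Local Notation mu := (@lebesgue_measure R).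
Local Notation h2 := (2^-1 : R).
Local Notation lI := (lam (- 2^-1 : R) 2^-1).
Local Notation mR := (measurableTypeR R).

(* Since W is odd and nondecreasing, X |-> int W(X m - X n) dn is accretive.   *)
Lemma accretive (W a b : R -> R) (k Q Lam : R) (X Y : R -> R) (N : set mR) :
  good_kernel W -> 0 < k -> mono Q X -> mono Q Y -> bm (a : mR -> R) -> bm (b : mR -> R) ->
  null_set N -> (forall m, - h2 <= m <= h2 -> ~ N m -> `|a m - b m| <= Lam) ->
  dissipation W a k X Y + dissipation W b k Y X <= Lam.
Proof.
move=> hW k0 mX mY ba bb nN HN; have [odd mono_W _] := hW.
have [hX XQ] := mX; have [hY YQ] := mY.
have bs := bm_sgk k mX mY; have bs' := bm_sgk k mY mX.
have bvX := bm_vel hW ba hX XQ; have bvY := bm_vel hW bb hY YQ.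
have bK : bm (fun p : mR * mR => W (X p.1 - X p.2) - W (Y p.1 - Y p.2)).
  exact: bmB (bm_kernel hW hX hX XQ XQ) (bm_kernel hW hY hY YQ YQ).
pose K (m n : R) := W (X m - X n) - W (Y m - Y n).
have KN m n : K n m = - K m n by rewrite /K -(opprB (X m)) -(opprB (Y m)) !odd; ring.
pose s (m : R) := sgk k (X m - Y m).
have bsK : bm (fun p : mR * mR => s p.1 * K p.1 p.2).
  exact: bmM (bm_comp bs measurable_fst) bK.
have bsK' : bm (fun p : mR * mR => s p.2 * K p.1 p.2).
  exact: bmM (bm_comp bs measurable_snd) bK.
pose B := \int[lI]_m \int[lI]_n (s m * K m n).
have B1 : B = - \int[lI]_m \int[lI]_n (s n * K m n).
  apply: (etrans (int_swap lI lI bsK)); rewrite -(intN lI (bm_int1 lI lI bsK')).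
  apply: int_ext => n; rewrite -(intN lI (bm_sec1 n bsK')); apply: int_ext => m /=.
  by rewrite KN mulrN.
have B0 : 0 <= B.
  have bb1 := bm_int1 lI lI bsK; have bb2 := bm_int1 lI lI bsK'.
  suff : 0 <= B + B by lra.
  rewrite {2}B1 /B -(intB lI bb1 bb2); apply: int_ge0; first exact: bmB bb1 bb2.
  move=> m; have c1 := bm_sec1 m bsK; have c2 := bm_sec1 m bsK'.
  rewrite -(intB lI c1 c2); apply: int_ge0; first exact: bmB c1 c2.
  move=> n /=; rewrite -mulrBl /s /K.
  have [h|/ltW h] := leP (X m - Y m) (X n - Y n).
    rewrite -mulrNN mulr_ge0// oppr_ge0 subr_le0; first by apply: sgk_homo => //; exact: ltW.
    by apply: mono_W; lra.
  rewrite mulr_ge0// subr_ge0; first by apply: sgk_homo => //; exact: ltW.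
  by apply: mono_W; lra.
have -> : dissipation W a k X Y + dissipation W b k Y X =
    \int[lI]_m (s m * (a m - b m)) - B.
  have d1 := bmM bs bvX; have d2 := bmM bs' bvY; have d3 := bmM bs (bmB ba bb).
  rewrite /dissipation -(intD lI d1 d2) /B -(intB lI d3 (bm_int1 lI lI bsK)).
  apply: int_ext => m; rewrite /vel.
  have -> : \int[lI]_n (s (m, n).1 * K (m, n).1 (m, n).2) = s m * \int[lI]_n K m n.
    exact: (intZ lI (s m) (bm_sec1 m bK)).
  have -> : \int[lI]_n K m n = \int[lI]_n W (X m - X n) - \int[lI]_n W (Y m - Y n).
    exact: (intB lI (bm_sec1 m (bm_kernel hW hX hX XQ XQ)) (bm_sec1 m (bm_kernel hW hY hY YQ YQ))).
  rewrite -(opprB (X m)) sgkN -/(s m) /=; ring.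
suff : \int[lI]_m (s m * (a m - b m)) <= Lam by lra.
rewrite -(lI1 Lam); apply: (lam_le_null nN); [exact: bmM bs (bmB ba bb)|exact: bm_cst|].
move=> m mI Nm; apply: le_trans (ler_norm _) _; rewrite normrM.
apply: le_trans (HN m mI Nm); rewrite -[leRHS]mul1r ler_wpM2r//; exact: sgk_le1.
Qed.

Lemma local_growth (D : R -> R) (T dl c : R) : 0 < dl ->
  (forall s t, 0 <= s -> s < t -> t <= T -> t - s <= dl -> D t - D s <= c * (t - s)) ->
  forall t, 0 <= t <= T -> D t <= D 0 + c * t.
Proof.
move=> dl0 H t /andP[t0 tT]; move: t0; rewrite le_eqVlt => /predU1P[<-|t0].
  by rewrite mulr0 addr0.
have [n _ /(_ n (leqnn n)) /= hn] : \forall n \near \oo, t / dl < n%:R :> R by exact: nbhs_infty_gtr.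
have N0 : 0 < n.+1%:R :> R by rewrite ltr0n.
pose h := t / n.+1%:R; have h0 : 0 < h by exact: divr_gt0.
have hd : h <= dl.
  rewrite /h ler_pdivrMr// mulrC -ler_pdivrMr//; apply: le_trans (ltW hn) _; by rewrite ler_nat.
have tE : t = n.+1%:R * h by rewrite /h mulrC divfK// gt_eqF.
have step i : (i <= n.+1)%N -> D (i%:R * h) <= D 0 + c * (i%:R * h).
  elim: i => [|i IH] iN; first by rewrite mul0r mulr0 addr0.
  have := IH (ltnW iN).
  have iE : i.+1%:R * h = i%:R * h + h by rewrite -natr1 mulrDl mul1r.
  have := H (i%:R * h) (i.+1%:R * h); rewrite iE => /(_ _ _ _ _) Hs.
  have : D (i%:R * h + h) - D (i%:R * h) <= c * h.
    have -> : c * h = c * (i%:R * h + h - i%:R * h) by rewrite addrC addKr.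
    apply: Hs; [by rewrite mulr_ge0// ltW|by lra| |by lra].
    by rewrite -iE (le_trans _ tT)// tE ler_wpM2r ?ler_nat// ltW.
  by rewrite mulrDr; lra.
by rewrite {1 2}tE; exact: step.
Qed.

Section TwoSolutions.
Variables (T Q : R) (W : R -> R) (A a X : R -> R -> R) (L : R).
Variables (Y : R -> R -> R).
Hypotheses (hW : good_kernel W) (fd : flux_density T A a L).
Hypotheses (mX : forall t, 0 <= t <= T -> mono Q (X t))
  (mY : forall t, 0 <= t <= T -> mono Q (Y t)).
Hypotheses (uX : ucont_on T (fun t s => l1d (X t) (X s)))
  (uY : ucont_on T (fun t s => l1d (Y t) (Y s))).

Let lin_bound (e v1 v2 v3 v4 v5 v6 v7 : R) : 0 < e / 4 -> v1 <= e / 4 + v6 -> v4 <= v7 ->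
  v6 <= v5 -> v7 + v5 <= e / 4 -> v3 - v2 <= v4 + v1 -> v3 <= v2 + e.
Proof. lra. Qed.

(** Lets the two solutions be taken at different times in the dissipation, at the cost of e, so that
    rates met along a short time interval are compared with one final time. *)
Lemma dissipation_ucont k e : 0 < k -> 0 < e -> exists2 dl, 0 < dl & forall r s t,
  0 <= r <= T -> 0 <= s <= T -> 0 <= t <= T -> `|r - t| <= dl -> `|s - t| <= dl ->
  dissipation W (a r) k (X r) (Y s) <= dissipation W (a t) k (X t) (Y t) + e.
Proof.
move=> k0 e0; pose V := `|L + W (Q + Q)|; have V0 : 0 <= V by exact: normr_ge0.
have e4 : 0 < e / 4 by lra.
have [C C0 HC] := vel_cont Q hW fd e4.
pose c := V * k + C + 1.
have c0 : 0 < c.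
  have : 0 <= V * k by rewrite mulr_ge0// ltW.
  by rewrite /c; lra.
have e8 : 0 < e / 8 / c by rewrite !divr_gt0.
have [d1 d10 H1] := uX e8; have [d2 d20 H2] := uY e8.
exists (Num.min (e / 8 / c) (Num.min d1 d2)); first by rewrite !lt_min e8 d10.
move=> r s t rI sI tI; rewrite !le_min => /and3P[r1 r2 _] /and3P[_ _ s3].
have mr := mX rI; have mt := mX tI; have ns := mY sI; have nt := mY tI.
have bXr := bm_mono mr; have bXt := bm_mono mt; have bYs := bm_mono ns; have bYt := bm_mono nt.
have b1 := bm_sgk k mr ns; have b2 := bm_sgk k mt nt.
have bv1 := bm_velm hW fd r mr; have bv2 := bm_velm hW fd t mt.
have vV m : `|vel W (a r) (X r) m| <= V.
  by apply: le_trans (velm_bound hW fd r m mr) _; exact: ler_norm.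
have := int_prod_dist lI b1 bv1 b2 bv2 vV (fun m => sgk_le1 k (X t m - Y t m)).
have D1 : \int[lI]_m `|sgk k (X r m - Y s m) - sgk k (X t m - Y t m)| <=
    k * (l1d (X r) (X t) + l1d (Y s) (Y t)).
  have c1 := bm_norm (bmB bXr bXt); have c2 := bm_norm (bmB bYs bYt).
  rewrite /l1d -(intD lI c1 c2) -(intZ lI k (bmD c1 c2)).
  apply: int_le; [exact: bm_norm (bmB b1 b2)|exact: bmM (bm_cst k) (bmD c1 c2)|].
  move=> m; apply: le_trans (sgk_lip _ _ (ltW k0)) _; rewrite ler_wpM2l ?(ltW k0)//.
  rewrite (_ : _ - _ = (X r m - X t m) - (Y s m - Y t m)); last by ring.
  exact: ler_normB.
have D2 := HC (X r) (X t) t r mr mt tI rI.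
have D3 := H1 t r tI rI r2; have D4 := H2 t s tI sI s3.
rewrite mul1r -/(l1d (vel W (a r) (X r)) (vel W (a t) (X t))) -/(dissipation _ _ _ _ _) -/(dissipation W (a t) k (X t) (Y t)).
rewrite ler_norml => /andP[_].
have p0 : 0 <= l1d (X r) (X t) by exact: l1d_ge0.
have p1 : 0 <= l1d (Y s) (Y t) by exact: l1d_ge0.
have q0 := normr_ge0 (r - t).
have F1 : V * \int[lI]_m `|sgk k (X r m - Y s m) - sgk k (X t m - Y t m)| <=
    (V * k) * (e / 8 / c + e / 8 / c).
  rewrite -mulrA; apply: ler_wpM2l => //; apply: le_trans D1 _.
  by apply: ler_wpM2l; [exact: ltW|exact: lerD].
have F2 : C * (l1d (X r) (X t) + `|r - t|) <= C * (e / 8 / c + e / 8 / c).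
  by apply: ler_wpM2l => //; exact: lerD.
have F3 : (V * k) * (e / 8 / c + e / 8 / c) + C * (e / 8 / c + e / 8 / c) <= e / 4.
  have : c * (e / 8 / c) = e / 8 by rewrite mulrC divfK// gt_eqF.
  move: e8; set u := e / 8 / c => u0; rewrite /c => cu.
  have -> : V * k * (u + u) + C * (u + u) = 2 * ((V * k + C + 1) * u) - 2 * u by ring.
  by rewrite cu; lra.
exact: (lin_bound e4 D2 F1 F2 F3).
Qed.

End TwoSolutions.

Let growth_step (d1 d2 e c l jt jm js : R) : (d1 + d2) * c <= l * c ->
  jt <= jm + (d2 + e / 2) * c -> jm <= js + (d1 + e / 2) * c -> jt - js <= (l + e) * c.
Proof. lra. Qed.

Let final_bound (d d0 j j0 u t e l : R) : 0 < e -> 0 <= u -> d <= j -> j0 <= d0 + e / 4 ->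
  u * t + u = e / 2 -> j <= j0 + (l + u) * t -> d <= d0 + l * t + e.
Proof. by rewrite mulrDl; lra. Qed.

(** On a short interval [s, t], [evi] is applied to X with Y s frozen, then to Y with X t frozen. By
    [dissipation_ucont] both rates are close to those at time t, whose sum [accretive] bounds by
    Lam. Short intervals are chained by [local_growth], and finally k tends to infinity. This
    alternation takes the place of a doubling of the time variable. *)
Lemma stability (T Q : R) (W : R -> R) (A a X A' b Y : R -> R -> R) (L L' Lam : R) :
  0 < T -> 0 <= Q -> good_kernel W -> flux_density T A a L -> flux_density T A' b L' ->
  (forall t, 0 <= t <= T -> mono Q (X t)) -> (forall t, 0 <= t <= T -> mono Q (Y t)) ->
  ucont_on T (fun t s => l1d (X t) (X s)) -> ucont_on T (fun t s => l1d (Y t) (Y s)) ->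
  weak_solution T Q W a X -> weak_solution T Q W b Y ->
  (forall t, 0 <= t <= T -> exists2 N, null_set N & forall m, - h2 <= m <= h2 -> ~ N m ->
    `|a t m - b t m| <= Lam) ->
  forall t, 0 <= t <= T -> l1d (X t) (Y t) <= l1d (X 0) (Y 0) + Lam * t.
Proof.
move=> T0 Q0 hW fd fd' mX mY uX uY wX wY ab t tI.
have growth k e : 0 < k -> 0 < e ->
    \int[lI]_m absk k (X t m - Y t m) <= \int[lI]_m absk k (X 0 m - Y 0 m) + (Lam + e) * t.
  move=> k0 e0; have e2 : 0 < e / 2 by lra.
  have [d1 d10 H1] := dissipation_ucont hW fd mX mY uX uY k0 e2.
  have [d2 d20 H2] := dissipation_ucont hW fd' mY mX uY uX k0 e2.
  have dd : 0 < Num.min d1 d2 by rewrite lt_min d10.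
  apply: (@local_growth (fun t => \int[lI]_m absk k (X t m - Y t m)) T _ _ dd _ t tI).
  move=> s {tI}t s0 st tT; rewrite le_min => /andP[ts1 ts2].
  have tI : 0 <= t <= T by rewrite (le_trans s0 (ltW st)).
  have sI : 0 <= s <= T by rewrite s0 (le_trans (ltW st) tT).
  have near r d : s <= r -> r <= t -> t - s <= d -> `|r - t| <= d.
    by move=> r1 r2 ts; rewrite distrC ger0_norm ?subr_ge0// (le_trans _ ts)// lerD2l lerN2.
  have d1' := near s d1 (lexx s) (ltW st) ts1.
  have [N nN HN] := ab t tI.
  have [_ ba _ _ _] := fd; have [_ bb _ _ _] := fd'.
  have AC := accretive hW k0 (mX t tI) (mY t tI) (ba t).1 (bb t).1 nN HN.
  have K1 : forall r, s <= r <= t ->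
      dissipation W (a r) k (X r) (Y s) <= dissipation W (a t) k (X t) (Y t) + e / 2.
    move=> r /andP[r1 r2]; have rI : 0 <= r <= T by rewrite (le_trans s0 r1) (le_trans r2 tT).
    exact: (H1 r s t rI sI tI (near r d1 r1 r2 ts1) d1').
  have K2 : forall r, s <= r <= t ->
      dissipation W (b r) k (Y r) (X t) <= dissipation W (b t) k (Y t) (X t) + e / 2.
    move=> r /andP[r1 r2]; have rI : 0 <= r <= T by rewrite (le_trans s0 r1) (le_trans r2 tT).
    have d20' : `|t - t| <= d2 by rewrite subrr normr0 ltW.
    exact: (H2 r t t rI tI tI (near r d2 r1 r2 ts2) d20').
  have G1 := evi T0 Q0 hW fd mX uX wX k0 (mY s sI) s0 st tT K1.
  have := evi T0 Q0 hW fd' mY uY wY k0 (mX t tI) s0 st tT K2.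
  have sym (U V : R -> R) : \int[lI]_m absk k (U m - V m) = \int[lI]_m absk k (V m - U m).
    by apply: int_ext => m; rewrite -(opprB (V m)) abskN.
  rewrite (sym (Y t)) (sym (Y s)) => G2.
  apply: growth_step G2 G1.
  by apply: ler_wpM2r => //; rewrite subr_ge0 ltW.
apply/ler_addgt0Pr => e e0.
(* With this k, [absk k] is within e / 4 of the absolute value. *)
have [k k0 kE] : exists2 k : R, 0 < k & k^-1 = e / 4.
  by exists (4 / e); [rewrite divr_gt0|rewrite invf_div].
have t0 : 0 <= t by have /andP[] := tI.
have t1 : 0 < t + 1 by lra.
have e1 : 0 < e / 2 / (t + 1) by rewrite !divr_gt0.
have I0 : 0 <= (0 : R) <= T by rewrite lexx ltW.
have bt := bm_absk k0 (mX t tI) (mY t tI); have b0 := bm_absk k0 (mX 0 I0) (mY 0 I0).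
have c0 := bm_norm (bmB (bm_mono (mX 0 I0)) (bm_mono (mY 0 I0))).
have ct := bm_norm (bmB (bm_mono (mX t tI)) (bm_mono (mY t tI))).
have E1 : l1d (X t) (Y t) <= \int[lI]_m absk k (X t m - Y t m).
  by apply: int_le => // m; exact: absk_ge.
have E2 : \int[lI]_m absk k (X 0 m - Y 0 m) <= l1d (X 0) (Y 0) + e / 4.
  rewrite -[e / 4]lI1 /l1d -(intD lI c0 (bm_cst _)).
  apply: int_le => //; first exact: bmD c0 (bm_cst _).
  by move=> m; apply: le_trans (absk_le _ k0) _; rewrite lerD2l kE.
have := growth k _ k0 e1; move: E1 E2; set u := e / 2 / (t + 1) => E1 E2.
have E3 : u * t + u = e / 2 by rewrite /u -[X in _ + X]mulr1 -mulrDr divfK// gt_eqF.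
exact: (final_bound e0 (ltW e1) E1 E2 E3).
Qed.

End Contraction.

(** * The transport-collapse scheme *)

Section Rearrangement.
Context {R : realType}.
Local Notation mu := (@lebesgue_measure R).
Local Notation h2 := (2^-1 : R).
Local Notation lI := (lam (- 2^-1 : R) 2^-1).
Local Notation mR := (measurableTypeR R).
Implicit Types f y : R -> R.

Lemma ginv_cmp B f1 f2 (c v : R) : 0 <= B -> 0 <= c ->
  (forall z, - B <= z - c -> z <= B -> f2 (z - c) <= f1 z) ->
  ginv B f1 v <= ginv B f2 v + c.
Proof.
move=> B0 c0 H; have /andP[b1 _] := ginv_bound f2 v B0.
apply: ge_sup; first by exists (- B); right.
move=> z [[/andP[z1 z2] zv]|->]; last by rewrite ler_wpDr.
have [h|/ltW h] := leP (- B) (z - c); last by lra.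
rewrite -lerBlDr; apply: sup_upper_bound; first exact: ginv_sup.
left; split; last exact: le_trans (H z h z2) zv.
by apply/andP; split => //; lra.
Qed.

(** v stays below 1/2: for f with values at most 1/2, [ginv] at 1/2 is the truncation level B. This
    is why the point 1/2 is an exceptional set in the estimates of the scheme. *)
Lemma ginv_fine B f (q v : R) : 0 <= B -> 0 <= q -> - h2 <= v < h2 ->
  (forall z, q <= z -> h2 <= f z) -> (forall z, z < - q -> f z <= - h2) ->
  `|ginv B f v| <= q.
Proof.
move=> B0 q0 /andP[v1 v2] f1 f2; have /andP[b1 b2] := ginv_bound f v B0.
rewrite ler_norml; apply/andP; split.
  rewrite leNgt; apply/negP => H.
  pose z := (ginv B f v + - q) / 2.
  have zB : z <= B by rewrite /z; lra.
  have zv : ginv B f v < z by rewrite /z; lra.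
  have := ginv_lt B0 zB zv; have := f2 z; rewrite /z => /(_ ltac:(lra)); lra.
apply: ge_sup; first by exists (- B); right.
move=> z [[_ zv]|->]; last by lra.
by rewrite leNgt; apply/negP => /ltW /f1; lra.
Qed.

Lemma ind_le (b c : bool) : (b -> c) -> b%:R <= c%:R :> R.
Proof. by case: b c => [[]|[]]// /(_ isT). Qed.

Definition dist_fun y (z : R) : R := \int[lI]_m (y m <= z)%R%:R - h2.

Lemma bm_sub y (z : R) : measurable_fun setT (y : mR -> mR) ->
  bm ((fun m => (y m <= z)%R%:R) : mR -> R).
Proof. by move=> my; apply: bm_le => //; exact: measurable_cst. Qed.

Lemma int_below (c : R) : - h2 <= c <= h2 -> \int[lI]_m (m < c)%R%:R = c + h2.
Proof.
move=> /andP[c1 c2]; have := @lam_below R (- h2) h2 c (fun=> 1) (bm_cst 1) c1 c2.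
by rewrite lam_cst// mul1r opprK => <-; apply: int_ext => m; rewrite mul1r.
Qed.

Lemma dist_le y1 y2 (z1 z2 : R) N : measurable_fun setT (y1 : mR -> mR) ->
  measurable_fun setT (y2 : mR -> mR) -> null_set N ->
  (forall m, - h2 <= m <= h2 -> ~ N m -> y1 m <= z1 -> y2 m <= z2) ->
  dist_fun y1 z1 <= dist_fun y2 z2.
Proof.
move=> my1 my2 nN H; rewrite lerD2r; apply: (lam_le_null nN) => [||m mI Nm]; [exact: bm_sub|exact: bm_sub|].
by apply: ind_le; exact: H.
Qed.

Lemma dist_homo y : measurable_fun setT (y : mR -> mR) -> {homo dist_fun y : u v / u <= v}.
Proof.
by move=> my u v uv; apply: (dist_le my my (@null_set0 R)) => m _ _ h; exact: le_trans uv.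
Qed.

Lemma dist_itv y (z : R) : measurable_fun setT (y : mR -> mR) -> - h2 <= dist_fun y z <= h2.
Proof.
move=> my; have by_ := bm_sub z my; rewrite /dist_fun lerBDr addNr lerBlDr.
have -> : h2 + h2 = 1 by lra.
rewrite int_ge0//=; apply: le_trans (int_le lI by_ (bm_cst 1) _) _; last by rewrite lI1.
by move=> m; exact: (@ind_le (y m <= z) true).
Qed.

Lemma dist_hi y (z : R) N : measurable_fun setT (y : mR -> mR) -> null_set N ->
  (forall m, - h2 <= m <= h2 -> ~ N m -> y m <= z) -> dist_fun y z = h2.
Proof.
move=> my nN H; rewrite /dist_fun (lam_eq_null (g := fun=> 1) nN (bm_sub z my) (bm_cst _)).
  by rewrite lI1; lra.
by move=> m mI Nm; rewrite H.
Qed.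

Lemma dist_lo y (z : R) N : measurable_fun setT (y : mR -> mR) -> null_set N ->
  (forall m, - h2 <= m <= h2 -> ~ N m -> z < y m) -> dist_fun y z = - h2.
Proof.
move=> my nN H; rewrite /dist_fun (lam_eq_null (g := fun=> 0) nN (bm_sub z my) (bm_cst _)).
  by rewrite lI1; lra.
by move=> m mI Nm; rewrite leNgt H.
Qed.

(* The nondecreasing function of m with the same distribution as y.            *)
Definition rearr B y := ginv B (dist_fun y).

(** For X = [ginv B f] the sets X m <= z and m < f z agree up to an arbitrarily small shift of z, so
    f and the distribution function of X have the same generalized inverse. Equality holds at every
    point, as sup-norm estimates require. *)
Lemma rearr_id B f : 0 <= B -> {homo f : u v / u <= v} -> (forall z, - h2 <= f z <= h2) ->
  (forall z, B <= z -> f z = h2) -> rearr B (ginv B f) = ginv B f.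
Proof.
move=> B0 hf fI fB; set X := ginv B f.
have mX : measurable_fun setT (X : mR -> mR) by apply: measurable_homo; exact: ginv_homo.
have lo z : - B <= z -> f z <= dist_fun X z.
  move=> Bz; have := int_below (fI z); rewrite /dist_fun => h.
  suff : f z + h2 <= \int[lI]_m (X m <= z)%R%:R by lra.
  rewrite -h; apply: int_le; [apply: bm_lt => //; exact: measurable_cst|exact: bm_sub|].
  move=> m; apply: ind_le => mf; rewrite leNgt; apply/negP => zX.
  by have := lt_ginv B0 hf Bz zX; rewrite leNgt mf.
have hi z e : 0 < e -> dist_fun X z <= f (z + e).
  move=> e0; have [zB|Bz] := leP (z + e) B; last first.
    by rewrite (fB (z + e)); [have /andP[] := dist_itv z mX|exact: ltW].
  have := int_below (fI (z + e)); rewrite /dist_fun => h.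
  suff : \int[lI]_m (X m <= z)%R%:R <= f (z + e) + h2 by lra.
  rewrite -h; apply: int_le; [exact: bm_sub|apply: bm_lt => //; exact: measurable_cst|].
  move=> m; apply: ind_le => Xz; apply: (ginv_lt B0 zB).
  by apply: le_lt_trans Xz _; rewrite ltrDl.
apply: funext => v; apply/eqP; rewrite eq_le; apply/andP; split.
  rewrite -[leRHS]addr0; apply: ginv_cmp => // z; rewrite subr0 => z1 _; exact: lo.
apply/ler_addgt0Pr => e e0; apply: ginv_cmp => //; first exact: ltW.
by move=> z _ _; have := hi (z - e) e e0; rewrite subrK.
Qed.

(** Such a bound shifts the distribution functions by at most c. Used in both directions it makes
    the rearrangement a sup-norm contraction. *)
Lemma rearr_le B y1 y2 c N : 0 <= B -> 0 <= c -> measurable_fun setT (y1 : mR -> mR) ->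
  measurable_fun setT (y2 : mR -> mR) -> null_set N ->
  (forall m, - h2 <= m <= h2 -> ~ N m -> y1 m <= y2 m + c) ->
  forall v, rearr B y1 v <= rearr B y2 v + c.
Proof.
move=> B0 c0 my1 my2 nN H v; apply: ginv_cmp => // z _ _.
by apply: (dist_le my2 my1 nN) => m mI Nm; have := H m mI Nm; lra.
Qed.

(* Among the superlevel sets of given measure, the integral of a nondecreasing *)
(* g is maximal on the rightmost one.                                          *)
Lemma bathtub (g : R -> R) (chi : R -> R) c : {homo g : u v / u <= v} ->
  bm (g : mR -> R) -> bm (chi : mR -> R) -> (forall m, 0 <= chi m <= 1) ->
  - h2 <= c <= h2 -> \int[lI]_m chi m = h2 - c ->
  \int[lI]_m (g m * chi m) <= \int[lam c h2]_m g m.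
Proof.
move=> hg bg bchi chi01 /andP[c1 c2] chic; rewrite -(lam_above bg c1 c2).
have bi : bm ((fun m => (c <= m)%R%:R) : mR -> R) by apply: bm_le => //; exact: measurable_cst.
have ic : \int[lI]_m (c <= m)%R%:R = h2 - c.
  have := @lam_above R (- h2) h2 c (fun=> 1) (bm_cst 1) c1 c2.
  by rewrite lam_cst// mul1r => <-; apply: int_ext => m; rewrite mul1r.
have b1 := bmM bg bchi; have b2 := bmM bg bi.
have b3 := bmM (bmB bg (bm_cst (g c))) (bmB bchi bi).
have E : \int[lI]_m (g m * chi m) - \int[lI]_m (g m * (c <= m)%R%:R) =
    \int[lI]_m ((g m - g c) * (chi m - (c <= m)%R%:R)).
  have b4 := bmM (bm_cst (g c)) (bmB bchi bi).
  have -> : \int[lI]_m ((g m - g c) * (chi m - (c <= m)%R%:R)) =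
     \int[lI]_m (g m * chi m - g m * (c <= m)%R%:R - g c * (chi m - (c <= m)%R%:R)).
    by apply: int_ext => m; ring.
  rewrite (intB lI (bmB b1 b2) b4) (intB lI b1 b2) (intZ lI (g c) (bmB bchi bi)).
  by rewrite (intB lI bchi bi) chic ic subrr mulr0 subr0.
rewrite -subr_le0 E; apply: le_trans (int_le lI b3 (bm_cst 0) _) _; last by rewrite lI1.
move=> m; have /andP[x0 x1] := chi01 m; have [cm|mc] := leP c m.
  by rewrite mulr_ge0_le0// ?subr_ge0 ?subr_le0//; exact: hg.
by rewrite mulr_le0_ge0// ?subr_le0 ?subr0//; apply: hg; exact: ltW.
Qed.

Lemma bm_primX Q (f Y : R -> R) : bm (f : mR -> R) -> bm (Y : mR -> R) ->
  bm ((fun m => \int[lam (- Q) (Y m)]_x f x) : mR -> R).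
Proof.
move=> bf [mY [K hK]]; have [_ [C hC]] := bf.
have C0 : 0 <= C by apply: le_trans (hC 0).
have cZ : continuous (fun u : R => \int[lam (- Q) u]_x f x).
  move=> u; apply/cvgrPdist_le => e e0; exists (e / (C + 1)).
    by rewrite /= divr_gt0// ltr_wpDl.
  move=> v /= uv; apply: le_trans (lam_lip _ _ _ bf hC) _.
  apply: le_trans (_ : (C + 1) * `|u - v| <= _); first by rewrite ler_wpM2r// lerDl.
  by rewrite mulrC -ler_pdivlMr ?ltr_wpDl// ltW.
split.
  apply: (@measurableT_comp _ _ _ mR mR mR ((fun u => \int[lam (- Q) u]_x f x) : mR -> mR)) => //.
  exact: continuous_measurable_fun.
exists (C * (K + `|Q|)) => m; have := lam_lip (- Q) (Y m) (- Q) bf hC.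
rewrite [X in _ - X]lam_empty// subr0 => h; apply: le_trans h _; rewrite ler_wpM2l//.
by apply: le_trans (ler_normB _ _) _; rewrite normrN lerD.
Qed.

(** Layer by layer in x, the set y > x is replaced by the interval at the right end of [-1/2, 1/2]
    with the same measure, which by [bathtub] can only increase the integral of g; the layers are
    weighted by zeta >= 0. *)
Lemma rearr_entropy B Q y (g zeta : R -> R) N : 0 <= B -> B <= Q ->
  bm (y : mR -> R) -> null_set N ->
  (forall m, - h2 <= m <= h2 -> ~ N m -> - B < y m <= B) ->
  {homo g : u v / u <= v} -> bm (g : mR -> R) -> bm (zeta : mR -> R) -> (forall x, 0 <= zeta x) ->
  \int[lI]_m (g m * \int[lam (- Q) (y m)]_x zeta x) <=
  \int[lI]_m (g m * \int[lam (- Q) (rearr B y m)]_x zeta x).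
Proof.
move=> B0 BQ by_ nN yB hg bg bz z0; have [my _] := by_.
have hi z : B <= z -> dist_fun y z = h2 /\ dist_fun y (- z) = - h2.
  move=> Bz; split; [apply: (dist_hi my nN)|apply: (dist_lo my nN)] => m mI Nm;
  by have /andP[] := yB m mI Nm; lra.
have dI z : half_itv (dist_fun y z) by apply/half_itvE; exact: dist_itv.
have hd := dist_homo my.
have qr := qrel_ginv B0 hd dI hi.
have hr : {homo rearr B y : u v / u <= v} by exact: ginv_homo.
have rQ m : `|rearr B y m| <= Q by apply: le_trans BQ; exact: ginv_norm.
rewrite (layer_cake hd hr qr rQ dI bz bg).
have bF : bm (fun p : mR * mR => g p.1 * (zeta p.2 * (p.2 < y p.1)%R%:R)).
  apply: bmM; first exact: bm_comp bg measurable_fst.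
  apply: bmM; first exact: bm_comp bz measurable_snd.
  apply: bm_lt; first exact: measurable_snd.
  by apply: (measurableT_comp my); exact: measurable_fst.
have bP := bm_primX Q bz by_.
rewrite (lam_eq_null (g := fun m => \int[lam (- Q) Q]_x (g m * (zeta x * (x < y m)%R%:R))) nN
  (bmM bg bP) (bm_int1 lI (lam (- Q) Q) bF)); last first.
  move=> m mI Nm; have /andP[y1 y2] := yB m mI Nm.
  have yQ : y m <= Q by exact: le_trans BQ.
  have Qy : - Q <= y m by rewrite (le_trans _ (ltW y1))// lerN2.
  rewrite -(lam_below bz Qy yQ).
  apply/esym; apply: (intZ (lam (- Q) Q) (g m)).
  by apply: bmM => //; apply: bm_lt => //; exact: measurable_cst.
apply: le_trans (_ : \int[lam (- Q) Q]_x (\int[lI]_m (g m * (zeta x * (x < y m)%R%:R))) <= _).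
  by rewrite (int_swap lI (lam (- Q) Q) bF).
apply: int_le; first exact: (bm_int2 lI (lam (- Q) Q) bF).
  apply: bmM => //; apply: (bm_tail (X := rearr B y) (Q := Q)) => //; split=> //.
move=> x; have bc : bm ((fun m => (x < y m)%R%:R) : mR -> R).
  by apply: bm_lt => //; exact: measurable_cst.
rewrite (int_ext lI (g := fun m => zeta x * (g m * (x < y m)%R%:R))); last by move=> m; ring.
rewrite (intZ lI _ (bmM bg bc)) ler_wpM2l//; apply: bathtub => //; last 2 first.
- by move: (dI x) => /half_itvE.
- rewrite /dist_fun (int_ext lI (g := fun m => 1 - (y m <= x)%R%:R)).
    by rewrite (intB lI (bm_cst _) (bm_sub x my)) lI1; lra.
  by move=> m; rewrite leNgt; case: (x < y m); rewrite ?subr0 ?subrr.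
- by move=> m; case: (x < y m); rewrite ?lexx ler01.
Qed.

End Rearrangement.

(** * Euler steps followed by rearrangement *)

Section Scheme.
Context {R : realType}.
Local Notation mu := (@lebesgue_measure R).
Local Notation h2 := (2^-1 : R).
Local Notation lI := (lam (- 2^-1 : R) 2^-1).
Local Notation mR := (measurableTypeR R).

Definition euler (W a X : R -> R) (h : R) (m : R) : R := X m + h * vel W a X m.

(* Particles near the extremal position q are pushed inwards, up to the error  *)
(* in the modulus of continuity of W.                                          *)
Lemma euler_bound (W a X : R -> R) B C L q h m : good_kernel W ->
  (forall u v, `|W u - W v| <= 1 + C * `|u - v|) -> 0 <= h -> h * C <= 1 ->
  mono B X -> (forall m, `|a m| <= L) ->
  (forall m, - h2 <= m < h2 -> `|X m| <= q) -> - h2 <= m < h2 ->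
  `|euler W a X h m| <= q + h * (L + 1).
Proof.
move=> hW HC h0 hC mX aL Xq mI; have [odd mono_W _] := hW; have [hX XQ] := mX.
have nN := @null_set1 R h2.
have W0 : W 0 = 0 by have := odd 0; rewrite oppr0 => /eqP; rewrite -addr_eq0 -mulr2n mulrn_eq0 => /eqP.
have WC d : 0 <= d -> W d <= 1 + C * d.
  by move=> d0; have := HC d 0; rewrite W0 !subr0 (ger0_norm d0); apply: le_trans; exact: ler_norm.
have bk := bm_sec1 m (bm_kernel hW hX hX XQ XQ).
have Xm := Xq m mI; move: (Xm); rewrite ler_norml => /andP[X1 X2].
have lo : - (1 + C * (q - X m)) <= \int[lI]_n W (X m - X n).
  rewrite -[leLHS]lI1; apply: (lam_le_null nN (bm_cst _) bk) => n /andP[n1 n2] Nn.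
  have : `|X n| <= q by apply: Xq; rewrite n1 lt_neqAle n2 andbT; apply/eqP.
  rewrite ler_norml => /andP[_ Xn].
  apply: le_trans (_ : W (X m - q) <= _); last by apply: mono_W; rewrite lerD2l lerN2.
  by rewrite -(opprB q) odd lerN2; apply: WC; rewrite subr_ge0.
have hi : \int[lI]_n W (X m - X n) <= 1 + C * (X m + q).
  rewrite -[leRHS]lI1; apply: (lam_le_null nN bk (bm_cst _)) => n /andP[n1 n2] Nn.
  have : `|X n| <= q by apply: Xq; rewrite n1 lt_neqAle n2 andbT; apply/eqP.
  rewrite ler_norml => /andP[Xn _].
  apply: le_trans (WC (X m + q) _); last by lra.
  by apply: mono_W; lra.
have := aL m; rewrite ler_norml => /andP[a1 a2].
have e1 : h * vel W a X m <= h * (L + 1) + (q - X m).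
  apply: le_trans (_ : h * (L + (1 + C * (q - X m))) <= _).
    by apply: ler_wpM2l => //; rewrite /vel; lra.
  have : h * C * (q - X m) <= q - X m by rewrite ler_piMl// subr_ge0.
  rewrite (_ : h * (L + (1 + C * (q - X m))) = h * (L + 1) + h * C * (q - X m)); last by ring.
  by rewrite lerD2l.
have e2 : - (h * (L + 1) + (X m + q)) <= h * vel W a X m.
  apply: le_trans (_ : h * (- (L + (1 + C * (X m + q)))) <= _); last first.
    by apply: ler_wpM2l => //; rewrite /vel; lra.
  have : h * C * (X m + q) <= X m + q by rewrite ler_piMl//; lra.
  rewrite (_ : h * (- (L + (1 + C * (X m + q)))) = - (h * (L + 1) + h * C * (X m + q))); last by ring.
  by rewrite lerN2 lerD2l.
by rewrite /euler ler_norml; apply/andP; split; lra.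
Qed.

Section Iteration.
Variables (T : R) (W : R -> R) (A a : R -> R -> R) (L r0 : R) (f0 : R -> R).
Hypotheses (T0 : 0 < T) (hW : good_kernel W) (fd : flux_density T A a L).
Hypotheses (hf0 : {homo f0 : x y / x <= y}) (f0I : forall x, half_itv (f0 x)) (r00 : 0 < r0)
  (f0r : forall x, r0 <= x -> f0 x = h2 /\ f0 (- x) = - h2).

Let L0 : 0 <= L. Proof. by have [] := fd. Qed.

(** By [euler_bound] one step enlarges the range by at most h (L + 1), hence by T (L + 1) in total.
    The extra 1 keeps the points strictly inside, so that the truncation in [rearr] does not act on
    them. *)
Definition bound : R := r0 + T * (L + 1) + 1.
Definition speed : R := L + W (bound + bound).

Let B0 : 0 <= bound.
Proof.
apply: addr_ge0 => //; apply: addr_ge0; first exact: ltW.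
by apply: mulr_ge0; [exact: ltW|exact: addr_ge0].
Qed.

Fixpoint scheme (n k : nat) : R -> R :=
  if k is k'.+1 then rearr bound (euler W (a (tpt T n k')) (scheme n k') (T / n.+1%:R))
  else ginv bound f0.

Lemma scheme_mono n k : mono bound (scheme n k).
Proof.
have mg f : mono bound (ginv bound f) by split=> [|m]; [exact: ginv_homo|exact: ginv_norm].
by case: k => [|k]; exact: mg.
Qed.

Variable (C : R).
Hypotheses (HC : forall u v, `|W u - W v| <= 1 + C * `|u - v|).

Section Step.
Variable n : nat.
Hypothesis nC : T / n.+1%:R * C <= 1.
Local Notation h := (T / n.+1%:R).

Let h0 : 0 <= h. Proof. by rewrite divr_ge0// ltW. Qed.

Let y k := euler W (a (tpt T n k)) (scheme n k) h.

Let by_ k : bm (y k : mR -> R).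
Proof.
apply: bmD; first exact: bm_mono (scheme_mono n k).
have bv := bm_velm hW fd (tpt T n k) (scheme_mono n k).
exact: (bmM (bm_cst _) bv).
Qed.

Let my k : measurable_fun setT (y k : mR -> mR). Proof. by have [] := by_ k. Qed.

Let q k := r0 + k%:R * (h * (L + 1)).

Let qB k : (k <= n.+1)%N -> 0 <= q k /\ q k <= bound - 1.
Proof.
move=> kn; have d0 : 0 <= h * (L + 1) by rewrite mulr_ge0// addr_ge0.
split; first by apply: addr_ge0; [exact: ltW|exact: mulr_ge0].
rewrite /q /bound addrK lerD2l; apply: le_trans (_ : n.+1%:R * (h * (L + 1)) <= _).
  by rewrite ler_wpM2r// ler_nat.
by rewrite mulrA (mulrC n.+1%:R) divfK ?pnatr_eq0.
Qed.

(** The bound r0 + k h (L + 1) propagates from step to step because rearranging does not enlarge the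
    range. It is stated for m < 1/2 since each iterate equals [bound] at m = 1/2. *)
Let fine k : (k <= n.+1)%N -> forall m, - h2 <= m < h2 -> `|scheme n k m| <= q k.
Proof.
have L0' := L0; have r0' := r00.
elim: k => [|k IH] kn m mI.
  rewrite /q mul0r addr0 /=; apply: ginv_fine => //; first exact: ltW.
    by move=> z /f0r[-> _].
  move=> z zr; have [_] := f0r (x := - z) ltac:(lra); by rewrite opprK => ->.
have {}IH := IH (ltnW kn).
have [_ aL _ _ _] := fd.
have yq m' : - h2 <= m' < h2 -> `|y k m'| <= q k.+1.
  move=> mI'; rewrite (_ : q k.+1 = q k + h * (L + 1)); last by rewrite /q -natr1; ring.
  exact: (euler_bound hW HC h0 nC (scheme_mono n k) (aL _).2 IH mI').
have nN := @null_set1 R h2.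
have yq' m' : - h2 <= m' <= h2 -> ~ [set h2] m' -> `|y k m'| <= q k.+1.
  move=> /andP[m1 m2] Nm; apply: yq; rewrite m1 lt_neqAle m2 andbT.
  by apply/eqP.
have [q0 _] := qB kn; apply: ginv_fine => // z zq.
  rewrite (dist_hi (my k) nN)// => m' mI' Nm; have := yq' m' mI' Nm; rewrite ler_norml; lra.
rewrite (dist_lo (my k) nN)// => m' mI' Nm; have := yq' m' mI' Nm; rewrite ler_norml; lra.
Qed.

Let yB k : (k < n.+1)%N -> forall m, - h2 <= m <= h2 -> ~ [set h2] m -> `|y k m| <= bound - 1.
Proof.
move=> kn m /andP[m1 m2] Nm; have [_ aL _ _ _] := fd.
have mI : - h2 <= m < h2 by rewrite m1 lt_neqAle m2 andbT; apply/eqP.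
have [_] := qB kn; apply: le_trans.
rewrite (_ : q k.+1 = q k + h * (L + 1)); last by rewrite /q -natr1; ring.
exact: (euler_bound hW HC h0 nC (scheme_mono n k) (aL _).2 (fine (ltnW kn)) mI).
Qed.

Lemma scheme_rearr k : (k <= n.+1)%N -> rearr bound (scheme n k) = scheme n k.
Proof.
have L0' := L0; have r0' := r00; case: k => [_|k kn] /=.
  apply: rearr_id; [exact: B0|exact: hf0|by move=> z; apply/half_itvE; exact: f0I|move=> z zB].
  apply: (f0r _).1; apply: le_trans zB; rewrite /bound -addrA lerDl addr_ge0//.
  by rewrite mulr_ge0 ?ltW//; lra.
apply: rearr_id; [exact: B0|exact: (dist_homo (my k))|by move=> z; exact: (dist_itv z (my k))|].
move=> z zB; apply: (dist_hi (my k) (@null_set1 R h2)) => m mI Nm.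
by have := yB kn mI Nm; rewrite ler_norml; lra.
Qed.

(** The Euler step moves each point by at most h * speed; the old iterate is its own rearrangement
    ([scheme_rearr]), so the contraction property carries this bound to the new one. *)
Lemma scheme_step k m : (k < n.+1)%N -> `|scheme n k.+1 m - scheme n k m| <= h * speed.
Proof.
move=> kn; have mX := scheme_mono n k.
have vV u : `|h * vel W (a (tpt T n k)) (scheme n k) u| <= h * speed.
  rewrite normrM (ger0_norm h0) ler_wpM2l//; exact: (velm_bound hW fd).
have V0 : 0 <= h * speed by apply: le_trans (vV 0).
have mS : measurable_fun setT (scheme n k : mR -> mR) by have [] := bm_mono mX.
have lin (u v w : R) : u <= v + w -> v <= u + w -> `|u - v| <= w.
  by move=> ? ?; rewrite ler_norml; apply/andP; split; lra.
have yX u : y k u <= scheme n k u + h * speed /\ scheme n k u <= y k u + h * speed.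
  have := vV u; rewrite /y /euler ler_norml => /andP[].
  by move: (h * vel _ _ _ _) (h * speed) (scheme n k u) => u1 u2 u3 ? ?; split; lra.
rewrite -[in X in _ - X](scheme_rearr (ltnW kn)); apply: lin.
  by apply: (rearr_le B0 V0 (my k) mS (@null_set0 R)) => u _ _; have [] := yX u.
by apply: (rearr_le B0 V0 mS (my k) (@null_set0 R)) => u _ _; have [] := yX u.
Qed.

Lemma scheme_entropy k Q (g zeta : R -> R) : (k < n.+1)%N -> bound <= Q ->
  {homo g : u v / u <= v} -> bm (g : mR -> R) -> bm (zeta : mR -> R) -> (forall x, 0 <= zeta x) ->
  \int[lI]_m (g m * \int[lam (- Q) (y k m)]_x zeta x) <=
  \int[lI]_m (g m * \int[lam (- Q) (scheme n k.+1 m)]_x zeta x).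
Proof.
move=> kn BQ hg bg bz z0; apply: (rearr_entropy B0 BQ (by_ k) (@null_set1 R h2)) => // m mI Nm.
by have := yB kn mI Nm; rewrite ler_norml => /andP[? ?]; lra.
Qed.

Lemma scheme_lip k l m : (l <= k)%N -> (k <= n.+1)%N ->
  `|scheme n k m - scheme n l m| <= (tpt T n k - tpt T n l) * speed.
Proof.
elim: k => [|k IH] lk kn; first by move: lk; rewrite leqn0 => /eqP ->; rewrite !subrr normr0 mul0r.
move: lk; rewrite leq_eqVlt => /predU1P[->|lk]; first by rewrite !subrr normr0 mul0r.
apply: le_trans (ler_distD (scheme n k m) _ _) _; rewrite tptS.
rewrite (_ : (_ + _ - _) * speed = h * speed + (tpt T n k - tpt T n l) * speed); last by ring.
by apply: lerD; [exact: scheme_step|exact: IH lk (ltnW kn)].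
Qed.

End Step.
End Iteration.
End Scheme.

(** * Limit of the scheme *)

Section Limit.
Context {R : realType}.
Local Notation mu := (@lebesgue_measure R).
Local Notation h2 := (2^-1 : R).
Local Notation lI := (lam (- 2^-1 : R) 2^-1).
Local Notation mR := (measurableTypeR R).

Lemma arch_le (c e : R) : 0 < e -> exists n0, forall n, (n0 <= n)%N -> c / n.+1%:R <= e.
Proof.
move=> e0; have [n0 _ Hn] : \forall n \near \oo, c / e < n%:R :> R by exact: nbhs_infty_gtr.
exists n0 => n /Hn /=; rewrite ltr_pdivrMr// => h.
rewrite ler_pdivrMr ?ltr0n// mulrC; apply: le_trans (ltW h) _.
by rewrite ler_wpM2r ?(ltW e0)// ler_nat.
Qed.

(** Exactly what the passage to the limit uses of the iterates; the last clause is the discrete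
    entropy inequality. *)
Definition approx_scheme (T : R) (W : R -> R) (a : R -> R -> R) (B V : R) (X0 : R -> R)
    (N : nat) (xs : nat -> nat -> R -> R) := forall n, (N <= n)%N ->
  [/\ xs n 0%N = X0, forall k, mono B (xs n k),
    forall k l m, (l <= k)%N -> (k <= n.+1)%N ->
      `|xs n k m - xs n l m| <= (tpt T n k - tpt T n l) * V &
    forall k Q (g zeta : R -> R), (k < n.+1)%N -> B <= Q ->
      {homo g : u v / u <= v} -> bm (g : mR -> R) -> bm (zeta : mR -> R) ->
      (forall x, 0 <= zeta x) ->
      \int[lI]_m (g m * \int[lam (- Q) (euler W (a (tpt T n k)) (xs n k) (T / n.+1%:R) m)]_x zeta x)
      <= \int[lI]_m (g m * \int[lam (- Q) (xs n k.+1 m)]_x zeta x)].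

Lemma scheme_exists T W A a L f0 r0 : 0 < T -> good_kernel W -> flux_density T A a L ->
  {homo f0 : x y / x <= y} -> (forall x, half_itv (f0 x)) -> 0 < r0 ->
  (forall x, r0 <= x -> f0 x = h2 /\ f0 (- x) = - h2) ->
  exists B V N xs, [/\ 0 <= B, 0 <= V, r0 <= B, L + W (B + B) <= V &
    approx_scheme T W a B V (ginv B f0) N xs].
Proof.
move=> T0 hW fd hf0 f0I r00 f0r; have [_ _ /(_ 1 ltr01)[C C0 HC]] := hW.
have [L0 _ _ _ _] := fd.
have [N HN] := arch_le (T * C) ltr01.
have rB : r0 <= bound T L r0.
  by rewrite /bound -addrA lerDl addr_ge0// mulr_ge0 ?(ltW T0)// addr_ge0.
have B0 : 0 <= bound T L r0 by rewrite (le_trans _ rB)// ltW.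
exists (bound T L r0), (speed T W L r0), N, (scheme T W a L r0 f0).
split; [exact: B0| |exact: rB|exact: lexx|].
  rewrite /speed addr_ge0//; have [odd mW _] := hW.
  have W0 : W 0 = 0 by have := odd 0; rewrite oppr0 => /eqP; rewrite -addr_eq0 -mulr2n mulrn_eq0 => /eqP.
  by rewrite -W0 mW// addr_ge0.
move=> n /HN; rewrite mulrAC => nC; split; first by [].
- by move=> k; exact: (scheme_mono W f0 T0 fd r00).
- by move=> k l m lk kn; exact: (scheme_lip T0 hW fd hf0 f0I r00 f0r HC nC).
- by move=> k Q g zeta kn; exact: (scheme_entropy T0 hW fd r00 f0r HC nC kn).
Qed.

(** By compactness. One ultrafilter yields limits at all points (t, m) at once, without extracting
    subsequences. *)
Lemma ultra_limit (U : set_system nat) (u : nat -> R) B : UltraFilter U ->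
  (forall n, `|u n| <= B) -> exists l, forall e, 0 < e -> U [set n | `|u n - l| <= e].
Proof.
move=> UU uB.
have cK : compact `[- B, B]%classic by exact: segment_compact.
have PU : ProperFilter (u @ U) by exact: fmap_proper_filter.
have UB : (u @ U) `[- B, B]%classic.
  rewrite /fmap /=; apply: (@filterS _ U _ setT); last exact: filterT.
  by move=> n _ /=; rewrite in_itv/= -ler_norml.
have [l [_ cl]] := cK _ PU UB; exists l => e e0.
have [//|/= H] := @in_ultra_setVsetC nat U [set n | `|u n - l| <= e] UU.
have hC : (u @ U) (~` (ball l e)).
  change (U (u @^-1` (~` ball l e))); apply: filterS H => n h1 h3; apply: h1.
  by move: h3; rewrite /= /ball/= distrC => /ltW.
by have [y []] := cl _ _ hC (nbhsx_ballx l e e0).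
Qed.

(** Between neighbouring grid points monotone functions differ by at most e plus the increment of G;
    the increments telescope to at most B + B, and the mesh is 1 / (q + 1). *)
Lemma mono_grid (F G : R -> R) B q e : mono B F -> mono B G ->
  (forall i, (i <= q.+1)%N -> `|F (- h2 + i%:R / q.+1%:R) - G (- h2 + i%:R / q.+1%:R)| <= e) ->
  l1d F G <= e + (B + B) / q.+1%:R.
Proof.
move=> mF mG H; have [hF FB] := mF; have [hG GB] := mG.
pose p (i : nat) : R := - h2 + i%:R / q.+1%:R; pose d : R := q.+1%:R^-1.
have pS i : p i.+1 = p i + d by rewrite /p -[i.+1%:R]natr1 mulrDl mul1r addrA.
have d0 : 0 <= d by rewrite invr_ge0.
have p0 : p 0%N = - h2 by rewrite /p mul0r addr0.
have pq : p q.+1 = h2 by rewrite /p divff ?pnatr_eq0//; lra.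
have bd := bm_norm (bmB (bm_mono mF) (bm_mono mG)).
have pi i : - h2 <= p i by rewrite lerDl divr_ge0.
have key i : (i <= q.+1)%N ->
    \int[lam (- h2) (p i)]_m `|F m - G m| <= e * (p i + h2) + d * (G (p i) - G (p 0%N)).
  elim: i => [|i IH] iq.
    by rewrite lam_empty ?p0// addNr subrr !mulr0 addr0.
  have ppi : p i <= p i.+1 by rewrite pS lerDl.
  rewrite (lam_split bd (pi i) ppi).
  have -> : e * (p i.+1 + h2) + d * (G (p i.+1) - G (p 0%N)) =
    (e * (p i + h2) + d * (G (p i) - G (p 0%N))) + (e + (G (p i.+1) - G (p i))) * (p i.+1 - p i).
    by rewrite pS; ring.
  apply: lerD; first exact: IH (ltnW iq).
  rewrite -(lam_cst _ ppi); apply: lam_le => //; first exact: bm_cst.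
  move=> m /andP[m1 m2]; have := H i (ltnW iq); have := H i.+1 iq.
  rewrite -/(p i) -/(p i.+1) !ler_norml => /andP[? ?] /andP[? ?].
  have := hF _ _ m1; have := hF _ _ m2; have := hG _ _ m1; have := hG _ _ m2.
  by move=> ? ? ? ?; apply/andP; split; lra.
have := key q.+1 (leqnn _); rewrite pq -/(l1d F G) => h; apply: le_trans h _.
have -> : h2 + h2 = 1 by lra.
rewrite mulr1 lerD2l mulrC ler_wpM2r//; have := GB h2; have := GB (p 0%N).
by rewrite !ler_norml => /andP[? ?] /andP[? ?]; lra.
Qed.

Section UltraLimit.
Variables (T : R) (W : R -> R) (a : R -> R -> R) (B V : R) (X0 : R -> R).
Variables (N : nat) (xs : nat -> nat -> R -> R).
Hypotheses (T0 : 0 < T) (B0 : 0 <= B) (V0 : 0 <= V) (mX0 : mono B X0).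
Hypothesis hs : approx_scheme T W a B V X0 N xs.

Let idx n (t : R) := Num.truncn (t * n.+1%:R / T).

Let idx_cell n k t : tpt T n k <= t < tpt T n k.+1 -> idx n t = k.
Proof.
move=> /andP[t1 t2]; apply: truncn_def; move: t1 t2; rewrite /tpt.
have n0 : 0 < n.+1%:R :> R by rewrite ltr0n.
rewrite ler_pdivlMr// ltr_pdivrMr// => t1 t2; apply/andP; split.
  by move: t1; rewrite mulrA ler_pdivrMr// mulrC.
by move: t2; rewrite mulrA ltr_pdivlMr// [T * _]mulrC.
Qed.

Let idx_itv n t : 0 <= t <= T -> (idx n t <= n.+1)%N /\ tpt T n (idx n t) <= t < tpt T n (idx n t) + T / n.+1%:R.
Proof.
move=> /andP[t0 tT]; have n0 : 0 < n.+1%:R :> R by rewrite ltr0n.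
have Tn : 0 <= t * n.+1%:R / T by rewrite divr_ge0 ?(ltW T0)// mulr_ge0.
have /andP[i1 i2] := truncn_itv Tn; rewrite -tptS; split; last first.
  apply/andP; split; rewrite /tpt mulrA.
    by rewrite ler_pdivrMr// mulrC -ler_pdivlMr.
  by rewrite ltr_pdivlMr// [T * _]mulrC -ltr_pdivrMr.
rewrite -(ler_nat R) (le_trans i1)// ler_pdivrMr// mulrC ler_wpM2l//.
Qed.

Let Xn n t := xs n (idx n t).

Let Xn_lip n s t m : (N <= n)%N -> 0 <= s <= T -> 0 <= t <= T ->
  `|Xn n t m - Xn n s m| <= V * (`|t - s| + T / n.+1%:R).
Proof.
move=> nN sI tI; have [_ _ lip _] := hs nN.
have [i1 /andP[i2 i3]] := idx_itv n sI; have [j1 /andP[j2 j3]] := idx_itv n tI.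
have lin (p q u v h d : R) : p <= v -> u < q + h -> v - u <= d -> p - q <= d + h by lra.
have [ij|/ltnW ji] := leqP (idx n s) (idx n t).
  apply: le_trans (lip _ _ m ij j1) _; rewrite mulrC ler_wpM2l//.
  exact: lin j2 i3 (ler_norm _).
rewrite distrC; apply: le_trans (lip _ _ m ji i1) _; rewrite mulrC ler_wpM2l//.
by apply: lin i2 j3 _; rewrite distrC; exact: ler_norm.
Qed.

(** X is the pointwise limit along the ultrafilter. For L1 closeness at all times, closeness at
    finitely many points (t, m) suffices: [mono_grid] handles m and the Lipschitz bound handles t.
    So for each tolerance some arbitrarily large index n is good simultaneously on all time
    cells. *)
Lemma limit_exists : exists X : R -> R -> R, [/\ X 0 = X0, forall t, mono B (X t),
  forall s t m, 0 <= s <= T -> 0 <= t <= T -> `|X t m - X s m| <= V * `|t - s| &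
  forall e M, 0 < e -> exists n, [/\ (N <= n)%N, (M <= n)%N & forall k t, (k <= n)%N ->
    tpt T n k <= t < tpt T n k.+1 -> l1d (X t) (xs n k) <= e]].
Proof.
have [U [UU sU]] := ultraFilterLemma (filter.eventually_filter : ProperFilter \oo).
have tail M : U [set n | (M <= n)%N] by apply: sU; exists M.
pose x n t := if (N <= n)%N then Xn n t else X0.
have mx n t : mono B (x n t).
  by rewrite /x; case: ifP => // nN; have [_ h _ _] := hs nN; exact: h.
have H p : exists l, forall e, 0 < e -> U [set n | `|x n p.1 p.2 - l| <= e].
  by apply: (@ultra_limit U _ B) => n; have [_ h] := mx n p.1; exact: h.
have [f Hf] := choice H; pose X t m := f (t, m).
have HX t m e : 0 < e -> U [set n | `|x n t m - X t m| <= e] by exact: (Hf (t, m)).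
have FU : ProperFilter U by exact: ultra_proper.
have mX t : mono B (X t).
  split=> [u v uv|m]; apply/ler_addgt0Pr => e e0.
    have [n [/= h1 h3]] := filter_ex (filterI (HX t u (e / 2) (divr_gt0 e0 (ltr0Sn R 1)))
      (HX t v (e / 2) (divr_gt0 e0 (ltr0Sn R 1)))).
    have [hm _] := mx n t; have := hm _ _ uv.
    by move: h1 h3; rewrite !ler_norml => /andP[? ?] /andP[? ?]; lra.
  have [n /= h1] := filter_ex (HX t m e e0); have [_ hb] := mx n t; have := hb m.
  by move: h1; rewrite !ler_norml => /andP[? ?] /andP[? ?]; apply/andP; split; lra.
have Xlip s t m : 0 <= s <= T -> 0 <= t <= T -> `|X t m - X s m| <= V * `|t - s|.
  move=> sI tI; apply/ler_addgt0Pr => e e0.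
  have e3 : 0 < e / 3 by lra.
  have [M HM] := arch_le (V * T) e3.
  have [n [/= [h1 h3] [h4 h5]]] := filter_ex (filterI (filterI (HX t m _ e3) (HX s m _ e3))
    (filterI (tail N) (tail M))).
  have := HM n h5; have := Xn_lip m h4 sI tI; rewrite mulrDr mulrA.
  move: h1 h3; rewrite /x h4 => h1 h3 h6 h7.
  have -> : X t m - X s m = (X t m - Xn n t m) + (Xn n t m - Xn n s m) + (Xn n s m - X s m) by ring.
  apply: le_trans (ler_normD _ _) _; apply: le_trans (lerD (ler_normD _ _) (lexx _)) _.
  by rewrite [`|X t m - _|]distrC; move: h1 h3 h6 h7; move: (V * T / _) (V * `|_|) => ? ?; lra.
exists X; split; [|exact: mX|exact: Xlip|].
  apply/funext => m; apply/eqP; rewrite -subr_eq0 -normr_le0; apply/ler_addgt0Pr => e e0.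
  have [n [/= h1 h3]] := filter_ex (filterI (HX 0 m e e0) (tail N)).
  have [x0 _ _ _] := hs h3; move: h1; rewrite /x h3 /Xn /idx !mul0r truncn0 x0 distrC; lra.
move=> e M e0; have e8 : 0 < e / 8 by lra.
have [p Hp] := arch_le (V * T) e8; have {Hp}hp := Hp p (leqnn p).
have [q Hq] := arch_le (B + B) e8; have {Hq}hq := Hq q (leqnn q).
have [M' HM] := arch_le (V * T) e8.
(* A finite intersection of members of U, over a grid of times and of values of m. *)
have UG : U [set n | forall ij : 'I_p.+1 * 'I_q.+2,
    `|x n (tpt T p ij.1) (- h2 + ij.2%:R / q.+1%:R) - X (tpt T p ij.1) (- h2 + ij.2%:R / q.+1%:R)| <= e / 8].
  by apply: filter_forall => ij; exact: HX.
have [n [/= hG [h1 [h3 h4]]]] := filter_ex (filterI UG (filterI (tail N) (filterI (tail M) (tail M')))).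
exists n; split; [exact: h1|exact: h3|] => k t kn /[dup] tk /andP[t1 t2].
have k1 := tpt_itv T0 (n := n) (k := k) (leqW kn).
have k2 := tpt_itv T0 (n := n) (k := k.+1) kn.
have t0 : 0 <= t by have /andP[h _] := k1; exact: le_trans h t1.
have tT : t < T by have /andP[_ h] := k2; exact: lt_le_trans t2 h.
have tI : 0 <= t <= T by rewrite t0 ltW.
have tI' : 0 <= t < T by rewrite t0.
have [j jp /andP[j1 j2]] := tpt_cell p tI'.
have jI := tpt_itv T0 (n := p) (k := j) (ltnW jp).
set s := tpt T p j in j1 jI.
have ts : `|t - s| <= T / p.+1%:R.
  by rewrite ger0_norm ?subr_ge0// lerBlDl /s -tptS ltW.
have <- : Xn n t = xs n k by rewrite /Xn (idx_cell tk).
have mXn u : mono B (Xn n u) by have [_ h _ _] := hs h1; exact: h.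
have bX u := bm_mono (mX u); have bXn u := bm_mono (mXn u).
have Vp : V * `|t - s| <= e / 8.
  by apply: le_trans (ler_wpM2l V0 ts) _; rewrite mulrA.
have d1 : l1d (X t) (X s) <= e / 8.
  apply: l1d_le_sup => // m; exact: le_trans (Xlip s t m jI tI) Vp.
have d2 : l1d (Xn n s) (Xn n t) <= e / 8 + e / 8.
  rewrite l1d_sym; apply: l1d_le_sup => // m; apply: le_trans (Xn_lip m h1 jI tI) _.
  by rewrite mulrDr mulrA; apply: lerD => //; exact: HM.
have d3 : l1d (X s) (Xn n s) <= e / 8 + e / 8.
  rewrite l1d_sym; apply: le_trans (mono_grid (mXn s) (mX s) (q := q) (e := e / 8) _) _; last exact: lerD.
  move=> i iq; have := hG (Ordinal jp, Ordinal (iq : (i < q.+2)%N)).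
  by rewrite /= /x h1.
have := l1d_tri (bX t) (bX s) (bXn t); have := l1d_tri (bX s) (bXn s) (bXn t).
by move=> l1 l2; lra.
Qed.

End UltraLimit.
End Limit.

(** * Passage to the limit in the entropy inequality *)

Section LimitEntropy.
Context {R : realType}.
Local Notation mu := (@lebesgue_measure R).
Local Notation h2 := (2^-1 : R).
Local Notation lI := (lam (- 2^-1 : R) 2^-1).
Local Notation mR := (measurableTypeR R).
Local Notation e01 := ((0, 1) : R * R).

Lemma mono_le (B Q : R) X : B <= Q -> mono B X -> mono Q X.
Proof. by move=> BQ [hX XB]; split=> // m; exact: le_trans BQ. Qed.

Lemma lam_taylor (q x y K : R) (f : R -> R) : bm (f : mR -> R) -> 0 <= K ->
  (forall u v, `|f u - f v| <= K * `|u - v|) -> q <= x -> q <= y ->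
  `|\int[lam q y]_u f u - \int[lam q x]_u f u - (y - x) * f x| <= K * `|y - x| ^+ 2.
Proof.
move=> bf K0 fL qx qy.
have bd u v w : u <= v -> u <= w -> w <= v ->
    `|\int[lam u v]_z f z - (v - u) * f w| <= K * (v - u) ^+ 2.
  move=> uv uw wv; have bc := bm_cst (f w) (Y := mR).
  rewrite mulrC -(lam_cst (f w) uv) -(intB (lam u v) bf bc).
  apply: le_trans (int_norm (lam u v) (bmB bf bc)) _.
  have -> : K * (v - u) ^+ 2 = K * (v - u) * (v - u) by ring.
  rewrite -(lam_cst (K * (v - u)) uv).
  apply: lam_le; [exact: bm_norm (bmB bf bc)|exact: bm_cst|].
  move=> z /andP[z1 z2]; apply: le_trans (fL z w) _; rewrite ler_wpM2l// ler_norml.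
  by apply/andP; split; lra.
have [xy|/ltW yx] := leP x y.
  rewrite (lam_split bf qx xy) [X in `|X - _|]addrC addKr.
  by have := bd x y x xy (lexx x) xy; rewrite [`|y - x|]ger0_norm// subr_ge0.
rewrite (lam_split bf qy yx) opprD addrA subrr add0r distrC [`|y - x|]distrC.
have := bd y x x yx yx (lexx x); rewrite [`|x - y|]ger0_norm ?subr_ge0//.
by move: (Rintegral _ _ _) => I; rewrite (_ : I - _ = (y - x) * f x - - I)//; ring.
Qed.

Section Taylor.
Variables (T : R) (zeta : R * R -> R) (Q : R).
Hypothesis tz : test_function (strip T) zeta.

Definition sprim (t x : R) := \int[lam (- Q) x]_y zeta (y, t).

(** Taylor's formula in the direction (v, 1): [sprim] has derivative [zeta] in x and [tprim] in
    t. *)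
Lemma sprim_taylor V : 0 <= V -> exists2 C, 0 <= C & forall x t h v, - Q <= x -> x <= Q ->
  - Q <= x + h * v -> 0 <= h -> `|v| <= V ->
  `|sprim (t + h) (x + h * v) - sprim t x - h * (tprim Q zeta t x + zeta (x, t) * v)| <= C * h ^+ 2.
Proof.
move=> V0; have [sz _ _] := tz; have tz1 := test_derive e01 tz.
have [K K0 HK] := strip_lip tz; have [K1 K10 HK1] := strip_lip tz1.
have bz t := strip_section_bm t tz; have bz1 t := strip_section_bm t tz1.
exists (K * V ^+ 2 + K * V + K1 * (Q + `|Q|)) => [|x t h v Qx xQ Qy h0 vV].
  rewrite !addr_ge0// ?mulr_ge0// ?exprn_ge0//.
  by have := ler_normr (- Q) Q; have := ler_norm (- Q); rewrite normrN; lra.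
(* D1 is the displacement in x at time t + h, D2 the change of zeta in time, D3 the change of
   [sprim] in time at fixed x. *)
pose D1 := sprim (t + h) (x + h * v) - sprim (t + h) x - (h * v) * zeta (x, t + h).
pose D2 := (h * v) * (zeta (x, t + h) - zeta (x, t)).
pose D3 := sprim (t + h) x - sprim t x - h * tprim Q zeta t x.
have -> : sprim (t + h) (x + h * v) - sprim t x - h * (tprim Q zeta t x + zeta (x, t) * v) =
  D1 + D2 + D3 by rewrite /D1 /D2 /D3; ring.
have hv : `|h * v| <= h * V by rewrite normrM (ger0_norm h0) ler_wpM2l.
have E1 : `|D1| <= K * V ^+ 2 * h ^+ 2.
  have lp u w : `|zeta (u, t + h) - zeta (w, t + h)| <= K * `|u - w|.
    by apply: le_trans (HK u (t + h) w (t + h)).2 _; rewrite subrr normr0 addr0.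
  have := lam_taylor (bz (t + h)) K0 lp Qx Qy; rewrite (_ : x + h * v - x = h * v) => [H|]; last by rewrite addrC addKr.
  apply: le_trans H _; rewrite -mulrA ler_wpM2l// -exprMn [V * h]mulrC.
  by apply: lerXn2r => //; rewrite nnegrE// mulr_ge0.
have E2 : `|D2| <= K * V * h ^+ 2.
  rewrite /D2 normrM; have -> : K * V * h ^+ 2 = (h * V) * (K * h) by ring.
  apply: ler_pM => //; apply: le_trans (HK x (t + h) x t).2 _.
  by rewrite subrr normr0 add0r (_ : t + h - t = h) ?ger0_norm// addrC addKr.
have E3 : `|D3| <= K1 * (Q + `|Q|) * h ^+ 2.
  have b1 := bmB (bz (t + h)) (bz t); have b2 := bmM (bm_cst h) (bz1 t).
  rewrite /D3 /sprim /tprim -(intB (lam (- Q) x) (bz (t + h)) (bz t)).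
  rewrite -(intZ (lam (- Q) x) h (bz1 t)) -(intB (lam (- Q) x) b1 b2).
  apply: le_trans (int_norm (lam (- Q) x) (bmB b1 b2)) _.
  apply: le_trans (lam_le (g := fun=> K1 * h ^+ 2) (bm_norm (bmB b1 b2)) (bm_cst _) _) _.
    move=> y _; have [c /andP[c0 ch]] := MVT_line (f := zeta) (v := e01) ((y, t) : R * R)
      (fun q => smooth_derivable sz) h0.
    have pE (r : R) : (y, t) + r *: e01 = (y, t + r) :> R * R.
      by rewrite /GRing.add/GRing.scale/= /add_pair/= /GRing.scale/= mulr1 mulr0 addr0.
    rewrite !pE => ->; rewrite mulrC -mulrBr normrM (ger0_norm h0) expr2 mulrCA ler_wpM2l//.
    apply: le_trans (HK1 y (t + c) y t).2 _; rewrite subrr normr0 add0r.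
    by rewrite (_ : t + c - t = c) ?(ger0_norm c0) ?ler_wpM2l// addrC addKr.
  rewrite lam_cst// mulrAC ler_wpM2r ?exprn_ge0// ler_wpM2l//.
  by have := ler_norm Q; lra.
rewrite !mulrDl; apply: le_trans (ler_normD _ _) _; apply: lerD => //.
by apply: le_trans (ler_normD _ _) _; apply: lerD.
Qed.

End Taylor.

Let lin_low (x d b v q : R) : - b <= x -> - v <= d -> b + v <= q -> - q <= x + d.
Proof. lra. Qed.

Let lin_taylor (u d1 d2 h r c : R) : - c <= u * (d1 - d2 - h * r) ->
  h * (u * r) <= u * d1 - u * d2 + c.
Proof. lra. Qed.

Let lin_cell (s1 s2 c q : R) : c <= q + q -> s1 - s2 <= q + c -> s1 <= s2 + (q + (q + q)).
Proof. lra. Qed.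

Let lin_step (p s c q j1 j2 j3 : R) : s <= j2 - j1 + c -> c <= q ->
  (j1 - j3 + p) + (s + 3 * q) <= j2 - j3 + (p + 4 * q).
Proof. lra. Qed.

Section Inequality.
Variables (T : R) (W : R -> R) (A a : R -> R -> R) (L B V : R) (X0 : R -> R).
Variables (N : nat) (xs : nat -> nat -> R -> R) (X : R -> R -> R).
Hypotheses (T0 : 0 < T) (B0 : 0 <= B) (V0 : 0 <= V) (LV : L + W (B + B) <= V).
Hypotheses (hW : good_kernel W) (fd : flux_density T A a L).
Hypothesis hs : approx_scheme T W a B V X0 N xs.
Hypothesis mX : forall t, mono B (X t).
Hypothesis Xlip : forall s t m, 0 <= s <= T -> 0 <= t <= T -> `|X t m - X s m| <= V * `|t - s|.
Hypothesis Xapp : forall e M, 0 < e -> exists n, [/\ (N <= n)%N, (M <= n)%N & forall k t,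
  (k <= n)%N -> tpt T n k <= t < tpt T n k.+1 -> l1d (X t) (xs n k) <= e].
Variables (zeta : R * R -> R) (Q : R) (g : R -> R) (G : R).
Hypothesis tz : test_function (strip T) zeta.
Hypothesis zs : forall x t, ~~ (0 < t < T) -> zeta (x, t) = 0.
Hypothesis BQ : B + T * V <= Q.
Hypotheses (bg : bm (g : mR -> R)) (gG : forall m, `|g m| <= G).
Hypothesis hent : forall n k, (N <= n)%N -> (k < n.+1)%N ->
  \int[lI]_m (g m * sprim zeta Q (tpt T n k.+1) (euler W (a (tpt T n k)) (xs n k) (T / n.+1%:R) m))
  <= \int[lI]_m (g m * sprim zeta Q (tpt T n k.+1) (xs n k.+1 m)).

Let S t X := slice_rate W (a t) g (tprim Q zeta t) (fun x => zeta (x, t)) X.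

Let TV : 0 <= T * V. Proof. by rewrite mulr_ge0 ?(ltW T0). Qed.
Let BQ' : B <= Q. Proof. by apply: le_trans BQ; rewrite lerDl. Qed.
Let Q0 : 0 <= Q. Proof. exact: le_trans BQ'. Qed.
Let G0 : 0 <= G. Proof. by apply: le_trans (gG 0). Qed.

Lemma limit_ucont : ucont_on T (fun t s => l1d (X t) (X s)).
Proof.
move=> e e0; have V1 : 0 < V + 1 by rewrite ltr_wpDl.
exists (e / (V + 1)); first by rewrite divr_gt0.
move=> s t sI tI ts; apply: l1d_le_sup => [||m]; [exact: bm_mono (mX t)|exact: bm_mono (mX s)|].
apply: le_trans (Xlip m sI tI) _; apply: le_trans (_ : (V + 1) * `|t - s| <= _).
  by rewrite ler_wpM2r// lerDl.
by rewrite mulrC -ler_pdivlMr.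
Qed.

(* One step of the scheme for the entropy int g P(X) with P' = zeta >= 0.      *)
Lemma scheme_dissipation : exists2 C, 0 <= C & forall n k, (N <= n)%N -> (k < n.+1)%N ->
  T / n.+1%:R * S (tpt T n k) (xs n k) <=
  \int[lI]_m (g m * sprim zeta Q (tpt T n k.+1) (xs n k.+1 m)) -
  \int[lI]_m (g m * sprim zeta Q (tpt T n k) (xs n k m)) + C * (T / n.+1%:R) ^+ 2.
Proof.
have [C C0 HC] := sprim_taylor Q tz V0; exists (G * C); first exact: mulr_ge0.
move=> n k nN kn; have [_ mx _ _] := hs nN; have := hent nN kn.
set h := T / n.+1%:R; have h0 : 0 <= h by rewrite divr_ge0// ltW.
have hT : h <= T by rewrite /h ler_pdivrMr ?ltr0n// ler_peMr ?ler1n// ltW.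
set t := tpt T n k; have tE : tpt T n k.+1 = t + h by exact: tptS.
have bz u := strip_section_bm u tz.
have mk := mx k; have mkQ := mono_le BQ' mk; have [hk kB] := mk.
have bv := bm_velm hW fd t mk.
have bX := bm_mono mk.
have by_ : bm (euler W (a t) (xs n k) h : mR -> R) by exact: bmD bX (bmM (bm_cst h) bv).
have vV m : `|vel W (a t) (xs n k) m| <= V by apply: le_trans LV; exact: (velm_bound hW fd).
have b1 := bmM bg (bm_primX Q (bz (t + h)) by_).
have b2 := bmM bg (bm_primX Q (bz t) bX).
have b2' := bm_primX Q (bz t) bX.
rewrite tE => H; apply: (le_trans _ (lerD (lerB H (lexx _)) (lexx _))).
have [K [cp cz pzK _]] := strip_pair_zeta Q0 tz.
have bp : bm ((fun m => tprim Q zeta t (xs n k m)) : mR -> R).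
  by apply: (bm_contX (K := K) (cp t) mkQ) => x xQ; exact: (pzK t x xQ).1.
have bzX : bm ((fun m => zeta (xs n k m, t)) : mR -> R).
  by apply: (bm_contX (K := K) (cz t) mkQ) => x xQ; exact: (pzK t x xQ).2.
have bS := bmM bg (bmD bp (bmM bzX bv)).
have bhS := bmM (bm_cst h) bS.
rewrite /S /slice_rate -(intZ lI h bS) -[G * C * h ^+ 2]lI1 -(intB lI b1 b2).
have b3 := bmB b1 b2; rewrite -(intD lI b3 (bm_cst _)).
apply: int_le => //; first exact: bmD b3 (bm_cst _).
move=> m; have xB := kB m; move: (xB); rewrite ler_norml => /andP[x1 x2].
have hv : `|h * vel W (a t) (xs n k) m| <= T * V.
  by rewrite normrM (ger0_norm h0); exact: ler_pM.
have Qx : - Q <= xs n k m by rewrite (le_trans _ x1)// lerN2.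
have xQ : xs n k m <= Q by rewrite (le_trans x2).
have Qy : - Q <= xs n k m + h * vel W (a t) (xs n k) m.
  by move: hv; rewrite ler_norml => /andP[hv _]; exact: lin_low x1 hv BQ.
have := HC _ t h _ Qx xQ Qy h0 (vV m).
rewrite -/(euler W (a t) (xs n k) h m) -/(sprim zeta Q t (xs n k m)).
rewrite -/(sprim zeta Q (t + h) (euler W (a t) (xs n k) h m)).
set D1 := sprim _ _ (t + h) _; set D2 := sprim _ _ t _.
set r := _ + _ * vel _ _ _ _ => Hm.
have : `|g m * (D1 - D2 - h * r)| <= G * (C * h ^+ 2) by rewrite normrM; exact: ler_pM.
by rewrite ler_norml [G * (C * _)]mulrA => /andP[Hl _]; exact: (lin_taylor Hl).
Qed.

(** Summing [scheme_dissipation] over the time steps telescopes, and the boundary terms vanish with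
    zeta at times 0 and T. The discrete inequality is taken as a hypothesis for the given g and
    zeta, rather than monotonicity of g and a sign of zeta, so that the same argument yields
    conservation of mass. *)
Lemma limit_entropy : \int[lam 0 T]_t S (tclamp T t) (X (tclamp T t)) <= 0.
Proof.
have [C C0 HC] := scheme_dissipation.
have [K sp] := strip_pair_zeta Q0 tz.
have mXQ t := mono_le BQ' (mX t).
have uS : ucont T (fun t => S t (X t)).
  exact: (ucont_slice hW fd sp bg (fun t _ => mXQ t) limit_ucont).
have bS := ucont_bm T0 uS.
apply/ler_addgt0Pr => e e0; rewrite add0r.
have e1 : 0 < e / 4 / T by rewrite !divr_gt0.
have [C' C'0 HC'] := slice_cont hW fd sp bg e1.
have e2 : 0 < e / 4 / T / (C' + 1) by rewrite divr_gt0// ltr_wpDl.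
have e4 : 0 < e / 4 / T by rewrite !divr_gt0.
have [M1 HM1] := arch_le (C' * T) e4; have [M2 HM2] := arch_le (C * T) e4.
have [n [nN nM napp]] := Xapp (maxn M1 M2) e2.
have {}HM1 := HM1 n (leq_trans (leq_maxl _ _) nM).
have {}HM2 := HM2 n (leq_trans (leq_maxr _ _) nM).
have [_ mx _ _] := hs nN.
set h := T / n.+1%:R; have h0 : 0 <= h by rewrite divr_ge0// ltW.
pose J k := \int[lI]_m (g m * sprim zeta Q (tpt T n k) (xs n k m)).
have J0 t k : ~~ (0 < t < T) -> \int[lI]_m (g m * sprim zeta Q t (xs n k m)) = 0.
  move=> tT; rewrite (int_ext lI (g := fun=> 0)) ?int_cst ?mul0r// => m.
  rewrite /sprim (int_ext _ (g := fun=> 0)) ?int_cst ?mul0r ?mulr0// => x.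
  exact: zs.
have key k : (k <= n.+1)%N -> \int[lam 0 (tpt T n k)]_t S (tclamp T t) (X (tclamp T t)) <=
    J k - J 0%N + tpt T n k * (e / T).
  elim: k => [|k IH] kn; first by rewrite tpt0 lam_empty// subrr mul0r addr0.
  have tk := tpt_itv T0 (ltnW kn); have tk' := tpt_itv T0 kn.
  have /andP[tk0 _] := tk.
  have tt : tpt T n k <= tpt T n k.+1 by exact: tpt_le.
  rewrite (lam_split bS tk0 tt).
  (* Three errors e / (4 T) per unit of time: the slack in [slice_cont], the distance to the scheme,
     and the length of the cell. The Taylor remainder is the fourth. *)
  have cell : \int[lam (tpt T n k) (tpt T n k.+1)]_t S (tclamp T t) (X (tclamp T t)) <=
      (S (tpt T n k) (xs n k) + (e / 4 / T + (e / 4 / T + e / 4 / T))) * h.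
    have -> : h = tpt T n k.+1 - tpt T n k by rewrite tptS addrC addKr.
    rewrite -(lam_cst _ tt).
    apply: (lam_le_null (@null_set1 R (tpt T n k.+1)) bS (bm_cst _)) => t /andP[t1 t2] Nt.
    have t2' : t < tpt T n k.+1 by rewrite lt_neqAle t2 andbT; apply/eqP.
    have tI : 0 <= t <= T.
      by have /andP[_ h3] := tk'; rewrite (le_trans tk0 t1) (le_trans t2 h3).
    rewrite tclamp_id//.
    have d1 : l1d (X t) (xs n k) <= e / 4 / T / (C' + 1) by apply: napp => //; rewrite t1.
    have d2 : `|t - tpt T n k| <= h by rewrite ger0_norm ?subr_ge0// lerBlDl -tptS.
    have := HC' (X t) (xs n k) (tpt T n k) t (mXQ t) (mono_le BQ' (mx k)) tk tI.
    rewrite -/(S t (X t)) -/(S (tpt T n k) (xs n k)) => H.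
    have H1 : C' * (l1d (X t) (xs n k) + `|t - tpt T n k|) <= e / 4 / T + e / 4 / T.
      apply: le_trans (ler_wpM2l C'0 (lerD d1 d2)) _; rewrite mulrDr; apply: lerD.
        rewrite mulrCA ler_piMr ?(ltW e4)// ler_pdivrMr ?ltr_wpDl// mul1r lerDl//.
      by rewrite /h mulrA.
    by move: H; rewrite ler_norml => /andP[_]; exact: lin_cell H1.
  have := HC n k nN kn; rewrite -/h -/(J k.+1) -/(J k) => H.
  have Ch : C * h ^+ 2 <= e / 4 / T * h.
    by rewrite expr2 mulrA ler_wpM2r// /h mulrA.
  apply: le_trans (lerD (IH (ltnW kn)) cell) _.
  have -> : tpt T n k.+1 * (e / T) = tpt T n k * (e / T) + 4 * (e / 4 / T * h).
    rewrite tptS -/h; field; by rewrite gt_eqF.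
  have -> : (S (tpt T n k) (xs n k) + (e / 4 / T + (e / 4 / T + e / 4 / T))) * h =
    h * S (tpt T n k) (xs n k) + 3 * (e / 4 / T * h) by ring.
  exact: lin_step H Ch.
have := key n.+1 (leqnn _); rewrite tptN.
rewrite /J tptN tpt0 !J0 ?ltxx ?andbF// subrr add0r mulrC divfK// gt_eqF//.
Qed.

End Inequality.
End LimitEntropy.

(** * Jointly measurable densities and charges on the strip *)

Section JointMeasurability.
Context {R : realType}.
Local Notation mu := (@lebesgue_measure R).
Local Notation h2 := (2^-1 : R).
Local Notation lI := (lam (- 2^-1 : R) 2^-1).
Local Notation mR := (measurableTypeR R).

Lemma null_bigcup (F : nat -> set mR) : (forall n, null_set (F n)) -> null_set (\bigcup_n F n).
Proof.
move=> nF; have mF : measurable (\bigcup_n F n).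
  by apply: bigcup_measurable => n _; have [] := nF n.
split=> //; apply/(negligibleP _ mF); apply: negligible_bigcup => n.
by have [m0 e0] := nF n; apply/negligibleP.
Qed.

(* The density a(m, t) of d A(., t) is only determined for almost every m, for *)
(* each t; it is replaced by a jointly measurable version.                     *)
Lemma joint_density T A a L : 0 < T -> flux_density T A a L ->
  exists2 b : mR * mR -> R, bm b & forall t, 0 <= t < T ->
    exists2 N, null_set N & forall m, - h2 <= m <= h2 -> ~ N m -> b (m, t) = a t m.
Proof.
move=> T0 [L0 ba _ _ aL].
pose F (m : mR) (t : R) := a t m.
have bF t : bm (fun m => F m t) by exact: (ba t).1.
pose s n := steps T F n.
have sL n p : `|s n p| <= L.
  case: p => m t; have [tI|tI] := boolP (0 <= t < T).
    by have [k _ [_ sE]] := @stepsE _ mR R T T0 n t tI; rewrite /s sE; exact: (ba _).2.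
  rewrite /s /steps big_seq big1 ?normr0// => k; rewrite mem_iota /= add0n => kn.
  move: tI; rewrite negb_and -!ltNge -leNgt => /orP[t0|tT].
    rewrite [_ <= t]leNgt (lt_le_trans t0) ?mul0r ?mulr0//.
    by have /andP[] := tpt_itv T0 (ltnW kn).
  rewrite [t < _]ltNge (le_trans _ tT) ?mulr0//.
  by have /andP[] := tpt_itv T0 kn.
pose b p := limn_sup (s ^~ p).
have mb : measurable_fun setT b.
  apply: measurable_fun_limn_sup.
  - by move=> p _; exists L => _ [n _ <-]; apply: le_trans (ler_norm _) (sL n p).
  - by move=> p _; exists (- L) => _ [n _ <-]; have := sL n p; rewrite ler_norml => /andP[].
  - by move=> n; have [] := bm_steps T n bF.
exists (fun p => Num.max (- L) (Num.min (b p) L)).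
  split.
    by apply: measurable_maxr => //; apply: measurable_minr.
  exists L => p; rewrite ler_norml le_max lexx/= ge_max ge_min lexx orbT andbT; lra.
move=> t tI; have tI' : 0 <= t <= T by have /andP[-> /ltW ->] := tI.
have H n : exists N, null_set N /\ forall m, - h2 <= m <= h2 -> ~ N m ->
    `|s n (m, t) - a t m| <= L * (T / n.+1%:R).
  have [k kn [tk sE]] := @stepsE _ mR R T T0 n t tI; have kI := tpt_itv T0 (ltnW kn).
  have [N nN HN] := aL t _ tI' kI; exists N; split=> // m mI Nm.
  rewrite /s sE; apply: le_trans (HN m mI Nm) _.
  by rewrite ler_wpM2l// distrC.
have [N HN] := choice H.
exists (\bigcup_n N n); first by apply: null_bigcup => n; have [] := HN n.
move=> m mI Nm.
have cv : s n (m, t) @[n --> \oo] --> a t m.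
  apply/cvgrPdist_le => e e0; have [n0 Hn0] := arch_le (L * T) e0.
  exists n0 => // n /= nn; rewrite distrC; apply: le_trans ((HN n).2 m mI _) _.
    by move=> Nnm; apply: Nm; exists n.
  by rewrite mulrA; exact: Hn0.
have -> : b (m, t) = a t m by rewrite /b cvg_limn_supE; [exact/cvg_lim|apply/cvg_ex; exists (a t m)].
have := (ba t).2 m; rewrite ler_norml => /andP[a1 a2].
by rewrite min_l// max_r.
Qed.

Lemma prod_fin_num d1 d2 (Y1 : measurableType d1) (Y2 : measurableType d2)
  (la1 : {finite_measure set Y1 -> \bar R}) (la2 : {finite_measure set Y2 -> \bar R}) :
  fin_num_fun (la1 \x la2)%E.
Proof.
move=> D mD; rewrite ge0_fin_numE//.
apply: (@le_lt_trans _ _ ((la1 \x la2) (setT `*` setT))%E).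
  by apply: le_measure; rewrite ?inE//= ?setXTT//.
rewrite product_measure1E//.
by rewrite -ge0_fin_numE ?mule_ge0// fin_numM// fin_num_measure.
Qed.

Lemma strip_charge T (w x : mR * mR -> R) : bm w -> bm x ->
  exists nu : {charge set (mR * mR)%type -> \bar R}, forall f : R * R -> R,
    bm (f : mR * mR -> R) ->
    charge_integral nu f = \int[lam 0 T]_t \int[lI]_m (w (m, t) * f (x (m, t), t)).
Proof.
move=> bw bx; have [mx _] := bx.
pose la := fin_measure (prod_fin_num lI (lam (0 : R) T)).
pose Z (p : mR * mR) : mR * mR := (x p, p.2).
have mZ : measurable_fun setT Z by apply: measurable_fun_pair => //; exact: measurable_snd.
have [nu [m1 [m2 [nuE hE _]]]] := push_charge la bw mZ.
exists nu => f bf; rewrite (charge_integral_bm nuE bf) hE//.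
have bF : bm (fun p : mR * mR => w p * f (Z p)) by apply: bmM => //; exact: bm_comp bf mZ.
by rewrite -(int_swap lI (lam 0 T) bF) -(int_prod12 lI (lam 0 T) bF).
Qed.

Lemma strip_bm T (zeta : R * R -> R) : 0 < T -> test_function (strip T) zeta ->
  bm (zeta : mR * mR -> R).
Proof.
move=> T0 tz; have [C C0 HC] := strip_lip tz; have [Q Q0 HQ] := strip_support tz.
have [||G bG GE] := @caratheodory _ mR R T T0 (fun x t => zeta (x, t)) C C (fun t => strip_section_bm t tz).
- by move=> x t _; exact: (HC x t x t).1.
- by move=> x s t _ _; apply: le_trans (HC x t x s).2 _; rewrite subrr normr0 add0r.
have bi : bm (fun p : mR * mR => G p * ((0 <= p.2)%R%:R * (p.2 < T)%R%:R)).
  apply: bmM => //; apply: bmM; [apply: bm_le|apply: bm_lt];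
  by [exact: measurable_cst|exact: measurable_snd].
apply: bm_eq bi => -[x t] /=; have [tI|tI] := boolP (0 <= t < T).
  by rewrite GE//; have /andP[-> ->] := tI; rewrite !mulr1.
rewrite HQ; last by right; apply: contra tI => /andP[/ltW -> ->].
by move: tI; rewrite negb_and => /orP[/negbTE->|/negbTE->]; rewrite ?mul0r ?mulr0.
Qed.

End JointMeasurability.

(** * Bounded variation *)

Section BoundedVariation.
Context {R : realType}.
Local Notation mu := (@lebesgue_measure R).
Local Notation h2 := (2^-1 : R).
Local Notation lI := (lam (- 2^-1 : R) 2^-1).
Local Notation mR := (measurableTypeR R).
Variables (T : R) (W : R -> R) (A a M X : R -> R -> R) (L B V : R).
Hypotheses (T0 : 0 < T) (B0 : 0 <= B) (V0 : 0 <= V) (hW : good_kernel W) (fd : flux_density T A a L).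
Hypothesis hp : forall t, 0 <= t <= T -> profile (M^~ t) (X t) B.
Hypothesis Xlip : forall s t m, 0 <= s <= T -> 0 <= t <= T -> `|X t m - X s m| <= V * `|t - s|.
Hypothesis mX : forall t, mono B (X t).

(* Conservation of mass: the entropy inequalities for eta = id and eta = - id. *)
Hypothesis hcons : forall zeta, test_function (strip T) zeta -> exists Q0, forall Q, Q0 <= Q ->
  \int[lam 0 T]_t slice_rate W (a (tclamp T t)) (fun=> 1) (tprim Q zeta (tclamp T t))
    (fun x => zeta (x, tclamp T t)) (X (tclamp T t)) = 0.

Let slice_id Q t (psi : R -> R) : 0 <= t <= T -> B <= Q -> bm (psi : mR -> R) ->
  (forall x, Q < `|x| -> psi x = 0) ->
  \int[mu]_x (M x t * psi x) =
  h2 * \int[lam (- Q) Q]_x psi x - \int[lI]_m \int[lam (- Q) (X t m)]_x psi x.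
Proof.
move=> tI BQ bpsi psi0; have pQ := profileW (hp tI) BQ.
have bM := bm_density pQ (@has_density_id R).
rewrite (@Rint_supp _ Q); [|exact: bmM bM bpsi|by move=> x /psi0 ->; rewrite mulr0].
rewrite (slice_density pQ (@has_density_id R) bpsi); congr (_ - _).
by apply: int_ext => m; rewrite mul1r.
Qed.

Let sign_chain (p v v' i c : R) : p = - v -> v = v' -> v' = - i -> c = i -> h2 * 0 - p = - c.
Proof. by move=> -> -> -> ->; rewrite mulr0 sub0r opprK. Qed.

Lemma profile_BV : BV_strip T M.
Proof.
have [x bx xE] : exists2 x : mR * mR -> R, bm x & forall m t, 0 <= t < T -> x (m, t) = X t m.
  apply: (@caratheodory _ mR R T T0 (fun m t => X t m) V B).
  - by move=> t; exact: bm_mono (mX t).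
  - by move=> m t _; have [_ h] := mX t; exact: h.
  - by move=> m s t sI tI; exact: Xlip.
have [b bb bE] := joint_density T0 fd.
have [mx _] := bx.
have [odd mono_W _] := hW.
(* [x] is known to equal X for times in [0, T[ only; the truncation gives it the bound B everywhere,
   as [kernel_bound] requires. *)
pose x' (p : mR * mR) := Num.max (- B) (Num.min (x p) B).
have x'B p : `|x' p| <= B.
  rewrite ler_norml le_max lexx/= ge_max ge_min lexx orbT andbT.
  by have B0' := B0; lra.
have mx' : measurable_fun setT x' by apply: measurable_maxr => //; exact: measurable_minr.
have bx' : bm x' by split=> //; exists B.
have x'E m t : 0 <= t < T -> x' (m, t) = X t m.
  move=> tI; have [_ /(_ m)] := mX t; rewrite /x' xE// ler_norml => /andP[h1 h3].
  by rewrite min_l// max_r.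
have bK : bm (fun q : (mR * mR) * mR => W (x' q.1 - x' (q.2, q.1.2))).
  split.
    apply: (measurableT_comp (kernel_measurable hW)); apply: measurable_funB.
      exact: measurableT_comp mx' measurable_fst.
    apply: (measurableT_comp mx'); apply: measurable_fun_pair; first exact: measurable_snd.
    by apply: (measurableT_comp measurable_snd); exact: measurable_fst.
  exists (W (B + B)) => q; apply: (kernel_bound hW).
  by apply: le_trans (ler_normB _ _) _; exact: lerD.
pose la := fin_measure (prod_fin_num lI (lam (0 : R) T)).
have bw := bmB bb (bm_int1 la lI bK).
have [nux hx] := strip_charge T (bm_cst (1 : R)) bx'.
have [nut ht] := strip_charge T (bmN bw) bx'.
split.
  exists 2^-1 => y t; rewrite /= in_itv/= => tI; have [_ MI _ _ _] := hp tI.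
  by rewrite ler_norml; apply/half_itvE; exact: MI.
exists nux, nut => zeta tz; have bz := strip_bm T0 tz; have [sz _ _] := tz.
have [Q1 Q10 S1] := strip_support tz.
have tz1 := test_derive ((0, 1) : R * R) tz; have tz2 := test_derive ((1, 0) : R * R) tz.
have [Q2 Q20 S2] := strip_support tz1; have [Q3 Q30 S3] := strip_support tz2.
have [Q4 HQ4] := hcons tz.
pose Q := Num.max B (Num.max Q1 (Num.max Q2 (Num.max Q3 Q4))).
have BQ : B <= Q by rewrite le_max lexx.
have QQ1 : Q1 <= Q by rewrite !le_max lexx ?orbT.
have QQ2 : Q2 <= Q by rewrite !le_max lexx ?orbT.
have QQ3 : Q3 <= Q by rewrite !le_max lexx ?orbT.
have QQ4 : Q4 <= Q by rewrite !le_max lexx ?orbT.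
have Q0 : 0 <= Q by exact: le_trans BQ.
have zQ : (forall t, zeta (Q, t) = 0) /\ (forall t, zeta (- Q, t) = 0).
  by split=> t; apply: S1; left; rewrite ?normrN ger0_norm.
have nT := @null_set1 R T.
have mXQ t : mono Q (X t) := mono_le BQ (mX t).
have uX : ucont_on T (fun t s => l1d (X t) (X s)) := limit_ucont V0 mX Xlip.
have bt2 t := strip_section_bm t tz2; have bt1 t := strip_section_bm t tz1.
have btz t := strip_section_bm t tz.
have lt_T t : 0 <= t <= T -> ~ [set T] t -> 0 <= t < T.
  by move=> /andP[-> tT] Nt; rewrite lt_neqAle tT andbT; apply/eqP.
have bzx : bm (fun p : mR * mR => 1 * zeta (x' p, p.2)).
  apply: bmM; first exact: bm_cst.
  by apply: (bm_comp bz); apply: measurable_fun_pair => //; exact: measurable_snd.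
have bwx : bm (fun p : mR * mR => - (b p - \int[lI]_n W (x' p - x' (n, p.2))) * zeta (x' p, p.2)).
  apply: bmM; first exact: bmN bw.
  by apply: (bm_comp bz); apply: measurable_fun_pair => //; exact: measurable_snd.
split.
  rewrite hx// -(intN (lam 0 T) (bm_int2 lI (lam 0 T) bzx)).
  apply: (Rint_lam_null nT); first exact: bmN (bm_int2 lI (lam 0 T) bzx).
  move=> t tI Nt; rewrite (slice_id tI BQ (bt2 t)); last first.
    by move=> y /ltW Qy; apply: S3; left; exact: le_trans Qy.
  have cz2 : continuous (fun y => 'D_(1, 0) zeta (y, t)).
    apply: (continuous_is_derive (f' := fun x => 'D_(1, 0) ('D_(1, 0) zeta) (x, t))) => y.
    by apply: strip_derive10; exact: smooth_derive.
  have dz (y : R) : is_derive y (1 : R) (fun y => zeta (y, t)) ('D_(1, 0) zeta (y, t)).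
    exact: strip_derive10.
  have NQ : - Q <= Q by rewrite (le_trans _ Q0)// oppr_le0.
  rewrite (lam_deriv NQ cz2 (bt2 t) dz) zQ.1 zQ.2 subrr mulr0 sub0r; congr (- _).
  apply: int_ext => m; have := (mXQ t).2 m; rewrite ler_norml => /andP[h1 _].
  by rewrite (lam_deriv h1 cz2 (bt2 t) dz) zQ.2 subr0 mul1r x'E// lt_T.
have [K sp] := strip_pair_zeta Q0 tz; have [sp1 sp2] := strip_pair0 sp.
have mXt t (tI : 0 <= t <= T) := mXQ t.
have uP := ucont_slice hW fd sp1 (bm_cst (1 : R)) mXt uX.
have uV := ucont_slice hW fd sp2 (bm_cst (1 : R)) mXt uX.
have bP := ucont_bm T0 uP; have bV := ucont_bm T0 uV.
have bI := ucont_bm T0 (ucont_tprim Q0 tz); have bI' := bmM (bm_cst h2) bI.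
have SPE t : slice_rate W (a t) (fun=> 1) (tprim Q zeta t) (fun x => zeta (x, t)) (X t) =
    slice_rate W (a t) (fun=> 1) (tprim Q zeta t) (fun=> 0) (X t) +
    slice_rate W (a t) (fun=> 1) (fun=> 0) (fun x => zeta (x, t)) (X t).
  have [cp cz pzK _] := sp; have bv := bm_velm hW fd t (mXQ t).
  have b1 : bm ((fun m => tprim Q zeta t (X t m)) : mR -> R).
    by apply: (bm_contX (K := K) (cp t) (mXQ t)) => y yQ; exact: (pzK t y yQ).1.
  have b2 : bm ((fun m => zeta (X t m, t)) : mR -> R).
    by apply: (bm_contX (K := K) (cz t) (mXQ t)) => y yQ; exact: (pzK t y yQ).2.
  have b3 := bmM (bm_cst (1 : R)) (bmD b1 (bmM (bm_cst 0) bv)).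
  have b4 := bmM (bm_cst (1 : R)) (bmD (bm_cst 0) (bmM b2 bv)).
  by rewrite /slice_rate -(intD lI b3 b4); apply: int_ext => m; ring.
(* Conservation makes the part with [tprim] the opposite of the transport part, which is the
   integral of v zeta(X, t) and thus minus the integral against [nut]. *)
have cons := HQ4 Q QQ4.
rewrite (int_ext (lam 0 T) (g := fun t => slice_rate W (a (tclamp T t)) (fun=> 1) (tprim Q zeta (tclamp T t)) (fun=> 0) (X (tclamp T t)) +
    slice_rate W (a (tclamp T t)) (fun=> 1) (fun=> 0) (fun x => zeta (x, tclamp T t)) (X (tclamp T t)))) in cons; last by move=> t; exact: SPE.
rewrite (intD (lam 0 T) bP bV) in cons.
rewrite (Rint_lam_eq (bmB bI' bP)); last first.
  move=> t tI; rewrite tclamp_id// (slice_id tI BQ (bt1 t)); last first.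
    by move=> y /ltW Qy; apply: S2; left; exact: le_trans Qy.
  by congr (_ - _); apply: int_ext => m; rewrite mul0r addr0 mul1r.
rewrite (intB (lam 0 T) bI' bP) (intZ (lam 0 T) _ bI) (int_time_derive T0 Q0 tz); last first.
  by move=> y t [h|h]; apply: S1; [left; exact: le_trans h|right].
have /eqP := cons; rewrite addr_eq0 => /eqP consE.
apply: (sign_chain consE _ (intN (lam 0 T) (bm_int2 lI (lam 0 T) bwx)) (ht zeta bz)).
apply: (lam_eq_null nT bV (bmN (bm_int2 lI (lam 0 T) bwx))) => t tI Nt.
rewrite tclamp_id//; have tI' := lt_T t tI Nt; have [N nN HN] := bE t tI'.
have bwt := bm_sec2 t bwx; rewrite -(intN lI bwt).
have [_ cz pzK _] := sp; have bv := bm_velm hW fd t (mXQ t).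
have b2 : bm ((fun m => zeta (X t m, t)) : mR -> R).
  by apply: (bm_contX (K := K) (cz t) (mXQ t)) => y yQ; exact: (pzK t y yQ).2.
apply: (lam_eq_null nN (bmM (bm_cst (1 : R)) (bmD (bm_cst 0) (bmM b2 bv))) (bmN bwt)).
move=> m mI Nm /=; rewrite mul1r add0r mulNr opprK mulrC x'E// HN//; congr (_ * _).
by rewrite /vel; congr (_ - _); apply: int_ext => n; rewrite !x'E.
Qed.

End BoundedVariation.

(** * The Cauchy problem *)

Section ProfileDistance.
Context {R : realType}.
Local Notation mu := (@lebesgue_measure R).
Local Notation h2 := (2^-1 : R).
Local Notation mR := (measurableTypeR R).

Lemma profile_ginv (f : R -> R) Q : 0 <= Q -> {homo f : x y / x <= y} ->
  (forall x, half_itv (f x)) -> (forall x, Q <= x -> f x = h2 /\ f (- x) = - h2) ->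
  profile f (ginv Q f) Q.
Proof.
move=> Q0 hf fI fQ; split=> //; [exact: ginv_homo|by move=> m; exact: ginv_norm|exact: qrel_ginv].
Qed.

Lemma ginv_profile (X : R -> R) Q : mono Q X -> profile (ginv 2^-1 X) X Q.
Proof.
move=> [hX XQ]; have h0 : 0 <= h2 by rewrite invr_ge0.
split=> //; [exact: ginv_homo|by move=> x; apply/half_itvE; exact: ginv_bound|exact: ginv_qrel].
Qed.

Lemma profile_out (f X : R -> R) Q x : profile f X Q -> Q < x -> f x = h2 /\ f (- x) = - h2.
Proof.
move=> [_ fI _ XQ q] Qx; have [h1 h3] := h2itv (R := R).
have := XQ h2; have := XQ (- h2); rewrite !ler_norml => /andP[x1 x2] /andP[x3 x4].
have [_ /(_ (le_lt_trans x4 Qx)) u1] := q x h2 h3.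
have l1 : - x < X (- h2) by rewrite (lt_le_trans _ x1)// ltrN2.
have [/(_ l1) u2 _] := q (- x) (- h2) h1.
have /half_itvE/andP[v1 v2] := fI x; have /half_itvE/andP[v3 v4] := fI (- x).
by split; apply/eqP; rewrite eq_le; apply/andP.
Qed.

Lemma profile_L1 (f g X Y : R -> R) Q : profile f X Q -> profile g Y Q ->
  (\int[mu]_x `|(f x - g x)%:E|)%E = (l1d X Y)%:E.
Proof.
move=> pf pg; have [hf fI hX XQ q] := pf; have [hg gI hY YQ q'] := pg.
rewrite /l1d (quantile_L1 hf hX q hg hY q' XQ YQ fI gI).
have bf (k : R -> R) : {homo k : x y / x <= y} -> (forall x, half_itv (k x)) -> bm (k : mR -> R).
  move=> hk kI; apply: (bm_homo (C := 2^-1)) => // x.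
  by rewrite ler_norml; apply/half_itvE; exact: kI.
have bd := bm_norm (bmB (bf f hf fI) (bf g hg gI)).
rewrite -(Rint_lam _ _ bd) /Rintegral fineK; last first.
  by apply: integral_fune_fin_num => //; exact: lam_mu_integrable.
rewrite [RHS]integral_mkcond; apply: eq_integral => x _; rewrite patchE /=.
case: ifPn => // /negP; rewrite inE/= in_itv/= => /negP.
rewrite -ler_norml -ltNge lter_normr => /orP[Qx|Qx].
  by rewrite (profile_out pf Qx).1 (profile_out pg Qx).1 subrr normr0.
have := (profile_out pf Qx).2; have := (profile_out pg Qx).2; rewrite opprK => -> ->.
by rewrite subrr normr0.
Qed.

Lemma profile_ae (f g X Y : R -> R) Q : profile f X Q -> profile g Y Q -> l1d X Y = 0 ->
  {ae mu, forall x, f x = g x}.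
Proof.
move=> pf pg d0; have := profile_L1 pf pg; rewrite d0.
have [hf _ _ _ _] := pf; have [hg _ _ _ _] := pg.
have mfg : measurable_fun setT ((fun x => (f x - g x)%:E) : mR -> \bar R).
  by apply/measurable_EFinP; apply: measurable_funB; exact: measurable_homo.
move=> /(ae_eq_integral_abs _ measurableT mfg); apply: filterS => x /(_ I) [] /eqP.
by rewrite subr_eq0 => /eqP.
Qed.

Lemma L1normE (f : R -> R) : L1norm f = (\int[mu]_x `|(f x)%:E|)%E.
Proof. exact: Lnorm1. Qed.

Lemma ae_L1norm (f g : R -> R) : measurable_fun setT (f : mR -> mR) ->
  measurable_fun setT (g : mR -> mR) -> {ae mu, forall x, f x = g x} -> L1norm f = L1norm g.
Proof.
move=> mf mg fg; rewrite !L1normE; apply: ge0_ae_eq_integral => //.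
- by apply: measurableT_comp => //; apply/measurable_EFinP.
- by apply: measurableT_comp => //; apply/measurable_EFinP.
- have [N [mN N0 sN]] := fg; exists N; split=> // x nx; apply: sN => /= e.
  by apply: nx => _; rewrite e.
Qed.

End ProfileDistance.

(** * Stability and existence for entropy solutions *)

Section Cauchy.
Context {R : realType}.
Local Notation mu := (@lebesgue_measure R).
Local Notation h2 := (2^-1 : R).
Local Notation lI := (lam (- 2^-1 : R) 2^-1).
Local Notation mR := (measurableTypeR R).
Variables (phi : R -> \bar R) (T : R).
Hypotheses (hphi : communication_protocol phi) (T0 : 0 < T).

Lemma solution_profiles A M : entropy_solution phi T A M -> exists2 Q0, 0 <= Q0 &
  forall Q, Q0 <= Q -> forall t, 0 <= t <= T -> profile (M^~ t) (ginv Q (M^~ t)) Q.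
Proof.
move=> [MI _ Mh [r r0 Mr]]; exists r; first exact: ltW.
move=> Q rQ t tI; have tI' : `[0, T]%classic t by rewrite /= in_itv.
apply: profile_ginv; [exact: le_trans (ltW r0) rQ|exact: Mh|by move=> x; exact: MI|].
by move=> x Qx; exact: Mr (le_trans rQ Qx) tI'.
Qed.

Lemma solution_stability A a L A' b L' M M' Lam :
  flux_density T A a L -> flux_density T A' b L' ->
  entropy_solution phi T A M -> continuous_L1loc T M ->
  entropy_solution phi T A' M' -> continuous_L1loc T M' ->
  (forall t, 0 <= t <= T -> exists2 N, null_set N & forall m, - h2 <= m <= h2 -> ~ N m ->
    `|a t m - b t m| <= Lam) ->
  exists X Y Q, [/\ forall t, 0 <= t <= T -> profile (M^~ t) (X t) Q,
    forall t, 0 <= t <= T -> profile (M'^~ t) (Y t) Q &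
    forall t, 0 <= t <= T -> l1d (X t) (Y t) <= l1d (X 0) (Y 0) + Lam * t].
Proof.
move=> fd fd' sM cM sM' cM' ab; have hW := Phi_good hphi.
have [Q1 Q10 H1] := solution_profiles sM; have [Q2 Q20 H2] := solution_profiles sM'.
pose Q := Num.max Q1 Q2; have Q0 : 0 <= Q by rewrite le_max Q10.
have p1 := H1 Q ltac:(by rewrite le_max lexx); have p2 := H2 Q ltac:(by rewrite le_max lexx orbT).
have uX := time_continuity p1 cM; have uY := time_continuity p2 cM'.
have [_ e1 _ _] := sM; have [_ e2 _ _] := sM'.
have w1 := entropy_weak T0 Q0 hphi fd e1 p1 uX; have w2 := entropy_weak T0 Q0 hphi fd' e2 p2 uY.
have m1 t tI := profile_mono (p1 t tI); have m2 t tI := profile_mono (p2 t tI).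
exists (fun t => ginv Q (M^~ t)), (fun t => ginv Q (M'^~ t)), Q; split; [exact: p1|exact: p2|].
exact: (stability T0 Q0 hW fd fd' m1 m2 uX uY w1 w2 ab).
Qed.

Let le_congr (x x' y y' : R) : x = x' -> y = y' -> x <= y -> x' <= y'.
Proof. by move=> -> ->. Qed.

Let le_opp_eq (x y : R) : 1 * x <= 1 * y -> - 1 * x <= - 1 * y -> x = y.
Proof. by rewrite !mulN1r !mul1r lerN2 => h1 h3; apply/eqP; rewrite eq_le h1 h3. Qed.

Let add_inj (x y c d : R) : x + c = y + d -> c = d -> x = y.
Proof. by move=> + cd; rewrite cd => /addIr. Qed.

(** The constants 1 and -1 turn the inequality into an equality for nonnegative u; a bounded f
    becomes nonnegative after adding a constant. *)
Lemma conserves_of_le Q (y x : R -> R) : bm (y : mR -> R) -> bm (x : mR -> R) ->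
  (forall c u, bm (u : mR -> R) -> (forall z, 0 <= u z) ->
    \int[lI]_m (c * \int[lam (- Q) (y m)]_z u z) <= \int[lI]_m (c * \int[lam (- Q) (x m)]_z u z)) ->
  forall f, bm (f : mR -> R) ->
  \int[lI]_m \int[lam (- Q) (y m)]_z f z = \int[lI]_m \int[lam (- Q) (x m)]_z f z.
Proof.
move=> by_ bx H f bf.
have pos u : bm (u : mR -> R) -> (forall z, 0 <= u z) ->
    \int[lI]_m \int[lam (- Q) (y m)]_z u z = \int[lI]_m \int[lam (- Q) (x m)]_z u z.
  move=> bu u0; have b1 := bm_primX Q bu by_; have b2 := bm_primX Q bu bx.
  exact: (le_opp_eq (le_congr (intZ lI 1 b1) (intZ lI 1 b2) (H 1 u bu u0))
    (le_congr (intZ lI (- 1) b1) (intZ lI (- 1) b2) (H (- 1) u bu u0))).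
have [_ [C hC]] := bf.
have C0 : 0 <= C by apply: le_trans (hC 0).
have bC : bm ((fun=> C) : mR -> R) by exact: bm_cst.
have split_ (Z : R -> R) : bm (Z : mR -> R) -> \int[lI]_m \int[lam (- Q) (Z m)]_z (f z + C) =
    \int[lI]_m \int[lam (- Q) (Z m)]_z f z + \int[lI]_m \int[lam (- Q) (Z m)]_z (fun=> C) z.
  move=> bZ; rewrite -(intD lI (bm_primX Q bf bZ) (bm_primX Q bC bZ)).
  by apply: int_ext => m; exact: (intD (lam (- Q) (Z m)) bf bC).
have E1 := pos _ (bmD bf bC) (fun z => ltac:(by have := hC z; rewrite ler_norml => /andP[]; lra)).
have E2 := pos _ bC (fun=> C0).
exact: (add_inj (etrans (esym (split_ _ by_)) (etrans E1 (split_ _ bx))) E2).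
Qed.

Let le_of_eq (x y : R) : x = y -> x <= y. Proof. by move=> ->. Qed.

Lemma existence A a L M0 : flux_density T A a L -> initial_datum M0 ->
  exists M, [/\ entropy_solution phi T A M, associated_to T M0 M & BV_strip T M].
Proof.
move=> fd iM0; have hW := Phi_good hphi; have [M0I M0h [r0 r00 M0r]] := iM0.
have [B [V [N [xs [B0 V0 rB LV hs]]]]] := scheme_exists T0 hW fd M0h M0I r00 M0r.
have p0 : profile M0 (ginv B M0) B.
  by apply: profile_ginv => // x Bx; exact: M0r (le_trans rB Bx).
have mX0 := profile_mono p0.
have [X [X0 mX Xlip Xapp]] := limit_exists T0 V0 mX0 hs.
pose M x t := ginv 2^-1 (X t) x.
have hp t : profile (M^~ t) (X t) B := ginv_profile (mX t).
have uX := limit_ucont V0 mX Xlip.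
have ba t : bm (a t : mR -> R) by have [_ h _ _ _] := fd; exact: (h t).1.
have supp zeta : test_function (strip T) zeta -> exists2 Q, B + T * V <= Q &
    forall x t, Q <= `|x| \/ ~~ (0 < t < T) -> [/\ zeta (x, t) = 0,
     'D_(0, 1) zeta (x, t) = 0 & 'D_(1, 0) zeta (x, t) = 0].
  move=> tz; have [Q1 Q10 S1] := strip_support tz.
  have [Q2 Q20 S2] := strip_support (test_derive ((0, 1) : R * R) tz).
  have [Q3 Q30 S3] := strip_support (test_derive ((1, 0) : R * R) tz).
  exists (Num.max (B + T * V) (Num.max Q1 (Num.max Q2 Q3))); first by rewrite le_max lexx.
  move=> x t H; split; [apply: S1|apply: S2|apply: S3]; case: H => H; [left|by right|left|by right|left|by right];
  by apply: le_trans H; rewrite !le_max lexx ?orbT.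
have hz t zeta : test_function (strip T) zeta -> bm ((fun x => zeta (x, t)) : mR -> R).
  exact: strip_section_bm.
have TV : 0 <= T * V by rewrite mulr_ge0// ltW.
have ent eta zeta : entropy eta -> test_function (strip T) zeta -> (forall p, 0 <= zeta p) ->
    entropy_inequality phi T A M eta zeta.
  move=> ee tz z0; have [g ep [hg [G gG]]] := entropy_has_pair ee.
  have bg : bm (g : mR -> R) by exact: bm_homo gG.
  have [Q BQ zs] := supp zeta tz.
  have BQ' : B <= Q by apply: le_trans BQ; rewrite lerDl.
  have hp' t (_ : 0 <= t <= T) := profileW (hp t) BQ'.
  apply/(entropy_inequalityE T0 (le_trans B0 BQ') hphi fd hp' uX ep tz zs).
  have zs' x t : ~~ (0 < t < T) -> zeta (x, t) = 0 by move=> tT; have [] := zs x t (or_intror tT).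
  apply: (limit_entropy T0 B0 V0 LV hW fd hs mX Xlip Xapp tz zs' BQ bg gG) => n k nN kn.
  have [_ _ _ e4] := hs n nN; exact: (e4 k Q g _ kn BQ' hg bg (hz _ _ tz) (fun x => z0 (x, _))).
(* Constants of both signs are nondecreasing entropy densities, so one step of the scheme conserves
   the integrals exactly, for zeta of any sign; [limit_entropy] with g = 1 and g = -1 then gives an
   equality. *)
have cons zeta : test_function (strip T) zeta -> exists Q0, forall Q, Q0 <= Q ->
    \int[lam 0 T]_t slice_rate (Phi phi) (a (tclamp T t)) (fun=> 1) (tprim Q zeta (tclamp T t))
      (fun x => zeta (x, tclamp T t)) (X (tclamp T t)) = 0.
  move=> tz; have [Q0 BQ0 zs0] := supp zeta tz; exists Q0 => Q QQ.
  have BQ := le_trans BQ0 QQ; have BQ' : B <= Q by apply: le_trans BQ; rewrite lerDl.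
  have zs' x t : ~~ (0 < t < T) -> zeta (x, t) = 0 by move=> tT; have [] := zs0 x t (or_intror tT).
  have hent (c : R) n k : (N <= n)%N -> (k < n.+1)%N ->
      \int[lI]_m (c * sprim zeta Q (tpt T n k.+1) (euler (Phi phi) (a (tpt T n k)) (xs n k) (T / n.+1%:R) m))
      <= \int[lI]_m (c * sprim zeta Q (tpt T n k.+1) (xs n k.+1 m)).
    move=> nN kn; have [_ mx _ _] := hs n nN; have [hx xB] := mx k.
    have by_ := bmD (bm_mono (mx k)) (bmM (bm_cst (T / n.+1%:R)) (bm_vel hW (ba (tpt T n k)) hx xB)).
    have bz := hz (tpt T n k.+1) _ tz.
    have [_ _ _ e4] := hs n nN.
    have bx := bm_mono (mx k.+1).
    have E := conserves_of_le by_ bx (fun c u => e4 k Q (fun=> c) u kn BQ' (fun _ _ _ => lexx _) (bm_cst _)) bz.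
    have e1 := intZ lI c (bm_primX Q bz by_); have e2 := intZ lI c (bm_primX Q bz bx).
    exact: (le_of_eq (etrans e1 (etrans (congr1 ( *%R c) E) (esym e2)))).
  have le1 := limit_entropy T0 B0 V0 LV hW fd hs mX Xlip Xapp tz zs' BQ (bm_cst (1 : R)) (G := 1)
    (fun=> (ltac:(by rewrite normr1) : `|1 : R| <= 1)) (hent 1).
  have leN1 := limit_entropy T0 B0 V0 LV hW fd hs mX Xlip Xapp tz zs' BQ (bm_cst (- 1 : R)) (G := 1)
    (fun=> (ltac:(by rewrite normrN1) : `|- 1 : R| <= 1)) (hent (- 1)).
  have Q0' : 0 <= Q by exact: le_trans BQ'.
  have [K sp] := strip_pair_zeta Q0' tz.
  have bS := ucont_bm T0 (ucont_slice hW fd sp (bm_cst (1 : R)) (fun t _ => mono_le BQ' (mX t)) uX).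
  apply/eqP; rewrite eq_le le1/=; move: leN1.
  rewrite (int_ext (lam 0 T) (g := fun t => - slice_rate (Phi phi) (a (tclamp T t)) (fun=> 1)
      (tprim Q zeta (tclamp T t)) (fun x => zeta (x, tclamp T t)) (X (tclamp T t)))).
    by rewrite (intN (lam 0 T) bS) oppr_le0.
  move=> t; set s := tclamp T t; have mXQ := mono_le BQ' (mX s).
  have [cp cz pzK _] := sp; have bv := bm_velm hW fd s mXQ.
  have b1 : bm ((fun m => tprim Q zeta s (X s m)) : mR -> R).
    by apply: (bm_contX (K := K) (cp s) mXQ) => y yQ; exact: (pzK s y yQ).1.
  have b2 : bm ((fun m => zeta (X s m, s)) : mR -> R).
    by apply: (bm_contX (K := K) (cz s) mXQ) => y yQ; exact: (pzK s y yQ).2.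
  rewrite /slice_rate -(intN lI (bmM (bm_cst 1) (bmD b1 (bmM b2 bv)))).
  by apply: int_ext => m; rewrite mul1r mulN1r.
exists M; split; last exact: (profile_BV T0 B0 V0 hW fd (fun t _ => hp t) Xlip mX cons).
  split.
  - by move=> x t _; have [_ h _ _ _] := hp t; exact: h.
  - exact: ent.
  - by move=> t _; have [h _ _ _ _] := hp t; exact: h.
  (* [profile_out] needs |x| > B, whence the extra 1. *)
  - exists (B + 1); first by lra.
    by move=> x t Bx _; apply: (profile_out (hp t)); lra.
split; last first.
  (* M(., 0) and M0 have the same quantile, but may differ at the jumps of M0, so they agree only
     almost everywhere. *)
  have p0' := hp 0; rewrite X0 in p0'; apply: (profile_ae p0' p0).
  rewrite /l1d (int_ext lI (g := fun=> 0)) ?int_cst ?mul0r// => m.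
  by rewrite subrr normr0.
move=> K cK t; rewrite /= in_itv/= => tI.
have mK : measurable K by exact: compact_measurable.
have ub s : 0 <= s <= T ->
    (0 <= \int[mu]_(x in K) `|M x s - M x t|%:E <= (V * `|s - t|)%:E)%E.
  move=> sI; apply/andP; split; first by apply: integral_ge0 => x _; rewrite lee_fin.
  apply: (@le_trans _ _ (l1d (X s) (X t))%:E); last first.
    rewrite lee_fin; apply: l1d_le_sup => [||m]; [exact: bm_mono (mX s)|exact: bm_mono (mX t)|exact: Xlip].
  rewrite -(profile_L1 (hp s) (hp t)); apply: ge0_subset_integral => //.
  have bf u : bm (M^~ u : mR -> R).
    by have [hh hI _ _ _] := hp u; apply: (bm_homo (C := 2^-1)) => // x; rewrite ler_norml; apply/half_itvE; exact: hI.
  by apply/measurable_EFinP; have [] := bm_norm (bmB (bf s) (bf t)).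
apply: (@squeeze_cvge _ _ _ _ (fun=> 0%E) _ (fun s => (V * `|s - t|)%:E)); last 2 first.
- exact: cvg_cst.
- apply: cvg_EFin; first exact: nearW.
  rewrite -[X in _ --> X](mulr0 V); apply: cvgMr.
  rewrite -[X in _ --> X](normr0 R) -(subrr t).
  by apply: cvg_norm; apply: cvgB; [exact: cvg_within_filter cvg_id|exact: cvg_cst].
apply: (@filterS _ _ _ (`[0, T]%classic)); last exact: withinT.
by move=> s; rewrite /= in_itv/=; exact: ub.
Qed.

End Cauchy.

Section CauchyTheorem.
Context {R : realType}.
Local Notation mu := (@lebesgue_measure R).
Local Notation h2 := (2^-1 : R).
Local Notation mR := (measurableTypeR R).

Lemma ae_eq_subr (f f' g g' : R -> R) : {ae mu, forall x, f x = f' x} ->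
  {ae mu, forall x, g x = g' x} -> {ae mu, forall x, f x - g x = f' x - g' x}.
Proof.
move=> [N1 [mN1 N10 sN1]] [N2 [mN2 N20 sN2]].
have [mN N0] := null_setU (conj mN1 N10) (conj mN2 N20).
exists (N1 `|` N2); split=> // x nx; apply: contrapT => /not_orP[n1 n2]; apply: nx.
by congr (_ - _); [apply: contrapT => e; apply: n1; exact: sN1
  |apply: contrapT => e; apply: n2; exact: sN2].
Qed.

Lemma L1norm_profile (f g f' g' X Y : R -> R) Q : profile f X Q -> profile g Y Q ->
  {homo f' : x y / x <= y} -> {homo g' : x y / x <= y} ->
  {ae mu, forall x, f x = f' x} -> {ae mu, forall x, g x = g' x} ->
  L1norm (fun x => f' x - g' x) = (l1d X Y)%:E.
Proof.
move=> pf pg hf' hg' ff gg; rewrite -(profile_L1 pf pg) -L1normE.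
have [hf _ _ _ _] := pf; have [hg _ _ _ _] := pg.
apply/esym; apply: ae_L1norm; last exact: ae_eq_subr.
  exact: measurable_funB (measurable_homo hf) (measurable_homo hg).
exact: measurable_funB (measurable_homo hf') (measurable_homo hg').
Qed.

Lemma lipT_seminorm_ge0 T (F : R -> R -> R) : 0 <= T -> (0 <= lipT_seminorm T F)%E.
Proof.
move=> T0; apply: (@le_trans _ _ (lip_seminorm (F^~ 0))); last first.
  by apply: ereal_sup_ubound; exists 0 => //=; rewrite in_itv/= lexx.
apply: (@le_trans _ _ (`|F h2 0 - F (- h2) 0| / `|h2 - - h2|)%:E).
  by rewrite lee_fin divr_ge0.
apply: ereal_sup_ubound; exists h2, (- h2); have h0 : 0 < h2 by rewrite invr_gt0.
split=> //; rewrite /half_itv/= ?in_itv/=; lra.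
Qed.

Lemma flux_density_sub T A (a : R -> R -> R) L A' (b : R -> R -> R) L' Lam t :
  flux_density T A a L -> flux_density T A' b L' -> 0 <= t <= T ->
  lip_on Lam (fun m => A m t - A' m t) ->
  exists2 N, null_set N & forall m, - h2 <= m <= h2 -> ~ N m -> `|a t m - b t m| <= Lam.
Proof.
move=> [_ ba Aa _ _] [_ bb Ab _ _] tT lA; have [b1 _] := ba t; have [b2 _] := bb t.
apply: (density_lip (bmB b1 b2) lA) => m mI.
have e := intB (lam (- h2) m) b1 b2.
by rewrite [in LHS]Aa// [in LHS]Ab// e; ring.
Qed.

End CauchyTheorem.

Theorem theorem3p1 (R : realType) (phi : R -> \bar R) (T : R)
    (M0 : R -> R) (A : R -> R -> R) :
  communication_protocol phi ->
  0 < T ->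
  initial_datum M0 ->
  admissible_flux T A ->
  (exists M : R -> R -> R,
     [/\ entropy_solution phi T A M,
         associated_to T M0 M,
         BV_strip T M &
         forall M' : R -> R -> R,
           entropy_solution phi T A M' -> associated_to T M0 M' ->
           same_solution T M M']) /\
  (forall (M : R -> R -> R) (M0' : R -> R) (A' M' : R -> R -> R),
     entropy_solution phi T A M -> associated_to T M0 M ->
     initial_datum M0' -> admissible_flux T A' ->
     entropy_solution phi T A' M' -> associated_to T M0' M' ->
     forall t : R, `[0, T]%classic t ->
       (L1norm (fun x => (M x t - M' x t)%R) <=
        L1norm (fun x => (M0 x - M0' x)%R) +
        t%:E * lipT_seminorm T (fun m tau => (A m tau - A' m tau)%R))%E).
Proof.
move=> hphi T0 iM0 adA; have [a [L fd]] := flux_density_exists adA.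
have I0 : 0 <= (0 : R) <= T by rewrite lexx ltW.
have IT : `[0, T]%classic (0 : R) by rewrite /= in_itv.
have M0h : {homo M0 : x y / x <= y} by have [_ h _] := iM0.
split.
  have [M [sM aM BM]] := existence hphi T0 fd iM0; exists M; split=> // M' sM' aM' t.
  rewrite /= in_itv/= => tI.
  (* Uniqueness is stability for equal fluxes, with rate 0. *)
  have ab s : 0 <= s <= T -> exists2 N, null_set N & forall m, - 2^-1 <= m <= 2^-1 -> ~ N m ->
      `|a s m - a s m| <= 0.
    by move=> _; exists set0; [exact: null_set0|move=> m _ _; rewrite subrr normr0].
  have [X [Y [Q [p1 p2 le12]]]] := solution_stability hphi T0 fd fd sM aM.1 sM' aM'.1 ab.
  have : L1norm (fun x => M0 x - M0 x) = (l1d (X 0) (Y 0))%:E.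
    exact: (L1norm_profile (p1 0 I0) (p2 0 I0) M0h M0h aM.2 aM'.2).
  rewrite L1normE integral0_eq => [|x _]; last by rewrite subrr abse0.
  move=> [d0]; apply: (profile_ae (p1 t tI) (p2 t tI)).
  apply/eqP; rewrite eq_le (l1d_ge0 (bm_mono (profile_mono (p1 t tI))) (bm_mono (profile_mono (p2 t tI)))) andbT.
  by have := le12 t tI; rewrite -d0 mul0r addr0.
move=> M M0' A' M' sM aM iM0' adA' sM' aM' t; have [b [L' fd']] := flux_density_exists adA'.
move=> tI'; have tI : 0 <= t <= T by move: tI'; rewrite /= in_itv.
have M0h' : {homo M0' : x y / x <= y} by have [_ h _] := iM0'.
have hM s (_ : 0 <= s <= T) : {homo M^~ s : x y / x <= y}.
  by have [_ _ h _] := sM; apply: h; rewrite /= in_itv.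
have hM' s (_ : 0 <= s <= T) : {homo M'^~ s : x y / x <= y}.
  by have [_ _ h _] := sM'; apply: h; rewrite /= in_itv.
have bound Lam : lipT_seminorm T (fun m tau => A m tau - A' m tau) = Lam%:E ->
    (L1norm (fun x => (M x t - M' x t)%R) <= L1norm (fun x => (M0 x - M0' x)%R) + t%:E * Lam%:E)%E.
  move=> E; have ab s (sI : 0 <= s <= T) := flux_density_sub fd fd' sI (lip_sub_ereal sI E).
  have [X [Y [Q [p1 p2 le12]]]] := solution_stability hphi T0 fd fd' sM aM.1 sM' aM'.1 ab.
  have ae_refl (f : R -> R) : {ae @lebesgue_measure R, forall x, f x = f x} by exact: aeW.
  rewrite (L1norm_profile (p1 t tI) (p2 t tI) (hM t tI) (hM' t tI) (ae_refl _) (ae_refl _)).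
  rewrite (L1norm_profile (p1 0 I0) (p2 0 I0) M0h M0h' aM.2 aM'.2).
  by rewrite -EFinM -EFinD lee_fin mulrC; exact: le12.
(* For the value +oo the right-hand side is infinite when t > 0, while at t = 0 the product is 0 and
   the claim reduces to the initial data. *)
case E: (lipT_seminorm _ _) => [Lam| |]; first exact: bound.
  move: tI => /andP[]; rewrite le_eqVlt => /orP[/eqP t0 _|t0 _]; last first.
    by rewrite gt0_muley ?lte_fin// addey ?leey// gt_eqF// (lt_le_trans _ (Lnorm_ge0 _ _ _)).
  rewrite -t0 mul0e adde0 le_eqVlt; apply/orP; left; apply/eqP; apply: ae_L1norm.
  - exact: measurable_funB (measurable_homo (hM 0 I0)) (measurable_homo (hM' 0 I0)).
  - exact: measurable_funB (measurable_homo M0h) (measurable_homo M0h').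
  - exact: ae_eq_subr aM.2 aM'.2.
by have := lipT_seminorm_ge0 (fun m tau => A m tau - A' m tau) (ltW T0); rewrite E.
Qed.
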